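(* Let $\gamma>\frac13$, let $X:[0,T]\to\mathcal A_*$ be a $\gamma$-Hölder path in a non-commutative probability space $(\mathcal A,\varphi)$, and assume that we are given a product Lévy area $\mathbf X$ above $X$. Let $f=(f_1,\dots,f_m)\in\mathbf F_3^m$, let $g=(g_1,\dots,g_m)$ be either $(f_1^*,\dots,f_m^* )$ or $(f_m^*,\dots,f_1^* )$, and fix $A\in\mathcal A_*$. Then the equation $$Y_0=A,\qquad(\delta Y)_{st}=\sum_{i=1}^m\mathcal J_{st}(f_i(Y)\cdot dX\cdot g_i(Y)),\quad s<t\in[0,T],$$ admits a unique solution $Y\in\mathcal Q_*(X)$. Moreover, $$\mathcal N[Y;\mathcal Q(X)]\le P\big(\mathcal N[X;\mathcal C_1^\gamma(\mathcal A)],\mathcal N[\mathbf X;\mathcal C_2^{2\gamma}(\mathcal L(\mathcal A_\to))]\big)$$ for some polynomial expression $P$ depending only on $f$, $T$ and $A$.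
   Context: A non-commutative probability space $(\mathcal A,\varphi)$ is a von Neumann algebra $\mathcal A$ with a unital, weakly continuous, positive, faithful, tracial linear functional $\varphi$; $\|\cdot\|$ is the operator norm and $\mathcal A_*$ the real vector space of self-adjoint elements. Tensor products. $(U_1\otimes U_2)\cdot(V_1\otimes V_2)=(U_1V_1)\otimes(V_2U_2)$, $(U\otimes V)^*=V^*\otimes U^*$. $\hat\otimes$ is the projective tensor product. $(U_1\otimes U_2)\sharp X:=U_1XU_2$, $X\sharp(U_1\otimes U_2\otimes U_3):=(U_1XU_2)\otimes U_3$, $(U_1\otimes U_2\otimes U_3)\sharp X:=U_1\otimes(U_2XU_3)$, extended by continuity. Functions. $\mathbf F_k$ is the set of $f:\mathbb R\to\mathbb C$ of the form $f(x)=\int_{\mathbb R}e^{\imath x\xi}\mu_f(d\xi)$ with $\mu_f$ a measure such that $\int|\xi|^i\mu_f(d\xi)<\infty$ for $i=0,\dots,k$; $f(Y)$ is defined by functional calculus for $Y\in\mathcal A_*$. For $f\in\mathbf F_0$, $f^*$ is the function in $\mathbf F_0$ with $f^*(Y)=f(Y)^*$ for all $Y\in\mathcal A_*$. For $f\in\mathbf F_1$, $Y\in\mathcal A_*$: $\partial f(Y):=\int_0^1d\alpha\int_{\mathbb R}\imath\xi\,[e^{\imath\alpha\xi Y}\otimes e^{\imath(1-\alpha)\xi Y}]\,\mu_f(d\xi)\in\mathcal A\hat\otimes\mathcal A$. Hölder spaces. For a Banach space $V$, $\mathcal C_k(V)$ ($k=1,2,3$) is the set of continuous $V$-valued maps on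 $\{(t_1,\dots,t_k)\in[0,T]^k:t_1\le\dots\le t_k\}$ vanishing when two of the times are equal. $(\delta g)_{st}:=g_t-g_s$ for $g\in\mathcal C_1$; $(\delta h)_{sut}:=h_{st}-h_{su}-h_{ut}$ for $h\in\mathcal C_2$ (also denoted $\delta_2$). $\mathcal C_1^\alpha,\mathcal C_2^\alpha,\mathcal C_3^{(\alpha,\beta)}$ are the subspaces where respectively $\mathcal N[h;\mathcal C_1^\alpha]=\sup_{s<t}\|(\delta h)_{st}\|/|t-s|^\alpha$, $\mathcal N[h;\mathcal C_2^\alpha]=\sup_{s<t}\|h_{st}\|/|t-s|^\alpha$, $\sup_{s<u<t}\|h_{sut}\|/(|t-u|^\alpha|u-s|^\beta)$ are finite. $\mathcal N[h;\mathcal C_1^0]:=\sup_s\|h_s\|$. $\mathcal C_3^\mu$: finite sums of elements of $\mathcal C_3^{(\alpha,\mu-\alpha)}$, $0\le\alpha\le\mu$. Sewing map: for $\mu>1$ and $h\in\mathcal C_3^\mu(V)\cap\mathrm{Im}\,\delta_2$, $\Lambda h$ is the unique element of $\mathcal C_2^\mu(V)$ with $\delta(\Lambda h)=h$. Filtration. $\mathcal A_t$ is the unital subalgebra of $\mathcal A$ generated by $\{X_s\}_{s\in[0,t]}$. A process (resp. biprocess, triprocess) $Y$ is adapted if $Y_t\in\mathcal A_t$ (resp. $\mathcal A_t\hat\otimes\mathcal A_t$, $\mathcal A_t^{\hat\otimes3}$) for all $t$. Product Lévy area. For $L=(L_{st})_{0\le s<t\le T}$ with $L_{st}\in\mathcal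 L(\mathcal A_s\hat\otimes\mathcal A_s,\mathcal A_t)$, $\mathcal N[L;\mathcal C_2^{2\gamma}(\mathcal L(\mathcal A_\to))]:=\sup_{s<t,\,0\ne U\in\mathcal A_s\hat\otimes\mathcal A_s}\|L_{st}[U]\|/(|t-s|^{2\gamma}\|U\|)$; $\mathcal C_2^{2\gamma}(\mathcal L(\mathcal A_\to))$ is the set of $L$ for which this is finite. A product Lévy area above $X$ is $\mathbf X\in\mathcal C_2^{2\gamma}(\mathcal L(\mathcal A_\to))$ with $(\delta\mathbf X)_{sut}[\mathbf V]=(\mathbf V\sharp(\delta X)_{su})\cdot(\delta X)_{ut}$ for all $s<u<t$, $\mathbf V\in\mathcal A_s\hat\otimes\mathcal A_s$. $\mathbf X^*_{st}[\mathbf V]:=\mathbf X_{st}[\mathbf V^*]^*$. $[\mathbf X_{st}\times\mathrm{Id}](U_1\otimes U_2\otimes U_3):=\mathbf X_{st}[U_1\otimes U_2]\cdot U_3$ and $[\mathrm{Id}\times\mathbf X^*_{st}](U_1\otimes U_2\otimes U_3):=U_1\cdot\mathbf X^*_{st}[U_2\otimes U_3]$, extended continuously. Controlled processes (taken together with their decomposition). $\mathcal Q(X)$: adapted $Y\in\mathcal C_1^\gamma(\mathcal A)$ with $(\delta Y)_{st}=\mathbf Y^X_s\sharp(\delta X)_{st}+Y^\flat_{st}$, $\mathbf Y^X\in\mathcal C_1^\gamma(\mathcal A\hat\otimes\mathcal A)$ adapted, $Y^\flat\in\mathcal C_2^{2\gamma}(\mathcal A)$; $\mathcal N[Y;\mathcal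 Q(X)]:=\mathcal N[Y;\mathcal C_1^\gamma]+\mathcal N[\mathbf Y^X;\mathcal C_1^0]+\mathcal N[\mathbf Y^X;\mathcal C_1^\gamma]+\mathcal N[Y^\flat;\mathcal C_2^{2\gamma}]$. $\mathcal Q_*(X)$: those with $Y_s^*=Y_s$ and $(\mathbf Y^X_s)^*=\mathbf Y^X_s$ for all $s$. $\mathbf Q(X)$: adapted biprocesses $\mathbf U\in\mathcal C_1^\gamma(\mathcal A\hat\otimes\mathcal A)$ with $(\delta\mathbf U)_{st}=(\delta X)_{st}\sharp\mathbb U^{X,1}_s+\mathbb U^{X,2}_s\sharp(\delta X)_{st}+\mathbf U^\flat_{st}$, $\mathbb U^{X,i}\in\mathcal C_1^\gamma(\mathcal A^{\hat\otimes3})$ adapted, $\mathbf U^\flat\in\mathcal C_2^{2\gamma}(\mathcal A\hat\otimes\mathcal A)$. Integral. For $\mathbf U\in\mathbf Q(X)$: $\mathcal J_{st}(\mathbf U\sharp dX):=M_{st}-\Lambda_{st}(\delta M)$, $M_{st}:=\mathbf U_s\sharp(\delta X)_{st}+[\mathbf X_{st}\times\mathrm{Id}](\mathbb U^{X,1}_s)+[\mathrm{Id}\times\mathbf X^*_{st}](\mathbb U^{X,2}_s)$ (this is well-defined). A process $Z$ with $\delta Z=\mathcal J(\mathbf U\sharp dX)$ is regarded as an element of $\mathcal Q(X)$ with $\mathbf Z^X=\mathbf U$. For $Y\in\mathcal Q_*(X)$, $\mathcal J(f_i(Y)\cdot dX\cdot g_i(Y)):=\mathcal J(\mathbf U\sharp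 dX)$ with $\mathbf U=f_i(Y)\otimes g_i(Y)\in\mathbf Q(X)$, $\mathbb U^{X,1}_s=[\partial f_i(Y_s)\cdot\mathbf Y^X_s]\otimes g_i(Y_s)$, $\mathbb U^{X,2}_s=f_i(Y_s)\otimes[\partial g_i(Y_s)\cdot\mathbf Y^X_s]$. The equation is understood as an identity between elements of $\mathcal Q_*(X)$; in particular a solution has $\mathbf Y^X=\sum_{i=1}^mf_i(Y)\otimes g_i(Y)$.
   Formalization: The initial condition A is assumed to lie in A_0 (necessary, since a solution in Q_*(X) is adapted and Y_0 = A), and A_t is the norm-closed unital subalgebra generated by X_s, s in [0,t], since solutions need not lie in the unclosed algebra. *)

(* Defs.v *)
From HB Require Import structures.
From mathcomp Require Import all_boot all_order all_algebra.
From mathcomp Require Import all_classical all_reals all_analysis.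
From mathcomp Require Import measurable_realfun.
From mathcomp Require Import complex.

Set Implicit Arguments.
Unset Strict Implicit.
Unset Printing Implicit Defensive.

Import Order.TTheory GRing.Theory Num.Theory.
Import numFieldNormedType.Exports.

Local Open Scope classical_set_scope.
Local Open Scope ring_scope.
Local Open Scope complex_scope.

(* The norm of a normed module over [R[i]] takes its values in [R[i]];
   [rnorm] is the same number seen in [R]. *)
Definition rnorm (R : realType) (V : normedModType R[i]) (v : V) : R :=
  complex.Re `|v|.

Record hilbertSpace (R : realType) := HilbertSpace {
  hs_car :> completeNormedModType R[i];
  hs_ip : hs_car -> hs_car -> R[i];
  hs_ip_linear : forall (c : R[i]) x y z,
    hs_ip (c *: x + y) z = c * hs_ip x z + hs_ip y z;
  hs_ip_conj : forall x y, hs_ip y x = (hs_ip x y)^*;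
  hs_ip_norm : forall x, hs_ip x x = `|x| ^+ 2 }.

(* [vn_rep] identifies the algebra, isometrically for the operator norm, with a
   unital *-subalgebra of B(H) closed for the weak operator topology.  The
   algebra, involution and norm axioms of [vn_mul], [vn_one] and [vn_star]
   follow, since [vn_rep] is injective. *)
Record vonNeumannAlgebra (R : realType) := VonNeumannAlgebra {
  vn_car :> completeNormedModType R[i];
  vn_mul : vn_car -> vn_car -> vn_car;
  vn_one : vn_car;
  vn_star : vn_car -> vn_car;
  vn_space : hilbertSpace R;
  vn_rep : vn_car -> vn_space -> vn_space;
  vn_rep_op_linear : forall a (c : R[i]) x y,
    vn_rep a (c *: x + y) = c *: vn_rep a x + vn_rep a y;
  vn_rep_linear : forall (c : R[i]) a b x,
    vn_rep (c *: a + b) x = c *: vn_rep a x + vn_rep b x;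
  vn_rep_one : forall x, vn_rep vn_one x = x;
  vn_rep_mul : forall a b x, vn_rep (vn_mul a b) x = vn_rep a (vn_rep b x);
  vn_rep_star : forall a x y,
    hs_ip (vn_rep (vn_star a) x) y = hs_ip x (vn_rep a y);
  vn_norm_le : forall a x, `|vn_rep a x| <= `|a| * `|x|;
  vn_norm_ge : forall a (M : R[i]), 0 <= M ->
    (forall x, `|vn_rep a x| <= M * `|x|) -> `|a| <= M;
  vn_weakly_closed : forall L : vn_space -> vn_space,
    (forall (c : R[i]) x y, L (c *: x + y) = c *: L x + L y) ->
    (exists M : R[i], forall x, `|L x| <= M * `|x|) ->
    (forall (s : seq (vn_space * vn_space)) (e : R), 0 < e ->
       exists a, forall p, p \in s ->
         `|hs_ip (vn_rep a p.1 - L p.1) p.2| <= e%:C) ->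
    exists a, vn_rep a = L }.

Notation "a ** b" := (vn_mul a b) (at level 40, left associativity).

Definition vn_pow (R : realType) (A : vonNeumannAlgebra R) (a : A) (n : nat) : A :=
  iter n (vn_mul a) (vn_one A).

Definition selfadjoint (R : realType) (A : vonNeumannAlgebra R) (a : A) : Prop :=
  vn_star a = a.

(* [ns_weak] is continuity at 0, hence everywhere by linearity, for the weak
   operator topology. *)
Record ncState (R : realType) (A : vonNeumannAlgebra R) (phi : A -> R[i]) :
    Prop := NCState {
  ns_linear : forall (c : R[i]) a b, phi (c *: a + b) = c * phi a + phi b;
  ns_unital : phi (vn_one A) = 1;
  ns_weak : forall e : R, 0 < e ->
    exists (s : seq (vn_space A * vn_space A)) (d : R), 0 < d /\
      forall a, (forall p, p \in s -> `|hs_ip (vn_rep a p.1) p.2| <= d%:C) ->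
        `|phi a| <= e%:C;
  ns_positive : forall a, 0 <= phi (vn_star a ** a);
  ns_faithful : forall a, phi (vn_star a ** a) = 0 -> a = 0;
  ns_tracial : forall a b, phi (a ** b) = phi (b ** a) }.

Record linSubspace (R : realType) (V : completeNormedModType R[i]) := LinSubspace {
  subspace_set :> V -> Prop;
  subspace0 : subspace_set 0;
  subspace_lin : forall (c : R[i]) a b,
    subspace_set a -> subspace_set b -> subspace_set (c *: a + b) }.

Program Definition full_linSubspace (R : realType) (V : completeNormedModType R[i]) :
  linSubspace V := @LinSubspace R V (fun=> True) _ _.
Next Obligation. by []. Qed.
Next Obligation. by []. Qed.

Definition bounded_linear (R : realType) (E F : completeNormedModType R[i])
    (M : R) (L : E -> F) : Prop :=
  (forall (c : R[i]) x y, L (c *: x + y) = c *: L x + L y) /\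
  (forall x, `|L x| <= M%:C * `|x|).

Definition bilinear_on (R : realType) (V F : completeNormedModType R[i])
    (S : linSubspace V) (b : V -> V -> F) : Prop :=
  forall (c : R[i]) x y z, S x -> S y -> S z ->
    b (c *: x + y) z = c *: b x z + b y z /\
    b z (c *: x + y) = c *: b z x + b z y.

Definition trilinear_on (R : realType) (V F : completeNormedModType R[i])
    (S : linSubspace V) (b : V -> V -> V -> F) : Prop :=
  forall (c : R[i]) x y z w, S x -> S y -> S z -> S w ->
    [/\ b (c *: x + y) z w = c *: b x z w + b y z w,
        b z (c *: x + y) w = c *: b z x w + b z y w &
        b z w (c *: x + y) = c *: b z w x + b z w y].

(* [ptensor2 S] (resp. [ptensor3 S]) is the projective tensor product of two
   (resp. three) copies of [S], given by its universal property, which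
   determines it up to a unique isometric isomorphism compatible with
   elementary tensors.  Elementary tensors are total functions on [V] but only
   those with entries in [S] are meaningful. *)
Record ptensor2 (R : realType) (V : completeNormedModType R[i])
    (S : linSubspace V) := PTensor2 {
  pt2_car :> completeNormedModType R[i];
  tens2 : V -> V -> pt2_car;
  tens2_bilinear : bilinear_on S tens2;
  tens2_norm : forall x y, S x -> S y -> `|tens2 x y| <= `|x| * `|y|;
  tens2_universal : forall (F : completeNormedModType R[i]) (b : V -> V -> F)
      (M : R), 0 <= M -> bilinear_on S b ->
    (forall x y, S x -> S y -> `|b x y| <= M%:C * (`|x| * `|y|)) ->
    exists L : pt2_car -> F,
      [/\ bounded_linear M L,
          forall x y, S x -> S y -> L (tens2 x y) = b x y &
          forall M' (L' : pt2_car -> F), bounded_linear M' L' ->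
            (forall x y, S x -> S y -> L' (tens2 x y) = b x y) -> L' = L] }.

Record ptensor3 (R : realType) (V : completeNormedModType R[i])
    (S : linSubspace V) := PTensor3 {
  pt3_car :> completeNormedModType R[i];
  tens3 : V -> V -> V -> pt3_car;
  tens3_trilinear : trilinear_on S tens3;
  tens3_norm : forall x y z, S x -> S y -> S z ->
    `|tens3 x y z| <= `|x| * `|y| * `|z|;
  tens3_universal : forall (F : completeNormedModType R[i])
      (b : V -> V -> V -> F) (M : R), 0 <= M -> trilinear_on S b ->
    (forall x y z, S x -> S y -> S z ->
      `|b x y z| <= M%:C * (`|x| * `|y| * `|z|)) ->
    exists L : pt3_car -> F,
      [/\ bounded_linear M L,
          forall x y z, S x -> S y -> S z -> L (tens3 x y z) = b x y z &
          forall M' (L' : pt3_car -> F), bounded_linear M' L' ->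
            (forall x y z, S x -> S y -> S z -> L' (tens3 x y z) = b x y z) ->
            L' = L] }.

(* The extension by additivity and continuity of a map prescribed on elementary
   tensors.  Homogeneity is not required, so that this also applies to the
   antilinear involution; the extension is unique because a multiple of an
   elementary tensor is an elementary tensor. *)
Definition extend2 (R : realType) (V F : completeNormedModType R[i])
    (S : linSubspace V) (E : ptensor2 S) (b : V -> V -> F) : E -> F :=
  xget (fun=> 0) [set L : E -> F |
    [/\ forall x y, L (x + y) = L x + L y, continuous L &
        forall u v, S u -> S v -> L (tens2 E u v) = b u v]].

Definition extend3 (R : realType) (V F : completeNormedModType R[i])
    (S : linSubspace V) (E : ptensor3 S) (b : V -> V -> V -> F) : E -> F :=
  xget (fun=> 0) [set L : E -> F |
    [/\ forall x y, L (x + y) = L x + L y, continuous L &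
        forall u v w, S u -> S v -> S w -> L (tens3 E u v w) = b u v w]].

Section TensorOperations.
Context (R : realType) (A : vonNeumannAlgebra R).
Implicit Types (S : linSubspace A).

Definition mul2 S (E : ptensor2 S) (x y : E) : E :=
  extend2 (fun u1 u2 => extend2 (fun v1 v2 => tens2 E (u1 ** v1) (v2 ** u2)) y) x.

Definition star2 S (E : ptensor2 S) : E -> E :=
  extend2 (fun u v => tens2 E (vn_star v) (vn_star u)).

Definition sharp2 S (E : ptensor2 S) (x : E) (a : A) : A :=
  extend2 (fun u v => u ** a ** v) x.

(* The canonical map, for S included in S'. *)
Definition incl2 S S' (E : ptensor2 S) (E' : ptensor2 S') : E -> E' :=
  extend2 (tens2 E').

Definition tens21 S (E : ptensor2 S) (G : ptensor3 S) (x : E) (a : A) : G :=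
  extend2 (fun u v => tens3 G u v a) x.

Definition tens12 S (E : ptensor2 S) (G : ptensor3 S) (a : A) (x : E) : G :=
  extend2 (fun u v => tens3 G a u v) x.

Definition op_times_id S (E : ptensor2 S) (G : ptensor3 S) (L : E -> A) : G -> A :=
  extend3 (fun u v w => L (tens2 E u v) ** w).

Definition id_times_op S (E : ptensor2 S) (G : ptensor3 S) (L : E -> A) : G -> A :=
  extend3 (fun u v w => u ** L (tens2 E v w)).

Definition op_star S (E : ptensor2 S) (L : E -> A) (x : E) : A :=
  vn_star (L (star2 x)).

End TensorOperations.

(* A complex measure on the line in polar form, mu(dx) = cm_dens(x) |mu|(dx)
   with |cm_dens| = 1. *)
Record complexMeasure (R : realType) := ComplexMeasure {
  cm_abs : {finite_measure set R -> \bar R};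
  cm_dens : R -> R[i];
  cm_dens_Re : measurable_fun setT
    (fun x : R => complex.Re (cm_dens x));
  cm_dens_Im : measurable_fun setT
    (fun x : R => complex.Im (cm_dens x));
  cm_dens_norm : forall x, `|cm_dens x| = 1 }.

Section FourierClass.
Context (R : realType).
Implicit Types (mu : complexMeasure R).

Definition expi (x : R) : R[i] := cos x +i* sin x.

Definition fourier mu (x : R) : R[i] :=
  let F xi := expi (x * xi) * cm_dens mu xi in
  Rintegral (cm_abs mu) setT (fun xi => complex.Re (F xi)) +i*
  Rintegral (cm_abs mu) setT (fun xi => complex.Im (F xi)).

(* [fourier mu] belongs to F_k.  As the measure is determined by the function,
   elements of F_k are represented by measures satisfying this predicate. *)
Definition in_F (k : nat) mu : Prop :=
  forall j, (j <= k)%N ->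
    (\int[cm_abs mu]_(xi in setT) (`|xi| ^+ j)%:E < +oo)%E.

End FourierClass.

Section Reflected.
Context (R : realType) (m : {finite_measure set R -> \bar R}).

(* The image of a measure under x |-> - x. *)
Definition reflected : set R -> \bar R := pushforward m (-%R : R -> R).

Let measurable_reflect (B : set R) : measurable B -> measurable (-%R @^-1` B).
Proof. by move=> mB; rewrite -[X in measurable X]setTI; exact: oppr_measurable. Qed.

Let reflected0 : reflected set0 = 0%E.
Proof. by rewrite /reflected /pushforward preimage_set0 measure0. Qed.

Let reflected_ge0 B : (0 <= reflected B)%E.
Proof. exact: measure_ge0. Qed.

Let reflected_semi_sigma_additive : semi_sigma_additive reflected.
Proof.
move=> F mF tF mUF; rewrite /reflected /pushforward preimage_bigcup.
apply: measure_semi_sigma_additive.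
- by move=> n; exact: measurable_reflect.
- apply/trivIsetP => /= i j _ _ ij; rewrite -preimage_setI.
  by move/trivIsetP : tF => /(_ _ _ _ _ ij) ->//; rewrite preimage_set0.
- by rewrite -preimage_bigcup; exact: measurable_reflect.
Qed.

HB.instance Definition _ := isMeasure.Build _ _ _
  reflected reflected0 reflected_ge0 reflected_semi_sigma_additive.

Let reflected_fin_num : fin_num_fun reflected.
Proof. by move=> B mB; apply: fin_num_measure; exact: measurable_reflect. Qed.

HB.instance Definition _ := Measure_isFinite.Build _ _ _ reflected reflected_fin_num.

End Reflected.

Section Star.
Context (R : realType) (mu : complexMeasure R).

Let dens (x : R) : R[i] := (cm_dens mu (- x))^*.

Let dens_Re : measurable_fun setT (fun x : R => complex.Re (dens x)).
Proof.
have -> : (fun x : R => complex.Re (dens x)) =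
          (fun x => complex.Re (cm_dens mu x)) \o -%R.
  by apply/funext => x; rewrite /dens /=; case: (cm_dens mu (- x)).
by apply: measurableT_comp; [exact: cm_dens_Re | exact: oppr_measurable].
Qed.

Let dens_Im : measurable_fun setT (fun x : R => complex.Im (dens x)).
Proof.
have -> : (fun x : R => complex.Im (dens x)) =
          -%R \o ((fun x => complex.Im (cm_dens mu x)) \o -%R).
  by apply/funext => x; rewrite /dens /=; case: (cm_dens mu (- x)).
apply: measurableT_comp; first exact: oppr_measurable.
by apply: measurableT_comp; [exact: cm_dens_Im | exact: oppr_measurable].
Qed.

Let dens_norm x : `|dens x| = 1.
Proof. by rewrite /dens norm_conjC cm_dens_norm. Qed.

(* The measure of f^*, f being the function with measure [mu]. *)
Definition cm_star : complexMeasure R :=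
  @ComplexMeasure R (reflected (cm_abs mu)) dens dens_Re dens_Im dens_norm.

Let F x xi : R[i] := expi (x * xi) * cm_dens mu xi.

Let F_norm x xi : `|F x xi| = 1.
Proof.
by rewrite /F normrM cm_dens_norm mulr1 /expi normc_def /= cos2Dsin2 sqrtr1.
Qed.

Let F_star x xi : expi (x * xi) * dens xi = (F x (- xi))^*.
Proof. by rewrite /F /expi /dens mulrN cosN sinN rmorphM /= /conjc opprK. Qed.

Let measurable_F x : measurable_fun setT (fun xi => complex.Re (F x xi)) /\
                     measurable_fun setT (fun xi => complex.Im (F x xi)).
Proof.
have mcos : measurable_fun setT (fun xi => cos (x * xi)).
  apply: (@measurableT_comp _ _ _ _ _ _ cos).
    exact: (continuous_measurable_fun (@continuous_cos R)).
  exact: mulrl_measurable.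
have msin : measurable_fun setT (fun xi => sin (x * xi)).
  apply: (@measurableT_comp _ _ _ _ _ _ sin).
    exact: (continuous_measurable_fun (@continuous_sin R)).
  exact: mulrl_measurable.
have mRe := cm_dens_Re mu; have mIm := cm_dens_Im mu; split.
  have -> : (fun xi => complex.Re (F x xi)) =
    (fun xi => cos (x * xi)) \* (fun xi => complex.Re (cm_dens mu xi)) \-
    (fun xi => sin (x * xi)) \* (fun xi => complex.Im (cm_dens mu xi)).
    by apply/funext => xi; rewrite /F /expi /=; case: (cm_dens mu xi).
  by apply: measurable_funB; exact: measurable_funM.
have -> : (fun xi => complex.Im (F x xi)) =
    (fun xi => cos (x * xi)) \* (fun xi => complex.Im (cm_dens mu xi)) \+
    (fun xi => sin (x * xi)) \* (fun xi => complex.Re (cm_dens mu xi)).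
  by apply/funext => xi; rewrite /F /expi /=; case: (cm_dens mu xi).
by apply: measurable_funD; exact: measurable_funM.
Qed.

Let integrable_bounded (m : {finite_measure set R -> \bar R}) (h : R -> R) :
  measurable_fun setT h -> (forall x, `|h x| <= 1) ->
  m.-integrable setT (EFin \o h).
Proof.
move=> mh h1; apply: (@le_integrable _ _ _ _ _ _ _ (EFin \o cst 1)) => //.
- exact/measurable_EFinP.
- by move=> x _; rewrite /= lee_fin normr1.
- exact: finite_measure_integrable_cst.
Qed.

Let Rintegral_reflected (h : R -> R) : measurable_fun setT h ->
  (forall x, `|h x| <= 1) ->
  Rintegral (reflected (cm_abs mu)) setT (h \o -%R) =
  Rintegral (cm_abs mu) setT h.
Proof.
move=> mh h1; rewrite /Rintegral; congr fine.
have mho : measurable_fun setT (h \o -%R).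
  by apply: measurableT_comp => //; exact: oppr_measurable.
have hK : (fun x => (h \o -%R) (- x)) = h by apply/funext => x /=; rewrite opprK.
have mN : measurable_fun setT (-%R : R -> R) by exact: oppr_measurable.
have mE : measurable_fun setT (fun x : R => ((h \o -%R) x)%:E).
  exact/measurable_EFinP.
have iE : (cm_abs mu).-integrable (-%R @^-1` setT)
    ((fun x : R => ((h \o -%R) x)%:E) \o -%R).
  rewrite preimage_setT.
  have -> : (fun x : R => ((h \o -%R) x)%:E) \o -%R = EFin \o h.
    by apply/funext => x /=; rewrite opprK.
  exact: integrable_bounded.
have := integral_pushforward mN mE iE measurableT.
rewrite preimage_setT => ->.
by apply: eq_integral => x _ /=; rewrite opprK.
Qed.

Let Re_le1 (z : R[i]) : `|z| = 1 -> `|complex.Re z| <= 1.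
Proof. by move=> z1; have := normc_ge_Re z; rewrite z1 lecR. Qed.

Let Im_le1 (z : R[i]) : `|z| = 1 -> `|complex.Im z| <= 1.
Proof.
move=> z1; rewrite -normrN -ReiNIm.
by apply: Re_le1; rewrite normrM z1 normc_def /= expr0n expr1n add0r sqrtr1 mulr1.
Qed.

Lemma fourier_cm_star x : fourier cm_star x = (fourier mu x)^*.
Proof.
have [mRe mIm] := measurable_F x.
have bRe xi : `|complex.Re (F x xi)| <= 1 by apply: Re_le1; rewrite F_norm.
have bIm xi : `|complex.Im (F x xi)| <= 1 by apply: Im_le1; rewrite F_norm.
rewrite /fourier /=; congr (_ +i* _).
  rewrite -(Rintegral_reflected mRe bRe).
  by apply: eq_Rintegral => xi _; rewrite F_star; case: (F x (- xi)).
rewrite -mulN1r -(Rintegral_reflected mIm bIm) -RintegralZl //.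
  by apply: eq_Rintegral => xi _; rewrite F_star mulN1r /=; case: (F x (- xi)).
apply: integrable_bounded => [|xi]; last exact: bIm.
rewrite -[X in measurable_fun _ X]/((fun xi => complex.Im (F x xi)) \o -%R).
by apply: measurableT_comp => //; exact: oppr_measurable.
Qed.

End Star.

(* Bochner integral of [F] over [D]: the limit of the integrals of simple
   functions (finite sums of indicators times vectors) approximating [F] in
   mean. *)
Section BochnerIntegral.
Context d (T : measurableType d) (R : realType) (V : completeNormedModType R[i]).
Variables (m : {measure set T -> \bar R}) (D : set T).

Definition simple_value (s : seq (set T * V)) (x : T) : V :=
  \sum_(p <- s) (\1_(p.1) x : R)%:C *: p.2.

Definition simple_integral (s : seq (set T * V)) : V :=
  \sum_(p <- s) (fine (m (D `&` p.1)))%:C *: p.2.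

Definition is_bochner (F : T -> V) (v : V) : Prop :=
  exists s_ : nat -> seq (set T * V),
    [/\ forall n p, p \in s_ n -> measurable p.1 /\ (m (D `&` p.1) < +oo)%E,
        forall n, measurable_fun D (fun x => rnorm (F x - simple_value (s_ n) x)),
        (\int[m]_(x in D) (rnorm (F x - simple_value (s_ n) x))%:E)%E
          @[n --> \oo] --> 0%E &
        simple_integral (s_ n) @[n --> \oo] --> v].

Definition bochner (F : T -> V) : V := xget 0 [set v | is_bochner F v].

End BochnerIntegral.

Section FunctionalCalculus.
Context (R : realType) (A : vonNeumannAlgebra R).

Definition vn_exp (a : A) : A :=
  limn (series (fun n => (n`!%:R : R[i])^-1 *: vn_pow a n)).

Definition spectrum (a : A) : set R[i] :=
  [set z | ~ exists b, b ** (a - z *: vn_one A) = vn_one A /\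
                       (a - z *: vn_one A) ** b = vn_one A].

Definition vn_horner (p : {poly R[i]}) (a : A) : A :=
  \sum_(k < size p) p`_k *: vn_pow a k.

(* Continuous functional calculus at a self-adjoint element (whose spectrum is
   real): [f(a)] is approximated by [p(a)] whenever the polynomial [p]
   approximates [f] uniformly on the spectrum. *)
Definition fcalc (f : R -> R[i]) (a : A) : A :=
  xget 0 [set b | forall e : R, 0 < e -> exists p : {poly R[i]},
    (forall x : R, spectrum a x%:C -> `|p.[x%:C] - f x| <= e%:C) /\
    `|vn_horner p a - b| <= e%:C].

Definition deriv2 (S : linSubspace A) (E : ptensor2 S) (mu : complexMeasure R)
    (a : A) : E :=
  bochner lebesgue_measure `[0, 1] (fun alpha : R =>
    bochner (cm_abs mu) setT (fun xi : R =>
      (cm_dens mu xi * ('i * xi%:C)) *: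
        tens2 E (vn_exp (('i * (alpha * xi)%:C) *: a))
                (vn_exp (('i * ((1 - alpha) * xi)%:C) *: a)))).

End FunctionalCalculus.

(* Maps on [0,T] and on the simplex {0 <= s <= t <= T} are represented by total
   functions, whose values elsewhere are never used. *)
Section Hoelder.
Context (R : realType) (V : completeNormedModType R[i]) (T : R).

Definition N1 (al : R) (g : R -> V) : \bar R :=
  ereal_sup [set z | exists s t, [/\ 0 <= s, s < t, t <= T &
    z = (rnorm (g t - g s) / (t - s) `^ al)%:E]].

Definition N1_0 (g : R -> V) : \bar R :=
  ereal_sup [set z | exists s, [/\ 0 <= s, s <= T & z = (rnorm (g s))%:E]].

Definition N2 (al : R) (h : R -> R -> V) : \bar R :=
  ereal_sup [set z | exists s t, [/\ 0 <= s, s < t, t <= T &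
    z = (rnorm (h s t) / (t - s) `^ al)%:E]].

Definition C1 (al : R) (g : R -> V) : Prop :=
  {within `[0, T], continuous g} /\ (N1 al g < +oo)%E.

Definition simplex2 : set (R * R) :=
  [set p | [/\ 0 <= p.1, p.1 <= p.2 & p.2 <= T]].

Definition C2 (al : R) (h : R -> R -> V) : Prop :=
  [/\ {within simplex2, continuous (fun p : R * R => h p.1 p.2)},
      forall s, 0 <= s -> s <= T -> h s s = 0 &
      (N2 al h < +oo)%E].

Definition delta1 (g : R -> V) (s t : R) : V := g t - g s.

Definition delta2 (h : R -> R -> V) (s u t : R) : V := h s t - h s u - h u t.

(* The sewing map: for 1 < al, there is at most one such element of C_2^al, up
   to its irrelevant values outside the simplex, and there is one if [h] is in
   C_3^al and in the image of delta. *)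
Definition sewing (al : R) (h : R -> R -> R -> V) : R -> R -> V :=
  xget (fun _ _ => 0) [set k | C2 al k /\
    forall s u t, 0 <= s -> s < u -> u < t -> t <= T ->
      delta2 k s u t = h s u t].

End Hoelder.

Section Filtration.
Context (R : realType) (A : vonNeumannAlgebra R) (X : R -> A).

Definition closed_unital_subalgebra (B : set A) : Prop :=
  [/\ closed B, B (vn_one A),
      forall (c : R[i]) a b, B a -> B b -> B (c *: a + b) &
      forall a b, B a -> B b -> B (a ** b)].

(* The generated subalgebra is taken closed for the norm. *)
Definition alg_set (t : R) : set A :=
  smallest closed_unital_subalgebra (X @` `[0, t]).

Let alg_set_lin t (c : R[i]) a b :
  alg_set t a -> alg_set t b -> alg_set t (c *: a + b).
Proof.
move=> ha hb B hB; case: (hB) => -[_ _ hlin _] _.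
by apply: hlin; [exact: ha | exact: hb].
Qed.

Let alg_set0 t : alg_set t 0.
Proof.
move=> B [[_ h1 hlin _] _].
have -> : 0 = (-1) *: vn_one A + vn_one A by rewrite scaleN1r addNr.
exact: hlin.
Qed.

Definition alg (t : R) : linSubspace A :=
  @LinSubspace R A (alg_set t) (@alg_set0 t) (@alg_set_lin t).

End Filtration.

Section RoughEquation.
Context (R : realType) (A : vonNeumannAlgebra R).
Context (T2 : forall S : linSubspace A, ptensor2 S).
Context (T3 : forall S : linSubspace A, ptensor3 S).
Context (gam T : R) (X : R -> A).

(* [AA t] need not embed in [AAfull], nor in [AA u] for t <= u, hence the
   explicit canonical maps. *)
Definition AA (t : R) := T2 (alg X t).
Definition AAA (t : R) := T3 (alg X t).
Definition AAfull := T2 (full_linSubspace A).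

Definition adapted (Y : R -> A) : Prop :=
  forall t, 0 <= t -> t <= T -> alg X t (Y t).

(* An adapted biprocess, seen with values in A (x) A. *)
Definition in_full (U : forall t, AA t) (t : R) : AAfull := incl2 AAfull (U t).

Definition N_area (L : forall s : R, R -> AA s -> A) : \bar R :=
  ereal_sup [set z | exists s t (U : AA s), [/\ 0 <= s, s < t, t <= T, U != 0 &
    z = (rnorm (L s t U) / ((t - s) `^ (2 * gam) * rnorm U))%:E]].

Record productLevyArea (L : forall s : R, R -> AA s -> A) : Prop :=
    ProductLevyArea {
  area_linear : forall s t, 0 <= s -> s < t -> t <= T ->
    forall (c : R[i]) U V, L s t (c *: U + V) = c *: L s t U + L s t V;
  area_adapted : forall s t, 0 <= s -> s < t -> t <= T ->
    forall U, alg X t (L s t U);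
  area_bounded : (N_area L < +oo)%E;
  area_delta : forall s u t, 0 <= s -> s < u -> u < t -> t <= T ->
    forall V : AA s, L s t V - L s u V - L u t (incl2 (AA u) V) =
      sharp2 V (delta1 X s u) ** delta1 X u t }.

Definition remainder (Y : R -> A) (YX : forall t, AA t) (s t : R) : A :=
  delta1 Y s t - sharp2 (YX s) (delta1 X s t).

Record in_Q (Y : R -> A) (YX : forall t, AA t) : Prop := InQ {
  Q_adapted : adapted Y;
  Q_hoelder : C1 T gam Y;
  Q_derivative : C1 T gam (in_full YX);
  Q_remainder : C2 T (2 * gam) (remainder Y YX) }.

Definition in_Qstar (Y : R -> A) (YX : forall t, AA t) : Prop :=
  in_Q Y YX /\ forall s, 0 <= s -> s <= T ->
    vn_star (Y s) = Y s /\ star2 (YX s) = YX s.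

Definition N_Q (Y : R -> A) (YX : forall t, AA t) : \bar R :=
  (N1 T gam Y + N1_0 T (in_full YX) + N1 T gam (in_full YX) +
   N2 T (2 * gam) (remainder Y YX))%E.

Definition germ (L : forall s : R, R -> AA s -> A) (U : forall t, AA t)
    (U1 U2 : forall t, AAA t) (s t : R) : A :=
  sharp2 (U s) (delta1 X s t) + op_times_id (L s t) (U1 s)
  + id_times_op (op_star (L s t)) (U2 s).

(* The integral of the controlled biprocess [U] with derivatives [U1], [U2];
   the increments delta2 of its germ belong to C_3^(3 gam). *)
Definition rough_int (L : forall s : R, R -> AA s -> A) (U : forall t, AA t)
    (U1 U2 : forall t, AAA t) (s t : R) : A :=
  germ L U U1 U2 s t - sewing T (3 * gam) (delta2 (germ L U U1 U2)) s t.

(* J(f(Y) . dX . g(Y)), [f] and [g] being given by their measures. *)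
Definition rough_int_fg (L : forall s : R, R -> AA s -> A)
    (f g : complexMeasure R) (Y : R -> A) (YX : forall t, AA t) : R -> R -> A :=
  rough_int L
    (fun t => tens2 (AA t) (fcalc (fourier f) (Y t)) (fcalc (fourier g) (Y t)))
    (fun t => tens21 (AAA t) (mul2 (deriv2 (AA t) f (Y t)) (YX t))
                (fcalc (fourier g) (Y t)))
    (fun t => tens12 (AAA t) (fcalc (fourier f) (Y t))
                (mul2 (deriv2 (AA t) g (Y t)) (YX t))).

Record is_solution (L : forall s : R, R -> AA s -> A) (m : nat)
    (f g : 'I_m -> complexMeasure R) (a : A) (Y : R -> A) (YX : forall t, AA t) :
    Prop := IsSolution {
  sol_Qstar : in_Qstar Y YX;
  sol_init : Y 0 = a;
  sol_equation : forall s t, 0 <= s -> s < t -> t <= T ->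
    delta1 Y s t = \sum_(i < m) rough_int_fg L (f i) (g i) Y YX s t;
  sol_derivative : forall t, 0 <= t -> t <= T ->
    YX t = \sum_(i < m) tens2 (AA t) (fcalc (fourier (f i)) (Y t))
                                     (fcalc (fourier (g i)) (Y t)) }.

End RoughEquation.

(* Main.v *)
Require Import Defs.
From HB Require Import structures.
From mathcomp Require Import all_boot all_order all_algebra.
From mathcomp Require Import all_classical all_reals all_analysis.
From mathcomp Require Import measurable_realfun.
From mathcomp Require Import complex.
From mathcomp Require Import ring lra zify.

Set Implicit Arguments.
Unset Strict Implicit.
Unset Printing Implicit Defensive.

Import Order.TTheory GRing.Theory Num.Theory.
Import numFieldNormedType.Exports.

Local Open Scope classical_set_scope.
Local Open Scope ring_scope.
Local Open Scope complex_scope.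

(** Let mu_st(y) = y + sum_i (f_i(y) dX_st g_i(y) + X_st[df_i(y).W] g_i(y) +
    f_i(y) X*_st[dg_i(y).W]), with W = sum_i f_i(y) (x) g_i(y), be one step of
    the Euler scheme corrected by the area.  Since f_i(y) and df_i(y) are
    integrals of exponentials of y, their increments and second differences are
    controlled, and mu is an almost flow on self-adjoint elements: the defect
    mu_ut(mu_su(y)) - mu_st(y) is of order 3 gam > 1 in t - s, and so is its
    Lipschitz constant.  A discrete sewing argument then makes the compositions
    of mu along partitions uniformly Lipschitz and convergent.  A process solves
    the equation if and only if |Y_t - mu_st(Y_s)| = O(|t - s|^(3 gam)), and such
    a process exists and is unique given Y_0, which is Davie's approach to rough
    equations.  The local estimate holds on intervals whose length is polynomial
    in the inverse of the norms of the data; chaining it gives the bound. *)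

(** Compositions of steps must be Lipschitz with a constant that does not depend on their number.
    This forces a Lipschitz bound on the defect of two steps, hence bounds on second differences of
    f_i and of df_i and on differences of Taylor remainders; these cost a third power of xi, which
    is where F_3 is spent. Power series would give estimates growing exponentially in xi. They are
    avoided because exponentials of self-adjoint elements have norm at most 1, so that xi can be cut
    into N + 1 steps and N sent to infinity. The norm bound rests on the reality of the spectrum and
    on spectral mapping, both derived from the representation on a Hilbert space. The spaces A_s (x)
    A_s for different s are related only by canonical maps, and operations on them are chosen
    extensions; identities are checked on elementary tensors and carried over by density. The
    additive sewing map is obtained as nonlinear sewing for a flow of translations. All constants
    are powers of one number [B], with generous exponents, since only polynomial growth matters. *)

(** * Real norms, limits and linear identities *)

(* A decision procedure for linear identities in abelian groups: an expression
   is determined by its integer coefficients. *)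
Inductive zexpr := ZVar of nat | ZZero | ZAdd of zexpr & zexpr | ZOpp of zexpr.

Fixpoint zeval (V : zmodType) (env : seq V) (e : zexpr) : V :=
  match e with
  | ZVar n => nth 0 env n
  | ZZero => 0
  | ZAdd a b => zeval env a + zeval env b
  | ZOpp a => - zeval env a
  end.

Fixpoint zcoef (e : zexpr) (n : nat) : int :=
  match e with
  | ZVar k => if k == n then 1 else 0
  | ZZero => 0
  | ZAdd a b => zcoef a n + zcoef b n
  | ZOpp a => - zcoef a n
  end.

Lemma zeval_coef (V : zmodType) (env : seq V) (e : zexpr) :
  zeval env e = \sum_(i < size env) nth 0 env i *~ zcoef e i.
Proof.
elim: e => [k||a ha b hb|a ha] /=; rewrite ?ha ?hb.
- have [h|h] := ltnP k (size env).
    rewrite (bigD1 (Ordinal h)) //= eqxx mulr1z big1 ?addr0// => i.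
    by rewrite -val_eqE /= eq_sym => /negbTE ->; rewrite mulr0z.
  rewrite nth_default// big1// => i _; case: eqP => [ki|]; last by rewrite mulr0z.
  by move: h; rewrite ki leqNgt ltn_ord.
- by rewrite big1// => i _; rewrite mulr0z.
- by rewrite -big_split; apply: eq_bigr => i _; rewrite mulrzDr.
- by rewrite -sumrN; apply: eq_bigr => i _; rewrite mulrNz.
Qed.

Lemma zeval_eq (V : zmodType) (env : seq V) (e1 e2 : zexpr) :
  all (fun i => zcoef e1 i == zcoef e2 i) (iota 0 (size env)) ->
  zeval env e1 = zeval env e2.
Proof.
move=> /allP h; rewrite !zeval_coef; apply: eq_bigr => i _.
by rewrite (eqP (h i _))// mem_iota ltn_ord.
Qed.

(** Multiples of one vector may carry convertible but distinct module structures, so these atoms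
    alone are compared up to unification. *)
Ltac zmod_same x y :=
  lazymatch constr:((x, y)) with
  | (?z, ?z) => idtac
  | (@GRing.scale _ _ ?c ?v, @GRing.scale _ _ ?d ?v) => unify c d; unify x y
  end.
Ltac zmod_index x env :=
  lazymatch env with
  | ?y :: ?l =>
    match constr:(tt) with
    | _ => let _ := match constr:(tt) with _ => zmod_same x y end in constr:(0%N)
    | _ => let n := zmod_index x l in constr:(S n)
    end
  end.
Ltac zmod_vars t env :=
  lazymatch t with
  | (?a + ?b)%R => let env' := zmod_vars a env in zmod_vars b env'
  | (- ?a)%R => zmod_vars a env
  | 0%R => env
  | _ => match constr:(tt) with
         | _ => let _ := zmod_index t env in env
         | _ => constr:(t :: env)
         end
  end.
Ltac zmod_reify t env :=
  lazymatch t with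
  | (?a + ?b)%R => let a' := zmod_reify a env in let b' := zmod_reify b env in constr:(ZAdd a' b')
  | (- ?a)%R => let a' := zmod_reify a env in constr:(ZOpp a')
  | 0%R => constr:(ZZero)
  | _ => let n := zmod_index t env in constr:(ZVar n)
  end.
Ltac zmod :=
  lazymatch goal with
  | |- @eq ?T ?a ?b =>
    let env := zmod_vars a (@nil T) in
    let env := zmod_vars b env in
    let a' := zmod_reify a env in
    let b' := zmod_reify b env in
    refine (@zeval_eq _ env a' b' _); vm_compute; reflexivity
  end.

Section RealNorm.
Context (R : realType).
Implicit Types (V : normedModType R[i]).

Lemma RCD (x y : R) : (x + y)%:C = x%:C + y%:C :> R[i]. Proof. exact: rmorphD. Qed.
Lemma RCB (x y : R) : (x - y)%:C = x%:C - y%:C :> R[i]. Proof. exact: rmorphB. Qed.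
Lemma RCN (x : R) : (- x)%:C = - x%:C :> R[i]. Proof. exact: rmorphN. Qed.
Lemma RCM (x y : R) : (x * y)%:C = x%:C * y%:C :> R[i]. Proof. exact: rmorphM. Qed.
Lemma RCV (x : R) : (x^-1)%:C = x%:C^-1 :> R[i]. Proof. exact: fmorphV. Qed.
Lemma RCX (x : R) n : (x ^+ n)%:C = x%:C ^+ n :> R[i]. Proof. exact: rmorphXn. Qed.
Lemma RC_nat n : (n%:R)%:C = n%:R :> R[i]. Proof. exact: rmorph_nat. Qed.

Lemma CJN (x : R[i]) : conjc (- x) = - conjc x. Proof. exact: rmorphN. Qed.
Lemma CJM (x y : R[i]) : conjc (x * y) = conjc x * conjc y. Proof. exact: rmorphM. Qed.
Lemma CJV (x : R[i]) : conjc x^-1 = (conjc x)^-1. Proof. exact: fmorphV. Qed.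
Lemma CJR (x : R) : conjc x%:C = x%:C. Proof. exact: conjc_real. Qed.
Lemma CJI : conjc 'i = - 'i :> R[i].
Proof. by rewrite /conjc; apply/eqP; rewrite eq_complex /= oppr0 !eqxx. Qed.
Lemma II : 'i * 'i = -1 :> R[i].
Proof. by apply/eqP; rewrite eq_complex /=; apply/andP; split; apply/eqP; ring. Qed.

Lemma rnorm_ge0 V (x : V) : 0 <= rnorm x.
Proof. by rewrite /rnorm; have := normr_ge0 x; rewrite lecE /= => /andP[]. Qed.

Lemma rnormE V (x : V) : `|x| = (rnorm x)%:C.
Proof.
rewrite /rnorm; have := normr_ge0 x; rewrite lecE /= => /andP[/eqP].
by case: `|x| => a b /= ->.
Qed.

Lemma rnorm0 V : rnorm (0 : V) = 0. Proof. by rewrite /rnorm normr0. Qed.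

Lemma rnormN V (x : V) : rnorm (- x) = rnorm x.
Proof. by rewrite /rnorm normrN. Qed.

Lemma rnormB V (x y : V) : rnorm (x - y) = rnorm (y - x).
Proof. by rewrite -rnormN opprB. Qed.

Lemma rnorm_lecP V (x : V) (e : R) : (`|x| <= e%:C) = (rnorm x <= e).
Proof. by rewrite rnormE lecR. Qed.

Lemma rnormD V (x y : V) : rnorm (x + y) <= rnorm x + rnorm y.
Proof. by have := ler_normD x y; rewrite !rnormE -rmorphD lecR. Qed.

Lemma rnormDB V (x y : V) : rnorm (x - y) <= rnorm x + rnorm y.
Proof. by rewrite -(rnormN y); exact: rnormD. Qed.

Lemma rnorm_dist V (x y z : V) : rnorm (x - z) <= rnorm (x - y) + rnorm (y - z).
Proof. by apply: le_trans (rnormD _ _); rewrite addrA subrK. Qed.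

Lemma rnorm_eq0 V (x : V) : rnorm x = 0 -> x = 0.
Proof. by move=> h; apply/eqP; rewrite -normr_eq0 rnormE h. Qed.

Lemma rnorm_eq0P V (x : V) : (rnorm x <= 0) -> x = 0.
Proof. by move=> h; apply: rnorm_eq0; apply/le_anti; rewrite h rnorm_ge0. Qed.

Definition cabs (c : R[i]) : R := complex.Re `|c|.

Lemma cabsE c : `|c| = (cabs c)%:C.
Proof. by rewrite /cabs normc_def. Qed.

Lemma cabs_ge0 c : 0 <= cabs c.
Proof. by have := normr_ge0 c; rewrite cabsE lecR. Qed.

Lemma cabsM c d : cabs (c * d) = cabs c * cabs d.
Proof. by apply: complexI; rewrite -cabsE normrM !cabsE -rmorphM. Qed.

Lemma cabsD c d : cabs (c + d) <= cabs c + cabs d.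
Proof. by have := ler_normD c d; rewrite !cabsE -rmorphD lecR. Qed.

Lemma cabsR (x : R) : cabs x%:C = `|x|.
Proof. by apply: complexI; rewrite -cabsE normc_def /= expr0n addr0 sqrtr_sqr. Qed.

Lemma cabsi : cabs 'i = 1.
Proof. by rewrite /cabs normc_def /= expr0n expr1n add0r sqrtr1. Qed.

Lemma cabs_Re c : `|complex.Re c| <= cabs c.
Proof. by rewrite -lecR -cabsE; exact: normc_ge_Re. Qed.

Lemma cabs_Im c : `|complex.Im c| <= cabs c.
Proof. by rewrite /cabs normc_def /= -sqrtr_sqr ler_wsqrtr// lerDr sqr_ge0. Qed.

Lemma cabs_le_ReIm c : cabs c <= `|complex.Re c| + `|complex.Im c|.
Proof.
case: c => a b; have e : a +i* b = a%:C + 'i * b%:C.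
  by apply/eqP; rewrite eq_complex /= !mul0r !mul1r !subr0 ?mul0r ?mulr0 ?addr0 ?add0r !eqxx.
by rewrite {1}e (le_trans (cabsD _ _))// cabsM cabsi !cabsR mul1r.
Qed.

Lemma rnormZ V (c : R[i]) (x : V) : rnorm (c *: x) = cabs c * rnorm x.
Proof. by apply: complexI; rewrite -rnormE normrZ rnormE cabsE -rmorphM. Qed.

Lemma rnormZR V (c : R) (x : V) : rnorm (c%:C *: x) = `|c| * rnorm x.
Proof. by rewrite rnormZ cabsR. Qed.

Lemma rnorm_sum V (I : Type) (r : seq I) (P : pred I) (F : I -> V) :
  rnorm (\sum_(i <- r | P i) F i) <= \sum_(i <- r | P i) rnorm (F i).
Proof.
elim/big_rec2: _ => [|i y x _ h]; first by rewrite rnorm0.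
by apply: le_trans (rnormD _ _) _; rewrite lerD2l.
Qed.

(* Instances of the module laws whose two sides carry the structure found by
   elaboration, as [zmod] compares atoms syntactically. *)
Lemma cscalerDr (V : completeNormedModType R[i]) (c : R[i]) (x y : V) :
  c *: (x + y) = c *: x + c *: y.
Proof. exact: scalerDr. Qed.

Lemma cscalerBr (V : completeNormedModType R[i]) (c : R[i]) (x y : V) :
  c *: (x - y) = c *: x - c *: y.
Proof. exact: scalerBr. Qed.

Lemma ler_eps (x y : R) : (forall e, 0 < e -> x <= y + e) -> x <= y.
Proof.
move=> h; rewrite leNgt; apply/negP => yx.
have := h ((x - y) / 2%:R); rewrite divr_gt0 ?subr_gt0// => /(_ isT); lra.
Qed.

Lemma rnorm_eps V (x : V) : (forall e, 0 < e -> rnorm x <= e) -> x = 0.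
Proof. by move=> h; apply: rnorm_eq0P; apply: ler_eps => e /h; rewrite add0r. Qed.

Lemma lecR_gt0 (e : R[i]) : 0 < e -> exists2 r : R, 0 < r & e = r%:C.
Proof.
case: e => a b; rewrite ltcE /= => /andP[/eqP b0 a0]; exists a => //.
by apply/eqP; rewrite eq_complex /= eqxx b0 eqxx.
Qed.

(** Only an upper bound is asked for: these sequences always majorise norms. *)
Definition to0 (e : nat -> R) := forall d, 0 < d -> exists N, forall n, (N <= n)%N -> e n <= d.

Lemma cvg_rnormP V (u : nat -> V) (l : V) :
  u @ \oo --> l <->
  forall e, 0 < e -> exists N, forall n, (N <= n)%N -> rnorm (u n - l) <= e.
Proof.
split=> [ul e e0|h].
  have e0' : 0 < e%:C :> R[i] by rewrite ltcR.
  move/cvgrPdist_le : ul => /(_ _ e0')[N _ hN]; exists N => n Nn.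
  by have := hN n Nn; rewrite /= rnorm_lecP rnormB.
apply/cvgrPdist_le => e /lecR_gt0[r r0 ->]; have [N hN] := h r r0.
by exists N => // n /hN; rewrite rnorm_lecP rnormB.
Qed.

Lemma cvg_to0 V (u : nat -> V) (l : V) (e : nat -> R) :
  (forall n, rnorm (u n - l) <= e n) -> to0 e -> u @ \oo --> l.
Proof.
move=> h he; apply/cvg_rnormP => d /he[N hN]; exists N => n /hN; exact: le_trans.
Qed.

(** The rate [e] survives in the limit, so later approximations come with explicit errors instead of
    mere convergence. *)
Lemma cauchy_limit (V : completeNormedModType R[i]) (u : nat -> V) (e : nat -> R) :
  to0 e -> (forall n m, (n <= m)%N -> rnorm (u m - u n) <= e n) ->
  exists l, forall n, rnorm (u n - l) <= e n.
Proof.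
move=> he hu.
have cu : cvg (u @ \oo).
  apply: cauchy_cvg; apply/cauchy_ballP => d /lecR_gt0[r r0 ->].
  have [N hN] := he (r / 3%:R) ltac:(by rewrite divr_gt0).
  exists (u @` [set n | (N <= n)%N], u @` [set n | (N <= n)%N]).
    by split; exists N => // n Nn; exists n.
  move=> [_ _] /= [[n Nn <-] [m Nm <-]]; rewrite -ball_normE /=.
  rewrite rnormE ltcR (le_lt_trans (rnorm_dist _ (u N) _))// (rnormB (u N)).
  have := hu _ _ Nn; have := hu _ _ Nm; have := hN N (leqnn _); lra.
have /cvg_rnormP hl : u @ \oo --> limn u by [].
exists (limn u) => n; apply: ler_eps => d d0.
have [N hN] := hl d d0; rewrite rnormB.
apply: le_trans (rnorm_dist _ (u (maxn N n)) _) _.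
rewrite rnormB addrC; apply: lerD; last by apply: hN; exact: leq_maxl.
by apply: hu; exact: leq_maxr.
Qed.

Lemma closed_approx V (B : set V) (x : V) : closed B ->
  (forall e : R, 0 < e -> exists2 b, B b & rnorm (x - b) <= e) -> B x.
Proof.
move=> cB h; apply: cB => U /nbhs_ballP[e /= /lecR_gt0[r r0 ->]] hU.
have [b Bb xb] := h (r / 2%:R) ltac:(by rewrite divr_gt0).
exists b; split => //; apply: hU; rewrite -ball_normE /= rnormE ltcR.
by apply: le_lt_trans xb _; lra.
Qed.

Lemma continuous_rnormP V (W : normedModType R[i]) (L : V -> W) : continuous L <->
  forall x e, 0 < e -> exists2 d, 0 < d &
    forall y, rnorm (x - y) <= d -> rnorm (L x - L y) <= e.
Proof.
split=> [cL x e e0|h x].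
  have e0' : 0 < e%:C :> R[i] by rewrite ltcR.
  have /cvgrPdist_le/(_ _ e0') := cL x; rewrite -filter_from_ballE /=.
  move=> [d /= /lecR_gt0[r r0 ->] hd]; exists (r / 2%:R); first by rewrite divr_gt0.
  move=> y xy; rewrite -rnorm_lecP; apply: hd; rewrite /= -ball_normE /= rnormE ltcR.
  by apply: le_lt_trans xy _; lra.
apply/cvgrPdist_le => e /lecR_gt0[r r0 ->]; have [d d0 hd] := h x r r0.
apply/nbhs_ballP; exists d%:C => /=; first by rewrite ltcR.
move=> y; rewrite -ball_normE /= rnormE ltcR => /ltW/hd.
by rewrite rnorm_lecP.
Qed.

Lemma lipschitz_continuous V (W : normedModType R[i]) (L : V -> W) (M : R) :
  (forall x y, rnorm (L x - L y) <= M * rnorm (x - y)) -> continuous L.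
Proof.
move=> h; apply/continuous_rnormP => x e e0; exists (e / (`|M| + 1)).
  by rewrite divr_gt0// ltr_wpDl.
move=> y; rewrite ler_pdivlMr ?ltr_wpDl// => hy.
apply: le_trans (h _ _) _; apply: le_trans hy; rewrite mulrC ler_wpM2l ?rnorm_ge0//.
by have := ler_norm M; lra.
Qed.

(** Transports completeness along an isometry whose range contains its limit points; it serves for
    closed subspaces and for conjugate modules. *)
Lemma complete_embedding (E : completeNormedModType R[i]) (W : normedModType R[i])
    (h : W -> E) :
  (forall x y, rnorm (h x - h y) = rnorm (x - y)) ->
  (forall y, (forall e, 0 < e -> exists x, rnorm (y - h x) <= e) ->
    exists x, h x = y) ->
  forall F : set_system W, ProperFilter F -> cauchy F -> cvg F.
Proof.
move=> hh hc F FF /cauchy_ballP cF.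
have chF : cauchy (h @ F).
  apply/cauchy_ballP => e e0; have := cF e e0.
  move=> [[A B] [FA FB] AB]; exists (h @` A, h @` B).
    split; rewrite /nbhs /=; [apply: filterS FA|apply: filterS FB] => x Ax;
      by exists x.
  move=> [_ _] /= [[x Ax <-] [y By <-]]; have /= := AB (x, y) (conj Ax By).
  by rewrite -!ball_normE /= !rnormE hh.
have /cvg_ex[l hl] : cvg (h @ F) by exact: cauchy_cvg.
have [x xl] : exists x, h x = l.
  apply: hc => e e0; have e0' : 0 < e%:C :> R[i] by rewrite ltcR.
  move/cvgrPdist_le : hl => /(_ _ e0') /= /filter_ex[x].
  by rewrite rnorm_lecP => ?; exists x.
apply/cvg_ex; exists x; apply/cvgrPdist_le => e e0.
move/cvgrPdist_le : hl => /(_ e e0) /=; apply: filterS => y.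
by rewrite -xl !rnormE hh.
Qed.

End RealNorm.

(** * Closed subspaces and conjugate modules *)

Section SubspaceModule.
Context (R : realType) (V : completeNormedModType R[i]) (S : linSubspace V).

(** Boolean membership makes the membership proofs irrelevant, so two elements are equal as soon as
    their values are. *)
Definition sub_car : Type := {x : V | `[< S x >]}.

Definition sub_val (x : sub_car) : V := sval x.

HB.instance Definition _ := gen_eqMixin sub_car.
HB.instance Definition _ := gen_choiceMixin sub_car.

Lemma sub_valP (x : sub_car) : S (sub_val x).
Proof. by case: x => x h; exact/asboolP. Qed.

Definition sub_mk (x : V) (h : S x) : sub_car := exist _ x (introT (asboolP _) h).

Lemma sub_val_inj (x y : sub_car) : sub_val x = sub_val y -> x = y.
Proof.
case: x y => x hx [y hy]; rewrite /sub_val /= => e; subst y.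
by congr exist; exact: Prop_irrelevance.
Qed.

Lemma subspaceD (x y : V) : S x -> S y -> S (x + y).
Proof. by move=> hx hy; rewrite -[x]scale1r; exact: subspace_lin. Qed.

Lemma subspaceZ (c : R[i]) (x : V) : S x -> S (c *: x).
Proof. by move=> hx; rewrite -[c *: x]addr0; exact/subspace_lin/subspace0. Qed.

Lemma subspaceN (x : V) : S x -> S (- x).
Proof. by rewrite -scaleN1r; exact: subspaceZ. Qed.

Lemma subspaceB (x y : V) : S x -> S y -> S (x - y).
Proof. by move=> hx /subspaceN; exact: subspaceD. Qed.

Lemma subspace_sum (I : Type) (r : seq I) (P : pred I) (F : I -> V) :
  (forall i, P i -> S (F i)) -> S (\sum_(i <- r | P i) F i).
Proof. by move=> h; apply: big_ind => //; [exact: subspace0|exact: subspaceD]. Qed.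

Let sadd (x y : sub_car) := sub_mk (subspaceD (sub_valP x) (sub_valP y)).
Let sopp (x : sub_car) := sub_mk (subspaceN (sub_valP x)).
Let sscale (c : R[i]) (x : sub_car) := sub_mk (subspaceZ c (sub_valP x)).
Let szero := sub_mk (subspace0 S).

Let saddA : associative sadd.
Proof. by move=> x y z; apply: sub_val_inj; exact: addrA. Qed.
Let saddC : commutative sadd.
Proof. by move=> x y; apply: sub_val_inj; exact: addrC. Qed.
Let sadd0 : left_id szero sadd.
Proof. by move=> x; apply: sub_val_inj; exact: add0r. Qed.
Let saddN : left_inverse szero sopp sadd.
Proof. by move=> x; apply: sub_val_inj; exact: addNr. Qed.

HB.instance Definition _ := GRing.isZmodule.Build sub_car saddA saddC sadd0 saddN.

Let sscaleA a b (v : sub_car) : sscale a (sscale b v) = sscale (a * b) v.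
Proof. by apply: sub_val_inj; exact: scalerA. Qed.
Let sscale1 : left_id 1 sscale.
Proof. by move=> x; apply: sub_val_inj; exact: scale1r. Qed.
Let sscaleDr : right_distributive sscale +%R.
Proof. by move=> a x y; apply: sub_val_inj; exact: scalerDr. Qed.
Let sscaleDl v : {morph sscale^~ v : a b / a + b}.
Proof. by move=> a b; apply: sub_val_inj; exact: scalerDl. Qed.

HB.instance Definition _ :=
  GRing.Zmodule_isLmodule.Build R[i] sub_car sscaleA sscale1 sscaleDr sscaleDl.

Let snorm (x : sub_car) : R[i] := `|sub_val x|.
Let snormD (x y : sub_car) : snorm (x + y) <= snorm x + snorm y.
Proof. exact: ler_normD. Qed.
Let snormZ (l : R[i]) (x : sub_car) : snorm (l *: x) = `|l| * snorm x.
Proof. exact: normrZ. Qed.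
Let snorm0 (x : sub_car) : snorm x = 0 -> x = 0.
Proof. by move=> h; apply: sub_val_inj; exact: normr0_eq0. Qed.

HB.instance Definition _ := Lmodule_isNormed.Build R[i] sub_car snormD snormZ snorm0.

Lemma sub_norm (x : sub_car) : rnorm x = rnorm (sub_val x).
Proof. by []. Qed.

End SubspaceModule.

Section ClosedSubspace.
Context (R : realType) (V : completeNormedModType R[i]) (S : linSubspace V).

(** The closedness proof is a parameter of the type so that the completeness instance can be
    attached to it. *)
Definition csub (cS : closed [set x | S x]) : Type := sub_car S.
Context (cS : closed [set x | S x]).

HB.instance Definition _ := NormedModule.on (csub cS).

Let csub_complete (F : set_system (csub cS)) : ProperFilter F -> cauchy F -> cvg F.
Proof.
apply: (complete_embedding (h := fun x : csub cS => sub_val x)).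
  by move=> x y; rewrite /rnorm.
move=> y hy; have Sy : S y.
  apply: (closed_approx cS) => e /hy[x xe]; exists (sub_val x) => //.
  exact: sub_valP.
by exists (sub_mk Sy).
Qed.

HB.instance Definition _ := Uniform_isComplete.Build (csub cS) csub_complete.

End ClosedSubspace.

Section ConjugateModule.
Context (R : realType) (V : completeNormedModType R[i]).

(** An antilinear map into [V] is linear into this module; the universal property of the tensor
    products then applies to the involution. *)
Definition conj_car : Type := V.

HB.instance Definition _ := GRing.Zmodule.on conj_car.

Let cscale (c : R[i]) (x : conj_car) : conj_car := conjc c *: (x : V).
Let cscaleA a b (v : conj_car) : cscale a (cscale b v) = cscale (a * b) v.
Proof. by rewrite /cscale scalerA rmorphM. Qed.
Let cscale1 : left_id 1 cscale.
Proof. by move=> x; rewrite /cscale rmorph1 scale1r. Qed.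
Let cscaleDr : right_distributive cscale +%R.
Proof. by move=> a x y; rewrite /cscale scalerDr. Qed.
Let cscaleDl v : {morph cscale^~ v : a b / a + b}.
Proof. by move=> a b; rewrite /cscale rmorphD scalerDl. Qed.

HB.instance Definition _ :=
  GRing.Zmodule_isLmodule.Build R[i] conj_car cscaleA cscale1 cscaleDr cscaleDl.

Let cnorm (x : conj_car) : R[i] := `|(x : V)|.
Let cnormD (x y : conj_car) : cnorm (x + y) <= cnorm x + cnorm y.
Proof. exact: ler_normD. Qed.
Let cnormZ (l : R[i]) (x : conj_car) : cnorm (l *: x) = `|l| * cnorm x.
Proof. by rewrite /cnorm /GRing.scale /= normrZ norm_conjC. Qed.
Let cnorm0 (x : conj_car) : cnorm x = 0 -> x = 0.
Proof. exact: normr0_eq0. Qed.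

HB.instance Definition _ := Lmodule_isNormed.Build R[i] conj_car cnormD cnormZ cnorm0.

Let conj_complete (F : set_system conj_car) : ProperFilter F -> cauchy F -> cvg F.
Proof.
apply: (complete_embedding (h := fun x : conj_car => (x : V))).
  by move=> x y; rewrite /rnorm.
move=> y _; by exists y.
Qed.

HB.instance Definition _ := Uniform_isComplete.Build conj_car conj_complete.

Lemma conj_scaleE (c : R[i]) (x : conj_car) : c *: x = (conjc c *: (x : V) : V).
Proof. by []. Qed.

End ConjugateModule.

(** * Density of elementary tensors *)

Section Tensor2.
Context (R : realType) (V : completeNormedModType R[i]) (S : linSubspace V).
Context (E : ptensor2 S).

Lemma bounded_linearD (E1 F1 : completeNormedModType R[i]) (M : R) (L : E1 -> F1) :
  bounded_linear M L -> forall x y, L (x + y) = L x + L y.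
Proof. by move=> [h _] x y; have := h 1 x y; rewrite !scale1r. Qed.

Lemma bounded_linear0 (E1 F1 : completeNormedModType R[i]) (M : R) (L : E1 -> F1) :
  bounded_linear M L -> L 0 = 0.
Proof.
by move=> /bounded_linearD h; apply: (addrI (L 0)); rewrite -h !addr0.
Qed.

Lemma bounded_linearZ (E1 F1 : completeNormedModType R[i]) (M : R) (L : E1 -> F1) :
  bounded_linear M L -> forall (c : R[i]) x, L (c *: x) = c *: L x.
Proof.
by move=> h c x; have := h.1 c x 0; rewrite (bounded_linear0 h) !addr0.
Qed.

Lemma bounded_linear_rnorm (E1 F1 : completeNormedModType R[i]) (M : R) (L : E1 -> F1) :
  bounded_linear M L -> forall x, rnorm (L x) <= M * rnorm x.
Proof. by move=> [_ h] x; have := h x; rewrite !rnormE -rmorphM lecR. Qed.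

Lemma rnorm_bounded_linear (E1 F1 : completeNormedModType R[i]) (M : R) (L : E1 -> F1) :
  (forall (c : R[i]) x y, L (c *: x + y) = c *: L x + L y) ->
  (forall x, rnorm (L x) <= M * rnorm x) -> bounded_linear M L.
Proof. by move=> h1 h2; split=> // x; rewrite !rnormE -rmorphM lecR. Qed.

Lemma additive0 (E1 F1 : zmodType) (L : E1 -> F1) :
  (forall x y, L (x + y) = L x + L y) -> L 0 = 0.
Proof. by move=> h; apply: (addrI (L 0)); rewrite -h !addr0. Qed.

Lemma additiveN (E1 F1 : zmodType) (L : E1 -> F1) :
  (forall x y, L (x + y) = L x + L y) -> forall x, L (- x) = - L x.
Proof.
by move=> h x; apply: (addrI (L x)); rewrite -h !subrr; exact: additive0.
Qed.

Lemma additiveB (E1 F1 : zmodType) (L : E1 -> F1) :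
  (forall x y, L (x + y) = L x + L y) -> forall x y, L (x - y) = L x - L y.
Proof. by move=> h x y; rewrite h additiveN. Qed.

Lemma bounded_additive_continuous (E1 F1 : completeNormedModType R[i]) (M : R) (L : E1 -> F1) :
  (forall x y, L (x + y) = L x + L y) -> (forall x, rnorm (L x) <= M * rnorm x) ->
  continuous L.
Proof. by move=> h1 h2; apply: (@lipschitz_continuous _ _ _ _ M) => x y; rewrite -additiveB. Qed.

(** The universal property with target the closed subspace D gives a map into D. Followed by the
    inclusion, it extends the elementary tensors, as the identity does, so by uniqueness it is the
    identity and every element lies in D. *)
Lemma dense2 (D : linSubspace E) : closed [set x | D x] ->
  (forall u v, S u -> S v -> D (tens2 E u v)) -> forall x, D x.
Proof.
move=> cD hD.
pose b (u v : V) : csub cD := match pselect (S u /\ S v) with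
  | left h => sub_mk (hD u v h.1 h.2) | right _ => 0 end.
have bE u v : S u -> S v -> sub_val (b u v) = tens2 E u v.
  by move=> hu hv; rewrite /b; case: pselect => // -[]; split.
have [L [hL Lb _]] : exists L : E -> csub cD,
    [/\ bounded_linear 1 L, forall x y, S x -> S y -> L (tens2 E x y) = b x y &
     forall M' (L' : E -> csub cD), bounded_linear M' L' ->
            (forall x y, S x -> S y -> L' (tens2 E x y) = b x y) -> L' = L].
  apply: tens2_universal => //.
    move=> c x y z hx hy hz; have hxy : S (c *: x + y) by exact: subspace_lin.
    have [h1 h2] := tens2_bilinear E c hx hy hz.
    by split; apply: sub_val_inj; rewrite bE//= ?h1 ?h2 /sub_val/=;
       congr (_ *: _ + _); rewrite -bE.
  move=> x y hx hy; rewrite mul1r.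
  by have := tens2_norm E hx hy; rewrite -bE.
have [L0 [_ _ hu]] := tens2_universal E ler01
  (tens2_bilinear E) ltac:(by move=> x y hx hy; rewrite mul1r; exact: tens2_norm).
have e1 : id = L0.
  by apply: (hu 1) => //; split => // x; rewrite mul1r.
have e2 : (fun x => sub_val (L x)) = L0.
  apply: (hu 1) => [|x y hx hy]; last by rewrite Lb// bE.
  by split => [c x y|x]; [rewrite hL.1|exact: (hL.2 x)].
by move=> x; rewrite -[x]/(id x) e1 -e2; exact: sub_valP.
Qed.

Lemma agree_continuous (E1 F1 : completeNormedModType R[i]) (L1 L2 : E1 -> F1) x :
  continuous L1 -> continuous L2 ->
  (forall e, 0 < e -> exists2 y, L1 y = L2 y & rnorm (x - y) <= e) -> L1 x = L2 x.
Proof.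
move=> /continuous_rnormP h1 /continuous_rnormP h2 h.
apply/eqP; rewrite -subr_eq0; apply/eqP; apply: rnorm_eps => e e0.
have e2 : 0 < e / 2%:R by rewrite divr_gt0.
have [d1 d10 hd1] := h1 x _ e2; have [d2 d20 hd2] := h2 x _ e2.
have m0 : 0 < Num.min d1 d2 by rewrite lt_min d10 d20.
have [y yE] := h _ m0; rewrite le_min => /andP[/hd1 k1 /hd2 k2].
apply: le_trans (rnorm_dist _ (L1 y) _) _; rewrite {2}yE (rnormB (L2 y)); lra.
Qed.

(** The maps are only additive, so the set where they agree need not be a complex subspace; asking
    for agreement on all multiples of x makes it one. *)
Lemma uniq2 (F : completeNormedModType R[i]) (L1 L2 : E -> F) :
  (forall x y, L1 (x + y) = L1 x + L1 y) -> continuous L1 ->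
  (forall x y, L2 (x + y) = L2 x + L2 y) -> continuous L2 ->
  (forall u v, S u -> S v -> L1 (tens2 E u v) = L2 (tens2 E u v)) -> L1 = L2.
Proof.
move=> a1 c1 a2 c2 h.
pose D x := forall c : R[i], L1 (c *: x) = L2 (c *: x).
have D0 : D 0 by move=> c; rewrite scaler0 !additive0.
have Dl c x y : D x -> D y -> D (c *: x + y).
  by move=> hx hy d; rewrite scalerDr scalerA a1 a2 hx hy.
apply/funext => x; rewrite -[x]scale1r.
apply: (dense2 (D := LinSubspace D0 Dl)) => [|u v hu hv c].
  move=> /= y hy c; apply: (agree_continuous (L1 := L1) (L2 := L2)) => //.
  move=> e e0; have d0 : 0 < e / (cabs c + 1) by rewrite divr_gt0// ltr_wpDl ?cabs_ge0.
  have : 0 < (e / (cabs c + 1))%:C :> R[i] by rewrite ltcR.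
  move=> d0'; have [z [zD]] := hy _ (nbhsx_ballx y _ d0').
  rewrite -ball_normE /= rnormE ltcR => hz; exists (c *: z); first exact: zD.
  rewrite -scalerBr rnormZ; move: (ltW hz); rewrite ler_pdivlMr ?ltr_wpDl ?cabs_ge0//.
  apply: le_trans; rewrite mulrC ler_wpM2l ?rnorm_ge0//; lra.
(* Bilinearity with second vector 0 moves the scalar into the first factor: a multiple of an
   elementary tensor is elementary. *)
have := (tens2_bilinear E c hu (subspace0 S) hv).1.
have := (tens2_bilinear E 1 hu (subspace0 S) hv).1.
rewrite !scale1r !addr0 => /esym/(canRL (addKr _)); rewrite addNr => ->.
by rewrite addr0 => <-; apply: h => //; exact: subspaceZ.
Qed.

Lemma extend2_eq (F : completeNormedModType R[i]) (b : V -> V -> F) (L : E -> F) (M : R) :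
  (forall x y, L (x + y) = L x + L y) -> (forall x, rnorm (L x) <= M * rnorm x) ->
  (forall u v, S u -> S v -> L (tens2 E u v) = b u v) -> extend2 b = L.
Proof.
move=> h1 h2 h3; have cL : continuous L by exact: bounded_additive_continuous h1 h2.
rewrite /extend2; case: xgetP => [L' _ [a1 c1 t1]|/(_ L) []//].
by apply: uniq2 => // u v hu hv; rewrite t1// h3.
Qed.

Lemma extend2P (F : completeNormedModType R[i]) (b : V -> V -> F) (M : R) :
  0 <= M -> bilinear_on S b ->
  (forall x y, S x -> S y -> rnorm (b x y) <= M * (rnorm x * rnorm y)) ->
  bounded_linear M (extend2 (E := E) b) /\
  forall u v, S u -> S v -> extend2 (E := E) b (tens2 E u v) = b u v.
Proof.
move=> M0 hb hM.
have [|L [hL hLb _]] := tens2_universal E M0 hb.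
  by move=> x y hx hy; rewrite !rnormE -!rmorphM lecR hM.
have e : extend2 (E := E) b = L.
  apply: (@extend2_eq _ _ _ M) => //; first exact: bounded_linearD hL.
  exact: bounded_linear_rnorm.
by rewrite e.
Qed.

Lemma tens2_rnorm u v : S u -> S v -> rnorm (tens2 E u v) <= rnorm u * rnorm v.
Proof. by move=> hu hv; have := tens2_norm E hu hv; rewrite !rnormE -rmorphM lecR. Qed.

Lemma bilinearDl (F : completeNormedModType R[i]) (b : V -> V -> F) x y z :
  bilinear_on S b -> S x -> S y -> S z -> b (x + y) z = b x z + b y z.
Proof. by move=> h hx hy hz; have [+ _] := h 1 _ _ _ hx hy hz; rewrite !scale1r. Qed.

Lemma bilinearDr (F : completeNormedModType R[i]) (b : V -> V -> F) x y z :
  bilinear_on S b -> S x -> S y -> S z -> b z (x + y) = b z x + b z y.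
Proof. by move=> h hx hy hz; have [_] := h 1 _ _ _ hx hy hz; rewrite !scale1r. Qed.

Lemma bilinearBl (F : completeNormedModType R[i]) (b : V -> V -> F) x y z :
  bilinear_on S b -> S x -> S y -> S z -> b (x - y) z = b x z - b y z.
Proof.
move=> h hx hy hz; apply: (addIr (b y z)); rewrite subrK -(bilinearDl h)// ?subrK//.
exact: subspaceB.
Qed.

Lemma bilinearBr (F : completeNormedModType R[i]) (b : V -> V -> F) x y z :
  bilinear_on S b -> S x -> S y -> S z -> b z (x - y) = b z x - b z y.
Proof.
move=> h hx hy hz; apply: (addIr (b z y)); rewrite subrK -(bilinearDr h)// ?subrK//.
exact: subspaceB.
Qed.

End Tensor2.

Section Tensor3.
Context (R : realType) (V : completeNormedModType R[i]) (S : linSubspace V).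
Context (E : ptensor3 S).

(** As for two factors: factor the universal map through the closed subspace and compare it with the
    identity. *)
Lemma dense3 (D : linSubspace E) : closed [set x | D x] ->
  (forall u v w, S u -> S v -> S w -> D (tens3 E u v w)) -> forall x, D x.
Proof.
move=> cD hD.
pose b (u v w : V) : csub cD := match pselect [/\ S u, S v & S w] with
  | left h => sub_mk (hD u v w (let: And3 a _ _ := h in a)
      (let: And3 _ a _ := h in a) (let: And3 _ _ a := h in a)) | right _ => 0 end.
have bE u v w : S u -> S v -> S w -> sub_val (b u v w) = tens3 E u v w.
  by move=> hu hv hw; rewrite /b; case: pselect => // -[]; split.
have [L [hL Lb _]] : exists L : E -> csub cD,
    [/\ bounded_linear 1 L,
     forall x y z, S x -> S y -> S z -> L (tens3 E x y z) = b x y z &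
     forall M' (L' : E -> csub cD), bounded_linear M' L' ->
            (forall x y z, S x -> S y -> S z -> L' (tens3 E x y z) = b x y z) -> L' = L].
  apply: tens3_universal => //.
    move=> c x y z w hx hy hz hw; have hxy : S (c *: x + y) by exact: subspace_lin.
    have [h1 h2 h3] := tens3_trilinear E c hx hy hz hw.
    by split; apply: sub_val_inj; rewrite bE//= ?h1 ?h2 ?h3 /sub_val/=;
       congr (_ *: _ + _); rewrite -bE.
  move=> x y z hx hy hz; rewrite mul1r.
  by have := tens3_norm E hx hy hz; rewrite -bE.
have [L0 [_ _ hu]] := tens3_universal E ler01
  (tens3_trilinear E)
  ltac:(by move=> x y z hx hy hz; rewrite mul1r; exact: tens3_norm).
have e1 : id = L0.
  by apply: (hu 1) => //; split => // x; rewrite mul1r.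
have e2 : (fun x => sub_val (L x)) = L0.
  apply: (hu 1) => [|x y z hx hy hz]; last by rewrite Lb// bE.
  by split => [c x y|x]; [rewrite hL.1|exact: (hL.2 x)].
by move=> x; rewrite -[x]/(id x) e1 -e2; exact: sub_valP.
Qed.

Lemma uniq3 (F : completeNormedModType R[i]) (L1 L2 : E -> F) :
  (forall x y, L1 (x + y) = L1 x + L1 y) -> continuous L1 ->
  (forall x y, L2 (x + y) = L2 x + L2 y) -> continuous L2 ->
  (forall u v w, S u -> S v -> S w -> L1 (tens3 E u v w) = L2 (tens3 E u v w)) -> L1 = L2.
Proof.
move=> a1 c1 a2 c2 h.
pose D x := forall c : R[i], L1 (c *: x) = L2 (c *: x).
have D0 : D 0 by move=> c; rewrite scaler0 !additive0.
have Dl c x y : D x -> D y -> D (c *: x + y).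
  by move=> hx hy d; rewrite scalerDr scalerA a1 a2 hx hy.
apply/funext => x; rewrite -[x]scale1r.
apply: (dense3 (D := LinSubspace D0 Dl)) => [|u v w hu hv hw c].
  move=> /= y hy c; apply: (agree_continuous (L1 := L1) (L2 := L2)) => //.
  move=> e e0; have d0 : 0 < e / (cabs c + 1) by rewrite divr_gt0// ltr_wpDl ?cabs_ge0.
  have : 0 < (e / (cabs c + 1))%:C :> R[i] by rewrite ltcR.
  move=> d0'; have [z [zD]] := hy _ (nbhsx_ballx y _ d0').
  rewrite -ball_normE /= rnormE ltcR => hz; exists (c *: z); first exact: zD.
  rewrite -scalerBr rnormZ; move: (ltW hz); rewrite ler_pdivlMr ?ltr_wpDl ?cabs_ge0//.
  apply: le_trans; rewrite mulrC ler_wpM2l ?rnorm_ge0//; lra.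
have h0 := subspace0 S.
have [+ _ _] := (tens3_trilinear E c hu h0 hv hw).
have [+ _ _] := (tens3_trilinear E 1 hu h0 hv hw).
rewrite !scale1r !addr0 => /esym/(canRL (addKr _)); rewrite addNr => ->.
by rewrite addr0 => <-; apply: h => //; exact: subspaceZ.
Qed.

Lemma extend3_eq (F : completeNormedModType R[i]) (b : V -> V -> V -> F) (L : E -> F) (M : R) :
  (forall x y, L (x + y) = L x + L y) -> (forall x, rnorm (L x) <= M * rnorm x) ->
  (forall u v w, S u -> S v -> S w -> L (tens3 E u v w) = b u v w) -> extend3 b = L.
Proof.
move=> h1 h2 h3; have cL : continuous L by exact: bounded_additive_continuous h1 h2.
rewrite /extend3; case: xgetP => [L' _ [a1 c1 t1]|/(_ L) []//].
by apply: uniq3 => // u v w hu hv hw; rewrite t1// h3.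
Qed.

Lemma extend3P (F : completeNormedModType R[i]) (b : V -> V -> V -> F) (M : R) :
  0 <= M -> trilinear_on S b ->
  (forall x y z, S x -> S y -> S z -> rnorm (b x y z) <= M * (rnorm x * rnorm y * rnorm z)) ->
  bounded_linear M (extend3 (E := E) b) /\
  forall u v w, S u -> S v -> S w -> extend3 (E := E) b (tens3 E u v w) = b u v w.
Proof.
move=> M0 hb hM.
have [|L [hL hLb _]] := tens3_universal E M0 hb.
  by move=> x y z hx hy hz; rewrite !rnormE -!rmorphM lecR hM.
have e : extend3 (E := E) b = L.
  apply: (@extend3_eq _ _ _ M) => //; first exact: bounded_linearD hL.
  exact: bounded_linear_rnorm.
by rewrite e.
Qed.

End Tensor3.

(** * Algebra and involution *)

Section HilbertSpace.
Context (R : realType) (H : hilbertSpace R).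
Implicit Types x y z : H.

Lemma ipDl x y z : hs_ip (x + y) z = hs_ip x z + hs_ip y z.
Proof. by have := hs_ip_linear 1 x y z; rewrite scale1r mul1r. Qed.

Lemma ip0l z : hs_ip 0 z = 0.
Proof. by apply: (addrI (hs_ip (0 : H) z)); rewrite -ipDl !addr0. Qed.

Lemma ipZl c x z : hs_ip (c *: x) z = c * hs_ip x z.
Proof. by have := hs_ip_linear c x 0 z; rewrite ip0l !addr0. Qed.

Lemma ipDr x y z : hs_ip x (y + z) = hs_ip x y + hs_ip x z.
Proof. by rewrite hs_ip_conj ipDl rmorphD /= -!hs_ip_conj. Qed.

Lemma ipZr c x z : hs_ip x (c *: z) = conjc c * hs_ip x z.
Proof. by rewrite hs_ip_conj ipZl rmorphM /= -hs_ip_conj. Qed.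

Lemma ipNl x z : hs_ip (- x) z = - hs_ip x z.
Proof. by rewrite -scaleN1r ipZl mulN1r. Qed.

Lemma ipNr x z : hs_ip x (- z) = - hs_ip x z.
Proof. by rewrite hs_ip_conj ipNl rmorphN /= -hs_ip_conj. Qed.

Lemma ipBl x y z : hs_ip (x - y) z = hs_ip x z - hs_ip y z.
Proof. by rewrite ipDl ipNl. Qed.

Lemma ipBr x y z : hs_ip x (y - z) = hs_ip x y - hs_ip x z.
Proof. by rewrite ipDr ipNr. Qed.

Lemma ip_rnorm x : hs_ip x x = (rnorm x ^+ 2)%:C.
Proof. by rewrite hs_ip_norm rnormE rmorphXn. Qed.

Lemma ip_ext x y : (forall z, hs_ip x z = hs_ip y z) -> x = y.
Proof.
move=> h; apply/eqP; rewrite -subr_eq0; apply/eqP; apply: rnorm_eq0.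
have := ip_rnorm (x - y); rewrite {1}ipBl h subrr => /esym/(congr1 (@complex.Re R)) /= /eqP.
by rewrite sqrf_eq0 => /eqP.
Qed.

Lemma cauchy_schwarz x y : cabs (hs_ip x y) <= rnorm x * rnorm y.
Proof.
have [y0|y0] := eqVneq (rnorm y) 0.
  by rewrite (rnorm_eq0 y0) hs_ip_conj ip0l conjc0 rnorm0 mulr0 /cabs normr0.
have n0 : 0 < rnorm y by rewrite lt_neqAle eq_sym y0 rnorm_ge0.
pose n := (rnorm y ^+ 2)%:C : R[i].
have nn0 : n != 0 by rewrite fmorph_eq0 sqrf_eq0.
have nc : n^* = n by exact: conjc_real.
(* The coefficient of the orthogonal projection of x on y; the squared norm of what remains is
   nonnegative. *)
pose c := hs_ip x y / n.
have : (rnorm (x - c *: y) ^+ 2)%:C = (rnorm x ^+ 2 - cabs (hs_ip x y) ^+ 2 / rnorm y ^+ 2)%:C :> R[i].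
  rewrite -ip_rnorm ipBl !ipBr !ipZl !ipZr !ip_rnorm -/n.
  have e1 : (cabs (hs_ip x y) ^+ 2)%:C = hs_ip x y * conjc (hs_ip x y) :> R[i].
    by rewrite rmorphXn /= -cabsE normCK.
  rewrite RCB RCM RCV e1 -/n.
  have -> : conjc c = conjc (hs_ip x y) / n by rewrite /c CJM CJV /n CJR.
  rewrite (hs_ip_conj x y) /c.
  by rewrite divfK//; ring.
move/complexI => e; have := sqr_ge0 (rnorm (x - c *: y)); rewrite e subr_ge0.
rewrite ler_pdivrMr ?exprn_gt0// -exprMn => h.
by rewrite -(@ler_pXn2r _ 2)// ?nnegrE ?cabs_ge0 ?mulr_ge0 ?rnorm_ge0.
Qed.

End HilbertSpace.

Section VonNeumann.
Context (R : realType) (A : vonNeumannAlgebra R).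
Implicit Types a b c : A.

Lemma vn_rnorm_le a x : rnorm (vn_rep a x) <= rnorm a * rnorm x.
Proof. by have := vn_norm_le a x; rewrite !rnormE -rmorphM lecR. Qed.

Lemma vn_rnorm_ge a (M : R) : 0 <= M ->
  (forall x, rnorm (vn_rep a x) <= M * rnorm x) -> rnorm a <= M.
Proof.
move=> M0 h; rewrite -rnorm_lecP; apply: vn_norm_ge; first by rewrite lecR.
by move=> x; rewrite !rnormE -rmorphM lecR.
Qed.

Lemma repD a b x : vn_rep (a + b) x = vn_rep a x + vn_rep b x.
Proof. by have := vn_rep_linear 1 a b x; rewrite !scale1r. Qed.

Lemma rep0 x : vn_rep (0 : A) x = 0.
Proof. by apply: (addrI (vn_rep (0 : A) x)); rewrite -repD !addr0. Qed.

Lemma repZ (k : R[i]) a x : vn_rep (k *: a) x = k *: vn_rep a x.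
Proof. by have := vn_rep_linear k a 0 x; rewrite rep0 !addr0. Qed.

Lemma repN a x : vn_rep (- a) x = - vn_rep a x.
Proof. by rewrite -scaleN1r repZ scaleN1r. Qed.

Lemma repB a b x : vn_rep (a - b) x = vn_rep a x - vn_rep b x.
Proof. by rewrite repD repN. Qed.

Lemma rep_opD a x y : vn_rep a (x + y) = vn_rep a x + vn_rep a y.
Proof. by have := vn_rep_op_linear a 1 x y; rewrite !scale1r. Qed.

Lemma rep_op0 a : vn_rep a 0 = 0.
Proof. by apply: (addrI (vn_rep a 0)); rewrite -rep_opD !addr0. Qed.

Lemma rep_opZ (k : R[i]) a x : vn_rep a (k *: x) = k *: vn_rep a x.
Proof. by have := vn_rep_op_linear a k x 0; rewrite rep_op0 !addr0. Qed.

Lemma vn_ext a b : (forall x, vn_rep a x = vn_rep b x) -> a = b.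
Proof.
move=> h; apply/eqP; rewrite -subr_eq0; apply/eqP; apply: rnorm_eq0P.
by apply: vn_rnorm_ge => // x; rewrite repB h subrr rnorm0 mul0r.
Qed.

Lemma vmulA a b c : a ** (b ** c) = a ** b ** c.
Proof. by apply: vn_ext => x; rewrite !vn_rep_mul. Qed.

Lemma vmulDl a b c : (a + b) ** c = a ** c + b ** c.
Proof. by apply: vn_ext => x; rewrite !(vn_rep_mul, repD). Qed.

Lemma vmulDr a b c : a ** (b + c) = a ** b + a ** c.
Proof. by apply: vn_ext => x; rewrite !(vn_rep_mul, repD, rep_opD). Qed.

Lemma vmulZl (k : R[i]) a b : (k *: a) ** b = k *: (a ** b).
Proof. by apply: vn_ext => x; rewrite !(vn_rep_mul, repZ). Qed.

Lemma vmulZr (k : R[i]) a b : a ** (k *: b) = k *: (a ** b).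
Proof. by apply: vn_ext => x; rewrite !(vn_rep_mul, repZ, rep_opZ). Qed.

Lemma vmul0l a : 0 ** a = 0.
Proof. by apply: vn_ext => x; rewrite vn_rep_mul !rep0. Qed.

Lemma vmul0r a : a ** 0 = 0.
Proof. by apply: vn_ext => x; rewrite vn_rep_mul !rep0 rep_op0. Qed.

Lemma vmulNl a b : (- a) ** b = - (a ** b).
Proof. by rewrite -scaleN1r vmulZl scaleN1r. Qed.

Lemma vmulNr a b : a ** (- b) = - (a ** b).
Proof. by rewrite -scaleN1r vmulZr scaleN1r. Qed.

Lemma vmulBl a b c : (a - b) ** c = a ** c - b ** c.
Proof. by rewrite vmulDl vmulNl. Qed.

Lemma vmulBr a b c : a ** (b - c) = a ** b - a ** c.
Proof. by rewrite vmulDr vmulNr. Qed.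

Lemma vmul1 a : a ** vn_one A = a.
Proof. by apply: vn_ext => x; rewrite vn_rep_mul vn_rep_one. Qed.

Lemma v1mul a : vn_one A ** a = a.
Proof. by apply: vn_ext => x; rewrite vn_rep_mul vn_rep_one. Qed.

Lemma vmul_suml (I : Type) (r : seq I) (P : pred I) (F : I -> A) b :
  (\sum_(i <- r | P i) F i) ** b = \sum_(i <- r | P i) (F i ** b).
Proof. by elim/big_rec2: _ => [|i y x _ <-]; rewrite ?vmul0l ?vmulDl. Qed.

Lemma rnormM a b : rnorm (a ** b) <= rnorm a * rnorm b.
Proof.
apply: vn_rnorm_ge => [|x]; first by rewrite mulr_ge0 ?rnorm_ge0.
rewrite vn_rep_mul (le_trans (vn_rnorm_le _ _))// -mulrA ler_wpM2l ?rnorm_ge0//.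
exact: vn_rnorm_le.
Qed.

Lemma rnorm1_le : rnorm (vn_one A) <= 1.
Proof. by apply: vn_rnorm_ge => // x; rewrite vn_rep_one mul1r. Qed.

Lemma rnormM_le a b (M N : R) : rnorm a <= M -> rnorm b <= N -> rnorm (a ** b) <= M * N.
Proof.
by move=> h1 h2; apply: le_trans (rnormM _ _) _; apply: ler_pM => //; exact: rnorm_ge0.
Qed.

Lemma starE a x y : hs_ip (vn_rep a x) y = hs_ip x (vn_rep (vn_star a) y).
Proof. by rewrite hs_ip_conj -vn_rep_star -hs_ip_conj. Qed.

Lemma star_ext a b : (forall x y, hs_ip (vn_rep a x) y = hs_ip (vn_rep b x) y) -> a = b.
Proof. by move=> h; apply: vn_ext => x; apply: ip_ext. Qed.

Lemma starK a : vn_star (vn_star a) = a.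
Proof. by apply: star_ext => x y; rewrite vn_rep_star -starE. Qed.

Lemma starD a b : vn_star (a + b) = vn_star a + vn_star b.
Proof.
by apply: star_ext => x y; rewrite vn_rep_star !repD ipDr ipDl !vn_rep_star.
Qed.

Lemma starZ (k : R[i]) a : vn_star (k *: a) = conjc k *: vn_star a.
Proof.
by apply: star_ext => x y; rewrite vn_rep_star !repZ ipZr ipZl !vn_rep_star.
Qed.

Lemma star0 : vn_star (0 : A) = 0.
Proof. exact: additive0 starD. Qed.

Lemma starB a b : vn_star (a - b) = vn_star a - vn_star b.
Proof. exact: additiveB starD _ _. Qed.

Lemma starM a b : vn_star (a ** b) = vn_star b ** vn_star a.
Proof.
by apply: star_ext => x y; rewrite vn_rep_star !vn_rep_mul !vn_rep_star.
Qed.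

Lemma star1 : vn_star (vn_one A) = vn_one A.
Proof. by apply: star_ext => x y; rewrite vn_rep_star !vn_rep_one. Qed.

Lemma star_sum (I : Type) (r : seq I) (P : pred I) (F : I -> A) :
  vn_star (\sum_(i <- r | P i) F i) = \sum_(i <- r | P i) vn_star (F i).
Proof. by elim/big_rec2: _ => [|i y x _ <-]; rewrite ?star0 ?starD. Qed.

(** The square of the norm of a^* x is the inner product of x with a (a^* x); Cauchy-Schwarz allows
    one factor to be cancelled. *)
Lemma rnorm_star_le a : rnorm (vn_star a) <= rnorm a.
Proof.
apply: vn_rnorm_ge => [|x]; first exact: rnorm_ge0.
have [->|n0] := eqVneq (rnorm (vn_rep (vn_star a) x)) 0.
  by rewrite mulr_ge0 ?rnorm_ge0.
have n1 : 0 < rnorm (vn_rep (vn_star a) x) by rewrite lt_neqAle eq_sym n0 rnorm_ge0.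
rewrite -(ler_pM2r n1).
have : rnorm (vn_rep (vn_star a) x) ^+ 2 = cabs (hs_ip x (vn_rep a (vn_rep (vn_star a) x))).
  by rewrite -vn_rep_star ip_rnorm cabsR ger0_norm ?sqr_ge0.
rewrite expr2 => ->; apply: le_trans (cauchy_schwarz _ _) _.
rewrite [rnorm a * _]mulrC -mulrA ler_wpM2l ?rnorm_ge0//.
exact: vn_rnorm_le.
Qed.

Lemma rnorm_star a : rnorm (vn_star a) = rnorm a.
Proof.
by apply/le_anti; rewrite rnorm_star_le /= -{1}(starK a) rnorm_star_le.
Qed.

Lemma vn_powS a n : vn_pow a n.+1 = a ** vn_pow a n.
Proof. by []. Qed.

Lemma vn_powSr a n : vn_pow a n.+1 = vn_pow a n ** a.
Proof.
elim: n => [|n ih]; first by rewrite /vn_pow /= vmul1 v1mul.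
by rewrite vn_powS {1}ih vmulA.
Qed.

Lemma vn_powZ (k : R[i]) a n : vn_pow (k *: a) n = k ^+ n *: vn_pow a n.
Proof.
elim: n => [|n ih]; first by rewrite scale1r.
by rewrite !vn_powS ih vmulZl vmulZr scalerA exprS.
Qed.

Lemma rnorm_pow a n : rnorm (vn_pow a n) <= rnorm a ^+ n.
Proof.
elim: n => [|n ih]; first by rewrite expr0 rnorm1_le.
by rewrite vn_powS exprS; apply: rnormM_le.
Qed.

Lemma star_pow a n : vn_star (vn_pow a n) = vn_pow (vn_star a) n.
Proof. by elim: n => [|n ih]; [exact: star1|rewrite vn_powS starM ih -vn_powSr]. Qed.

(** The inner product of a x with x is real, so the cross terms cancel: a x and the imaginary
    multiple of x add up as in Pythagoras' theorem. *)
Lemma rnorm_selfadjoint_shift a (s : R) : selfadjoint a ->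
  rnorm (a + ('i * s%:C) *: vn_one A) ^+ 2 <= rnorm a ^+ 2 + s ^+ 2.
Proof.
set k : R[i] := 'i * s%:C; move=> sa; set t := a + _.
have kc : conjc k = - k by rewrite /k rmorphM /= /conjc /=; simpc.
have kk : k * k = - (s ^+ 2)%:C by rewrite /k; simpc; rewrite expr2.
have s0 : 0 <= rnorm a ^+ 2 + s ^+ 2 by rewrite addr_ge0 ?sqr_ge0.
rewrite -[leRHS]sqr_sqrtr// ler_pXn2r ?nnegrE ?rnorm_ge0 ?sqrtr_ge0//.
apply: vn_rnorm_ge => [|x]; first exact: sqrtr_ge0.
rewrite -(@ler_pXn2r _ 2)// ?nnegrE ?mulr_ge0 ?rnorm_ge0 ?sqrtr_ge0// exprMn sqr_sqrtr//.
have e : (rnorm (vn_rep t x) ^+ 2)%:C = (rnorm (vn_rep a x) ^+ 2 + s ^+ 2 * rnorm x ^+ 2)%:C :> R[i].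
  rewrite -ip_rnorm /t repD repZ vn_rep_one ipDl !ipDr !ipZl !ipZr !ip_rnorm.
  have -> : hs_ip (vn_rep a x) x = hs_ip x (vn_rep a x) by rewrite -vn_rep_star sa.
  rewrite kc; set z := hs_ip _ _; rewrite RCD (RCM (s ^+ 2)).
  transitivity ((rnorm (vn_rep a x) ^+ 2)%:C - (k * k) * (rnorm x ^+ 2)%:C : R[i]); first by ring.
  by rewrite kk mulNr opprK.
move/complexI : e => ->; rewrite mulrDl lerD2r -exprMn.
by rewrite ler_pXn2r ?nnegrE ?mulr_ge0 ?rnorm_ge0// vn_rnorm_le.
Qed.

End VonNeumann.

(** * Spectrum of self-adjoint elements *)

Section PolynomialCalculus.
Context (R : realType) (A : vonNeumannAlgebra R).
Implicit Types (a b c w h : A) (p q : {poly R[i]}).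

Lemma vn_hornerE p a n : (size p <= n)%N ->
  vn_horner p a = \sum_(k < n) p`_k *: vn_pow a k.
Proof.
move=> pn; rewrite /vn_horner (big_ord_widen _ (fun k => p`_k *: vn_pow a k) pn).
rewrite [RHS](bigID (fun k : 'I_n => (k < size p)%N)) /= [X in _ + X]big1 ?addr0//.
by move=> i; rewrite -leqNgt => h; rewrite nth_default// scale0r.
Qed.

Lemma vn_hornerD p q a : vn_horner (p + q) a = vn_horner p a + vn_horner q a.
Proof.
pose n := maxn (size p) (size q).
rewrite (@vn_hornerE (p + q) a n) ?(@vn_hornerE p a n) ?(@vn_hornerE q a n) ?leq_maxl ?leq_maxr ?size_polyD//.
by rewrite -big_split; apply: eq_bigr => i _; rewrite coefD scalerDl.
Qed.

Lemma vn_hornerZ (k : R[i]) p a : vn_horner (k *: p) a = k *: vn_horner p a.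
Proof.
rewrite (@vn_hornerE (k *: p) a (size p)) ?size_scale_leq// scaler_sumr.
by apply: eq_bigr => i _; rewrite coefZ scalerA.
Qed.

Lemma vn_hornerN p a : vn_horner (- p) a = - vn_horner p a.
Proof. by rewrite -scaleN1r vn_hornerZ scaleN1r. Qed.

Lemma vn_hornerC (k : R[i]) a : vn_horner k%:P a = k *: vn_one A.
Proof.
by rewrite (@vn_hornerE _ a 1) ?size_polyC_leq1// big_ord1 coefC eqxx.
Qed.

Lemma vn_hornerMX p a : vn_horner (p * 'X) a = vn_horner p a ** a.
Proof.
rewrite (@vn_hornerE (p * 'X) a (size p).+1); last first.
  by rewrite (leq_trans (size_polyMleq _ _))// size_polyX addn2.
rewrite big_ord_recl coefMX eqxx scale0r add0r vmul_suml.
by apply: eq_bigr => i _; rewrite coefMX /= vmulZl -vn_powSr.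
Qed.

Lemma vn_hornerX a : vn_horner 'X a = a.
Proof. by rewrite -(mul1r 'X) vn_hornerMX -polyC1 vn_hornerC scale1r v1mul. Qed.

Lemma vn_hornerM p q a : vn_horner (p * q) a = vn_horner p a ** vn_horner q a.
Proof.
elim/poly_ind : q => [|q k ih].
  by rewrite mulr0 -(scale0r (1 : {poly R[i]})) vn_hornerZ scale0r vmul0r.
rewrite mulrDr mulrA !vn_hornerD !vn_hornerMX ih vn_hornerC vmulDr vmulZr vmul1.
by rewrite mulrC mul_polyC vn_hornerZ vmulA.
Qed.

Lemma vn_horner_star p a : vn_star (vn_horner p a) = vn_horner (map_poly conjc p) (vn_star a).
Proof.
rewrite (@vn_hornerE (map_poly _ p) _ (size p)) ?size_poly// /vn_horner star_sum.
by apply: eq_bigr => i _; rewrite starZ star_pow coef_map_id0// rmorph0.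
Qed.

Definition vn_inv a := exists b, b ** a = vn_one A /\ a ** b = vn_one A.

Lemma vn_invM a b : vn_inv a -> vn_inv b -> vn_inv (a ** b).
Proof.
move=> [a' [h1 h2]] [b' [h3 h4]]; exists (b' ** a'); split.
  by rewrite vmulA -(vmulA b') h1 vmul1.
by rewrite vmulA -(vmulA a) h4 vmul1.
Qed.

Lemma vn_invZ (k : R[i]) a : k != 0 -> vn_inv a -> vn_inv (k *: a).
Proof.
move=> k0 [b [h1 h2]]; exists (k^-1 *: b).
by rewrite !vmulZl !vmulZr h1 h2 !scalerA mulVf// mulfV// scale1r.
Qed.

Lemma vn_inv1 : vn_inv (vn_one A).
Proof. by exists (vn_one A); rewrite vmul1. Qed.

Lemma to0_expr (r C : R) : 0 <= r < 1 -> to0 (fun n => C * r ^+ n).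
Proof.
move=> /andP[r0 r1] e e0.
have r1' : `|r| < 1 by rewrite ger0_norm.
have C1 : 0 < `|C| + 1 by rewrite ltr_wpDl.
have /cvgrPdist_le /(_ (e / (`|C| + 1))) := cvg_expr r1'.
rewrite divr_gt0// => /(_ isT)[N _ hN]; exists N => n /hN /=.
rewrite sub0r normrN ger0_norm ?exprn_ge0// ler_pdivlMr// mulrC; apply: le_trans.
by rewrite ler_wpM2r ?exprn_ge0//; have := ler_norm C; lra.
Qed.

Lemma neumann w : rnorm w < 1 -> vn_inv (vn_one A - w).
Proof.
move=> w1; set r := rnorm w; have r0 : 0 <= r by exact: rnorm_ge0.
have r1 : 0 < 1 - r by rewrite subr_gt0.
pose u n : A := \sum_(k < n) vn_pow w k.
have he : to0 (fun n => (1 - r)^-1 * r ^+ n) by apply: to0_expr; rewrite r0.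
have hu n m : (n <= m)%N -> rnorm (u m - u n) <= (1 - r)^-1 * r ^+ n.
  move=> nm; rewrite -(subnKC nm) /u big_split_ord /= addrAC subrr add0r.
  apply: le_trans (rnorm_sum _ _ _) _.
  apply: (@le_trans _ _ (\sum_(i < (m - n)%N) r ^+ (n + i))).
    by apply: ler_sum => i _; exact: rnorm_pow.
  rewrite mulrC ler_pdivlMr// mulr_suml.
  under eq_bigr do rewrite exprD -mulrA.
  rewrite -mulr_sumr -mulr_suml mulrC [_ * (1 - r)]mulrC -opprB mulNr -subrX1 opprB.
  by rewrite mulrBl mul1r lerBlDr lerDl mulr_ge0 ?exprn_ge0.
have [b hb] := cauchy_limit he hu.
have e1 n : (vn_one A - w) ** u n = vn_one A - vn_pow w n.
  rewrite /u; elim: n => [|n ih]; first by rewrite big_ord0 vmul0r subrr.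
  rewrite big_ord_recr /= vmulDr ih vmulBl v1mul -vn_powS.
  by rewrite addrA subrK.
have e2 n : u n ** (vn_one A - w) = vn_one A - vn_pow w n.
  rewrite /u; elim: n => [|n ih]; first by rewrite big_ord0 vmul0l subrr.
  rewrite big_ord_recr /= vmulDl ih vmulBr vmul1 -vn_powSr.
  by rewrite addrA subrK.
have hC : to0 (fun n => (rnorm (vn_one A - w) * (1 - r)^-1 + 1) * r ^+ n).
  by apply: to0_expr; rewrite r0.
exists b; split; apply/eqP; rewrite -subr_eq0; apply/eqP; apply: rnorm_eps => e /hC[N /(_ N (leqnn _))].
  apply: le_trans; have -> : b ** (vn_one A - w) - vn_one A =
     (b - u N) ** (vn_one A - w) - vn_pow w N.
    by rewrite vmulBl e2 opprB addrA addrAC addrK.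
  apply: le_trans (rnormDB _ _) _; rewrite mulrDl mul1r; apply: lerD; last exact: rnorm_pow.
  apply: le_trans (rnormM _ _) _; rewrite -mulrA [leLHS]mulrC ler_wpM2l ?rnorm_ge0//.
  by rewrite rnormB.
apply: le_trans; have -> : (vn_one A - w) ** b - vn_one A =
     (vn_one A - w) ** (b - u N) - vn_pow w N.
  by rewrite vmulBr e1 opprB addrA addrAC addrK.
apply: le_trans (rnormDB _ _) _; rewrite mulrDl mul1r; apply: lerD; last exact: rnorm_pow.
by rewrite -mulrA; apply: rnormM_le => //; rewrite rnormB.
Qed.

Lemma resolvent_far a (z : R[i]) : rnorm a < cabs z -> vn_inv (a - z *: vn_one A).
Proof.
move=> h; have z0 : z != 0.
  by apply/eqP => z0; move: h; rewrite z0 /cabs normr0 /= ltNge rnorm_ge0.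
have -> : a - z *: vn_one A = (- z) *: (vn_one A - z^-1 *: a).
  by rewrite scalerBr scalerA mulNr divff// scaleN1r opprK scaleNr addrC.
apply: vn_invZ; rewrite ?oppr_eq0//; apply: neumann; rewrite rnormZ.
have zp : 0 < cabs z by apply: le_lt_trans h; exact: rnorm_ge0.
have -> : cabs z^-1 = (cabs z)^-1.
  by apply: complexI; rewrite -cabsE normfV cabsE RCV.
by rewrite mulrC ltr_pdivrMr// mul1r.
Qed.

Lemma spectrum_bound a z : spectrum a z -> cabs z <= rnorm a.
Proof. by move=> h; rewrite leNgt; apply/negP => /resolvent_far. Qed.

Lemma selfadjoint_shift a (x : R) : selfadjoint a -> selfadjoint (a - x%:C *: vn_one A).
Proof. by move=> sa; rewrite /selfadjoint starB starZ CJR star1 sa. Qed.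

(* Arens' trick: shifting [a] by a large imaginary number moves the resolvent
   disk over any given non-real number. *)
Lemma spectrum_real a z : selfadjoint a -> spectrum a z -> z = (complex.Re z)%:C.
Proof.
move=> sa; case: z => al be /= sp; have [->//|b0] := eqVneq be 0; exfalso; apply: sp.
set h := a - al%:C *: vn_one A; have sh : selfadjoint h by exact: selfadjoint_shift.
(* The value of s for which the squared bound on the shifted element equals (be + s)^2 - be^2,
   strictly below (be + s)^2. *)
pose s := rnorm h ^+ 2 / (2%:R * be).
have -> : a - (al +i* be) *: vn_one A = (h + ('i * s%:C) *: vn_one A) - ('i * (be + s)%:C) *: vn_one A.
  rewrite /h -!addrA; congr (_ + _); rewrite -!scaleNr -!scalerDl; congr (_ *: _).
  by apply/eqP; rewrite eq_complex /=; apply/andP; split; apply/eqP; ring.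
apply: resolvent_far; rewrite cabsM cabsi mul1r cabsR.
rewrite -(@ltr_pXn2r _ 2)// ?nnegrE ?rnorm_ge0//.
apply: le_lt_trans (rnorm_selfadjoint_shift s sh) _.
rewrite real_normK ?num_real//.
have -> : rnorm h ^+ 2 + s ^+ 2 = (be + s) ^+ 2 - be ^+ 2 by rewrite /s; field.
by rewrite ltrBlDr ltrDl lt_neqAle sqr_ge0 eq_sym sqrf_eq0 b0.
Qed.

(** This replaces the spectral radius formula. If both h - N and h + N were invertible, so would be
    h^2 - N^2, and its inverse would keep the norm of h x away from N times that of x by a fixed
    proportion, against N being the norm of h. *)
Lemma spectrum_norm h : selfadjoint h -> 0 < rnorm h ->
  spectrum h (rnorm h)%:C \/ spectrum h (- rnorm h)%:C.
Proof.
move=> sh h0; set N := rnorm h.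
have [i1|?] := pselect (vn_inv (h - N%:C *: vn_one A)); last by left.
have [i2|?] := pselect (vn_inv (h - (- N)%:C *: vn_one A)); last by right.
have [b [hb _]] := vn_invM i1 i2; exfalso.
have e : (h - N%:C *: vn_one A) ** (h - (- N)%:C *: vn_one A) = h ** h - (N ^+ 2)%:C *: vn_one A.
  rewrite RCN scaleNr opprK vmulBl !vmulDr !vmulZl !vmulZr v1mul !vmul1 scalerA.
  by rewrite expr2 RCM opprD addrA addrK.
move: hb; rewrite e => hb.
(* The gap is 1/B; adding 1 only guarantees that B is positive. *)
pose B := rnorm b ^+ 2 * N ^+ 2 + 1.
have B0 : 0 < B by apply: ltr_wpDl => //; apply: mulr_ge0; exact: sqr_ge0.
have key x : rnorm (vn_rep h x) ^+ 2 <= (N ^+ 2 - B^-1) * rnorm x ^+ 2.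
  set hx := rnorm (vn_rep h x).
  have n1 : hx ^+ 2 <= N ^+ 2 * rnorm x ^+ 2.
    by rewrite -exprMn ler_pXn2r ?nnegrE ?mulr_ge0 ?rnorm_ge0// vn_rnorm_le.
  set y := vn_rep (h ** h - (N ^+ 2)%:C *: vn_one A) x.
  have ey : (rnorm y ^+ 2)%:C = (rnorm (vn_rep h (vn_rep h x)) ^+ 2 - 2%:R * N ^+ 2 * hx ^+ 2
      + N ^+ 2 * N ^+ 2 * rnorm x ^+ 2)%:C :> R[i].
    rewrite -ip_rnorm /y repB repZ vn_rep_one vn_rep_mul ipBl !ipBr !ipZl !ipZr !CJR !ip_rnorm.
    have -> : hs_ip (vn_rep h (vn_rep h x)) x = (hx ^+ 2)%:C.
      by rewrite -[X in vn_rep X _]sh vn_rep_star ip_rnorm.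
    have -> : hs_ip x (vn_rep h (vn_rep h x)) = (hx ^+ 2)%:C.
      by rewrite -[X in hs_ip _ (vn_rep X _)]sh -starE ip_rnorm.
    by rewrite RCD RCB !RCM RC_nat; ring.
  move/complexI : ey => ey.
  have n2 : rnorm (vn_rep h (vn_rep h x)) ^+ 2 <= N ^+ 2 * hx ^+ 2.
    by rewrite -exprMn ler_pXn2r ?nnegrE ?mulr_ge0 ?rnorm_ge0// vn_rnorm_le.
  have n3 : rnorm x ^+ 2 <= rnorm b ^+ 2 * rnorm y ^+ 2.
    rewrite -exprMn ler_pXn2r ?nnegrE ?mulr_ge0 ?rnorm_ge0//.
    by apply: le_trans (vn_rnorm_le _ _); rewrite /y -vn_rep_mul hb vn_rep_one.
  have n4 : rnorm y ^+ 2 <= N ^+ 2 * (N ^+ 2 * rnorm x ^+ 2 - hx ^+ 2).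
    by rewrite ey; move: n2; lra.
  have n5 : rnorm x ^+ 2 <= B * (N ^+ 2 * rnorm x ^+ 2 - hx ^+ 2).
    apply: le_trans n3 _; rewrite /B mulrDl mul1r.
    have : rnorm b ^+ 2 * rnorm y ^+ 2 <= rnorm b ^+ 2 * (N ^+ 2 * (N ^+ 2 * rnorm x ^+ 2 - hx ^+ 2)).
      by rewrite ler_wpM2l ?sqr_ge0.
    rewrite mulrA; lra.
  rewrite mulrBl lerBrDr -lerBrDl mulrC ler_pdivrMr//; first by rewrite mulrC.
pose M := Num.sqrt (Num.max 0 (N ^+ 2 - B^-1)).
have M0 : 0 <= Num.max 0 (N ^+ 2 - B^-1) by rewrite le_max lexx.
have NM : N <= M.
  apply: vn_rnorm_ge => [|x]; first exact: sqrtr_ge0.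
  rewrite -(@ler_pXn2r _ 2)// ?nnegrE ?mulr_ge0 ?sqrtr_ge0 ?rnorm_ge0//.
  rewrite exprMn sqr_sqrtr//; apply: le_trans (key x) _.
  by rewrite ler_wpM2r ?sqr_ge0// le_max lexx orbT.
have : N ^+ 2 <= M ^+ 2 by rewrite ler_pXn2r ?nnegrE ?sqrtr_ge0 ?rnorm_ge0.
rewrite sqr_sqrtr// le_max => /orP[|]; first by rewrite leNgt exprn_gt0.
by rewrite lerBrDr gerDl invr_le0 leNgt B0.
Qed.

Lemma spectrum_nonempty a : selfadjoint a -> vn_one A != 0 -> exists x : R, spectrum a x%:C.
Proof.
move=> sa nz; have [a0|a0] := eqVneq (rnorm a) 0.
  exists 0; rewrite (rnorm_eq0 a0) => -[b [+ _]].
  rewrite (_ : 0%:C = 0)// scale0r subr0 => h.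
  by move: nz; rewrite -h vmul0r eqxx.
have [|s|s] := spectrum_norm sa; first by rewrite lt_neqAle eq_sym a0 rnorm_ge0.
  by exists (rnorm a).
by exists (- rnorm a).
Qed.

(** Split q - la into linear factors: if no root were in the spectrum, the product of the factors
    would be invertible. The root found is real because [a] is self-adjoint. *)
Lemma spectral_mapping q a (la : R) : selfadjoint a -> vn_one A != 0 ->
  spectrum (vn_horner q a) la%:C -> exists2 x : R, spectrum a x%:C & q.[x%:C] = la%:C.
Proof.
move=> sa nz sp.
(* If q is the constant la there is no factorisation to use, and any point of the spectrum will
   do. *)
have [q0|q0] := eqVneq (q - (la%:C)%:P) 0.
  have [x hx] := spectrum_nonempty sa nz; exists x => //.
  by move/eqP : q0; rewrite subr_eq0 => /eqP ->; rewrite hornerC.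
have [rs hrs] := closed_field_poly_normal (q - (la%:C)%:P).
have /existsNP[z /not_implyP[zr hz]] : ~ forall z, z \in rs -> vn_inv (a - z *: vn_one A).
  move=> h; apply: sp.
  have -> : vn_horner q a - la%:C *: vn_one A = vn_horner (q - (la%:C)%:P) a.
    by rewrite vn_hornerD vn_hornerN vn_hornerC.
  rewrite hrs vn_hornerZ; apply: vn_invZ; first by rewrite lead_coef_eq0.
  elim: rs {hrs} h => [_|z rs ih h].
    by rewrite big_nil vn_hornerC scale1r; exact: vn_inv1.
  rewrite big_cons vn_hornerM; apply: vn_invM.
    have -> : vn_horner ('X - z%:P) a = a - z *: vn_one A.
      by rewrite vn_hornerD vn_hornerX vn_hornerN vn_hornerC.
    by apply: h; rewrite inE eqxx.
  by apply: ih => y yr; apply: h; rewrite inE yr orbT.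
have zE := spectrum_real sa hz; exists (complex.Re z); rewrite -zE//.
have : root (q - (la%:C)%:P) z.
  rewrite hrs rootZ ?lead_coef_eq0//.
  by rewrite root_prod_XsubC.
by rewrite /root hornerD hornerN hornerC subr_eq0 => /eqP.
Qed.

Lemma rnorm_sqr_star a : rnorm a ^+ 2 <= rnorm (vn_star a ** a).
Proof.
rewrite -[leRHS]sqr_sqrtr ?rnorm_ge0// ler_pXn2r ?nnegrE ?rnorm_ge0 ?sqrtr_ge0//.
apply: vn_rnorm_ge => [|x]; first exact: sqrtr_ge0.
rewrite -(@ler_pXn2r _ 2)// ?nnegrE ?mulr_ge0 ?sqrtr_ge0 ?rnorm_ge0//.
rewrite exprMn sqr_sqrtr ?rnorm_ge0//.
have := cauchy_schwarz (vn_rep (vn_star a ** a) x) x.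
rewrite vn_rep_mul vn_rep_star ip_rnorm cabsR ger0_norm ?sqr_ge0// => h.
apply: le_trans h _; rewrite expr2 mulrA ler_wpM2r ?rnorm_ge0// -vn_rep_mul.
exact: vn_rnorm_le.
Qed.

(** Apply [spectrum_norm] to the self-adjoint element given by the conjugate of p times p: its norm
    is attained on the spectrum, which spectral mapping expresses by values of p. *)
Lemma horner_norm_le p a (e : R) : selfadjoint a -> 0 <= e ->
  (forall x : R, spectrum a x%:C -> cabs p.[x%:C] <= e) -> rnorm (vn_horner p a) <= e.
Proof.
move=> sa e0 h; have [nz|nz] := eqVneq (vn_one A) 0.
  by rewrite -(v1mul (vn_horner p a)) nz vmul0l rnorm0.
pose q := map_poly conjc p * p.
have hE : vn_horner q a = vn_star (vn_horner p a) ** vn_horner p a.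
  by rewrite vn_hornerM vn_horner_star sa.
have qE (x : R) : q.[x%:C] = (cabs p.[x%:C] ^+ 2)%:C.
  rewrite hornerM RCX -cabsE normCK mulrC; congr (_ * _).
  by rewrite -{1}(CJR x) horner_map.
have sh : selfadjoint (vn_horner q a) by rewrite /selfadjoint hE starM starK.
rewrite -(@ler_pXn2r _ 2)// ?nnegrE ?rnorm_ge0//.
apply: le_trans (rnorm_sqr_star _) _; rewrite -hE.
have [n0|n0] := eqVneq (rnorm (vn_horner q a)) 0; first by rewrite n0 sqr_ge0.
have np : 0 < rnorm (vn_horner q a) by rewrite lt_neqAle eq_sym n0 rnorm_ge0.
have fin x (la : R) : spectrum a x%:C -> q.[x%:C] = la%:C -> `|la| <= e ^+ 2.
  move=> hx; rewrite qE => /complexI <-; rewrite ger0_norm ?sqr_ge0//.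
  by rewrite ler_pXn2r ?nnegrE ?cabs_ge0//; exact: h.
have [/(spectral_mapping sa nz)[x hx /(fin _ _ hx)]|/(spectral_mapping sa nz)[x hx /(fin _ _ hx)]] := spectrum_norm sh np.
  by rewrite ger0_norm ?rnorm_ge0.
by rewrite normrN ger0_norm ?rnorm_ge0.
Qed.

(** [fcalc] is a choice among candidates. Polynomials close to f on the spectrum are close to each
    other in norm by [horner_norm_le], so there is only one candidate. *)
Lemma fcalcE (f : R -> R[i]) a b : selfadjoint a ->
  (forall e : R, 0 < e -> exists p : {poly R[i]},
    (forall x : R, spectrum a x%:C -> cabs (p.[x%:C] - f x) <= e) /\
    rnorm (vn_horner p a - b) <= e) -> fcalc f a = b.
Proof.
move=> sa hb; rewrite /fcalc; case: xgetP => [b' _ hb'|/(_ b) []].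
  apply/eqP; rewrite -subr_eq0; apply/eqP; apply: rnorm_eps => e e0.
  have e4 : 0 < e / 4%:R by rewrite divr_gt0.
  have [p [p1 p2]] := hb _ e4; have [p' [p1' p2']] := hb' _ e4.
  rewrite rnorm_lecP in p2'.
  have : rnorm (vn_horner (p' - p) a) <= e / 4%:R + e / 4%:R.
    apply: horner_norm_le => // [|x hx]; first by rewrite addr_ge0// ltW.
    rewrite hornerD hornerN -(subrKA (f x)) (le_trans (cabsD _ _))// lerD//.
      by have := p1' x hx; rewrite cabsE lecR.
    by have := p1 x hx; rewrite /cabs distrC.
  have -> : vn_horner (p' - p) a = vn_horner p' a - vn_horner p a.
    by rewrite vn_hornerD vn_hornerN.
  have := rnorm_dist b' (vn_horner p' a) b.
  have := rnorm_dist (vn_horner p' a) (vn_horner p a) b.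
  by rewrite (rnormB b' (vn_horner p' a)) => *; lra.
move=> e /hb[p [p1 p2]]; exists p; split; last by rewrite rnorm_lecP.
by move=> x /p1; rewrite cabsE lecR.
Qed.

End PolynomialCalculus.

(** * Unitary exponentials *)

Section ScalarExponential.
Context (R : realType).
Implicit Types (M x y : R).

Lemma cabs_natV n : cabs (n%:R^-1 : R[i]) = n%:R^-1.
Proof. by apply: complexI; rewrite -cabsE RCV RC_nat ger0_norm// invr_ge0. Qed.

Lemma cabsN (z : R[i]) : cabs (- z) = cabs z.
Proof. by rewrite /cabs normrN. Qed.

(** Used with P, Q and S the values on the spectrum of the Taylor polynomials of two exponentials
    and of their product; d <= 1 makes the product of errors linear in d. *)
Lemma unit_prod_approx (P Q S u v : R[i]) (d : R) :
  cabs u = 1 -> cabs v = 1 -> cabs (P - u) <= d -> cabs (Q - v) <= d ->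
  cabs (S - u * v) <= d -> d <= 1 -> cabs (S - P * Q) <= 4%:R * d.
Proof.
move=> u1 v1 kp kq kr d1.
have -> : S - P * Q = (S - u * v) - ((P - u) * (Q - v) + (u * (Q - v) + (P - u) * v)) by ring.
apply: le_trans (cabsD _ _) _; rewrite cabsN.
have := cabsD ((P - u) * (Q - v)) (u * (Q - v) + (P - u) * v).
have := cabsD (u * (Q - v)) ((P - u) * v).
rewrite !cabsM u1 v1 mul1r mulr1.
have : cabs (P - u) * cabs (Q - v) <= d * 1.
  by apply: ler_pM; rewrite ?cabs_ge0//; apply: le_trans d1.
by move=> *; lra.
Qed.

Definition exp_tail M n : R := expR M - series (exp_coeff M) n.

Lemma series_exp_le M n : 0 <= M -> series (exp_coeff M) n <= expR M.
Proof.
move=> M0; rewrite /expR; apply: nondecreasing_cvgn_le; last exact: is_cvg_series_exp_coeff.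
by apply/nondecreasing_seqP => k; rewrite seriesSr lerDl exp_coeff_ge0.
Qed.

Lemma exp_tail_ge0 M n : 0 <= M -> 0 <= exp_tail M n.
Proof. by move=> M0; rewrite subr_ge0 series_exp_le. Qed.

Lemma exp_tail_to0 M : to0 (exp_tail M).
Proof.
move=> e e0; have : series (exp_coeff M) @ \oo --> expR M.
  by rewrite /expR; exact: is_cvg_series_exp_coeff.
move/cvgrPdist_le => /(_ e e0)[N _ hN]; exists N => n /hN /=.
by apply: le_trans; exact: ler_norm.
Qed.

Lemma exp_tail_sum M n m : 0 <= M -> (n <= m)%N ->
  \sum_(n <= k < m) M ^+ k / k`!%:R <= exp_tail M n.
Proof.
move=> M0 nm; rewrite /exp_tail lerBrDl; apply: le_trans (series_exp_le m M0).
rewrite /series /= [leRHS](@big_cat_nat _ _ _ n)//= lerD2l.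
Qed.

(** For s <= 1 every term of index at least 2 contains the factor s^2, and what remains is part of
    the series of e. *)
Lemma exp_tail2 s : 0 <= s <= 1 -> exp_tail s 2 <= s ^+ 2 * expR 1.
Proof.
move=> /andP[s0 s1]; apply: ler_eps => e /(exp_tail_to0 s)[N /(_ (N + 2)%N (leq_addr _ _))].
rewrite /exp_tail; set a := expR s => h.
have -> : a - series (exp_coeff s) 2 = (a - series (exp_coeff s) (N + 2)) +
   \sum_(2 <= k < N + 2) s ^+ k / k`!%:R.
  rewrite /series /= (@big_cat_nat _ _ _ 2 0 (N + 2))//= ?leq_addl// opprD addrA.
  by rewrite addrNK.
rewrite addrC lerD//; apply: (@le_trans _ _ (s ^+ 2 * \sum_(2 <= k < N + 2) 1 ^+ k / k`!%:R)).
  rewrite mulr_sumr big_nat [leRHS]big_nat; apply: ler_sum => k /andP[k2 _].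
  rewrite expr1n mulrA mulr1 ler_wpM2r ?invr_ge0//.
  by rewrite -(subnK k2) exprD ler_piMl ?exprn_ge0// exprn_ile1.
rewrite ler_wpM2l ?exprn_ge0//; apply: le_trans (exp_tail_sum _ _) _ => //.
  by rewrite leq_addl.
rewrite /exp_tail gerBl /series /= big_nat; apply: sumr_ge0 => k _.
by rewrite exp_coeff_ge0.
Qed.

Lemma imag_expn k : 'i ^+ k = ((~~ odd k)%:R * (-1) ^+ k./2)%:C
   + 'i * ((odd k)%:R * (-1) ^+ k.-1./2)%:C :> R[i].
Proof.
rewrite -{1}(odd_double_half k) exprD -mul2n exprM [X in X ^+ k./2]expr2 II.
have [od|od] := boolP (odd k).
  have -> : k.-1./2 = k./2.
    by case: k od => //= k /negbTE od; rewrite uphalf_half od.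
  by rewrite !mul0r !mul1r (_ : 0%:C = 0)// add0r RCX RCN.
by rewrite !mul0r !mul1r (_ : 0%:C = 0)// mulr0 addr0 RCX RCN.
Qed.

Lemma exp_imag_partial y n :
  \sum_(k < n) (k`!%:R : R[i])^-1 * ('i * y%:C) ^+ k =
  series (cos_coeff y) n +i* series (sin_coeff y) n.
Proof.
rewrite /series /= !big_mkord; elim: n => [|n ih]; first by rewrite !big_ord0.
rewrite !big_ord_recr /= ih.
have -> : (n`!%:R : R[i])^-1 * ('i * y%:C) ^+ n = cos_coeff y n +i* sin_coeff y n.
  have -> : cos_coeff y n +i* sin_coeff y n = (cos_coeff y n)%:C + 'i * (sin_coeff y n)%:C.
    by apply/eqP; rewrite eq_complex /=; apply/andP; split; apply/eqP; ring.
  rewrite exprMn imag_expn /cos_coeff /sin_coeff /=.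
  by rewrite !RCM !RCV !RCX !RC_nat; ring.
by apply/eqP; rewrite eq_complex /= !eqxx.
Qed.

Lemma expi_approx y M n : `|y| <= M ->
  cabs (\sum_(k < n) (k`!%:R : R[i])^-1 * ('i * y%:C) ^+ k - expi y) <= exp_tail M n.
Proof.
move=> yM; have M0 : 0 <= M by apply: le_trans yM.
pose S n := \sum_(k < n) (k`!%:R : R[i])^-1 * ('i * y%:C) ^+ k.
have hS m : (n <= m)%N -> cabs (S m - S n) <= exp_tail M n.
  move=> nm; rewrite /S -(subnKC nm) big_split_ord /= addrAC subrr add0r.
  apply: le_trans (exp_tail_sum M0 nm).
  rewrite -[X in \sum_(X <= _ < _) _]add0n big_addn big_mkord.
  elim/big_rec2: _ => [|i a b _ h]; first by rewrite /cabs normr0.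
  rewrite (le_trans (cabsD _ _))//; apply: lerD => //.
  rewrite cabsM; rewrite [(i + n)%N]addnC cabs_natV mulrC ler_wpM2r ?invr_ge0//.
  have -> : cabs (('i * y%:C) ^+ (n + i)) = `|y| ^+ (n + i).
    by apply: complexI; rewrite -cabsE normrX normrM !cabsE cabsi mul1r cabsR RCX.
  by rewrite lerXn2r ?nnegrE.
have c1 : series (cos_coeff y) @ \oo --> cos y.
  by rewrite unlock; exact: is_cvg_series_cos_coeff.
have c2 : series (sin_coeff y) @ \oo --> sin y.
  by rewrite unlock; exact: is_cvg_series_sin_coeff.
apply: ler_eps => e e0; have e2 : 0 < e / 2%:R by rewrite divr_gt0.
move/cvgrPdist_le : c1 => /(_ _ e2)[N1 _ h1].
move/cvgrPdist_le : c2 => /(_ _ e2)[N2 _ h2].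
pose m := maxn n (maxn N1 N2).
have := h1 m; rewrite /= /m !leq_max leqnn !orbT => /(_ isT) k1.
have := h2 m; rewrite /= /m !leq_max leqnn !orbT => /(_ isT) k2.
have k3 := hS m (leq_maxl _ _).
have -> : \sum_(k < n) (k`!%:R : R[i])^-1 * ('i * y%:C) ^+ k - expi y = - (S m - S n) + (S m - expi y).
  by rewrite opprB addrA subrK.
apply: le_trans (cabsD _ _) _; apply: lerD.
  by apply: le_trans k3; rewrite /cabs normrN.
apply: le_trans (cabs_le_ReIm _) _.
have -> : S m = series (cos_coeff y) m +i* series (sin_coeff y) m by exact: exp_imag_partial.
rewrite /expi /= -(normrN (_ - cos y)) -(normrN (_ - sin y)) !opprB.
by have := lerD k1 k2; lra.
Qed.

Lemma cabs_expi y : cabs (expi y) = 1.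
Proof. by rewrite /cabs /expi normc_def /= cos2Dsin2 sqrtr1. Qed.

Lemma expiD x y : expi (x + y) = expi x * expi y :> R[i].
Proof. by rewrite /expi cosD sinD; apply/eqP; rewrite eq_complex /= addrC eqxx [X in _ == X]addrC eqxx. Qed.

Lemma expi0 : expi 0 = 1 :> R[i].
Proof. by rewrite /expi cos0 sin0. Qed.

Definition taylor_exp n (xi : R) : {poly R[i]} :=
  \poly_(k < n) ((k`!%:R)^-1 * ('i * xi%:C) ^+ k).

Lemma taylor_exp_approx n xi x M : `|x * xi| <= M ->
  cabs ((taylor_exp n xi).[x%:C] - expi (x * xi)) <= exp_tail M n.
Proof.
move=> /(@expi_approx _ _ n); congr (cabs (_ - _) <= _).
rewrite /taylor_exp horner_poly; apply: eq_bigr => k _.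
by rewrite -mulrA -exprMn -mulrA -RCM (mulrC xi).
Qed.

(** The form in which the O(1/N) errors of subdivisions into N + 1 steps are discarded. *)
Lemma ler_harmonic x y (C : R) N :
  (forall n, (N <= n)%N -> x <= y + C / n.+1%:R) -> x <= y.
Proof.
move=> h; apply: ler_eps => e e0.
pose n := maxn N (Num.truncn (`|C| / e)).
apply: le_trans (h n (leq_maxl _ _)) _; rewrite lerD2l ler_pdivrMr//.
have : `|C| / e < n.+1%:R.
  apply: lt_le_trans (truncnS_gt _) _ => //.
  by rewrite ler_nat ltnS leq_maxr.
rewrite ltr_pdivrMr// => /ltW hn; apply: le_trans (ler_norm C) _.
by rewrite mulrC.
Qed.

End ScalarExponential.

Section Exponential.
Context (R : realType) (A : vonNeumannAlgebra R).
Implicit Types (a b c y z : A) (xi eta : R) (n k : nat).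

Definition E xi a : A := vn_exp (('i * xi%:C) *: a).

Lemma vn_exp_approx a n :
  rnorm (series (fun n => (n`!%:R : R[i])^-1 *: vn_pow a n) n - vn_exp a) <= exp_tail (rnorm a) n.
Proof.
set u := series _; have hu k m : (k <= m)%N -> rnorm (u m - u k) <= exp_tail (rnorm a) k.
  move=> km; rewrite /u /series /= (@big_cat_nat _ _ _ k 0 m)//= addrAC subrr add0r.
  apply: le_trans (rnorm_sum _ _ _) _; apply: le_trans (exp_tail_sum _ km); last exact: rnorm_ge0.
  apply: ler_sum_nat => i _; rewrite rnormZ mulrC.
  by rewrite cabs_natV ler_wpM2r ?invr_ge0// rnorm_pow.
have [l hl] := cauchy_limit (@exp_tail_to0 R (rnorm a)) hu.
have -> : vn_exp a = l; last exact: hl.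
by apply: norm_cvg_lim; apply: cvg_to0 hl _; exact: exp_tail_to0.
Qed.

Lemma E_approx xi a n :
  rnorm (vn_horner (taylor_exp n xi) a - E xi a) <= exp_tail (`|xi| * rnorm a) n.
Proof.
have := vn_exp_approx (('i * xi%:C) *: a) n.
rewrite rnormZ cabsM cabsi mul1r cabsR; congr (rnorm (_ - _) <= _).
rewrite (@vn_hornerE _ _ _ _ n) ?size_poly// /series /= big_mkord.
apply: eq_bigr => k _; rewrite vn_powZ scalerA; congr (_ *: _).
by rewrite coef_poly ltn_ord.
Qed.

Section SelfAdjoint.
Context (a : A) (sa : selfadjoint a).

Lemma spectrum_mul_le xi (x : R) : spectrum a x%:C -> `|x * xi| <= `|xi| * rnorm a.
Proof.
move=> /spectrum_bound; rewrite cabsR normrM mulrC => h.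
by rewrite ler_wpM2l.
Qed.

(** On the real spectrum the Taylor polynomials differ from a number of modulus 1 by the tail of the
    series, and [horner_norm_le] turns this into a norm bound. *)
Lemma E_norm xi : rnorm (E xi a) <= 1.
Proof.
apply: ler_eps => e e0; have e2 : 0 < e / 2%:R by rewrite divr_gt0.
have [n /(_ n (leqnn _)) hn] := @exp_tail_to0 R (`|xi| * rnorm a) _ e2.
have h1 := E_approx xi a n.
have h2 : rnorm (vn_horner (taylor_exp n xi) a) <= 1 + exp_tail (`|xi| * rnorm a) n.
  apply: horner_norm_le => // [|x hx].
    by rewrite addr_ge0// exp_tail_ge0// mulr_ge0 ?rnorm_ge0.
  have := cabsD ((taylor_exp n xi).[x%:C] - expi (x * xi)) (expi (x * xi)).
  rewrite subrK cabs_expi => /le_trans; apply; rewrite addrC lerD2l.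
  exact: taylor_exp_approx (spectrum_mul_le _ hx).
have := rnormD (vn_horner (taylor_exp n xi) a) (E xi a - vn_horner (taylor_exp n xi) a).
by rewrite addrC subrK rnormB => *; lra.
Qed.

(** The identity is reduced to scalars: the difference of the Taylor polynomial of the sum and of
    the product of Taylor polynomials is small on the spectrum, hence in norm. No manipulation of
    double series occurs. *)
Lemma E_add xi eta : E (xi + eta) a = E xi a ** E eta a.
Proof.
apply/eqP; rewrite -subr_eq0; apply/eqP; apply: rnorm_eps => e e0.
pose t n := exp_tail (`|xi| * rnorm a) n; pose u n := exp_tail (`|eta| * rnorm a) n.
pose v n := exp_tail (`|xi + eta| * rnorm a) n.
pose d := Num.min 1 (e / 8%:R).
have d0 : 0 < d by rewrite lt_min ltr01 divr_gt0.
have [n1 h1] := @exp_tail_to0 R (`|xi| * rnorm a) _ d0.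
have [n2 h2] := @exp_tail_to0 R (`|eta| * rnorm a) _ d0.
have [n3 h3] := @exp_tail_to0 R (`|xi + eta| * rnorm a) _ d0.
pose n := maxn n1 (maxn n2 n3).
have {}h1 : t n <= d by apply: h1; rewrite /n !leq_max leqnn.
have {}h2 : u n <= d by apply: h2; rewrite /n !leq_max leqnn orbT.
have {}h3 : v n <= d by apply: h3; rewrite /n !leq_max leqnn !orbT.
have [d1 de] : d <= 1 /\ d <= e / 8%:R.
  by split; rewrite /d ge_min lexx ?orbT.
set p := taylor_exp n xi; set q := taylor_exp n eta; set r := taylor_exp n (xi + eta).
have hp : rnorm (vn_horner p a - E xi a) <= d by apply: le_trans (E_approx _ _ _) h1.
have hq : rnorm (vn_horner q a - E eta a) <= d by apply: le_trans (E_approx _ _ _) h2.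
have hr : rnorm (vn_horner r a - E (xi + eta) a) <= d by apply: le_trans (E_approx _ _ _) h3.
have key : rnorm (vn_horner (r - p * q) a) <= 4%:R * d.
  apply: horner_norm_le => // [|x hx]; first by rewrite mulr_ge0// ltW.
  have kp : cabs (p.[x%:C] - expi (x * xi)) <= d.
    by apply: le_trans h1; exact: taylor_exp_approx (spectrum_mul_le _ hx).
  have kq : cabs (q.[x%:C] - expi (x * eta)) <= d.
    by apply: le_trans h2; exact: taylor_exp_approx (spectrum_mul_le _ hx).
  have kr : cabs (r.[x%:C] - expi (x * (xi + eta))) <= d.
    by apply: le_trans h3; exact: taylor_exp_approx (spectrum_mul_le _ hx).
  rewrite mulrDr expiD in kr; rewrite hornerD hornerN hornerM.
  by apply: unit_prod_approx kp kq kr d1; exact: cabs_expi.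
rewrite vn_hornerD vn_hornerN vn_hornerM in key.
have e1 : rnorm (vn_horner p a ** vn_horner q a - E xi a ** E eta a) <= 3%:R * d.
  have -> : vn_horner p a ** vn_horner q a - E xi a ** E eta a =
     (vn_horner p a - E xi a) ** (vn_horner q a - E eta a) +
     (E xi a ** (vn_horner q a - E eta a) + (vn_horner p a - E xi a) ** E eta a).
    rewrite !vmulBr !vmulBl.
    set s1 := vn_horner p a ** vn_horner q a; set s2 := E xi a ** vn_horner q a.
    set s3 := vn_horner p a ** E eta a; set s4 := E xi a ** E eta a.
    by zmod.
  apply: le_trans (rnormD _ _) _.
  have := rnormD (E xi a ** (vn_horner q a - E eta a)) ((vn_horner p a - E xi a) ** E eta a).
  have := rnormM_le hp (le_trans hq d1); have := rnormM_le (E_norm xi) hq.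
  by have := rnormM_le hp (E_norm eta); move=> *; lra.
rewrite rnormB in hr.
have := rnorm_dist (E (xi + eta) a) (vn_horner r a) (E xi a ** E eta a).
have := rnorm_dist (vn_horner r a) (vn_horner p a ** vn_horner q a) (E xi a ** E eta a).
by move=> *; lra.
Qed.

Lemma E_0 : E 0 a = vn_one A.
Proof.
apply/eqP; rewrite -subr_eq0; apply/eqP; apply: rnorm_eps => e e0.
have e2 : 0 < e / 2%:R by rewrite divr_gt0.
have [n hn0] := @exp_tail_to0 R 0 _ e2; have hn := hn0 n (leqnn n).
have := E_approx 0 a n; rewrite normr0 mul0r => h1.
have h2 : rnorm (vn_horner (taylor_exp n 0 - 1%:P) a) <= exp_tail 0 n.
  apply: horner_norm_le => // [|x hx]; first exact: exp_tail_ge0.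
  rewrite hornerD hornerN hornerC -expi0 -{2}(mulr0 x).
  by apply: taylor_exp_approx; rewrite mulr0 normr0.
rewrite vn_hornerD vn_hornerN vn_hornerC scale1r in h2.
have := rnorm_dist (E 0 a) (vn_horner (taylor_exp n 0) a) (vn_one A).
by rewrite (rnormB (E 0 a) (vn_horner _ _)) => *; lra.
Qed.

Lemma E_star xi : vn_star (E xi a) = E (- xi) a.
Proof.
have e0 : vn_star (('i * xi%:C) *: a) = ('i * (- xi)%:C) *: a.
  by rewrite starZ sa CJM CJI CJR RCN mulrN -mulNr.
apply/eqP; rewrite -subr_eq0; apply/eqP; apply: rnorm_eps => e ep.
have e2 : 0 < e / 2%:R by rewrite divr_gt0.
set b := ('i * xi%:C) *: a in e0; set c := ('i * (- xi)%:C) *: a in e0.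
have [n hn0] := @exp_tail_to0 R (rnorm b) _ e2; have hn := hn0 n (leqnn n).
have h1 := vn_exp_approx b n; have h2 := vn_exp_approx c n.
rewrite -e0 rnorm_star e0 in h2.
set u := series _ n in h1; set v := series _ n in h2.
have h3 : vn_star u = v.
  rewrite /u /v /series /= star_sum; apply: eq_bigr => k _.
  by rewrite starZ star_pow e0 CJV conjc_nat.
rewrite -rnorm_star starB h3 rnormB in h1.
have := rnorm_dist (vn_star (E xi a)) v (E (- xi) a).
by rewrite -/b -/c in h1 h2 *; rewrite /E -/b -/c => *; lra.
Qed.

Lemma E_mulrn xi n : E (n%:R * xi) a = vn_pow (E xi a) n.
Proof.
elim: n => [|n ih]; first by rewrite mul0r E_0.
by rewrite -addn1 natrD mulrDl mul1r E_add ih addn1 vn_powSr.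
Qed.

Lemma E_small xi : `|xi| * rnorm a <= 1 ->
  rnorm (E xi a - vn_one A - ('i * xi%:C) *: a) <= (xi * rnorm a) ^+ 2 * expR 1.
Proof.
move=> h; have := vn_exp_approx (('i * xi%:C) *: a) 2.
rewrite rnormZ cabsM cabsi mul1r cabsR /series /= big_mkord !big_ord_recr big_ord0 /= add0r.
rewrite /vn_pow /= vmul1 fact0 (_ : 1`! = 1)%N// !invr1 !scale1r rnormB opprD addrA => k1.
apply: le_trans k1 _; apply: le_trans (exp_tail2 _) _.
  by rewrite h mulr_ge0 ?rnorm_ge0.
by rewrite !exprMn real_normK ?num_real.
Qed.

End SelfAdjoint.
End Exponential.

Section ExponentialEstimates.
Context (R : realType) (A : vonNeumannAlgebra R).
Implicit Types (a b c d h y z : A) (xi dl : R) (n k N : nat).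

Lemma vn_pow_telescope a b n : vn_pow a n - vn_pow b n =
  \sum_(k < n) vn_pow a k ** (a - b) ** vn_pow b (n.-1 - k).
Proof.
elim: n => [|n ih]; first by rewrite big_ord0 subrr.
rewrite big_ord_recr /= subnn vmul1.
have -> : \sum_(i < n) vn_pow a i ** (a - b) ** vn_pow b (n - i) = (vn_pow a n - vn_pow b n) ** b.
  rewrite ih vmul_suml; apply: eq_bigr => i _; rewrite -!vmulA -vn_powSr.
  by congr (_ ** (_ ** vn_pow b _)); case: n i {ih} => [[]//|n] i /=; rewrite subSn// -ltnS.
rewrite vmulBl vmulBr -!vn_powS !vn_powSr; zmod.
Qed.

Lemma E_at0 xi : E xi (0 : A) = vn_one A.
Proof.
have s0 : selfadjoint (0 : A) by exact: star0.
by rewrite -(E_0 s0) /E !scaler0.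
Qed.

(** A discrete Duhamel formula. The outer exponentials have norm at most 1 and the middle factor is
    an increment over the small time [dl], for which a first order expansion is enough. *)
Lemma E_telescope xi a b N : selfadjoint a -> selfadjoint b ->
  let dl := xi / N.+1%:R in
  E xi a - E xi b =
  \sum_(k < N.+1) E (k%:R * dl) a ** (E dl a - E dl b) ** E ((N - k)%:R * dl) b.
Proof.
move=> sa sb dl.
have -> : xi = N.+1%:R * dl by rewrite /dl mulrC divfK.
rewrite !E_mulrn// vn_pow_telescope; apply: eq_bigr => k _.
by rewrite !E_mulrn.
Qed.

Lemma E_norm3 xi eta a b c : selfadjoint a -> selfadjoint b ->
  rnorm (E xi a ** c ** E eta b) <= rnorm c.
Proof.
move=> sa sb; have -> : rnorm c = 1 * rnorm c * 1 by rewrite mul1r mulr1.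
apply: rnormM_le; last exact: E_norm.
by apply: rnormM_le => //; exact: E_norm.
Qed.

Lemma E_small_diff a b dl (M : R) : selfadjoint a -> selfadjoint b ->
  rnorm a <= M -> rnorm b <= M -> `|dl| * M <= 1 ->
  rnorm (E dl a - E dl b - ('i * dl%:C) *: (a - b)) <= 2%:R * (dl ^+ 2 * M ^+ 2 * expR 1).
Proof.
move=> sa sb aM bM dM; set w := 'i * dl%:C.
have -> : E dl a - E dl b - w *: (a - b) =
  (E dl a - vn_one A - w *: a) - (E dl b - vn_one A - w *: b) by rewrite cscalerBr; zmod.
apply: le_trans (rnormDB _ _) _.
have hb (x : A) : selfadjoint x -> rnorm x <= M ->
    rnorm (E dl x - vn_one A - w *: x) <= dl ^+ 2 * M ^+ 2 * expR 1.
  move=> sx xM; apply: le_trans (E_small _) _.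
    by apply: le_trans dM; rewrite ler_wpM2l.
  rewrite ler_wpM2r ?expR_ge0// exprMn ler_wpM2l ?sqr_ge0//.
  by rewrite ler_pXn2r ?nnegrE ?rnorm_ge0//; apply: le_trans xM; exact: rnorm_ge0.
by have := hb _ sa aM; have := hb _ sb bM; lra.
Qed.

Lemma sqr_step dl N : dl ^+ 2 * N.+1%:R = (dl * N.+1%:R) ^+ 2 / N.+1%:R.
Proof. by rewrite [in RHS]expr2 [dl * _ * (_ * _)]mulrA mulfK ?pnatr_eq0//; ring. Qed.

Lemma step_le1 xi (M : R) N : (Num.truncn (`|xi| * M) <= N)%N ->
  `|xi / N.+1%:R| * M <= 1.
Proof.
move=> h; rewrite normrM normfV normr_nat// mulrAC ler_pdivrMr// mul1r.
apply: ltW; apply: lt_le_trans (truncnS_gt _) _.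
by rewrite ler_nat ltnS.
Qed.

(** The crude expansion with constant e is applied only to steps of length |xi|/(N+1); its total
    error is O(1/N), which leaves the sharp constant. *)
Lemma E_lipschitz xi a b : selfadjoint a -> selfadjoint b ->
  rnorm (E xi a - E xi b) <= `|xi| * rnorm (a - b).
Proof.
move=> sa sb; pose M := Num.max (rnorm a) (rnorm b).
have aM : rnorm a <= M by rewrite le_max lexx.
have bM : rnorm b <= M by rewrite le_max lexx orbT.
apply: (@ler_harmonic _ _ _ (2%:R * (xi ^+ 2 * M ^+ 2 * expR 1)) (Num.truncn (`|xi| * M))) => N hN.
rewrite (E_telescope xi N sa sb); set dl := xi / _.
have hd := step_le1 hN; rewrite -/dl in hd.
have dE : dl * N.+1%:R = xi by rewrite /dl divfK.
have h1 := E_small_diff sa sb aM bM hd.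
have h2 : rnorm (E dl a - E dl b) <= `|dl| * rnorm (a - b) + 2%:R * (dl ^+ 2 * M ^+ 2 * expR 1).
  have := rnormD (E dl a - E dl b - ('i * dl%:C) *: (a - b)) (('i * dl%:C) *: (a - b)).
  by rewrite subrK rnormZ cabsM cabsi cabsR mul1r => *; lra.
apply: le_trans (rnorm_sum _ _ _) _.
apply: (@le_trans _ _ (\sum_(k < N.+1) (`|dl| * rnorm (a - b) + 2%:R * (dl ^+ 2 * M ^+ 2 * expR 1)))).
  by apply: ler_sum => k _; apply: le_trans h2; exact: E_norm3.
rewrite sumr_const card_ord -[leLHS]mulr_natr.
have xE : `|xi| = `|dl| * N.+1%:R by rewrite -dE normrM normr_nat.
have d2 : dl ^+ 2 * N.+1%:R = xi ^+ 2 / N.+1%:R.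
  by rewrite -dE sqr_step.
rewrite le_eqVlt; apply/orP; left; apply/eqP.
transitivity ((`|dl| * N.+1%:R) * rnorm (a - b) + 2%:R * ((dl ^+ 2 * N.+1%:R) * M ^+ 2 * expR 1)); first by ring.
rewrite -xE d2; ring.
Qed.

Lemma E_sub1 xi a : selfadjoint a -> rnorm (E xi a - vn_one A) <= `|xi| * rnorm a.
Proof.
move=> sa; have s0 : selfadjoint (0 : A) by exact: star0.
by have := E_lipschitz xi sa s0; rewrite E_at0 subr0.
Qed.

Lemma E_continuous xi eta a : selfadjoint a ->
  rnorm (E xi a - E eta a) <= `|xi - eta| * rnorm a.
Proof.
move=> sa; have -> : E xi a - E eta a = E eta a ** (E (xi - eta) a - vn_one A).
  by rewrite vmulBr vmul1 -E_add// (_ : eta + (xi - eta) = xi)//; ring.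
rewrite -[leRHS]mul1r; apply: rnormM_le; first exact: E_norm.
exact: E_sub1.
Qed.

Lemma step_mul_le xi N k : (k <= N.+1)%N -> `|k%:R * (xi / N.+1%:R)| <= `|xi|.
Proof.
move=> kN; rewrite mulrCA normrM ler_piMr// ger0_norm ?divr_ge0//.
by rewrite ler_pdivrMr// mul1r ler_nat.
Qed.

Lemma E_second xi a : selfadjoint a ->
  rnorm (E xi a - vn_one A - ('i * xi%:C) *: a) <= xi ^+ 2 * rnorm a ^+ 2.
Proof.
move=> sa; have s0 : selfadjoint (0 : A) by exact: star0.
apply: (@ler_harmonic _ _ _ (xi ^+ 2 * rnorm a ^+ 2 * expR 1) (Num.truncn (`|xi| * rnorm a))) => N hN.
rewrite -(E_at0 xi) (E_telescope xi N sa s0); set dl := xi / _.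
have hd := step_le1 hN; rewrite -/dl in hd.
have dE : xi = dl * N.+1%:R by rewrite /dl divfK.
have -> : ('i * xi%:C) *: a = \sum_(k < N.+1) (('i * dl%:C) *: a).
  rewrite sumr_const card_ord -scaler_nat scalerA; congr (_ *: _).
  by rewrite dE RCM RC_nat; ring.
rewrite -sumrB; apply: le_trans (rnorm_sum _ _ _) _.
have h1 := E_small hd.
apply: (@le_trans _ _ (\sum_(k < N.+1) (`|xi| * `|dl| * rnorm a ^+ 2 + (dl * rnorm a) ^+ 2 * expR 1))).
  apply: ler_sum => k _; rewrite !E_at0 vmul1.
  have -> : E (k%:R * dl) a ** (E dl a - vn_one A) - ('i * dl%:C) *: a =
    (E (k%:R * dl) a - vn_one A) ** (E dl a - vn_one A) + (E dl a - vn_one A - ('i * dl%:C) *: a).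
    by rewrite vmulBl v1mul; zmod.
  apply: le_trans (rnormD _ _) _; apply: lerD => //.
  have -> : `|xi| * `|dl| * rnorm a ^+ 2 = (`|xi| * rnorm a) * (`|dl| * rnorm a) by ring.
  apply: rnormM_le; last exact: E_sub1.
  apply: le_trans (E_sub1 _ sa) _; rewrite ler_wpM2r ?rnorm_ge0//.
  by apply: step_mul_le; apply: ltnW.
rewrite sumr_const card_ord -[leLHS]mulr_natr mulrDl.
have xE : `|xi| = `|dl| * N.+1%:R by rewrite dE normrM normr_nat.
have x2 : xi ^+ 2 = `|xi| * (`|dl| * N.+1%:R) by rewrite -xE -expr2 real_normK ?num_real.
have d2 : dl ^+ 2 * N.+1%:R = xi ^+ 2 / N.+1%:R.
  by rewrite dE sqr_step.
rewrite le_eqVlt; apply/orP; left; apply/eqP.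
transitivity ((`|xi| * (`|dl| * N.+1%:R)) * rnorm a ^+ 2 + (dl ^+ 2 * N.+1%:R) * rnorm a ^+ 2 * expR 1); first by ring.
rewrite -x2 d2; ring.
Qed.

Lemma vmul3_diff (u v w u' v' w' : A) : u ** v ** w - u' ** v' ** w' =
  (u - u') ** v ** w + u' ** (v - v') ** w + u' ** v' ** (w - w').
Proof. rewrite !(vmulBl, vmulBr); zmod. Qed.

Lemma rnorm_mul3 (u v w : A) (k l m : R) : rnorm u <= k -> rnorm v <= l -> rnorm w <= m ->
  rnorm (u ** v ** w) <= k * l * m.
Proof. by move=> *; do 2![apply: rnormM_le => //]. Qed.

(** Both increments are telescoped with the same steps and the products of three factors are
    compared factor by factor: the middle one gives the second difference, the outer ones the
    products of first differences. *)
Lemma E_fourpoint xi a b c d : selfadjoint a -> selfadjoint b -> selfadjoint c -> selfadjoint d ->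
  rnorm (E xi a - E xi b - E xi c + E xi d) <=
  `|xi| * rnorm (a - b - c + d) +
  xi ^+ 2 * (rnorm (a - c) * rnorm (a - b) + rnorm (c - d) * rnorm (b - d)).
Proof.
move=> sa sb sc sd; pose M := Num.max (Num.max (rnorm a) (rnorm b)) (Num.max (rnorm c) (rnorm d)).
have aM : rnorm a <= M by rewrite !le_max lexx.
have bM : rnorm b <= M by rewrite !le_max lexx ?orbT.
have cM : rnorm c <= M by rewrite !le_max lexx ?orbT.
have dM : rnorm d <= M by rewrite !le_max lexx ?orbT.
apply: (@ler_harmonic _ _ _ (4%:R * (xi ^+ 2 * M ^+ 2 * expR 1)) (Num.truncn (`|xi| * M))) => N hN.
have -> : E xi a - E xi b - E xi c + E xi d = (E xi a - E xi b) - (E xi c - E xi d) by zmod.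
rewrite (E_telescope xi N sa sb) (E_telescope xi N sc sd); set dl := xi / _.
have hd := step_le1 hN; rewrite -/dl in hd.
have dE : xi = dl * N.+1%:R by rewrite /dl divfK.
have h1 := E_small_diff sa sb aM bM hd; have h2 := E_small_diff sc sd cM dM hd.
have h3 : rnorm ((E dl a - E dl b) - (E dl c - E dl d)) <=
   `|dl| * rnorm (a - b - c + d) + 4%:R * (dl ^+ 2 * M ^+ 2 * expR 1).
  set w := 'i * dl%:C in h1 h2.
  have -> : (E dl a - E dl b) - (E dl c - E dl d) =
    (E dl a - E dl b - w *: (a - b)) - (E dl c - E dl d - w *: (c - d)) + w *: (a - b - c + d).
    by rewrite !(cscalerBr, cscalerDr); zmod.
  apply: le_trans (rnormD _ _) _; rewrite rnormZ /w cabsM cabsi cabsR mul1r.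
  have := rnormDB (E dl a - E dl b - w *: (a - b)) (E dl c - E dl d - w *: (c - d)).
  by rewrite -/w => *; lra.
rewrite -sumrB; apply: le_trans (rnorm_sum _ _ _) _.
(* The three summands bound the terms of [vmul3_diff], one for each varying factor. *)
pose B := `|xi| * rnorm (a - c) * (`|dl| * rnorm (a - b)) * 1
  + 1 * (`|dl| * rnorm (a - b - c + d) + 4%:R * (dl ^+ 2 * M ^+ 2 * expR 1)) * 1
  + 1 * (`|dl| * rnorm (c - d)) * (`|xi| * rnorm (b - d)).
apply: (@le_trans _ _ (\sum_(k < N.+1) B)).
  apply: ler_sum => k _; rewrite vmul3_diff.
  apply: le_trans (rnormD _ _) _; apply: lerD; first apply: le_trans (rnormD _ _) _.
    apply: lerD; apply: rnorm_mul3 => //; try exact: E_norm; try exact: E_lipschitz.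
    apply: le_trans (E_lipschitz _ _ _) _ => //; rewrite ler_wpM2r ?rnorm_ge0//.
    by apply: step_mul_le; apply: ltnW.
  apply: rnorm_mul3 => //; try exact: E_norm; try exact: E_lipschitz.
  apply: le_trans (E_lipschitz _ _ _) _ => //; rewrite ler_wpM2r ?rnorm_ge0//.
  by apply: step_mul_le; apply: leq_trans (leq_subr _ _) _.
rewrite sumr_const card_ord -[leLHS]mulr_natr /B.
have xE : `|xi| = `|dl| * N.+1%:R by rewrite dE normrM normr_nat.
have x2 : xi ^+ 2 = `|xi| * (`|dl| * N.+1%:R) by rewrite -xE -expr2 real_normK ?num_real.
have d2 : (dl ^+ 2 * N.+1%:R) = xi ^+ 2 / N.+1%:R.
  by rewrite dE sqr_step.
rewrite le_eqVlt; apply/orP; left; apply/eqP.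
transitivity (`|xi| * (`|dl| * N.+1%:R) * (rnorm (a - c) * rnorm (a - b)) +
   (`|dl| * N.+1%:R) * rnorm (a - b - c + d) + 4%:R * ((dl ^+ 2 * N.+1%:R) * M ^+ 2 * expR 1) +
   `|xi| * (`|dl| * N.+1%:R) * (rnorm (c - d) * rnorm (b - d))); first by ring.
rewrite -x2 -xE d2; ring.
Qed.

(** A discrete first order Taylor remainder of the exponential. The sum is the Riemann sum, at the
    nodes k/(N+1), of the integral defining the derivative at y applied to z - y. *)
Definition taylor_step N xi y z : A := E xi z - E xi y -
  \sum_(k < N.+1) ('i * (xi / N.+1%:R)%:C) *:
     (E (k%:R * (xi / N.+1%:R)) y ** (z - y) ** E ((N.+1 - k)%:R * (xi / N.+1%:R)) y).

(** What remains of [taylor_step] after telescoping, up to O(1/N): the quadratic part in z - y. *)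
Let second_sum N xi y z : A := \sum_(k < N.+1) ('i * (xi / N.+1%:R)%:C) *:
     (E (k%:R * (xi / N.+1%:R)) y ** (z - y) **
      (E ((N - k)%:R * (xi / N.+1%:R)) z - E ((N - k)%:R * (xi / N.+1%:R)) y)).

(** Collects the constants of the O(1/N) errors, which disappear in the limit. *)
Definition taylor_const y z : R := rnorm z ^+ 2 + rnorm y ^+ 2 + rnorm y * rnorm (z - y).

Let taylor_stepE N xi y z : selfadjoint y -> selfadjoint z ->
  rnorm (taylor_step N xi y z - second_sum N xi y z) <= xi ^+ 2 * taylor_const y z / N.+1%:R.
Proof.
move=> sy sz; rewrite /taylor_step /second_sum.
have -> : E xi z - E xi y = - (E xi y - E xi z) by rewrite opprB.
rewrite (E_telescope xi N sy sz); set dl := xi / _.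
have dE : xi = dl * N.+1%:R by rewrite /dl divfK.
rewrite -sumrN -!sumrB; apply: le_trans (rnorm_sum _ _ _) _.
apply: (@le_trans _ _ (\sum_(k < N.+1) (dl ^+ 2 * taylor_const y z))); last first.
  rewrite sumr_const card_ord -[leLHS]mulr_natr dE.
  by rewrite [leRHS]mulrAC -sqr_step mulrAC.
apply: ler_sum => k _.
have kN : (k <= N)%N by rewrite -ltnS.
set w := 'i * dl%:C; set U := E (k%:R * dl) y; set Z := E ((N - k)%:R * dl) z.
set Y := E ((N - k)%:R * dl) y.
(* Riemann nodes leave N + 1 - k steps on the right while telescoping leaves N - k; the extra factor
   differs from the unit by O(1/N). *)
have -> : E ((N.+1 - k)%:R * dl) y = Y ** E dl y.
  by rewrite /Y -E_add//; congr (E _ y); rewrite subSn// -addn1 natrD mulrDl mul1r.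
have -> : - (U ** (E dl y - E dl z) ** Z) - w *: (U ** (z - y) ** (Y ** E dl y))
    - w *: (U ** (z - y) ** (Z - Y)) =
  U ** ((E dl z - vn_one A - w *: z) - (E dl y - vn_one A - w *: y)) ** Z
  - w *: (U ** (z - y) ** (Y ** (E dl y - vn_one A))).
  rewrite !(vmulBl, vmulBr, vmulZl, vmulZr, cscalerBr, vmul1, vmulA); zmod.
apply: le_trans (rnormDB _ _) _.
have h1 : rnorm (U ** ((E dl z - vn_one A - w *: z) - (E dl y - vn_one A - w *: y)) ** Z)
    <= dl ^+ 2 * rnorm z ^+ 2 + dl ^+ 2 * rnorm y ^+ 2.
  apply: le_trans (E_norm3 _ _ _ sy sz) _; apply: le_trans (rnormDB _ _) _.
  by apply: lerD; exact: E_second.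
have h2 : rnorm (w *: (U ** (z - y) ** (Y ** (E dl y - vn_one A)))) <=
    `|dl| * (1 * rnorm (z - y) * (1 * (`|dl| * rnorm y))).
  rewrite rnormZ /w cabsM cabsi cabsR mul1r ler_wpM2l//.
  apply: rnorm_mul3 => //; first exact: E_norm.
  by apply: rnormM_le; [exact: E_norm|exact: E_sub1].
apply: le_trans (lerD h1 h2) _; rewrite /taylor_const -[in leRHS](@real_normK _ dl) ?num_real//.
by rewrite -[in leLHS](@real_normK _ dl) ?num_real// le_eqVlt; apply/orP; left; apply/eqP; ring.
Qed.

Lemma rnorm_sum_const N (F : 'I_N.+1 -> A) (B : R) :
  (forall i, rnorm (F i) <= B) -> rnorm (\sum_i F i) <= B * N.+1%:R.
Proof.
move=> h; apply: le_trans (rnorm_sum _ _ _) _.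
apply: (@le_trans _ _ (\sum_(k < N.+1) B)); first exact: ler_sum.
by rewrite sumr_const card_ord mulr_natr.
Qed.

Lemma taylor_step_norm N xi y z : selfadjoint y -> selfadjoint z ->
  rnorm (taylor_step N xi y z) <=
    xi ^+ 2 * rnorm (z - y) ^+ 2 + xi ^+ 2 * taylor_const y z / N.+1%:R.
Proof.
move=> sy sz; rewrite -(subrK (second_sum N xi y z) (taylor_step _ _ _ _)) addrC.
apply: le_trans (rnormD _ _) _; apply: lerD; last exact: taylor_stepE.
rewrite /second_sum; set dl := xi / _.
have xE : `|dl| * N.+1%:R = `|xi| by rewrite /dl normrM normfV normr_nat// divfK.
have -> : xi ^+ 2 * rnorm (z - y) ^+ 2 = `|dl| * (1 * rnorm (z - y) * (`|xi| * rnorm (z - y))) * N.+1%:R.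
  transitivity (`|xi| * (`|dl| * N.+1%:R) * rnorm (z - y) ^+ 2); last by ring.
  by rewrite xE -expr2 real_normK ?num_real.
apply: rnorm_sum_const => k; rewrite rnormZ cabsM cabsi cabsR mul1r ler_wpM2l//.
apply: rnorm_mul3 => //; first exact: E_norm.
apply: le_trans (E_lipschitz _ _ _) _ => //; rewrite ler_wpM2r ?rnorm_ge0//.
by apply: step_mul_le; apply: leq_trans (leq_subr _ _) _.
Qed.

(** The cube of |xi| appears here: the four-point estimate costs xi^2 and the prefactor of the
    derivative another |xi|. *)
Lemma taylor_step_diff N xi y z y' z' :
  selfadjoint y -> selfadjoint z -> selfadjoint y' -> selfadjoint z' ->
  rnorm (taylor_step N xi y z - taylor_step N xi y' z') <=
   `|xi| ^+ 3 * (rnorm (y - y') * rnorm (z - y) ^+ 2 + rnorm (z' - y') *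
      (rnorm (z - z') * rnorm (z - y) + rnorm (z' - y') * rnorm (y - y')))
   + xi ^+ 2 * (rnorm ((z - y) - (z' - y')) * (rnorm (z - y) + rnorm (z' - y')))
   + xi ^+ 2 * (taylor_const y z + taylor_const y' z') / N.+1%:R.
Proof.
move=> sy sz sy' sz'; set h := z - y; set h' := z' - y'.
have -> : taylor_step N xi y z - taylor_step N xi y' z' =
  (second_sum N xi y z - second_sum N xi y' z') +
  ((taylor_step N xi y z - second_sum N xi y z) - (taylor_step N xi y' z' - second_sum N xi y' z')) by zmod.
apply: le_trans (rnormD _ _) _; apply: lerD; last first.
  apply: le_trans (rnormDB _ _) _; rewrite mulrDr mulrDl.
  by apply: lerD; exact: taylor_stepE.
rewrite /second_sum -sumrB -/h -/h'; set dl := xi / _.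
have xE : `|dl| * N.+1%:R = `|xi| by rewrite /dl normrM normfV normr_nat// divfK.
have x2 : xi ^+ 2 = `|xi| ^+ 2 by rewrite real_normK ?num_real.
pose B := `|dl| * (`|xi| * rnorm (y - y') * rnorm h * (`|xi| * rnorm h)
  + 1 * rnorm (h - h') * (`|xi| * rnorm h)
  + 1 * rnorm h' * (`|xi| * rnorm (h - h') + `|xi| ^+ 2 * (rnorm (z - z') * rnorm h + rnorm h' * rnorm (y - y')))).
have -> : `|xi| ^+ 3 * (rnorm (y - y') * rnorm h ^+ 2
     + rnorm h' * (rnorm (z - z') * rnorm h + rnorm h' * rnorm (y - y')))
   + xi ^+ 2 * (rnorm (h - h') * (rnorm h + rnorm h')) = B * N.+1%:R.
  rewrite /B [in RHS](_ : forall t, `|dl| * t * N.+1%:R = `|dl| * N.+1%:R * t) ?xE ?x2; first by ring.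
  by move=> t; rewrite -xE; ring.
apply: rnorm_sum_const => k; rewrite -scalerBr rnormZ cabsM cabsi cabsR mul1r ler_wpM2l//.
have kN : (N - k <= N.+1)%N by apply: leq_trans (leq_subr _ _) _.
have hE a b m : (m <= N.+1)%N -> selfadjoint a -> selfadjoint b ->
    rnorm (E (m%:R * dl) a - E (m%:R * dl) b) <= `|xi| * rnorm (a - b).
  move=> mN sa sb; apply: le_trans (E_lipschitz _ sa sb) _.
  by rewrite ler_wpM2r ?rnorm_ge0//; exact: step_mul_le.
rewrite vmul3_diff; apply: le_trans (rnormD _ _) _; apply: lerD.
  apply: le_trans (rnormD _ _) _; apply: lerD; apply: rnorm_mul3 => //; try exact: hE; try exact: E_norm.
  by apply: hE => //; exact: ltnW.
apply: rnorm_mul3 => //; first exact: E_norm.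
have -> : forall p q r s : A, p - q - (r - s) = p - q - r + s by move=> *; zmod.
apply: le_trans (E_fourpoint _ sz sy sz' sy') _.
have hx : `|(N - k)%:R * dl| <= `|xi| by exact: step_mul_le.
have -> : z - y - z' + y' = h - h' by rewrite /h /h'; zmod.
apply: lerD; first by rewrite ler_wpM2r ?rnorm_ge0.
apply: ler_pM; rewrite ?sqr_ge0 ?addr_ge0 ?mulr_ge0 ?rnorm_ge0//.
by rewrite -(@real_normK _ (_ * dl)) ?num_real// ler_pXn2r ?nnegrE.
Qed.

End ExponentialEstimates.

(** * Bochner integrals *)

Section StronglyMeasurable.
Context d (T : measurableType d) (R : realType).

(* [simple_value], for vectors that need not live in a complete space. *)
Definition lval (V : normedModType R[i]) (s : seq (set T * V)) (x : T) : V :=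
  \sum_(p <- s) (\1_(p.1) x : R)%:C *: p.2.

Definition mlist (V : normedModType R[i]) (s : seq (set T * V)) : Prop :=
  forall p, p \in s -> measurable p.1.

(** Convergence holds everywhere, not almost everywhere, so that sums, products and images under
    continuous additive maps involve no null sets and the notion does not depend on a measure. *)
Definition smeas (V : normedModType R[i]) (F : T -> V) : Prop :=
  exists s : nat -> seq (set T * V), (forall n, mlist (s n)) /\
    forall x e, 0 < e -> exists N, forall n, (N <= n)%N -> rnorm (lval (s n) x - F x) <= e.

Lemma mlist_cons (V : normedModType R[i]) (p : set T * V) s :
  mlist (p :: s) <-> measurable p.1 /\ mlist s.
Proof.
split=> [h|[h1 h2] q]; last by rewrite inE => /predU1P[->|/h2].
by split=> [|q qs]; apply: h; rewrite inE ?eqxx ?qs ?orbT.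
Qed.

Lemma mlist_cat (V : normedModType R[i]) (s t : seq (set T * V)) :
  mlist s -> mlist t -> mlist (s ++ t).
Proof. by move=> hs ht p; rewrite mem_cat => /orP[/hs|/ht]. Qed.

Lemma lval_cons (V : normedModType R[i]) (p : set T * V) s x :
  lval (p :: s) x = (if x \in p.1 then p.2 else 0) + lval s x.
Proof.
rewrite /lval big_cons indicE; case: (x \in p.1); first by rewrite scale1r.
by rewrite (_ : 0%:R%:C = 0)// scale0r.
Qed.

Lemma lval_cat (V : normedModType R[i]) (s t : seq (set T * V)) x :
  lval (s ++ t) x = lval s x + lval t x.
Proof. by rewrite /lval big_cat. Qed.

Definition lmap (V W : normedModType R[i]) (L : V -> W) (s : seq (set T * V)) :=
  [seq (p.1, L p.2) | p <- s].

Lemma lval_map (V W : normedModType R[i]) (L : V -> W) s x :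
  (forall u v, L (u + v) = L u + L v) -> lval (lmap L s) x = L (lval s x).
Proof.
move=> hL; elim: s => [|p s ih]; first by rewrite /lval !big_nil (additive0 hL).
rewrite /= !lval_cons /= ih hL; congr (_ + _).
by case: (x \in p.1) => //; rewrite (additive0 hL).
Qed.

Lemma mlist_map (V W : normedModType R[i]) (L : V -> W) s : mlist s -> mlist (lmap L s).
Proof. by move=> h _ /mapP[p /h ? ->]. Qed.

Definition lprod (V : normedModType R[i]) (c : seq (set T * R[i]^o)) (s : seq (set T * V)) :=
  [seq (p.1 `&` q.1, (p.2 : R[i]) *: q.2) | p <- c, q <- s].

Lemma lval_prod (V : normedModType R[i]) c (s : seq (set T * V)) x :
  lval (lprod c s) x = (lval c x : R[i]) *: lval s x.
Proof.
elim: c => [|p c ih]; first by rewrite /lval !big_nil scale0r.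
rewrite /lprod allpairs_cons lval_cat ih lval_cons scalerDl; congr (_ + _).
elim: s {ih} => [|q s ih]; first by rewrite /lval !big_nil scaler0.
rewrite /= !lval_cons /= ih scalerDr; congr (_ + _).
by rewrite in_setI; case: (x \in p.1) => /=; case: (x \in q.1); rewrite ?scale0r ?scaler0.
Qed.

Lemma mlist_prod (V : normedModType R[i]) c (s : seq (set T * V)) :
  mlist c -> mlist s -> mlist (lprod c s).
Proof. by move=> hc hs _ /allpairsP[[p q] /= [/hc ? /hs ? ->]]; exact: measurableI. Qed.

Lemma smeas_add (V : normedModType R[i]) (F G : T -> V) : smeas F -> smeas G ->
  smeas (fun x => F x + G x).
Proof.
move=> [s [ms hs]] [t [mt ht]]; exists (fun n => s n ++ t n); split.
  by move=> n; exact: mlist_cat.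
move=> x e e0; have e2 : 0 < e / 2%:R by rewrite divr_gt0.
have [N1 h1] := hs x _ e2; have [N2 h2] := ht x _ e2; exists (maxn N1 N2) => n.
rewrite geq_max => /andP[/h1 k1 /h2 k2]; rewrite lval_cat.
have -> : lval (s n) x + lval (t n) x - (F x + G x) =
  (lval (s n) x - F x) + (lval (t n) x - G x) by zmod.
by apply: le_trans (rnormD _ _) _; lra.
Qed.

Lemma smeas_map (V W : normedModType R[i]) (L : V -> W) (F : T -> V) :
  (forall u v, L (u + v) = L u + L v) -> continuous L -> smeas F -> smeas (L \o F).
Proof.
move=> hL /continuous_rnormP cL [s [ms hs]]; exists (fun n => lmap L (s n)); split.
  by move=> n; exact: mlist_map.
move=> x e e0; have [dl dl0 hdl] := cL (F x) e e0.
have [N hN] := hs x _ dl0; exists N => n /hN h; rewrite lval_map//=.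
by rewrite rnormB; apply: hdl; rewrite rnormB.
Qed.

Lemma smeas_scale (V : normedModType R[i]) (c : T -> R[i]^o) (F : T -> V) :
  smeas c -> smeas F -> smeas (fun x => (c x : R[i]) *: F x).
Proof.
move=> [s [ms hs]] [t [mt ht]]; exists (fun n => lprod (s n) (t n)); split.
  by move=> n; exact: mlist_prod.
move=> x e e0; set K := cabs (c x) + rnorm (F x) + 1.
have K0 : 0 < K by rewrite ltr_wpDl ?addr_ge0 ?cabs_ge0 ?rnorm_ge0.
pose dl := Num.min 1 (e / (2%:R * K)).
have dl0 : 0 < dl by rewrite lt_min ltr01 divr_gt0// mulr_gt0.
have [N1 h1] := hs x _ dl0; have [N2 h2] := ht x _ dl0; exists (maxn N1 N2) => n.
rewrite geq_max => /andP[/h1 k1 /h2 k2]; rewrite lval_prod.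
set u := lval (s n) x in k1 *; set v := lval (t n) x in k2 *.
have -> : (u : R[i]) *: v - (c x : R[i]) *: F x =
    (u - c x : R[i]) *: v + (c x : R[i]) *: (v - F x).
  by rewrite scalerBr scalerBl addrA subrK.
have vb : rnorm v <= rnorm (F x) + 1.
  have := rnormD (v - F x) (F x); rewrite subrK => h; apply: le_trans h _.
  by rewrite addrC lerD2l; apply: le_trans k2 _; rewrite /dl ge_min lexx.
apply: le_trans (rnormD _ _) _; rewrite !rnormZ.
have k3 : cabs (u - c x) * rnorm v <= dl * (rnorm (F x) + 1).
  by apply: ler_pM; rewrite ?cabs_ge0 ?rnorm_ge0.
have k4 : cabs (c x) * rnorm (v - F x) <= cabs (c x) * dl.
  by apply: ler_wpM2l; rewrite ?cabs_ge0.
apply: le_trans (lerD k3 k4) _.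
have -> : dl * (rnorm (F x) + 1) + cabs (c x) * dl = dl * K by rewrite /K; ring.
apply: (@le_trans _ _ (e / (2%:R * K) * K)).
  by apply: ler_wpM2r; [exact: ltW|rewrite /dl ge_min lexx orbT].
by rewrite invfM mulrA mulfVK ?gt_eqF//; lra.
Qed.

(** One partition by the values of h serves every G, in every space: on each cell the simple
    function takes the value of G at a point close to h. *)
Lemma grid_exists (h : T -> R) (n : nat) : measurable_fun setT h ->
  exists l : seq (set T * R), (forall p, p \in l -> measurable p.1) /\
    forall x, `|h x| < n.+1%:R -> exists a : R, `|h x - a| <= n.+1%:R^-1 /\
      forall (V : normedModType R[i]) (G : R -> V),
        lval [seq (p.1, G p.2) | p <- l] x = G a.
Proof.
move=> mh; set M := n.+1; have M0 : 0 < M%:R :> R by rewrite ltr0n.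
(* A grid of mesh 1/M on [-M, M[, hence 2 M^2 cells. *)
pose a (j : nat) : R := (j%:R - (M * M)%:R) / M%:R.
pose B j := [set x | a j <= h x < a j.+1].
exists [seq (B j, a j) | j <- iota 0 (2 * (M * M))]; split.
  move=> _ /mapP[j _ ->] /=.
  have -> : B j = setT `&` (h @^-1` `[a j, a j.+1[).
    by rewrite setTI; apply/seteqP; split => x /=; rewrite in_itv.
  by apply: mh => //; exact: measurable_itv.
move=> x hx; pose w := h x * M%:R + (M * M)%:R.
have w0 : 0 <= w.
  rewrite /w natrM -mulrDl mulr_ge0// -lerBlDr sub0r; apply: ltW.
  by move: hx; rewrite ltr_norml => /andP[].
pose j0 := Num.truncn w.
have := @truncn_itv R w w0; rewrite -/j0 => /andP[j1 j2].
have aE j : (a j <= h x < a j.+1) = (j == j0).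
  rewrite /a ler_pdivrMr// ltr_pdivlMr// lerBlDr ltrBrDr -/w.
  apply/idP/eqP => [/andP[i1 i2]|->]; last by rewrite j1 j2.
  apply/eqP; rewrite eqn_leq; apply/andP; split; rewrite -ltnS -(@ltr_nat R).
    exact: le_lt_trans i1 j2.
  exact: le_lt_trans j1 i2.
have j0b : (j0 < 2 * (M * M))%N.
  rewrite -(@ltr_nat R); apply: le_lt_trans j1 _.
  rewrite /w mul2n -addnn natrD ltrD2r natrM ltr_pM2r//.
  by apply: le_lt_trans hx; exact: ler_norm.
exists (a j0); split.
  have /andP[b1 b2] : a j0 <= h x < a j0.+1 by rewrite aE.
  rewrite ger0_norm ?subr_ge0// lerBlDl; apply: (le_trans (ltW b2)).
  by rewrite /a -[j0.+1]addn1 natrD addrAC mulrDl div1r.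
move=> V G; rewrite /lval !big_map (bigD1_seq j0) ?mem_iota ?iota_uniq//=.
rewrite indicE mem_set; last by rewrite /B /= aE eqxx.
rewrite scale1r big1 ?addr0// => j jj0; rewrite indicE memNset ?scale0r//.
by rewrite /B /= aE; exact/negP.
Qed.

Lemma inv_succ_le (r : R) n : 0 < r -> (Num.truncn r^-1 <= n)%N -> n.+1%:R^-1 <= r.
Proof.
move=> r0 h; rewrite -[leRHS]invrK lef_pV2 ?posrE ?invr_gt0//; apply: ltW.
by apply: lt_le_trans (truncnS_gt _) _; rewrite ler_nat ltnS.
Qed.

Lemma smeas_comp (V : normedModType R[i]) (h : T -> R) (G : R -> V) :
  measurable_fun setT h ->
  (forall x e, 0 < e -> exists2 dl, 0 < dl & forall y, `|x - y| <= dl -> rnorm (G x - G y) <= e) ->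
  smeas (G \o h).
Proof.
move=> mh cG; have /choice[l hl] := fun n => grid_exists n mh.
exists (fun n => [seq (p.1, G p.2) | p <- l n]); split.
  by move=> n _ /mapP[p pl ->]; exact: (hl n).1.
move=> x e e0; have [dl dl0 hdl] := cG (h x) e e0.
exists (maxn (Num.truncn `|h x|) (Num.truncn dl^-1)) => n; rewrite geq_max => /andP[n1 n2].
have [|a [ha hG]] := (hl n).2 x.
  by apply: lt_le_trans (truncnS_gt _) _; rewrite ler_nat ltnS.
rewrite hG rnormB; apply: hdl; apply: le_trans ha _; exact: inv_succ_le.
Qed.

Lemma smeas_cst (V : normedModType R[i]) (v : V) : smeas (fun _ : T => v).
Proof.
apply: (@smeas_comp _ (fun=> 0) (fun=> v)); first exact: measurable_cst.
by move=> x e e0; exists 1 => // y _; rewrite subrr rnorm0 ltW.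
Qed.

Lemma smeas_complex (c : T -> R[i]) :
  measurable_fun setT (fun x => complex.Re (c x)) ->
  measurable_fun setT (fun x => complex.Im (c x)) -> smeas (c : T -> R[i]^o).
Proof.
move=> m1 m2.
have -> : (c : T -> R[i]^o) = (fun x => ((fun r : R => r%:C : R[i]^o) \o (fun x => complex.Re (c x))) x
   + ((fun r : R => 'i * r%:C : R[i]^o) \o (fun x => complex.Im (c x))) x).
  apply/funext => x /=; case: (c x) => u v /=.
  by apply/eqP; rewrite eq_complex /=; apply/andP; split; apply/eqP; ring.
apply: smeas_add; apply: smeas_comp => // x e e0; exists e => // y; apply: le_trans.
  by rewrite -RCB -cabsR.
by rewrite -mulrBr -RCB -[leRHS]mul1r -cabsi -cabsR -cabsM.
Qed.

Section Norm.
Context (V : normedModType R[i]).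
Implicit Types (F G : T -> V).

(** A simple function takes finitely many values, so [psi] may be arbitrary; the vector v
    accumulates the contribution of the sets already examined. *)
Lemma measurable_lval (psi : V -> R) v s : mlist s ->
  measurable_fun setT (fun x => psi (v + lval s x)).
Proof.
elim: s v => [|p s ih] v hs.
  have -> : (fun x => psi (v + lval [::] x)) = cst (psi v).
    by apply/funext => x; rewrite /lval big_nil addr0.
  exact: measurable_cst.
have [mp ms] := (mlist_cons _ _).1 hs.
have -> : (fun x => psi (v + lval (p :: s) x)) =
   (fun x => if x \in p.1 then psi ((v + p.2) + lval s x) else psi (v + lval s x)).
  apply/funext => x; rewrite lval_cons; case: (x \in p.1); first by rewrite addrA.
  by rewrite add0r.
apply: measurable_fun_ifT; [|exact: ih|exact: ih].
apply: (measurable_fun_bool true); rewrite setTI.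
have -> : (fun x => x \in p.1) @^-1` [set true] = p.1.
  by apply/seteqP; split => x /=; [move/set_mem|move/mem_set].
by [].
Qed.

Lemma smeas_norm F : smeas F -> measurable_fun setT (fun x => rnorm (F x)).
Proof.
move=> [s [ms hs]]; apply: (@measurable_fun_cvg _ _ _ _ (fun n x => rnorm (0 + lval (s n) x))).
  by move=> n; exact: measurable_lval.
move=> x _; apply/cvgrPdist_le => e e0; have [N hN] := hs x e e0; exists N => // n /hN h /=.
rewrite add0r; apply: le_trans h; rewrite ler_norml.
have := rnormD (lval (s n) x - F x) (F x); rewrite subrK => k1.
have := rnormD (F x - lval (s n) x) (lval (s n) x); rewrite subrK (rnormB (F x)) => k2.
by apply/andP; split; lra.
Qed.

Lemma smeas_lval s : mlist s -> smeas (lval s : T -> V).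
Proof.
move=> hs; exists (fun=> s); split=> // x e e0; exists 0 => n _.
by rewrite subrr rnorm0 ltW.
Qed.

Lemma smeas_opp F : smeas F -> smeas (fun x => - F x).
Proof.
apply: (@smeas_map V V -%R F); first by move=> u v; rewrite opprD.
by apply: (@lipschitz_continuous _ _ _ _ 1) => x y; rewrite mul1r -opprD rnormN.
Qed.

Lemma smeas_sub F G : smeas F -> smeas G -> smeas (fun x => F x - G x).
Proof. by move=> hF hG; apply: smeas_add => //; exact: smeas_opp. Qed.

End Norm.
End StronglyMeasurable.

(** * Bochner integrals over sets of finite measure *)

Section BochnerTheory.
Context d (T : measurableType d) (R : realType).
Context (m : {measure set T -> \bar R}) (D : set T).
Hypothesis mD : measurable D.
Hypothesis fD : (m D < +oo)%E.

Local Notation "'inte' h" := (\int[m]_(x in D) (h x)%:E)%E (at level 10, h at level 9).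

Lemma measure_sub_fin B : measurable B -> (m (D `&` B) < +oo)%E.
Proof.
move=> mB; apply: le_lt_trans fD; apply: le_measure; rewrite ?inE//.
exact: measurableI.
Qed.

Section Space.
Context (V : completeNormedModType R[i]).
Implicit Types (F G : T -> V) (v w : V) (s : seq (set T * V)).

Lemma lvalE s x : simple_value s x = lval s x.
Proof. by []. Qed.

Lemma inte_ge0 F : (0 <= inte (fun x => rnorm (F x)))%E.
Proof. by apply: integral_ge0 => x _; rewrite lee_fin rnorm_ge0. Qed.

(** The sets of the list may overlap. The induction splits the domain B along the first of them and
    stores its vector in v, so no disjoint representation is ever built. *)
Lemma simple_norm_le_aux (B : set T) s v : measurable B -> B `<=` D -> mlist s ->
  ((rnorm ((fine (m B))%:C *: v + \sum_(p <- s) (fine (m (B `&` p.1)))%:C *: p.2))%:E <=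
   \int[m]_(x in B) (rnorm (v + lval s x))%:E)%E.
Proof.
have fB B' : measurable B' -> B' `<=` D -> m B' \is a fin_num.
  move=> mB' B'D; rewrite ge0_fin_numE//; apply: le_lt_trans fD.
  by apply: le_measure; rewrite ?inE.
elim: s B v => [|p s ih] B v mB BD hs.
  rewrite big_nil addr0 rnormZR ger0_norm ?fine_ge0//.
  under eq_integral do rewrite /lval big_nil addr0.
  by rewrite integral_cst// EFinM fineK ?fB// muleC.
have [mp ms] := (mlist_cons _ _).1 hs.
pose B1 := B `&` p.1; pose B2 := B `\` p.1.
have mB1 : measurable B1 by exact: measurableI.
have mB2 : measurable B2 by exact: measurableD.
have B12 : [disjoint B1 & B2].
  by apply/disj_setPS => x [[_ h1] [_ h2]].
have BE : B = B1 `|` B2 by rewrite /B1 /B2 setUIDK.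
have B1D : B1 `<=` D by apply: subset_trans BD => x [].
have B2D : B2 `<=` D by apply: subset_trans BD => x [].
have mU (A C : set T) : measurable A -> measurable C -> A `<=` D -> C `<=` D -> [disjoint A & C] ->
   fine (m (A `|` C)) = fine (m A) + fine (m C).
  move=> mA mC AD CD AC; rewrite measureU//; last exact/eqP.
  by rewrite fineD ?fB.
have h1 := ih B1 (v + p.2) mB1 B1D ms; have h2 := ih B2 v mB2 B2D ms.
have mf B' w s' : measurable B' -> mlist s' -> measurable_fun B' (fun x => (rnorm (w + lval s' x))%:E).
  move=> mB' ms'; apply/measurable_EFinP; apply: measurable_funTS.
  exact: (measurable_lval (@rnorm R V)).
rewrite [in leRHS]BE ge0_integral_setU//; last 2 first.
- by apply: mf => //; rewrite -BE.
- by move=> x _; rewrite lee_fin rnorm_ge0.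
have e1 : (\int[m]_(x in B1) (rnorm (v + lval (p :: s) x))%:E =
  \int[m]_(x in B1) (rnorm (v + p.2 + lval s x))%:E)%E.
  apply: eq_integral => x /set_mem[_ xp]; rewrite lval_cons mem_set// addrA.
  by [].
have e2 : (\int[m]_(x in B2) (rnorm (v + lval (p :: s) x))%:E =
  \int[m]_(x in B2) (rnorm (v + lval s x))%:E)%E.
  by apply: eq_integral => x /set_mem[_ xp]; rewrite lval_cons memNset// add0r.
rewrite e1 e2; apply: le_trans (leeD h1 h2); rewrite -EFinD lee_fin.
apply: le_trans (rnormD _ _).
rewrite le_eqVlt; apply/orP; left; apply/eqP; congr rnorm.
rewrite big_cons -/B1 {1}BE mU// RCD scalerDl scalerDr.
have -> : \sum_(q <- s) (fine (m (B `&` q.1)))%:C *: q.2 =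
  \sum_(q <- s) (fine (m (B1 `&` q.1)))%:C *: q.2 + \sum_(q <- s) (fine (m (B2 `&` q.1)))%:C *: q.2.
  rewrite -big_split /= big_seq [RHS]big_seq; apply: eq_bigr => q qs.
  have mq : measurable q.1 by exact: ms.
  rewrite -scalerDl -RCD {1}BE setIUl mU//; try exact: measurableI.
  - by move=> x [/B1D].
  - by move=> x [/B2D].
  - by apply/disj_setPS => x [[[_ k1] _] [[_ k2] _]].
zmod.
Qed.

Lemma simple_norm_le s : mlist s ->
  ((rnorm (simple_integral m D s))%:E <= inte (fun x => rnorm (lval s x)))%E.
Proof.
move=> hs; have := simple_norm_le_aux 0 mD (@subset_refl _ D) hs.
by rewrite scaler0 add0r; under eq_integral do rewrite add0r.
Qed.

Lemma simple_integral_cat s t :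
  simple_integral m D (s ++ t) = simple_integral m D s + simple_integral m D t.
Proof. by rewrite /simple_integral big_cat. Qed.

Lemma simple_integral_map (W : completeNormedModType R[i]) (L : V -> W) s :
  (forall u v, L (u + v) = L u + L v) -> (forall (r : R) u, L (r%:C *: u) = r%:C *: L u) ->
  simple_integral m D (lmap L s) = L (simple_integral m D s).
Proof.
move=> hD hZ; rewrite /simple_integral big_map.
elim/big_rec2: _ => [|p u w _ ->]; first by rewrite (additive0 hD).
by rewrite hD hZ.
Qed.

Lemma simple_integral_opp s : simple_integral m D (lmap -%R s) = - simple_integral m D s.
Proof.
by apply: simple_integral_map => *; rewrite ?opprD// scalerN.
Qed.

Lemma lval_opp s x : lval (lmap -%R s) x = - lval s x.
Proof. by apply: lval_map => u v; rewrite opprD. Qed.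

Lemma le_inte (h k : T -> R) : measurable_fun setT h -> measurable_fun setT k ->
  (forall x, 0 <= h x <= k x) -> (inte h <= inte k)%E.
Proof.
move=> mh mk hk; apply: ge0_le_integral => //.
- by move=> x _; rewrite lee_fin; case/andP: (hk x).
- by apply/measurable_EFinP; exact: measurable_funTS.

- by apply/measurable_EFinP; exact: measurable_funTS.
- by move=> x _; rewrite lee_fin; case/andP: (hk x).
Qed.

Lemma inteD (h k : T -> R) : measurable_fun setT h -> measurable_fun setT k ->
  (forall x, 0 <= h x) -> (forall x, 0 <= k x) ->
  (inte (fun x => (h x + k x)%R) = inte h + inte k)%E.
Proof.
move=> mh mk h0 k0; rewrite -ge0_integralD//.
- by move=> x _; rewrite lee_fin.
- by apply/measurable_EFinP; exact: measurable_funTS.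
- by move=> x _; rewrite lee_fin.
- by apply/measurable_EFinP; exact: measurable_funTS.
Qed.

Lemma inteZ (h : T -> R) (c : R) : measurable_fun setT h -> (forall x, 0 <= h x) -> 0 <= c ->
  (inte (fun x => (c * h x)%R) = c%:E * inte h)%E.
Proof.
move=> mh h0 c0; rewrite -ge0_integralZl_EFin//.
- by move=> x _; rewrite lee_fin.
- by apply/measurable_EFinP; exact: measurable_funTS.
Qed.

Lemma ecvg0_le (u : nat -> \bar R) (e : R) : 0 < e -> u n @[n --> \oo] --> 0%E ->
  exists N, forall n, (N <= n)%N -> (u n <= e%:E)%E.
Proof.
move=> e0 /fine_cvgP[[N1 _ f1] /cvgrPdist_le /(_ e e0)[N2 _ f2]].
exists (maxn N1 N2) => n; rewrite geq_max => /andP[/f1 /= h1 /f2 /= h2].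
rewrite -(fineK h1) lee_fin; move: h2; rewrite sub0r normrN.
by apply: le_trans; exact: ler_norm.
Qed.

(** Contains both uniqueness of the integral, with F = G, and the norm bound, with G = 0. *)
Lemma is_bochner_dist F G v w : smeas F -> smeas G ->
  is_bochner m D F v -> is_bochner m D G w ->
  ((rnorm (v - w))%:E <= inte (fun x => rnorm (F x - G x)))%E.
Proof.
move=> sF sG [s [ms _ s0 sv]] [t [mt _ t0 tw]].
have mls n : mlist (s n) by move=> p /ms[].
have mlt n : mlist (t n) by move=> p /mt[].
set I := (\int[m]_(x in D) (rnorm (F x - G x))%:E)%E; have I0 : (0 <= I)%E by exact: inte_ge0.
have [->|Ify] := eqVneq I +oo%E; first by rewrite leey.
have If : I \is a fin_num by rewrite ge0_fin_numE// lt_neqAle Ify leey.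
rewrite -(fineK If) lee_fin; apply: ler_eps => e e0.
have e4 : 0 < e / 4%:R by rewrite divr_gt0.
move/cvg_rnormP : sv => /(_ _ e4)[N1 h1]; move/cvg_rnormP : tw => /(_ _ e4)[N2 h2].
have [N3 h3] := ecvg0_le e4 s0; have [N4 h4] := ecvg0_le e4 t0.
pose n := maxn (maxn N1 N2) (maxn N3 N4).
have {}h1 := h1 n ltac:(by rewrite /n !leq_max leqnn).
have {}h2 := h2 n ltac:(by rewrite /n !leq_max leqnn orbT).
have {}h3 := h3 n ltac:(by rewrite /n !leq_max leqnn !orbT).
have {}h4 := h4 n ltac:(by rewrite /n !leq_max leqnn !orbT).
have mS : measurable_fun setT (fun x => rnorm (F x - lval (s n) x)).
  by apply: smeas_norm; apply: smeas_sub => //; exact: smeas_lval.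
have mT : measurable_fun setT (fun x => rnorm (G x - lval (t n) x)).
  by apply: smeas_norm; apply: smeas_sub => //; exact: smeas_lval.
have mI : measurable_fun setT (fun x => rnorm (F x - G x)).
  by apply: smeas_norm; exact: smeas_sub.
have key : ((rnorm (simple_integral m D (s n) - simple_integral m D (t n)))%:E <=
   (e / 4%:R)%:E + I + (e / 4%:R)%:E)%E.
  rewrite -simple_integral_opp -simple_integral_cat.
  apply: (le_trans (simple_norm_le _)).
    by apply: mlist_cat => //; exact: mlist_map.
  apply: (@le_trans _ _ (inte (fun x => (rnorm (F x - lval (s n) x) + rnorm (F x - G x) + rnorm (G x - lval (t n) x))%R))).
    apply: le_inte.
    - apply: (smeas_norm (F := lval _)); apply: smeas_lval.
      by apply: mlist_cat => //; exact: mlist_map.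
    - by do 2![apply: measurable_funD => //].
    - move=> x; rewrite rnorm_ge0 lval_cat lval_opp /=.
      have := rnorm_dist (lval (s n) x) (F x) (lval (t n) x).
      have := rnorm_dist (F x) (G x) (lval (t n) x).
      by rewrite (rnormB _ (F x)); lra.
  rewrite inteD//; last 3 first.
  - by apply: measurable_funD.
  - by move=> x; rewrite addr_ge0 ?rnorm_ge0.
  - by move=> x; rewrite rnorm_ge0.
  rewrite inteD//; try by move=> x; rewrite rnorm_ge0.
  by apply: leeD => //; apply: leeD.
move: key; rewrite -(fineK If) -!EFinD lee_fin => key.
have := rnorm_dist v (simple_integral m D (s n)) w.
have := rnorm_dist (simple_integral m D (s n)) (simple_integral m D (t n)) w.
by rewrite (rnormB v (simple_integral m D (s n))) /= => *; lra.
Qed.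

Lemma is_bochner_unique F v w : smeas F -> is_bochner m D F v -> is_bochner m D F w -> v = w.
Proof.
move=> sF hv hw; apply/eqP; rewrite -subr_eq0; apply/eqP; apply: rnorm_eq0P.
have := is_bochner_dist sF sF hv hw.
under eq_integral do rewrite subrr rnorm0.
by rewrite integral0 lee_fin.
Qed.

Definition bintegrable F := smeas F /\ (inte (fun x => rnorm (F x)) < +oo)%E.

Lemma cauchy_exists (u : nat -> V) :
  (forall e, 0 < e -> exists N, forall n k, (N <= n)%N -> (N <= k)%N -> rnorm (u n - u k) <= e) ->
  exists l : V, u @ \oo --> l.
Proof.
move=> hu; apply/cvg_ex; apply: cauchy_cvg; apply/cauchy_ballP => e /lecR_gt0[r r0 ->].
have [N hN] := hu (r / 2%:R) ltac:(by rewrite divr_gt0).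
exists (u @` [set n | (N <= n)%N], u @` [set n | (N <= n)%N]).
  by split; exists N => // n Nn; exists n.
move=> [_ _] /= [[n Nn <-] [k Nk <-]]; rewrite -ball_normE /= rnormE ltcR.
by apply: le_lt_trans (hN _ _ Nn Nk) _; lra.
Qed.

Lemma is_bochner_exists F : bintegrable F -> exists v, is_bochner m D F v.
Proof.
move=> [sF Ff]; have [s [ms hs]] := sF.
have mF := smeas_norm sF.
(* Discarding the approximants where they exceed twice the norm of F makes the errors dominated by 3
   times that norm, and keeps pointwise convergence: where F vanishes the truncated approximants
   vanish, elsewhere the truncation is eventually inactive. *)
pose ok n x := rnorm (lval (s n) x) <= 2%:R * rnorm (F x).
pose B n := [set x | ok n x].
have mB n : measurable (B n).
  have -> : B n = setT `&` (ok n) @^-1` [set true].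
    by rewrite setTI; apply/seteqP; split => x /=.
  apply: (@measurable_fun_ler _ _ _ _ (fun x => rnorm (lval (s n) x)) (fun x => 2%:R * rnorm (F x))) => //.
    exact/smeas_norm/smeas_lval.
  exact: measurable_funM.
pose t n := [seq (p.1 `&` B n, p.2) | p <- s n].
have mt n : mlist (t n) by move=> _ /mapP[p /ms mp ->]; exact: measurableI.
have tE n x : lval (t n) x = if ok n x then lval (s n) x else 0.
  rewrite /t; elim: (s n) => [|p l ih]; first by rewrite /lval !big_nil; case: ifP.
  rewrite /= !lval_cons ih /= in_setI.
  have -> : (x \in B n) = ok n x by apply/idP/idP => [/set_mem|h]; [|apply/mem_set].
  by case: (ok n x); rewrite ?andbT ?andbF ?addr0.
have t2 n x : rnorm (lval (t n) x) <= 2%:R * rnorm (F x).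
  by rewrite tE; case: ifP => //; rewrite rnorm0 mulr_ge0 ?rnorm_ge0.
have tF x e : 0 < e -> exists N, forall n, (N <= n)%N -> rnorm (lval (t n) x - F x) <= e.
  move=> e0; have [F0|F0] := eqVneq (rnorm (F x)) 0.
    exists 0 => n _; apply: le_trans (rnormDB _ _) _.
    by have := t2 n x; rewrite F0; lra.
  have Fp : 0 < rnorm (F x) by rewrite lt_neqAle eq_sym F0 rnorm_ge0.
  have m0 : 0 < Num.min e (rnorm (F x)) by rewrite lt_min e0.
  have [N hN] := hs x _ m0; exists N => n /hN; rewrite le_min => /andP[h1 h2].
  rewrite tE ifT//; have := rnormD (lval (s n) x - F x) (F x).
  by rewrite subrK /ok; lra.
have mG n : measurable_fun setT (fun x => rnorm (F x - lval (t n) x)).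
  by apply: smeas_norm; apply: smeas_sub => //; exact: smeas_lval.
have c0 : inte (fun x => rnorm (F x - lval (t n) x)) @[n --> \oo] --> 0%E.
  have -> : 0%E = inte (fun=> 0) by rewrite integral0.
  apply: (@dominated_cvg _ _ _ m D mD (fun n x => (rnorm (F x - lval (t n) x))%:E) (fun=> 0%E)
     (fun x => (3%:R * rnorm (F x))%:E)) => //.
  - by move=> n; apply/measurable_EFinP; exact: measurable_funTS.
  - move=> x _; apply/fine_cvgP; split; first by near=> n.
    apply/cvgrPdist_le => e /(tF x)[N hN]; exists N => // n /hN h /=.
    by rewrite sub0r normrN ger0_norm ?rnorm_ge0// rnormB.
  - apply/integrableP; split.
      by apply/measurable_EFinP; apply: measurable_funTS; exact: measurable_funM.
    under eq_integral do rewrite gee0_abs ?lee_fin ?mulr_ge0 ?rnorm_ge0//.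
    rewrite inteZ//; last by move=> x; exact: rnorm_ge0.
    by rewrite lte_mul_pinfty.
  - move=> n x _; rewrite gee0_abs ?lee_fin ?rnorm_ge0//.
    by have := rnormDB (F x) (lval (t n) x); have := t2 n x; lra.
have [v hv] : exists v, simple_integral m D (t n) @[n --> \oo] --> v.
  apply: cauchy_exists => e e0; have e2 : 0 < e / 2%:R by rewrite divr_gt0.
  have [N hN] := ecvg0_le e2 c0; exists N => n k /hN h1 /hN h2.
  rewrite -lee_fin; rewrite -simple_integral_opp -simple_integral_cat.
  apply: (le_trans (simple_norm_le _)).
    by apply: mlist_cat => //; exact: mlist_map.
  apply: (@le_trans _ _ (inte (fun x => (rnorm (F x - lval (t n) x) + rnorm (F x - lval (t k) x))%R))).
    apply: le_inte.
    - apply: (smeas_norm (F := lval _)); apply: smeas_lval.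
      by apply: mlist_cat => //; exact: mlist_map.
    - exact: measurable_funD.
    - move=> x; rewrite rnorm_ge0 lval_cat lval_opp /=.
      by have := rnorm_dist (lval (t n) x) (F x) (lval (t k) x); rewrite (rnormB _ (F x)).
  rewrite inteD//; try by move=> x; rewrite rnorm_ge0.
  have -> : e = e / 2%:R + e / 2%:R by lra.
  by rewrite EFinD; exact: leeD.
exists v, t; split => //.
  by move=> n p pt; split; [exact: mt pt|apply: measure_sub_fin; exact: mt pt].
by move=> n; apply: measurable_funTS; exact: mG.
Unshelve. all: by end_near.
Qed.

Lemma bochnerP F : bintegrable F -> is_bochner m D F (bochner m D F).
Proof.
move=> hF; rewrite /bochner; case: xgetP => [v _ //|h].
by have [v hv] := is_bochner_exists hF; have := h v.
Qed.

Lemma bochnerE F v : smeas F -> is_bochner m D F v -> bochner m D F = v.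
Proof.
move=> sF hv; rewrite /bochner; case: xgetP => [w _ hw|/(_ v)//].
exact: is_bochner_unique hw hv.
Qed.

Lemma bochner_dist F G (c : R) : bintegrable F -> bintegrable G ->
  (inte (fun x => rnorm (F x - G x)) <= c%:E)%E ->
  rnorm (bochner m D F - bochner m D G) <= c.
Proof.
move=> hF hG h; rewrite -lee_fin; apply: le_trans h.
by apply: is_bochner_dist; [exact: hF.1|exact: hG.1|exact: bochnerP|exact: bochnerP].
Qed.

Lemma bintegrable0 : bintegrable (fun=> 0).
Proof.
split; first exact: smeas_cst.
by under eq_integral do rewrite rnorm0; rewrite integral0.
Qed.

Lemma is_bochner0 : is_bochner m D (fun=> 0 : V) 0.
Proof.
exists (fun=> [::]); split=> //.
- by move=> n; under eq_fun do rewrite /simple_value big_nil subrr rnorm0; exact: measurable_cst.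
- under eq_fun do under eq_integral do rewrite /simple_value big_nil subrr rnorm0.
  by under eq_fun do rewrite integral0; exact: cvg_cst.
- by under eq_fun do rewrite /simple_integral big_nil; exact: cvg_cst.
Qed.

Lemma bochner_norm F (c : R) : bintegrable F -> (inte (fun x => rnorm (F x)) <= c%:E)%E ->
  rnorm (bochner m D F) <= c.
Proof.
move=> hF h; rewrite -lee_fin; apply: le_trans h.
have := is_bochner_dist hF.1 bintegrable0.1 (bochnerP hF) is_bochner0.
by rewrite subr0; under eq_integral do rewrite subr0.
Qed.

End Space.

(** Homogeneity is required for real scalars only, so that involutions are covered. *)
Lemma bochner_map (V W : completeNormedModType R[i]) (L : V -> W) (M : R) (F : T -> V) :
  (forall u v, L (u + v) = L u + L v) -> (forall (r : R) u, L (r%:C *: u) = r%:C *: L u) ->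
  0 <= M -> (forall u, rnorm (L u) <= M * rnorm u) -> bintegrable F ->
  bintegrable (L \o F) /\ bochner m D (L \o F) = L (bochner m D F).
Proof.
move=> hD hZ M0 hM hF; have cL : continuous L by exact: bounded_additive_continuous hD hM.
have sLF : smeas (L \o F) by apply: smeas_map => //; exact: hF.1.
have mF := smeas_norm hF.1; split.
  split=> //; apply: (@le_lt_trans _ _ (inte (fun x => M * rnorm (F x)))).
    apply: le_inte; first exact: smeas_norm.
      exact: measurable_funM.
    by move=> x; rewrite rnorm_ge0 hM.
  rewrite inteZ//; last by move=> x; exact: rnorm_ge0.
  by rewrite lte_mul_pinfty// hF.2.
apply: bochnerE => //; have [s [ms _ s0 sv]] := bochnerP hF.
have mls n : mlist (s n) by move=> p /ms[].
have mls' n : mlist (lmap L (s n)) by exact: mlist_map.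
exists (fun n => lmap L (s n)); split.
- move=> n p pt; split; first exact: mls' pt.
  by apply: measure_sub_fin; exact: mls' pt.
- move=> n; apply: measurable_funTS; apply: smeas_norm.
  by apply: smeas_sub => //; exact: smeas_lval.
- apply: (@squeeze_cvge _ _ _ _ (cst 0%E) _ (fun n => M%:E * inte (fun x => rnorm (F x - simple_value (s n) x)))%E).
  + apply: nearW => n; rewrite inte_ge0 /=.
    have mS : measurable_fun setT (fun x => rnorm (F x - lval (s n) x)).
      by apply: smeas_norm; apply: smeas_sub; [exact: hF.1|exact: smeas_lval].
    have e1 := inteZ mS (fun x => rnorm_ge0 _) M0; rewrite -e1.
    apply: le_inte.
    - apply: smeas_norm; apply: smeas_sub => //; exact: smeas_lval.
    - exact: measurable_funM.
    - by move=> x; rewrite rnorm_ge0 /= lvalE lval_map// -additiveB.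
  + exact: cvg_cst.
  + by rewrite -[X in _ --> X](mule0 M%:E); apply: cvgeZl.
- apply/cvg_rnormP => e e0; move/continuous_rnormP : cL => /(_ (bochner m D F) e e0)[dl dl0 hdl].
  move/cvg_rnormP : sv => /(_ dl dl0)[N hN]; exists N => n /hN h.
  by rewrite simple_integral_map// rnormB; apply: hdl; rewrite rnormB.
Qed.

Lemma bintegrableD (V : completeNormedModType R[i]) (F G : T -> V) :
  bintegrable F -> bintegrable G ->
  bintegrable (fun x => F x + G x) /\
  bochner m D (fun x => F x + G x) = bochner m D F + bochner m D G.
Proof.
move=> hF hG; have sFG : smeas (fun x => F x + G x) by apply: smeas_add; [exact: hF.1|exact: hG.1].
have mF := smeas_norm hF.1; have mG := smeas_norm hG.1; split.
  split=> //; apply: (@le_lt_trans _ _ (inte (fun x => (rnorm (F x) + rnorm (G x))%R))).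
    apply: le_inte; [exact: smeas_norm|exact: measurable_funD|].
    by move=> x; rewrite rnorm_ge0 rnormD.
  rewrite inteD//; try by move=> x; exact: rnorm_ge0.
  by rewrite lte_add_pinfty// ?hF.2 ?hG.2.
apply: bochnerE => //; have [s [ms _ s0 sv]] := bochnerP hF; have [t [mt _ t0 tw]] := bochnerP hG.
have mls n : mlist (s n) by move=> p /ms[].
have mlt n : mlist (t n) by move=> p /mt[].
have mst n : mlist (s n ++ t n) by exact: mlist_cat.
have mS n : measurable_fun setT (fun x => rnorm (F x - lval (s n) x)).
  by apply: smeas_norm; apply: smeas_sub; [exact: hF.1|exact: smeas_lval].
have mT n : measurable_fun setT (fun x => rnorm (G x - lval (t n) x)).
  by apply: smeas_norm; apply: smeas_sub; [exact: hG.1|exact: smeas_lval].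
exists (fun n => s n ++ t n); split.
- by move=> n p pt; split; [exact: mst pt|apply: measure_sub_fin; exact: mst pt].
- move=> n; apply: measurable_funTS; apply: smeas_norm.
  by apply: smeas_sub => //; exact: smeas_lval.
- apply: (@squeeze_cvge _ _ _ _ (cst 0%E) _ (fun n => inte (fun x => rnorm (F x - simple_value (s n) x)) +
      inte (fun x => rnorm (G x - simple_value (t n) x)))%E).
  + apply: nearW => n; rewrite inte_ge0 /=.
    have e1 := inteD (mS n) (mT n) (fun x => rnorm_ge0 _) (fun x => rnorm_ge0 _).
    rewrite -e1; apply: le_inte.
    * by apply: smeas_norm; apply: smeas_sub => //; exact: smeas_lval.
    * exact: measurable_funD (mS n) (mT n).
    * move=> x; rewrite rnorm_ge0 lvalE lval_cat /=.
      have -> : F x + G x - (lval (s n) x + lval (t n) x) = (F x - lval (s n) x) + (G x - lval (t n) x) by zmod.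
      exact: rnormD.
  + exact: cvg_cst.
  + by rewrite -[X in _ --> X](adde0 0%E); apply: cvgeD.
- under eq_fun do rewrite simple_integral_cat.
  exact: cvgD.
Qed.

Lemma bintegrableB (V : completeNormedModType R[i]) (F G : T -> V) :
  bintegrable F -> bintegrable G ->
  bintegrable (fun x => F x - G x) /\
  bochner m D (fun x => F x - G x) = bochner m D F - bochner m D G.
Proof.
move=> hF hG; have [||||h1 h2] := bochner_map (L := -%R) (M := 1) _ _ _ _ hG => //.
- by move=> u v; rewrite opprD.
- by move=> r u; rewrite scalerN.
- by move=> u; rewrite rnormN mul1r.
by have [k1 k2] := bintegrableD hF h1; rewrite -h2.
Qed.

End BochnerTheory.

(** * Scalar integrals as Bochner integrals *)

Section ScalarIntegral.
Context d (T : measurableType d) (R : realType) (m : {finite_measure set T -> \bar R}).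
Context (V : completeNormedModType R[i]).

Lemma finite_setT : (m setT < +oo)%E.
Proof. by rewrite -ge0_fin_numE//; exact: fin_num_measure. Qed.

Lemma integrable_bounded (h : T -> R) (K : R) : measurable_fun setT h ->
  (forall x, `|h x| <= K) -> m.-integrable setT (EFin \o h).
Proof.
move=> mh hK; apply: (@le_integrable _ _ _ _ _ _ _ (EFin \o cst K)) => //.
- exact/measurable_EFinP.
- by move=> x _; rewrite /= lee_fin; apply: le_trans (hK x) _; exact: ler_norm.
- exact: finite_measure_integrable_cst.
Qed.

Lemma bintegrable_bounded (F : T -> V) (K : R) : smeas F -> (forall x, rnorm (F x) <= K) ->
  bintegrable m setT F.
Proof.
move=> sF hK; split=> //; apply: (@le_lt_trans _ _ (\int[m]_(x in setT) (cst K%:E) x)%E).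
  apply: ge0_le_integral => //.
  - by move=> x _; rewrite lee_fin rnorm_ge0.
  - by apply/measurable_EFinP; exact: smeas_norm.
  - by move=> x _; rewrite lee_fin.
rewrite integral_cst// lte_mul_pinfty ?finite_setT//.
  by rewrite lee_fin; apply: le_trans (hK point); exact: rnorm_ge0.
Qed.

Definition rval (l : seq (set T * R)) (x : T) : R := \sum_(p <- l) \1_(p.1) x * p.2.

Lemma rval_integral (l : seq (set T * R)) : (forall p, p \in l -> measurable p.1) ->
  m.-integrable setT (EFin \o rval l) /\
  \int[m]_(x in setT) (rval l x) = \sum_(p <- l) fine (m p.1) * p.2.
Proof.
elim: l => [|p l ih] hl.
  have -> : rval [::] = cst 0 by apply/funext => x; rewrite /rval big_nil.
  split; first exact: finite_measure_integrable_cst.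
  by rewrite Rintegral_cst// mul0r big_nil.
have mp : measurable p.1 by apply: hl; rewrite inE eqxx.
have [i1 i2] := ih (fun q ql => hl q ltac:(by rewrite inE ql orbT)).
have ei : (fun x => (\1_(p.1) x * p.2)%:E) = (EFin \o (fun x => \1_(p.1) x * p.2)) by [].
have j1 : m.-integrable setT (EFin \o (fun x => \1_(p.1) x * p.2)).
  apply: (integrable_bounded (K := `|p.2|)).
    by apply: measurable_funM => //; exact: measurable_indic.
  move=> x; rewrite normrM ler_piMl// indicE; case: (_ \in _); rewrite ?normr1 ?normr0//.
have -> : rval (p :: l) = (fun x => \1_(p.1) x * p.2 + rval l x).
  by apply/funext => x; rewrite /rval big_cons.
split; first exact: (integrableD measurableT j1 i1).
rewrite RintegralD// i2 big_cons; congr (_ + _).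
rewrite RintegralZr//; last exact: integrable_indic.
by rewrite /Rintegral integral_indic// setIT.
Qed.

Lemma bochner_real (h : T -> R) (K : R) (v : V) : measurable_fun setT h ->
  (forall x, `|h x| <= K) ->
  bochner m setT (fun x => (h x)%:C *: v) = (\int[m]_(x in setT) (h x))%:C *: v.
Proof.
move=> mh hK; have /choice[l hl] := fun n => grid_exists n mh.
have sG : smeas (fun x => (h x)%:C *: v).
  apply: (smeas_comp (G := fun r : R => r%:C *: v)) => // x e e0.
  exists (e / (rnorm v + 1)); first by rewrite divr_gt0// ltr_wpDl ?rnorm_ge0.
  move=> y; rewrite ler_pdivlMr ?ltr_wpDl ?rnorm_ge0// => hy.
  rewrite -scalerBl -RCB rnormZR; apply: le_trans hy; rewrite ler_wpM2l//; lra.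
apply: bochnerE => //; first exact: finite_setT.
pose s n := [seq (p.1, p.2%:C *: v) | p <- l n].
have ms n : mlist (s n) by move=> _ /mapP[p pl ->]; exact: (hl n).1.
have mr n : measurable_fun setT (rval (l n)).
  apply/measurable_EFinP; exact: measurable_int (rval_integral (hl n).1).1.
have rE n x : (rval (l n) x)%:C = lval [seq (p.1, p.2%:C : R[i]^o) | p <- l n] x :> R[i].
  rewrite /rval /lval big_map (big_morph _ (@RCD R) (erefl : 0%:C = 0 :> R[i])).
  by apply: eq_bigr => p _; rewrite RCM.
have near n : (Num.truncn K <= n)%N -> forall x, `|h x - rval (l n) x| <= n.+1%:R^-1 /\
    lval (s n) x = (rval (l n) x)%:C *: v.
  move=> nK x; have [|a [ha hG]] := (hl n).2 x.
    apply: le_lt_trans (hK x) _; apply: lt_le_trans (truncnS_gt _) _.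
    by rewrite ler_nat ltnS.
  have ra : rval (l n) x = a by apply: (@complexI R); rewrite rE (hG _ (fun r : R => r%:C : R[i]^o)).
  by rewrite ra; split=> //; exact: (hG _ (fun r : R => r%:C *: v)).
exists s; split.
- move=> n p pt; split; first exact: ms pt.
  by apply: measure_sub_fin; [exact: measurableT|exact: finite_setT|exact: ms pt].
- move=> n; apply: smeas_norm; apply: smeas_sub => //; exact: smeas_lval.
- apply: (@squeeze_cvge _ _ _ _ (cst 0%E) _ (fun n => (n.+1%:R^-1 * rnorm v * fine (m setT))%:E)).
  + exists (Num.truncn K) => // n /near hn; rewrite inte_ge0 /=.
    apply: (@le_trans _ _ (\int[m]_(x in setT) (cst (n.+1%:R^-1 * rnorm v)%:E) x)%E).
      apply: ge0_le_integral => //.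
      * by move=> x _; rewrite lee_fin rnorm_ge0.
      * apply/measurable_EFinP; apply: smeas_norm; apply: smeas_sub => //; exact: smeas_lval.
      * move=> x _; rewrite lee_fin; have [h1 h2] := hn x.
        by rewrite lvalE h2 -scalerBl -RCB rnormZR ler_wpM2r ?rnorm_ge0.
    by rewrite integral_cst// [in leRHS]EFinM fineK ?fin_num_measure.
  + exact: cvg_cst.
  + apply: cvg_EFin; first by near=> n.
    have : to0 (fun n => (rnorm v * fine (m setT)) / n.+1%:R).
      move=> e e0; exists (Num.truncn ((e / (`|rnorm v * fine (m setT)| + 1))^-1)) => n hn.
      have p0 : 0 < `|rnorm v * fine (m setT)| + 1 by rewrite ltr_wpDl.
      have := @inv_succ_le R (e / (`|rnorm v * fine (m setT)| + 1)) n ltac:(by rewrite divr_gt0) hn.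
      rewrite ler_pdivlMr// mulrC => h1; apply: le_trans h1; rewrite ler_wpM2r ?invr_ge0//.
      by have := ler_norm (rnorm v * fine (m setT)); lra.
    move=> t0; apply/cvgrPdist_le => e e0; have [N hN] := t0 e e0; exists N => // n /hN hn /=.
    rewrite sub0r normrN ger0_norm ?mulr_ge0 ?rnorm_ge0 ?invr_ge0 ?fine_ge0//.
    by rewrite -mulrA mulrC.
- apply/cvg_rnormP => e e0.
  pose C := fine (m setT) * rnorm v + 1; have C0 : 0 < C by rewrite ltr_wpDl ?mulr_ge0 ?fine_ge0 ?rnorm_ge0.
  exists (maxn (Num.truncn K) (Num.truncn ((e / C)^-1))) => n; rewrite geq_max => /andP[/near hn nC].
  have eC : n.+1%:R^-1 <= e / C by apply: inv_succ_le => //; rewrite divr_gt0.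
  have -> : simple_integral m setT (s n) = (\int[m]_(x in setT) (rval (l n) x))%:C *: v.
    rewrite (rval_integral (hl n).1).2 /simple_integral big_map.
    rewrite (big_morph _ (@RCD R) (erefl : 0%:C = 0 :> R[i])) scaler_suml.
    by apply: eq_bigr => p _ /=; rewrite setTI RCM scalerA.
  have ih := integrable_bounded mh hK; have il := (rval_integral (hl n).1).1.
  rewrite -scalerBl -RCB rnormZR -RintegralB//.
  have k1 : `|\int[m]_(x in setT) (rval (l n) x - h x)| <= n.+1%:R^-1 * fine (m setT).
    apply: le_trans (le_normr_Rintegral _ _) _ => //; first exact: (integrableB measurableT il ih).
    rewrite -Rintegral_cst//; apply: le_Rintegral => //.
    - apply: (@integrable_bounded _ n.+1%:R^-1); first by apply: measurableT_comp => //; exact: measurable_funB.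
      by move=> x; rewrite normr_id distrC; exact: (hn x).1.
    - exact: finite_measure_integrable_cst.
    - by move=> x _; rewrite distrC; exact: (hn x).1.
  apply: (@le_trans _ _ (n.+1%:R^-1 * fine (m setT) * rnorm v)).
    by rewrite ler_wpM2r ?rnorm_ge0.
  rewrite -mulrA; apply: (@le_trans _ _ (e / C * C)); last by rewrite divfK// gt_eqF.
  by apply: ler_pM; rewrite ?invr_ge0 ?mulr_ge0 ?fine_ge0 ?rnorm_ge0// /C lerDl.
Unshelve. all: by end_near.
Qed.

(** The bridge between [fourier], defined by the real and imaginary parts of scalar integrals, and
    vector-valued integrals. *)
Lemma bochner_complex (F : T -> R[i]) (K : R) (v : V) :
  measurable_fun setT (fun x => complex.Re (F x)) ->
  measurable_fun setT (fun x => complex.Im (F x)) -> (forall x, cabs (F x) <= K) ->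
  bochner m setT (fun x => F x *: v) =
   (\int[m]_(x in setT) complex.Re (F x) +i* \int[m]_(x in setT) complex.Im (F x)) *: v.
Proof.
move=> mR mI hK.
have kR x : `|complex.Re (F x)| <= K by apply: le_trans (cabs_Re _) (hK x).
have kI x : `|complex.Im (F x)| <= K by apply: le_trans (cabs_Im _) (hK x).
have b (h : T -> R) (w : V) : measurable_fun setT h -> (forall x, `|h x| <= K) ->
    bintegrable m setT (fun x => (h x)%:C *: w).
  move=> mh hh; apply: (@bintegrable_bounded _ (K * rnorm w)).
    apply: (@smeas_scale _ _ _ _ (fun x => (h x)%:C : R[i]^o) (fun=> w)); last exact: smeas_cst.
    apply: (@smeas_complex _ _ _ (fun x => (h x)%:C)) => //=.
  by move=> x; rewrite rnormZR ler_wpM2r ?rnorm_ge0.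
have E z (w : V) : z *: w = (complex.Re z)%:C *: w + (complex.Im z)%:C *: ('i *: w).
  rewrite scalerA -scalerDl; congr (_ *: _); case: z => p q.
  by apply/eqP; rewrite eq_complex /=; apply/andP; split; apply/eqP; ring.
have -> : (fun x => F x *: v) =
    (fun x => (complex.Re (F x))%:C *: v + (complex.Im (F x))%:C *: ('i *: v)).
  by apply/funext => x; exact: E.
have [_ ->] := bintegrableD measurableT finite_setT (b _ v mR kR) (b _ ('i *: v) mI kI).
by rewrite (bochner_real v mR kR) (bochner_real ('i *: v) mI kI) [RHS]E.
Qed.

Lemma bochner_sum (F : nat -> T -> V) n : (forall k, bintegrable m setT (F k)) ->
  bintegrable m setT (fun x => \sum_(k < n) F k x) /\
  bochner m setT (fun x => \sum_(k < n) F k x) = \sum_(k < n) bochner m setT (F k).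
Proof.
move=> hF; elim: n => [|n [h1 h2]].
  have -> : (fun x => \sum_(k < 0) F k x) = (fun=> 0) by apply/funext => x; rewrite big_ord0.
  rewrite big_ord0; split; first exact: bintegrable0.
  apply: bochnerE; [exact: measurableT|exact: finite_setT|exact: smeas_cst|exact: is_bochner0].
have -> : (fun x => \sum_(k < n.+1) F k x) = (fun x => \sum_(k < n) F k x + F n x).
  by apply/funext => x; rewrite big_ord_recr.
have [k1 k2] := bintegrableD measurableT finite_setT h1 (hF n).
by split=> //; rewrite big_ord_recr /= -h2.
Qed.

End ScalarIntegral.

(** * Integrals against Fourier measures *)

Section FourierIntegral.
Context (R : realType) (mu : complexMeasure R).
Implicit Types (V : completeNormedModType R[i]) (xi : R).

(* A majorant of 1, |xi|, |xi|^2 and |xi|^3, hence integrable for measures in F_3. *)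
Definition weight xi : R := (1 + `|xi|) ^+ 3.

Definition moment : R := fine (\int[cm_abs mu]_(xi in setT) (weight xi)%:E)%E.

Lemma weight_ge1 xi : 1 <= weight xi.
Proof. by rewrite /weight exprn_ege1// lerDl. Qed.

Lemma weight_ge_norm xi k : (k <= 3)%N -> `|xi| ^+ k <= weight xi.
Proof.
move=> k3; apply: (@le_trans _ _ ((1 + `|xi|) ^+ k)).
  by rewrite lerXn2r ?nnegrE ?addr_ge0// lerDr.
by rewrite /weight ler_weXn2l// lerDl.
Qed.

Lemma measurable_weight : measurable_fun setT weight.
Proof.
by apply: measurable_funX; apply: measurable_funD.
Qed.

(** Continuity gives strong measurability, and domination by the weight gives integrability against
    every measure in F_3. *)
Definition fkernel V (G : R -> V) : Prop :=
  (forall xi e, 0 < e -> exists2 dl, 0 < dl & forall eta, `|xi - eta| <= dl -> rnorm (G xi - G eta) <= e) /\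
  exists c, forall xi, rnorm (G xi) <= c * weight xi.

Definition fint V (G : R -> V) : V := bochner (cm_abs mu) setT (fun xi => cm_dens mu xi *: G xi).

Hypothesis h3 : in_F 3 mu.

Lemma weight_integrable : (\int[cm_abs mu]_(xi in setT) (weight xi)%:E < +oo)%E.
Proof.
have m0 k : measurable_fun setT (fun xi : R => `|xi| ^+ k).
  by apply: measurable_funX; exact: (measurableT_comp (@normr_measurable _ _)).
apply: (@le_lt_trans _ _ (\int[cm_abs mu]_(xi in setT) ((4%:R + 4%:R * `|xi| ^+ 3)%:E))%E).
  apply: ge0_le_integral => //.
  - by move=> x _; rewrite lee_fin (le_trans _ (weight_ge1 _)).
  - by apply/measurable_EFinP; exact: measurable_weight.
  - by apply/measurable_EFinP; apply: measurable_funD => //; exact: measurable_funM.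
  - move=> x _; rewrite lee_fin /weight; set t := `|x|; have t0 : 0 <= t by exact: normr_ge0.
    (* This product is exactly 4 + 4 t^3 - (1 + t)^3. *)
    have : 0 <= 3%:R * (t + 1) * (t - 1) ^+ 2 by rewrite mulr_ge0 ?sqr_ge0// mulr_ge0// addr_ge0.
    by rewrite !exprS !expr0; nra.
have p0 (x : R) : 0 <= `|x| ^+ 3 by rewrite exprn_ge0.
have m4 : measurable_fun setT (fun xi : R => 4%:R * `|xi| ^+ 3) by exact: measurable_funM.
have e1 := inteD (cm_abs mu) measurableT (measurable_cst (4%:R : R)) m4 (fun=> ler0n _ 4)
  (fun x => mulr_ge0 (ler0n _ 4) (p0 x)).
have e2 := inteZ (cm_abs mu) measurableT (m0 3) p0 (ler0n R 4).
rewrite e1 e2 lte_add_pinfty//.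
  have -> : (\int[cm_abs mu]_x (cst 4%:R x)%:E = \int[cm_abs mu]_(x in setT) cst (4%:R)%:E x)%E by [].
  by rewrite integral_cst// lte_mul_pinfty ?finite_setT.
by rewrite lte_mul_pinfty// h3.
Qed.

Lemma momentE : (\int[cm_abs mu]_(xi in setT) (weight xi)%:E)%E = moment%:E.
Proof.
rewrite /moment fineK// ge0_fin_numE ?weight_integrable//.
by apply: integral_ge0 => x _; rewrite lee_fin (le_trans _ (weight_ge1 _)).
Qed.

Lemma moment_ge0 : 0 <= moment.
Proof.
by apply: fine_ge0; apply: integral_ge0 => x _; rewrite lee_fin (le_trans _ (weight_ge1 _)).
Qed.

Lemma smeas_dens : smeas (cm_dens mu : R -> R[i]^o).
Proof. by apply: smeas_complex; [exact: cm_dens_Re|exact: cm_dens_Im]. Qed.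

Lemma cabs_dens xi : cabs (cm_dens mu xi) = 1.
Proof. by rewrite /cabs cm_dens_norm. Qed.

Lemma integral_weight_le V (F : R -> V) (c : R) : smeas F -> 0 <= c ->
  (forall xi, rnorm (F xi) <= c * weight xi) ->
  (\int[cm_abs mu]_(xi in setT) (rnorm (F xi))%:E <= (c * moment)%:E)%E.
Proof.
move=> sF c0 hF.
have e1 := inteZ (cm_abs mu) measurableT measurable_weight (fun x => le_trans ler01 (weight_ge1 x)) c0.
rewrite EFinM -momentE -e1; apply: le_inte => //; first exact: smeas_norm.
  by apply: measurable_funM => //; exact: measurable_weight.
by move=> x; rewrite rnorm_ge0 hF.
Qed.

Lemma fkernel_smeas V (G : R -> V) : fkernel G -> smeas (fun xi => cm_dens mu xi *: G xi).
Proof.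
move=> [hG _]; apply: (smeas_scale smeas_dens).
by apply: (smeas_comp (G := G) (h := id)).
Qed.

Lemma fkernel_bintegrable V (G : R -> V) : fkernel G ->
  bintegrable (cm_abs mu) setT (fun xi => cm_dens mu xi *: G xi).
Proof.
move=> kG; split; first exact: fkernel_smeas.
have [_ [c hc]] := kG; apply: (@le_lt_trans _ _ (`|c| * moment)%:E); last by rewrite ltry.
apply: integral_weight_le => //; first exact: fkernel_smeas.
move=> xi; rewrite rnormZ cabs_dens mul1r; apply: le_trans (hc xi) _.
by rewrite ler_wpM2r ?ler_norm// (le_trans _ (weight_ge1 _)).
Qed.

Lemma fint_norm V (G : R -> V) (c : R) : fkernel G -> 0 <= c ->
  (forall xi, rnorm (G xi) <= c * weight xi) -> rnorm (fint G) <= c * moment.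
Proof.
move=> kG c0 hc; apply: bochner_norm; [exact: measurableT|exact: finite_setT|exact: fkernel_bintegrable|].
apply: integral_weight_le => //; first exact: fkernel_smeas.
by move=> xi; rewrite rnormZ cabs_dens mul1r.
Qed.

Lemma fkernel_map V (W : completeNormedModType R[i]) (L : V -> W) (M : R) (G : R -> V) :
  (forall u v, L (u + v) = L u + L v) -> 0 <= M -> (forall u, rnorm (L u) <= M * rnorm u) ->
  fkernel G -> fkernel (L \o G).
Proof.
move=> hD M0 hM [h1 [c hc]]; split.
  move=> xi e e0; have M1 : 0 < M + 1 by rewrite ltr_wpDl.
  have [dl dl0 hdl] := h1 xi (e / (M + 1)) ltac:(by rewrite divr_gt0).
  exists dl => // eta /hdl; rewrite ler_pdivlMr// => k; rewrite /= -additiveB//.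
  apply: le_trans (hM _) _; apply: le_trans k; rewrite mulrC ler_wpM2l ?rnorm_ge0//.
  by rewrite lerDl.
exists (M * c) => xi; apply: le_trans (hM _) _; rewrite -mulrA ler_wpM2l//.
Qed.

Lemma fint_map V (W : completeNormedModType R[i]) (L : V -> W) (M : R) (G : R -> V) :
  0 <= M -> bounded_linear M L -> fkernel G -> fint (L \o G) = L (fint G).
Proof.
move=> M0 bL kG; have hD := bounded_linearD bL; have hZ := bounded_linearZ bL.
have hM := bounded_linear_rnorm bL.
have [_ <-] := bochner_map measurableT (finite_setT _) hD (fun r u => hZ r%:C u) M0 hM (fkernel_bintegrable kG).
by congr (bochner _ _ _); apply/funext => xi /=; rewrite hZ.
Qed.

Lemma fkernelD V (G G' : R -> V) : fkernel G -> fkernel G' -> fkernel (fun xi => G xi + G' xi).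
Proof.
move=> [h1 [c hc]] [h1' [c' hc']]; split.
  move=> xi e e0; have e2 : 0 < e / 2%:R by rewrite divr_gt0.
  have [d d0 hd] := h1 xi _ e2; have [d' d0' hd'] := h1' xi _ e2.
  exists (Num.min d d'); first by rewrite lt_min d0.
  move=> eta; rewrite le_min => /andP[/hd k /hd' k'].
  have -> : G xi + G' xi - (G eta + G' eta) = (G xi - G eta) + (G' xi - G' eta) by zmod.
  by apply: le_trans (rnormD _ _) _; lra.
by exists (c + c') => xi; rewrite mulrDl; apply: le_trans (rnormD _ _) _; apply: lerD.
Qed.

Lemma fkernelN V (G : R -> V) : fkernel G -> fkernel (fun xi => - G xi).
Proof.
by apply: (@fkernel_map _ _ -%R 1) => // [u v|u]; rewrite ?opprD// rnormN mul1r.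
Qed.

Lemma fkernelB V (G G' : R -> V) : fkernel G -> fkernel G' -> fkernel (fun xi => G xi - G' xi).
Proof. by move=> h1 h2; apply: fkernelD => //; exact: fkernelN. Qed.

Lemma fkernel0 V : fkernel (fun=> 0 : V).
Proof.
split; first by move=> xi e e0; exists 1 => // eta _; rewrite subrr rnorm0 ltW.
by exists 0 => xi; rewrite rnorm0 mul0r.
Qed.

Lemma fkernel_sum V (I : Type) (r : seq I) (G : I -> R -> V) : (forall i, fkernel (G i)) ->
  fkernel (fun xi => \sum_(i <- r) G i xi).
Proof.
move=> h; elim: r => [|i r ih].
  by rewrite (_ : (fun xi => _) = (fun=> 0)); [exact: fkernel0|apply/funext => x; rewrite big_nil].
rewrite (_ : (fun xi => _) = (fun xi => G i xi + \sum_(i <- r) G i xi)); first exact: fkernelD.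
by apply/funext => x; rewrite big_cons.
Qed.

Lemma fintB V (G G' : R -> V) : fkernel G -> fkernel G' ->
  fint (fun xi => G xi - G' xi) = fint G - fint G'.
Proof.
move=> h1 h2.
have [_ <-] := bintegrableB measurableT (finite_setT _) (fkernel_bintegrable h1) (fkernel_bintegrable h2).
by congr (bochner _ _ _); apply/funext => xi; rewrite scalerBr.
Qed.

Lemma fintD V (G G' : R -> V) : fkernel G -> fkernel G' ->
  fint (fun xi => G xi + G' xi) = fint G + fint G'.
Proof.
move=> h1 h2.
have [_ <-] := bintegrableD measurableT (finite_setT _) (fkernel_bintegrable h1) (fkernel_bintegrable h2).
by congr (bochner _ _ _); apply/funext => xi; rewrite scalerDr.
Qed.

Lemma fint0 V : fint (fun=> 0 : V) = 0.
Proof.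
apply/eqP/eqP; apply: rnorm_eq0P; rewrite -(mul0r moment); apply: fint_norm => //.
  exact: fkernel0.
by move=> xi; rewrite rnorm0 mul0r.
Qed.

Lemma fint_sum V (I : Type) (r : seq I) (G : I -> R -> V) : (forall i, fkernel (G i)) ->
  fint (fun xi => \sum_(i <- r) G i xi) = \sum_(i <- r) fint (G i).
Proof.
move=> h; elim: r => [|i r ih].
  rewrite big_nil (_ : (fun xi => _) = (fun=> 0)); first exact: fint0.
  by apply/funext => x; rewrite big_nil.
rewrite big_cons -ih -fintD//; last exact: fkernel_sum.
by congr fint; apply/funext => x; rewrite big_cons.
Qed.

End FourierIntegral.

(** * Functional calculus of Fourier transforms *)

Section FunctionalCalculusIntegral.
Context (R : realType) (A : vonNeumannAlgebra R) (mu : complexMeasure R) (h3 : in_F 3 mu).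
Implicit Types (y z : A) (xi : R).

Definition fop y : A := fint mu (fun xi => E xi y).

Lemma E_fkernel y : selfadjoint y -> fkernel (fun xi => E xi y).
Proof.
move=> sy; split.
  move=> xi e e0; exists (e / (rnorm y + 1)); first by rewrite divr_gt0// ltr_wpDl ?rnorm_ge0.
  move=> eta; rewrite ler_pdivlMr ?ltr_wpDl ?rnorm_ge0// => h.
  apply: le_trans (E_continuous _ _ sy) _; apply: le_trans h; rewrite ler_wpM2l//; lra.
by exists 1 => xi; rewrite mul1r; apply: le_trans (E_norm sy xi) (weight_ge1 _).
Qed.

Lemma exp_tail_mono (M M' : R) n : 0 <= M -> M <= M' -> exp_tail M n <= exp_tail M' n.
Proof.
move=> M0 MM; apply: ler_eps => e /(exp_tail_to0 M)[N /(_ (N + n)%N (leq_addr _ _))].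
rewrite /exp_tail; set a := expR M => h.
have -> : a - series (exp_coeff M) n = (a - series (exp_coeff M) (N + n)) +
   \sum_(n <= k < N + n) M ^+ k / k`!%:R.
  rewrite /series /= (@big_cat_nat _ _ _ n 0 (N + n))//= ?leq_addl// opprD addrA.
  by rewrite addrNK.
rewrite addrC; apply: lerD => //; apply: (@le_trans _ _ (\sum_(n <= k < N + n) M' ^+ k / k`!%:R)).
  apply: ler_sum_nat => k _; rewrite ler_wpM2r ?invr_ge0//.
  by rewrite lerXn2r ?nnegrE//; apply: le_trans MM.
by apply: exp_tail_sum; rewrite ?leq_addl//; apply: le_trans MM.
Qed.

(** A measure in F_3 has only three moments, so f has no Taylor polynomials of high degree.
    Truncating to |xi| <= n makes all moments finite; [coef] and [tpoly] are the Taylor coefficients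
    and polynomials for the truncated measure. *)
Let cut n xi : R := if `|xi| <= n%:R then 1 else 0.

Let measurable_cut n : measurable_fun setT (cut n).
Proof.
apply: measurable_fun_ifT => //.
by apply: measurable_fun_ler => //.
Qed.

Let coef k n : R[i] :=
  let F xi := cm_dens mu xi * ((cut n xi)%:C * ((k`!%:R)^-1 * ('i * xi%:C) ^+ k)) in
  \int[cm_abs mu]_(xi in setT) complex.Re (F xi) +i* \int[cm_abs mu]_(xi in setT) complex.Im (F xi).

Let tpoly N n : {poly R[i]} := \poly_(k < N) coef k n.

Lemma smeas_ReIm (F : R -> R[i]) : smeas (F : R -> R[i]^o) ->
  measurable_fun setT (fun x => complex.Re (F x)) /\ measurable_fun setT (fun x => complex.Im (F x)).
Proof.
move=> [s [ms hs]].
have h (psi : R[i]^o -> R) : (forall p q : R[i]^o, `|psi p - psi q| <= cabs (p - q)) ->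
    measurable_fun setT (fun x => psi (F x)).
  move=> hpsi; apply: (@measurable_fun_cvg _ _ _ _ (fun n x => psi (0 + lval (s n) x))).
    by move=> n; exact: measurable_lval.
  move=> x _; apply/cvgrPdist_le => e e0; have [N hN] := hs x e e0; exists N => // n /hN k /=.
  by rewrite add0r distrC; apply: le_trans (hpsi _ _) k.
split; apply: h => [[a b] [a' b']].
  exact: (cabs_Re ((a - a') +i* (b - b'))).
exact: (cabs_Im ((a - a') +i* (b - b'))).
Qed.

Let cutkernel k n (v : A) : let F xi := cm_dens mu xi * ((cut n xi)%:C * ((k`!%:R)^-1 * ('i * xi%:C) ^+ k)) in
  bintegrable (cm_abs mu) setT (fun xi => F xi *: v) /\
  bochner (cm_abs mu) setT (fun xi => F xi *: v) = coef k n *: v.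
Proof.
move=> F; pose K : R := n%:R ^+ k.
have hF xi : cabs (F xi) <= K.
  rewrite /F !cabsM cabs_dens mul1r cabsR cabs_natV.
  have -> : cabs (('i * xi%:C) ^+ k) = `|xi| ^+ k.
    by apply: complexI; rewrite -cabsE normrX normrM !cabsE cabsi mul1r cabsR RCX.
  rewrite /cut; case: ifP => hx; last by rewrite normr0 mul0r exprn_ge0.
  rewrite normr1 mul1r; apply: (@le_trans _ _ (1 * `|xi| ^+ k)).
    by rewrite ler_wpM2r ?exprn_ge0// invf_le1 ?ltr0n ?fact_gt0// ler1n fact_gt0.
  by rewrite mul1r lerXn2r ?nnegrE.
have sF : smeas (F : R -> R[i]^o).
  have sdens := smeas_dens mu.
  have s1 : smeas (fun xi => (cut n xi)%:C : R[i]^o).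
    by apply: (@smeas_complex _ _ _ (fun xi => (cut n xi)%:C)) => //=; exact: measurable_cut.
  have s2 : smeas (fun xi : R => ((k`!%:R)^-1 * 'i ^+ k) * (xi ^+ k)%:C : R[i]^o).
    have s3 : smeas (fun xi : R => (xi ^+ k)%:C : R[i]^o).
      by apply: (@smeas_complex _ _ _ (fun xi : R => (xi ^+ k)%:C)) => //=.
    pose c : R[i]^o := (k`!%:R)^-1 * 'i ^+ k.
    change (smeas (fun xi : R => (c : R[i]) *: ((xi ^+ k)%:C : R[i]^o))).
    by apply: smeas_scale => //; exact: smeas_cst.
  have -> : (F : R -> R[i]^o) = (fun xi => (cm_dens mu xi : R[i]) *: (((cut n xi)%:C : R[i]) *:
       ((((k`!%:R)^-1 * 'i ^+ k) * (xi ^+ k)%:C : R[i]) : R[i]^o))).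
    apply/funext => xi; rewrite /F /GRing.scale /= exprMn RCX.
    by rewrite !mulrA.
  by apply: (smeas_scale sdens); exact: smeas_scale.
have [mR mI] := smeas_ReIm sF; split.
  apply: (@bintegrable_bounded _ _ _ _ _ _ (K * rnorm v)).
    by apply: smeas_scale => //; exact: smeas_cst.
  by move=> xi; rewrite rnormZ ler_wpM2r ?rnorm_ge0.
exact: bochner_complex mR mI hF.
Qed.

Let cutfint N n (v : nat -> A) : let G xi := (cut n xi)%:C *:
     \sum_(k < N) ((k`!%:R)^-1 * ('i * xi%:C) ^+ k) *: v k in
  bintegrable (cm_abs mu) setT (fun xi => cm_dens mu xi *: G xi) /\
  bochner (cm_abs mu) setT (fun xi => cm_dens mu xi *: G xi) = \sum_(k < N) coef k n *: v k.
Proof.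
move=> G; have -> : (fun xi => cm_dens mu xi *: G xi) = (fun xi => \sum_(k < N)
    (cm_dens mu xi * ((cut n xi)%:C * ((k`!%:R)^-1 * ('i * xi%:C) ^+ k))) *: v k).
  by apply/funext => xi; rewrite /G !scaler_sumr; apply: eq_bigr => k _; rewrite !scalerA !mulrA.
have [h1 ->] := bochner_sum N (fun k => (cutkernel k n (v k)).1).
by split=> //; apply: eq_bigr => k _; exact: (cutkernel k n (v k)).2.
Qed.

Lemma rnorm_one : vn_one A != 0 -> rnorm (vn_one A) = 1.
Proof.
move=> nz; apply/le_anti; rewrite rnorm1_le /=.
have n0 : 0 < rnorm (vn_one A).
  by rewrite lt_neqAle rnorm_ge0 andbT eq_sym; apply/eqP => /rnorm_eq0 /eqP; rewrite (negbTE nz).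
by have := rnormM (vn_one A) (vn_one A); rewrite vmul1 -{1}[rnorm _]mul1r ler_pM2r.
Qed.

(** Inside the cut the Taylor tail is small; outside it the weight exceeds n + 1, so an error of
    size 1 is at most the weight divided by n + 1. *)
Let cut_approx N n (M : R) (G : R -> A) (P : R -> A) : 0 <= M ->
  (forall xi, `|xi| <= n.+1%:R -> rnorm (P xi - G xi) <= exp_tail (n.+1%:R * M) N) ->
  (forall xi, rnorm (G xi) <= 1) ->
  forall xi, rnorm ((cut n.+1 xi)%:C *: P xi - G xi) <=
    (exp_tail (n.+1%:R * M) N + n.+1%:R^-1) * weight xi.
Proof.
move=> M0 h1 h2 xi; have t0 : 0 <= exp_tail (n.+1%:R * M) N by rewrite exp_tail_ge0// mulr_ge0.
have w1 := weight_ge1 xi; have i0 : 0 <= n.+1%:R^-1 :> R by rewrite invr_ge0.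
rewrite /cut; case: ifP => hx.
  rewrite (_ : 1%:C = 1)// scale1r; apply: le_trans (h1 _ hx) _.
  by apply: (@le_trans _ _ (exp_tail (n.+1%:R * M) N * 1)); [rewrite mulr1|apply: ler_pM => //; rewrite lerDl].
rewrite (_ : 0%:C = 0)// scale0r sub0r rnormN; apply: le_trans (h2 xi) _.
rewrite mulrDl; apply: (@le_trans _ _ (n.+1%:R^-1 * weight xi)); last first.
  by rewrite lerDr mulr_ge0// (le_trans _ w1).
rewrite mulrC ler_pdivlMr// mul1r; apply: le_trans (weight_ge_norm xi (_ : (1 <= 3)%N)) => //.
by move/negbT : hx; rewrite -ltNge expr1 => /ltW.
Qed.

Lemma expi_continuous (x xi d : R) : 0 < d ->
  exists2 dl, 0 < dl & forall eta, `|xi - eta| <= dl -> cabs (expi (x * xi) - expi (x * eta)) <= d.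
Proof.
move=> d0.
have cE : {for xi, continuous (fun r => cos (x * r))} /\ {for xi, continuous (fun r => sin (x * r))}.
  have cx : {for xi, continuous (fun r : R => x * r)} by exact: mulrl_continuous.
  by split; apply: (continuous_comp cx); [exact: continuous_cos|exact: continuous_sin].
have d2 : 0 < d / 2%:R by rewrite divr_gt0.
have [/cvgrPdist_le/(_ _ d2) q1 /cvgrPdist_le/(_ _ d2) q2] := cE.
have q : nbhs xi ((fun t => `|cos (x * xi) - cos (x * t)| <= d / 2%:R) `&`
    (fun t => `|sin (x * xi) - sin (x * t)| <= d / 2%:R)) by exact: filterI q1 q2.
have [r /= r0 hr] := (nbhs_ballP _ _).1 q.
exists (r / 2%:R); first by rewrite divr_gt0.
move=> eta heta; have [|k1 k2] := hr eta; first by rewrite /ball /=; lra.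
by apply: le_trans (cabs_le_ReIm _) _; rewrite /= in k1 k2 *; lra.
Qed.

(** The polynomial [tpoly] must approximate f on the spectrum and [fop y] in norm. Both follow from
    the single estimate [key]: for the first, the exponential of y is replaced by a scalar
    exponential times the unit. *)
Lemma fcalc_fourier y : selfadjoint y -> fcalc (fourier mu) y = fop y.
Proof.
move=> sy; apply: fcalcE => // e e0.
have [nz|nz] := eqVneq (vn_one A) 0.
  exists 0; split; last by rewrite -(v1mul (_ - _)) nz vmul0l rnorm0 ltW.
  by move=> x [];
  exists 0; rewrite -(v1mul (_ ** _)) -[X in _ /\ X = _](v1mul (_ ** _)) nz !vmul0l.
pose M := rnorm y; have M0 : 0 <= M := rnorm_ge0 y.
pose K := moment mu + 1; have K0 : 0 < K by rewrite ltr_wpDl ?moment_ge0.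
have e2 : 0 < e / (2%:R * K) by rewrite divr_gt0// mulr_gt0.
(* The cut is fixed first, then the degree N, as the Taylor tail depends on the cut. *)
pose n := Num.truncn ((e / (2%:R * K))^-1).
have hn : n.+1%:R^-1 <= e / (2%:R * K) by exact: inv_succ_le.
have [N hN0] := exp_tail_to0 (n.+1%:R * M) e2; have hN := hN0 N (leqnn N).
have n10 : 0 <= n.+1%:R * M by rewrite mulr_ge0.
pose c := exp_tail (n.+1%:R * M) N + n.+1%:R^-1.
have c0 : 0 <= c by rewrite addr_ge0 ?exp_tail_ge0 ?invr_ge0.
have ce : c * moment mu <= e.
  have : c <= e / K.
    by rewrite /c; have -> : e / K = e / (2%:R * K) + e / (2%:R * K);
      [field; rewrite gt_eqF|exact: lerD].
  rewrite ler_pdivlMr// /K mulrDr mulr1 => h; apply: le_trans h.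
  by rewrite lerDl.
have key (v : nat -> A) (G : R -> A) : fkernel G -> (forall xi, rnorm (G xi) <= 1) ->
   (forall xi, `|xi| <= n.+1%:R ->
     rnorm (\sum_(k < N) ((k`!%:R)^-1 * ('i * xi%:C) ^+ k) *: v k - G xi) <= exp_tail (n.+1%:R * M) N) ->
   rnorm (\sum_(k < N) coef k n.+1 *: v k - fint mu G) <= e.
  move=> kG h1 h2; have [i1 <-] := cutfint N n.+1 v.
  apply: le_trans ce; apply: bochner_dist; [exact: measurableT|exact: finite_setT|exact: i1|exact: fkernel_bintegrable|].
  have [sP [sG _]] : _ /\ _ := conj i1.1 (fkernel_bintegrable h3 kG).
  have e1 xi : rnorm (cm_dens mu xi *: ((cut n.+1 xi)%:C *: \sum_(k < N) ((k`!%:R)^-1 * ('i * xi%:C) ^+ k) *: v k)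
      - cm_dens mu xi *: G xi) <= c * weight xi.
    rewrite -scalerBr rnormZ cabs_dens mul1r.
    exact: (@cut_approx N n M G (fun xi => \sum_(k < N) ((k`!%:R)^-1 * ('i * xi%:C) ^+ k) *: v k)).
  apply: (integral_weight_le h3 _ c0 e1); exact: smeas_sub.
exists (tpoly N n.+1); split.
  move=> x hx; have xM : `|x| <= M by have := spectrum_bound hx; rewrite cabsR.
  (* Scalars are read as multiples of the unit, of norm 1, so that the vector estimate applies to
     them. *)
  have -> : cabs ((tpoly N n.+1).[x%:C] - fourier mu x) =
      rnorm (((tpoly N n.+1).[x%:C] - fourier mu x) *: vn_one A).
    by rewrite rnormZ rnorm_one// mulr1.
  rewrite scalerBl.
  have -> : fourier mu x *: vn_one A = fint mu (fun xi => expi (x * xi) *: vn_one A).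
    have sE : smeas (fun xi => expi (x * xi) : R[i]^o).
      apply: (smeas_comp (G := fun r => expi (x * r) : R[i]^o) (h := id)) => // xi d d0.
      exact: expi_continuous.
    have [mR mI] := smeas_ReIm (smeas_scale sE (smeas_dens mu)).
    have h1 xi : cabs (expi (x * xi) * cm_dens mu xi) <= 1 by rewrite cabsM cabs_expi cabs_dens mulr1.
    have e1 := bochner_complex (cm_abs mu) (vn_one A) mR mI h1.
    rewrite /fint /fourier /= -e1.
    congr (bochner _ _ _); apply/funext => xi; rewrite [RHS]scalerA; congr (_ *: _).
    exact: mulrC.
  have -> : (tpoly N n.+1).[x%:C] *: vn_one A = \sum_(k < N) coef k n.+1 *: (x%:C ^+ k *: vn_one A).
    rewrite horner_poly scaler_suml; apply: eq_bigr => k _; by rewrite scalerA.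
  apply: (key (fun k => x%:C ^+ k *: vn_one A)).
  - split.
      move=> xi d d0; have [dl dl0 hdl] := expi_continuous x xi d0; exists dl => // eta /hdl.
      by rewrite -scalerBl rnormZ rnorm_one// mulr1.
    by exists 1 => xi; rewrite rnormZ cabs_expi mul1r mul1r; apply: le_trans (rnorm1_le _) (weight_ge1 _).
  - by move=> xi; rewrite rnormZ cabs_expi mul1r rnorm1_le.
  - move=> xi hxi; have -> : \sum_(k < N) ((k`!%:R)^-1 * ('i * xi%:C) ^+ k) *: (x%:C ^+ k *: vn_one A) =
        (taylor_exp N xi).[x%:C] *: vn_one A.
      by rewrite /taylor_exp horner_poly scaler_suml; apply: eq_bigr => k _; rewrite scalerA.
    rewrite -scalerBl rnormZ rnorm_one// mulr1; apply: taylor_exp_approx.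
    by rewrite normrM mulrC; apply: ler_pM.
rewrite /fop (@vn_hornerE _ _ _ _ N) ?size_poly//.
have -> : \sum_(k < N) (tpoly N n.+1)`_k *: vn_pow y k = \sum_(k < N) coef k n.+1 *: vn_pow y k.
  by apply: eq_bigr => k _; rewrite coef_poly ltn_ord.
apply: (key (vn_pow y)); [exact: E_fkernel|by move=> xi; exact: E_norm|].
move=> xi hxi; have := E_approx xi y N.
rewrite (@vn_hornerE _ _ _ _ N) ?size_poly//.
have -> : \sum_(k < N) (taylor_exp N xi)`_k *: vn_pow y k =
    \sum_(k < N) ((k`!%:R)^-1 * ('i * xi%:C) ^+ k) *: vn_pow y k.
  by apply: eq_bigr => k _; rewrite coef_poly ltn_ord.
move/le_trans; apply; apply: exp_tail_mono; first by rewrite mulr_ge0 ?rnorm_ge0.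
by rewrite ler_wpM2r.
Qed.

End FunctionalCalculusIntegral.

(** * Graded estimates of second order *)

Section GradedCalculus.
Context (R : realType).
Implicit Types (V W : completeNormedModType R[i]) (k l : R).

(* The second order part of the variation of a smooth map over the
   quadrilateral (a, b, c, d). *)
Definition quad V (a b c d : V) : R :=
  (rnorm (a - b) + rnorm (c - d)) * (rnorm (a - c) + rnorm (b - d)).

(* The grading is such that a product of maps with constants (k, l) and
   (k', l') has constants (k k', l + l'). *)
Record good V W (D : V -> Prop) (F : V -> W) k l : Prop := Good {
  good_ge0 : 0 <= k;
  good_grade_ge0 : 0 <= l;
  good_norm : forall y, D y -> rnorm (F y) <= k;
  good_lip : forall y z, D y -> D z -> rnorm (F y - F z) <= k * (l * rnorm (y - z));
  good_four : forall a b c d, D a -> D b -> D c -> D d ->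
    rnorm (F a - F b - (F c - F d)) <= k * (l * rnorm (a - b - (c - d)) + l ^+ 2 * quad a b c d) }.

Lemma quad_ge0 V (a b c d : V) : 0 <= quad a b c d.
Proof. by rewrite mulr_ge0 ?addr_ge0 ?rnorm_ge0. Qed.

Section Operations.
Context (V : completeNormedModType R[i]) (D : V -> Prop).

Lemma good_mono W (F : V -> W) k l k' l' : good D F k l -> k <= k' -> l <= l' -> good D F k' l'.
Proof.
move=> [k0 l0 h1 h2 h3] kk ll; split.
- exact: le_trans kk.
- exact: le_trans ll.
- by move=> y /h1 /le_trans; apply.
- move=> y z hy hz; apply: le_trans (h2 _ _ hy hz) _.
  by apply: ler_pM => //; rewrite ?mulr_ge0 ?rnorm_ge0 ?ler_wpM2r ?rnorm_ge0.
- move=> a b c d ha hb hc hd; apply: le_trans (h3 _ _ _ _ ha hb hc hd) _.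
  have q0 := quad_ge0 a b c d.
  apply: ler_pM => //; first by rewrite addr_ge0// mulr_ge0 ?rnorm_ge0 ?exprn_ge0.
  apply: lerD; rewrite ler_wpM2r ?rnorm_ge0//.
  by rewrite lerXn2r ?nnegrE// (le_trans l0).
Qed.

Lemma eq_ler (x y : R) : x = y -> x <= y.
Proof. by move->. Qed.

Lemma good_cst W (c : W) : good D (fun=> c) (rnorm c) 0.
Proof.
split; rewrite ?rnorm_ge0//.
  by move=> y z _ _; rewrite subrr rnorm0 mul0r mulr0.
by move=> p q r s _ _ _ _; rewrite !subrr rnorm0 expr0n !mul0r addr0 mulr0.
Qed.

Lemma good_add W (F G : V -> W) k k' l : good D F k l -> good D G k' l ->
  good D (fun y => F y + G y) (k + k') l.
Proof.
move=> [k0 l0 h1 h2 h3] [k0' _ h1' h2' h3']; split; rewrite ?addr_ge0//.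
- by move=> y hy; apply: le_trans (rnormD _ _) _; apply: lerD; [exact: h1|exact: h1'].
- move=> y z hy hz; have -> : F y + G y - (F z + G z) = (F y - F z) + (G y - G z) by zmod.
  by rewrite mulrDl; apply: le_trans (rnormD _ _) _; apply: lerD; [exact: h2|exact: h2'].
- move=> a b c d ha hb hc hd.
  have -> : F a + G a - (F b + G b) - (F c + G c - (F d + G d)) =
     (F a - F b - (F c - F d)) + (G a - G b - (G c - G d)) by zmod.
  by rewrite mulrDl; apply: le_trans (rnormD _ _) _; apply: lerD; [exact: h3|exact: h3'].
Qed.

Lemma good_sum W (I : Type) (r : seq I) (F : I -> V -> W) (k : I -> R) l : 0 <= l ->
  (forall i, good D (F i) (k i) l) -> good D (fun y => \sum_(i <- r) F i y) (\sum_(i <- r) k i) l.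
Proof.
move=> l0 h; elim: r => [|i r ih].
  rewrite big_nil (_ : (fun y => _) = (fun=> 0)); last by apply/funext => y; rewrite big_nil.
  by apply: good_mono (good_cst _) _ _; rewrite ?rnorm0.
rewrite big_cons (_ : (fun y => _) = (fun y => F i y + \sum_(j <- r) F j y)).
  exact: good_add.
by apply/funext => y; rewrite big_cons.
Qed.

Lemma good_map W W' (L : W -> W') (M : R) (F : V -> W) k l :
  (forall u v, L (u + v) = L u + L v) -> 0 <= M -> (forall u, rnorm (L u) <= M * rnorm u) ->
  good D F k l -> good D (L \o F) (M * k) l.
Proof.
move=> hD M0 hM [k0 l0 h1 h2 h3]; split => //=; first by rewrite mulr_ge0.
- by move=> y hy; apply: le_trans (hM _) _; rewrite ler_wpM2l ?h1.
- by move=> y z hy hz; rewrite -additiveB//; apply: le_trans (hM _) _; rewrite -mulrA ler_wpM2l ?h2.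
- move=> a b c d ha hb hc hd; rewrite -!(additiveB hD); apply: le_trans (hM _) _.
  by rewrite -mulrA ler_wpM2l ?h3.
Qed.

Lemma good_scale W (c : R[i]) (F : V -> W) k l : good D F k l ->
  good D (fun y => c *: F y) (cabs c * k) l.
Proof.
apply: (@good_map _ _ ( *:%R c)) => [u v||u]; rewrite ?scalerDr ?cabs_ge0//.
by rewrite rnormZ.
Qed.

(** The bound on second differences of a product is where the grading pays off: the products of
    first differences are absorbed by the cross term 2 l l' of (l + l')^2. Domains S1 and S2 are
    needed because [tens2] is meaningful only on a subspace. *)
Lemma good_bilinear_on W1 W2 W (S1 : linSubspace W1) (S2 : linSubspace W2) (b : W1 -> W2 -> W)
    (F : V -> W1) (G : V -> W2) (M : R) k l k' l' :
  (forall x y z, S1 x -> S1 y -> S2 z -> b (x - y) z = b x z - b y z) ->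
  (forall x y z, S1 z -> S2 x -> S2 y -> b z (x - y) = b z x - b z y) -> 0 <= M ->
  (forall x y, S1 x -> S2 y -> rnorm (b x y) <= M * (rnorm x * rnorm y)) ->
  (forall y, D y -> S1 (F y)) -> (forall y, D y -> S2 (G y)) ->
  good D F k l -> good D G k' l' -> good D (fun y => b (F y) (G y)) (M * (k * k')) (l + l').
Proof.
move=> bl br M0 bM sF sG [k0 l0 h1 h2 h3] [k0' l0' h1' h2' h3'].
have kk : 0 <= k * k' by rewrite mulr_ge0.
have bP x y (u v : R) : S1 x -> S2 y -> rnorm x <= u -> rnorm y <= v -> rnorm (b x y) <= M * (u * v).
  move=> sx sy hu hv; apply: le_trans (bM _ _ sx sy) _; rewrite ler_wpM2l//.
  by apply: ler_pM; rewrite ?rnorm_ge0.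
split; rewrite ?addr_ge0 ?mulr_ge0//.
- by move=> y hy; apply: bP; [exact: sF|exact: sG|exact: h1|exact: h1'].
- move=> y z hy hz; have [fy fz gy gz] := And4 (sF _ hy) (sF _ hz) (sG _ hy) (sG _ hz).
  have -> : b (F y) (G y) - b (F z) (G z) = b (F y - F z) (G y) + b (F z) (G y - G z).
    by rewrite bl// br//; zmod.
  apply: le_trans (rnormD _ _) _; apply: le_trans (lerD
     (bP _ _ _ _ _ _ (h2 _ _ hy hz) (h1' _ hy)) (bP _ _ _ _ _ _ (h1 _ hz) (h2' _ _ hy hz))) _ => //.
  - exact: subspaceB.
  - exact: subspaceB.
  - by apply: eq_ler; ring.
- move=> p q r s hp hq hr hs.
  have [f1 f2 f3 f4] := And4 (sF _ hp) (sF _ hq) (sF _ hr) (sF _ hs).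
  have [g1 g2 g3 g4] := And4 (sG _ hp) (sG _ hq) (sG _ hr) (sG _ hs).
  (* Leibniz rule for second differences: two second differences and two products of first
     differences. *)
  have e : b (F p) (G p) - b (F q) (G q) - (b (F r) (G r) - b (F s) (G s)) =
    b (F p - F q - (F r - F s)) (G p) + b (F s) (G p - G q - (G r - G s)) +
    (b (F q - F s) (G p - G q) + b (F r - F s) (G p - G r)).
    by rewrite !bl ?br//; try exact: subspaceB; zmod.
  rewrite e.
  have t1 := bP _ _ _ _ (subspaceB (subspaceB f1 f2) (subspaceB f3 f4)) g1 (h3 _ _ _ _ hp hq hr hs) (h1' _ hp).
  have t2 := bP _ _ _ _ f4 (subspaceB (subspaceB g1 g2) (subspaceB g3 g4)) (h1 _ hs) (h3' _ _ _ _ hp hq hr hs).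
  have t3 := bP _ _ _ _ (subspaceB f2 f4) (subspaceB g1 g2) (h2 _ _ hq hs) (h2' _ _ hp hq).
  have t4 := bP _ _ _ _ (subspaceB f3 f4) (subspaceB g1 g3) (h2 _ _ hr hs) (h2' _ _ hp hr).
  apply: le_trans (rnormD _ _) _; apply: le_trans (lerD (rnormD _ _) (rnormD _ _)) _.
  apply: le_trans (lerD (lerD t1 t2) (lerD t3 t4)) _.
  set A := rnorm (p - q - (r - s)).
  rewrite -subr_ge0 /quad; set x := rnorm (p - q); set y := rnorm (r - s).
  set u := rnorm (p - r); set v := rnorm (q - s).
  set e1 := (X in 0 <= X).
  have -> : e1 = (M * (k * k')) * (l * l') * (2%:R * (x * u) + 2%:R * (y * v) + x * v + y * u).
    by rewrite /e1; ring.
  by rewrite mulr_ge0 ?addr_ge0 ?mulr_ge0 ?rnorm_ge0.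
Qed.

Lemma good_bilinear W1 W2 W (b : W1 -> W2 -> W) (F : V -> W1) (G : V -> W2) (M : R) k l k' l' :
  (forall x y z, b (x - y) z = b x z - b y z) ->
  (forall x y z, b z (x - y) = b z x - b z y) -> 0 <= M ->
  (forall x y, rnorm (b x y) <= M * (rnorm x * rnorm y)) ->
  good D F k l -> good D G k' l' -> good D (fun y => b (F y) (G y)) (M * (k * k')) (l + l').
Proof.
move=> bl br M0 bM; apply: (@good_bilinear_on _ _ _ (full_linSubspace W1) (full_linSubspace W2)) => //.
- by move=> x y z _ _ _; exact: bl.
- by move=> x y z _ _ _; exact: br.

Qed.

Lemma good_limit W (F : nat -> V -> W) (G : V -> W) k l :
  (forall n, good D (F n) k l) ->
  (forall y, D y -> forall e, 0 < e -> exists N, forall n, (N <= n)%N -> rnorm (F n y - G y) <= e) ->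
  good D G k l.
Proof.
move=> hF hlim; have [k0 l0 _ _ _] := hF 0%N.
split => // [y hy|y z hy hz|a b c d ha hb hc hd]; apply: ler_eps => e e0.
- have [N /(_ N (leqnn _)) h] := hlim _ hy _ e0.
  have := good_norm (hF N) hy; have -> : G y = F N y - (F N y - G y) by zmod.
  by move=> h1; apply: le_trans (rnormDB _ _) _; exact: lerD.
- have e2 : 0 < e / 2%:R by rewrite divr_gt0.
  have [N1 h1] := hlim _ hy _ e2; have [N2 h2] := hlim _ hz _ e2.
  pose N := maxn N1 N2; have {}h1 := h1 N (leq_maxl _ _); have {}h2 := h2 N (leq_maxr _ _).
  have h := good_lip (hF N) hy hz.
  have -> : G y - G z = (F N y - F N z) - ((F N y - G y) - (F N z - G z)) by zmod.
  apply: le_trans (rnormDB _ _) _; have := rnormDB (F N y - G y) (F N z - G z); lra.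
- have e4 : 0 < e / 4%:R by rewrite divr_gt0.
  have [N1 h1] := hlim _ ha _ e4; have [N2 h2] := hlim _ hb _ e4.
  have [N3 h3] := hlim _ hc _ e4; have [N4 h4] := hlim _ hd _ e4.
  pose N := (N1 + N2 + N3 + N4)%N.
  have {}h1 : rnorm (F N a - G a) <= e / 4%:R by apply: h1; rewrite /N; lia.
  have {}h2 : rnorm (F N b - G b) <= e / 4%:R by apply: h2; rewrite /N; lia.
  have {}h3 : rnorm (F N c - G c) <= e / 4%:R by apply: h3; rewrite /N; lia.
  have {}h4 : rnorm (F N d - G d) <= e / 4%:R by apply: h4; rewrite /N; lia.
  have h := good_four (hF N) ha hb hc hd.
  have -> : G a - G b - (G c - G d) = (F N a - F N b - (F N c - F N d)) -
     ((F N a - G a) - (F N b - G b) - ((F N c - G c) - (F N d - G d))) by zmod.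
  apply: le_trans (rnormDB _ _) _.
  have t1 := rnormDB (F N a - G a - (F N b - G b)) (F N c - G c - (F N d - G d)).
  have t2 := rnormDB (F N a - G a) (F N b - G b).
  have t3 := rnormDB (F N c - G c) (F N d - G d).
  lra.
Qed.

Context (mu : complexMeasure R) (h3 : in_F 3 mu).

(** Second differences cost |xi|^(j+2), which the weight dominates for j <= 1. The case j = 0 gives
    f(y) and j = 1 its derivative, whose kernel carries a factor xi. *)
Lemma good_fint W (G : R -> V -> W) j : (j <= 1)%N ->
  (forall y, D y -> fkernel (fun xi => G xi y)) ->
  (forall xi, good D (G xi) (`|xi| ^+ j) `|xi|) ->
  good D (fun y => fint mu (fun xi => G xi y)) (moment mu) 1.
Proof.
move=> j1 kG hG.
have wj i (xi : R) : (i <= 2)%N -> `|xi| ^+ j * `|xi| ^+ i <= weight xi.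
  by move=> i2; rewrite -exprD; apply: weight_ge_norm; lia.
split; rewrite ?moment_ge0//.
- move=> y hy; rewrite -[moment mu]mul1r; apply: fint_norm => //; first exact: kG.
  by move=> xi; rewrite mul1r; apply: le_trans (good_norm (hG xi) hy) _; have := wj 0%N xi; rewrite mulr1; exact.
- move=> y z hy hz; rewrite -fintB//; [|exact: kG|exact: kG].
  rewrite mul1r mulrC; apply: fint_norm => //; [by apply: fkernelB; exact: kG|exact: rnorm_ge0|].
  move=> xi; apply: le_trans (good_lip (hG xi) hy hz) _.
  rewrite mulrA mulrC ler_wpM2l ?rnorm_ge0//; have := wj 1%N xi; rewrite expr1; exact.
- move=> a b c d ha hb hc hd; have [ka kb kc kd] := And4 (kG _ ha) (kG _ hb) (kG _ hc) (kG _ hd).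
  rewrite -!fintB//; try exact: fkernelB.
  have q0 := quad_ge0 a b c d.
  rewrite expr1n !mul1r mulrC; apply: fint_norm => //; first by apply: fkernelB; apply: fkernelB.
    by rewrite addr_ge0 ?rnorm_ge0.
  move=> xi; apply: le_trans (good_four (hG xi) ha hb hc hd) _.
  have w1 := wj 1%N xi isT; have w2 := wj 2%N xi isT; rewrite expr1 in w1; rewrite expr2 mulrA in w2.
  move: (quad a b c d) (weight xi) q0 w1 w2 => q w q0 w1 w2.
  rewrite mulrDr !mulrA [leRHS]mulrDl ![_ * w]mulrC.
  by apply: lerD; apply: ler_wpM2r => //; exact: rnorm_ge0.
Qed.

End Operations.

Lemma good_sub V W (D D' : V -> Prop) (F : V -> W) k l : good D F k l ->
  (forall y, D' y -> D y) -> good D' F k l.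
Proof.
move=> [k0 l0 h1 h2 h3] s; split => //; first by move=> y /s; exact: h1.
  by move=> y z /s hy /s hz; exact: h2.
by move=> a b c d /s ha /s hb /s hc /s hd; exact: h3.
Qed.

End GradedCalculus.

Section GoodExponential.
Context (R : realType) (A : vonNeumannAlgebra R) (mu : complexMeasure R) (h3 : in_F 3 mu).

Lemma good_E (xi : R) : good (@selfadjoint R A) (E xi) 1 `|xi|.
Proof.
split => //.
- by move=> y sy; exact: E_norm.
- by move=> y z sy sz; rewrite mul1r; exact: E_lipschitz.
- move=> a b c d sa sb sc sd; rewrite mul1r.
  have -> : E xi a - E xi b - (E xi c - E xi d) = E xi a - E xi b - E xi c + E xi d by zmod.
  apply: le_trans (E_fourpoint xi sa sb sc sd) _.
  have -> : a - b - (c - d) = a - b - c + d by zmod.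
  rewrite lerD2l real_normK ?num_real// ler_wpM2l ?sqr_ge0// /quad.
  have := rnorm_ge0 (a - b); have := rnorm_ge0 (c - d); have := rnorm_ge0 (a - c); have := rnorm_ge0 (b - d).
  move: (rnorm (a - b)) (rnorm (c - d)) (rnorm (a - c)) (rnorm (b - d)) => *; nra.
Qed.

Lemma good_fop : good (@selfadjoint R A) (fop mu) (moment mu) 1.
Proof.
apply: (@good_fint _ _ _ mu h3 A (fun xi y => E xi y) 0) => //; first by move=> y; exact: E_fkernel.
by move=> xi; rewrite expr0; exact: good_E.
Qed.

End GoodExponential.

(** * Riemann sums *)

Section RiemannSums.
Context (R : realType) (V : completeNormedModType R[i]) (g : R -> V) (lam : R).
Hypothesis g_lip : forall a b, rnorm (g a - g b) <= lam * `|a - b|.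
Local Notation leb := (@lebesgue_measure R).
Local Notation I01 := (`[(0 : R), 1]%classic).

Lemma lebesgue01 : (leb I01 < +oo)%E.
Proof. by rewrite lebesgue_measure_itv /= lte01 sube0 ltry. Qed.

(** The singleton {0}, of measure zero, makes the half-open cells cover the closed interval. *)
Let cells N M : seq (set R * V) := ([set 0], g 0) ::
  [seq (`](k%:R / N.+1%:R), (k.+1%:R / N.+1%:R)]%classic : set R, g (k%:R / N.+1%:R)) | k <- iota 0 M].

Let cellsS N M : cells N M.+1 = cells N M ++
  [:: (`](M%:R / N.+1%:R), (M.+1%:R / N.+1%:R)]%classic : set R, g (M%:R / N.+1%:R))].
Proof.
rewrite /cells; have -> : iota 0 M.+1 = iota 0 M ++ [:: M] by rewrite -addn1 iotaD.
by rewrite map_cat.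
Qed.

Let lval1 (p : set R * V) x : lval [:: p] x = if x \in p.1 then p.2 else 0.
Proof. by rewrite lval_cons /lval big_nil addr0. Qed.

Let mlist_cells N M : mlist (cells N M).
Proof.
elim: M => [|M ih]; first by move=> p; rewrite inE => /eqP ->; exact: measurable_set1.
rewrite cellsS; apply: mlist_cat => // p; rewrite inE => /eqP -> /=; exact: measurable_itv.
Qed.

Let lval_cells N M x : 0 <= x ->
  (x <= M%:R / N.+1%:R -> exists2 a, `|x - a| <= N.+1%:R^-1 & lval (cells N M) x = g a) /\
  (M%:R / N.+1%:R < x -> lval (cells N M) x = 0).
Proof.
move=> x0; elim: M => [|M [ih1 ih2]].
  rewrite mul0r /cells /= lval1 /=; split.
    move=> x0'; have -> : x = 0 by apply/le_anti; rewrite x0'.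
    by exists 0; rewrite ?subrr ?normr0 ?invr_ge0// mem_set.
  by move=> xp; rewrite memNset//= => x0'; rewrite x0' ltxx in xp.
have MM : M%:R / N.+1%:R < M.+1%:R / N.+1%:R :> R by rewrite ltr_pM2r ?invr_gt0// ltr_nat.
have stp : M.+1%:R / N.+1%:R = M%:R / N.+1%:R + N.+1%:R^-1 :> R by rewrite -[M.+1]addn1 natrD mulrDl mul1r.
rewrite cellsS lval_cat lval1 /=; split.
  move=> xM; have [xM'|xM'] := leP x (M%:R / N.+1%:R).
    have [a ha ->] := ih1 xM'; exists a => //; rewrite memNset ?addr0//=.
    by rewrite in_itv /= ltNge xM'.
  rewrite (ih2 xM') add0r mem_set /=; last by rewrite in_itv /= xM' xM.
  by exists (M%:R / N.+1%:R) => //; rewrite ger0_norm ?subr_ge0 ?(ltW xM')// lerBlDl -stp.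
move=> xM; rewrite (ih2 (lt_trans MM xM)) memNset ?addr0//= in_itv /= => /andP[_].
by rewrite leNgt xM.
Qed.

Let integral_cells N M : (M <= N.+1)%N ->
  simple_integral leb I01 (cells N M) = \sum_(k < M) (N.+1%:R^-1)%:C *: g (k%:R / N.+1%:R).
Proof.
elim: M => [_|M ih MN].
  rewrite big_ord0 /simple_integral /cells /= big_cons big_nil addr0 /=.
  have -> : leb (I01 `&` [set 0]) = 0%E.
    apply/eqP; rewrite -measure_le0 -(lebesgue_measure_set1 (0 : R)).
    by apply: le_measure; rewrite ?inE//; exact: measurableI.
  by rewrite fine0 scale0r.
rewrite cellsS simple_integral_cat ih 1?ltnW// big_ord_recr /=; congr (_ + _).
rewrite /simple_integral big_cons big_nil addr0 /=; congr (_%:C *: _).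
have stp : M.+1%:R / N.+1%:R = M%:R / N.+1%:R + N.+1%:R^-1 :> R by rewrite -[M.+1]addn1 natrD mulrDl mul1r.
have i0 : 0 < N.+1%:R^-1 :> R by rewrite invr_gt0.
have l1 : M.+1%:R / N.+1%:R <= 1 :> R by rewrite ler_pdivrMr// mul1r ler_nat.
have l0 : 0 <= M%:R / N.+1%:R :> R by rewrite mulr_ge0// ltW.
have -> : I01 `&` `](M%:R / N.+1%:R), (M.+1%:R / N.+1%:R)]%classic =
    `](M%:R / N.+1%:R), (M.+1%:R / N.+1%:R)]%classic.
  apply/seteqP; split=> [x []//|x /=]; rewrite !in_itv /= => /andP[h1 h2]; split; last by rewrite h1.
  by apply/andP; split; [apply: ltW; exact: le_lt_trans h1|exact: le_trans l1].
by rewrite lebesgue_measure_itv /= lte_fin stp ltrDl i0 -EFinD /= addrAC subrr add0r.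
Qed.

Lemma lipschitz_smeas (h : R -> V) (l : R) : (forall a b, rnorm (h a - h b) <= l * `|a - b|) ->
  smeas (h : measurableTypeR R -> V).
Proof.
move=> h_lip; apply: (smeas_comp (G := h) (h := id)) => // x e e0.
have l0 : 0 < `|l| + 1 by rewrite ltr_wpDl.
exists (e / (`|l| + 1)); first by rewrite divr_gt0.
move=> y; rewrite ler_pdivlMr// => hy; apply: le_trans (h_lip _ _) _; apply: le_trans hy.
by rewrite mulrC ler_wpM2l// (le_trans (ler_norm _))// lerDl.
Qed.

Lemma lipschitz_bintegrable : bintegrable leb I01 g.
Proof.
have sg := lipschitz_smeas g_lip; split => //.
have lam0 : 0 <= lam by have := g_lip 1 0; rewrite subr0 normr1 mulr1; apply: le_trans; exact: rnorm_ge0.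
apply: (@le_lt_trans _ _ (\int[leb]_(x in I01) (cst (rnorm (g 0) + lam)%:E x))%E); last first.
  by rewrite integral_cst//= lte_mul_pinfty// ?lebesgue01// lee_fin addr_ge0// rnorm_ge0.
apply: ge0_le_integral => //=.
- by move=> x _; rewrite lee_fin rnorm_ge0.
- by apply/measurable_EFinP; apply: measurable_funTS; exact: smeas_norm.
- move=> x; rewrite /= in_itv /= => /andP[x0 x1]; rewrite lee_fin.
  have -> : g x = g 0 + (g x - g 0) by zmod.
  apply: le_trans (rnormD _ _) _; rewrite lerD2l; apply: le_trans (g_lip _ _) _.
  by rewrite subr0 ger0_norm// ler_piMr.
Qed.

(** The outer integral of the derivative thus becomes a limit of finite sums, under which the graded
    estimates are stable. *)
Lemma riemann_sum N : rnorm (bochner leb I01 g -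
  \sum_(k < N.+1) (N.+1%:R^-1)%:C *: g (k%:R / N.+1%:R)) <= lam / N.+1%:R.
Proof.
have lam0 : 0 <= lam by have := g_lip 1 0; rewrite subr0 normr1 mulr1; apply: le_trans; exact: rnorm_ge0.
have mc := @mlist_cells N N.+1.
have sc : smeas (lval (cells N N.+1) : measurableTypeR R -> V) by exact: smeas_lval.
have key x : I01 x -> rnorm (g x - lval (cells N N.+1) x) <= lam / N.+1%:R.
  rewrite /= in_itv /= => /andP[x0 x1]; have [h _] := lval_cells N N.+1 x0.
  have [|a ha ->] := h; first by rewrite divff.
  by apply: le_trans (g_lip _ _) _; rewrite ler_wpM2l.
have bg := lipschitz_bintegrable.
have sd : smeas (fun x : measurableTypeR R => g x - lval (cells N N.+1) x) by apply: smeas_sub => //; exact: bg.1.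
have c_le (c : R) (h : measurableTypeR R -> R) : 0 <= c -> measurable_fun setT h -> (forall x, 0 <= h x) ->
    (forall x, I01 x -> h x <= c) -> (\int[leb]_(x in I01) (h x)%:E <= c%:E)%E.
  move=> c0 mh h0 hc; apply: (@le_trans _ _ (\int[leb]_(x in I01) (cst c%:E x))%E).
    apply: ge0_le_integral => //=.
    - by move=> x _; rewrite lee_fin.
    - by apply/measurable_EFinP; exact: measurable_funTS.

  by rewrite integral_cst//= lebesgue_measure_itv /= lte01 sube0 mule1.
have i_le := c_le _ _ _ (smeas_norm sd) (fun=> rnorm_ge0 _) key.
have z x : rnorm (lval (cells N N.+1) x - simple_value (cells N N.+1) x) = 0.
  by rewrite (_ : simple_value _ _ = lval (cells N N.+1) x)// subrr rnorm0.
have bc : is_bochner leb I01 (lval (cells N N.+1)) (simple_integral leb I01 (cells N N.+1)).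
  exists (fun=> cells N N.+1); split.
  - move=> _ p hp; split; first exact: mc.
    by apply: measure_sub_fin; [exact: measurable_itv|exact: lebesgue01|exact: mc].
  - move=> n; rewrite (_ : (fun _ => _) = (fun=> 0)); first exact: measurable_cst.
    by apply/funext => x; exact: z.
  - rewrite (_ : (fun _ => _) = (fun=> 0%E)); first exact: cvg_cst.
    by apply/funext => n; apply: integral0_eq => x _; rewrite [rnorm _]z.
  - exact: cvg_cst.
have ic : bintegrable leb I01 (lval (cells N N.+1)).
  split => //; have k0 : 0 <= lam / N.+1%:R by rewrite mulr_ge0// invr_ge0.
  have e1 := inteD leb (measurable_itv `[0, 1]) (smeas_norm sd) (smeas_norm bg.1) (fun=> rnorm_ge0 _) (fun=> rnorm_ge0 _).
  apply: (@le_lt_trans _ _ (\int[leb]_(x in I01) (rnorm (g x - lval (cells N N.+1) x) + rnorm (g x))%:E)%E).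
    apply: le_inte => //; first exact: smeas_norm.
      by apply: measurable_funD; [exact: smeas_norm sd|exact: smeas_norm bg.1].
    move=> x; rewrite rnorm_ge0 /=; rewrite (rnormB (g x)).
    by have := rnorm_dist (lval (cells N N.+1) x) (g x) 0; rewrite !subr0.
  rewrite e1 lte_add_pinfty//; first by apply: le_lt_trans (i_le k0) _; rewrite ltry.
  exact: bg.2.
have e1 : bochner leb I01 (lval (cells N N.+1)) = simple_integral leb I01 (cells N N.+1).
  by apply: bochnerE => //; exact: lebesgue01.
rewrite -(integral_cells (leqnn N.+1)) -e1.
apply: bochner_dist => //; [exact: lebesgue01|].
by apply: i_le; rewrite mulr_ge0// invr_ge0.
Qed.

End RiemannSums.

(** * Divided differences *)

Section DividedDifference.
Context (R : realType) (A : vonNeumannAlgebra R) (S : linSubspace A) (T : ptensor2 S).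
Implicit Types (y z : A) (xi al : R) (N k : nat).

(* The subalgebra [S] enters only through the exponentials of [y]. *)
Definition dom y : Prop := selfadjoint y /\ forall xi, S (E xi y).

Lemma dom_selfadjoint y : dom y -> selfadjoint y.
Proof. by case. Qed.

Lemma dom_S xi y : dom y -> S (E xi y).
Proof. by case. Qed.

Definition dker al xi y : T := ('i * xi%:C) *: tens2 T (E (al * xi) y) (E ((1 - al) * xi) y).

Lemma cabs_iR xi : cabs ('i * xi%:C : R[i]) = `|xi|.
Proof. by rewrite cabsM cabsi mul1r cabsR. Qed.

Lemma tens2_E_norm xi eta y : dom y -> rnorm (tens2 T (E xi y) (E eta y)) <= 1.
Proof.
move=> dy; apply: le_trans (tens2_rnorm T (dom_S _ dy) (dom_S _ dy)) _.
rewrite -[leRHS]mul1r; apply: ler_pM; rewrite ?rnorm_ge0//; apply: E_norm; exact: dom_selfadjoint.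
Qed.

Lemma dker_norm al xi y : dom y -> rnorm (dker al xi y) <= `|xi|.
Proof. by move=> dy; rewrite rnormZ cabs_iR ler_piMr// tens2_E_norm. Qed.

Lemma tens2_E_dist xi eta xi' eta' y : dom y ->
  rnorm (tens2 T (E xi y) (E eta y) - tens2 T (E xi' y) (E eta' y)) <=
  (`|xi - xi'| + `|eta - eta'|) * rnorm y.
Proof.
move=> dy; have sy := dom_selfadjoint dy; have Sy be : S (E be y) by exact: dom_S.
have -> : tens2 T (E xi y) (E eta y) - tens2 T (E xi' y) (E eta' y) =
   tens2 T (E xi y - E xi' y) (E eta y) + tens2 T (E xi' y) (E eta y - E eta' y).
  by rewrite (bilinearBl (tens2_bilinear T))// (bilinearBr (tens2_bilinear T))//; zmod.
rewrite mulrDl; apply: le_trans (rnormD _ _) _; apply: lerD.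
  apply: le_trans (tens2_rnorm T (subspaceB (Sy _) (Sy _)) (Sy _)) _.
  rewrite -[leRHS]mulr1; apply: ler_pM; rewrite ?rnorm_ge0//; [exact: E_continuous|exact: E_norm].
apply: le_trans (tens2_rnorm T (Sy _) (subspaceB (Sy _) (Sy _))) _.
rewrite -[leRHS]mul1r; apply: ler_pM; rewrite ?rnorm_ge0//; [exact: E_norm|exact: E_continuous].
Qed.

Lemma dker_fkernel al y : dom y -> fkernel (fun xi => dker al xi y).
Proof.
move=> dy; split; last first.
  by exists 1 => xi; rewrite mul1r; apply: le_trans (dker_norm al xi dy) _; exact: weight_ge_norm xi 1%N _.
move=> xi e e0; pose c : R := 1 + (`|xi| + 1) * ((`|al| + `|1 - al|) * rnorm y).
have c0 : 0 < c by rewrite ltr_wpDr// !mulr_ge0 ?addr_ge0 ?rnorm_ge0.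
exists (Num.min 1 (e / c)); first by rewrite lt_min ltr01 divr_gt0.
move=> eta; rewrite le_min => /andP[h1 h2]; rewrite ler_pdivlMr// in h2.
have -> : dker al xi y - dker al eta y =
   ('i * (xi - eta)%:C) *: tens2 T (E (al * xi) y) (E ((1 - al) * xi) y) +
   ('i * eta%:C) *: (tens2 T (E (al * xi) y) (E ((1 - al) * xi) y) -
      tens2 T (E (al * eta) y) (E ((1 - al) * eta) y)).
  by rewrite /dker RCB mulrBr scalerBl cscalerBr; zmod.
apply: le_trans (rnormD _ _) _; rewrite !rnormZ !cabs_iR.
have t1 : `|xi - eta| * rnorm (tens2 T (E (al * xi) y) (E ((1 - al) * xi) y)) <= `|xi - eta|.
  by rewrite ler_piMr// tens2_E_norm.
have t2 := tens2_E_dist (al * xi) ((1 - al) * xi) (al * eta) ((1 - al) * eta) dy.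
rewrite -!mulrBr !normrM -mulrDl mulrAC in t2.
have t3 : `|eta| <= `|xi| + 1.
  by have := ler_normB eta xi; have := ler_normD xi (eta - xi); rewrite (distrC eta) addrCA subrr addr0; lra.
apply: le_trans h2; rewrite /c mulrDr mulr1; apply: lerD => //.
by rewrite mulrCA; apply: ler_pM; rewrite ?rnorm_ge0// [leRHS]mulrC.
Qed.

(** The grades al |xi| and (1 - al) |xi| of the two exponentials add up to |xi|. *)
Lemma good_dker al xi : 0 <= al <= 1 -> good dom (dker al xi) (`|xi| ^+ 1) `|xi|.
Proof.
move=> /andP[a0 a1]; have a1' : 0 <= 1 - al by rewrite subr_ge0.
have gE be : good dom (E (be * xi)) 1 `|be * xi| := good_sub (good_E A _) dom_selfadjoint.
have h := good_bilinear_on (S1 := S) (S2 := S) (b := tens2 T) (M := 1)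
  (fun x y z hx hy hz => bilinearBl (tens2_bilinear T) hx hy hz)
  (fun x y z hz hx hy => bilinearBr (tens2_bilinear T) hx hy hz) ler01
  _ (fun y => @dom_S (al * xi) y) (fun y => @dom_S ((1 - al) * xi) y) (gE al) (gE (1 - al)).
have {}h := h (fun x y hx hy => le_trans (tens2_rnorm T hx hy) (eq_ler (esym (mul1r _)))).
have := good_scale ('i * xi%:C) h; rewrite cabs_iR !mulr1 expr1 => h'; apply: good_mono h' _ _ => //.
by rewrite !normrM (ger0_norm a0) (ger0_norm a1') -mulrDl addrCA subrr addr0 mul1r.
Qed.

Context (mu : complexMeasure R) (h3 : in_F 3 mu).

Definition dint al y : T := fint mu (fun xi => dker al xi y).

Lemma good_dint al : 0 <= al <= 1 -> good dom (dint al) (moment mu) 1.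
Proof.
move=> a01; apply: (@good_fint _ _ _ mu h3 T (dker al) 1) => //.
  by move=> y; exact: dker_fkernel.
by move=> xi; exact: good_dker.
Qed.

Lemma dint_lip y : dom y -> forall al be,
  rnorm (dint al y - dint be y) <= (2%:R * rnorm y * moment mu) * `|al - be|.
Proof.
move=> dy al be; rewrite -fintB//; try exact: dker_fkernel.
rewrite mulrAC; apply: fint_norm => //; first by apply: fkernelB; exact: dker_fkernel.
  by rewrite !mulr_ge0// rnorm_ge0.
move=> xi; rewrite -cscalerBr rnormZ cabs_iR.
have t := tens2_E_dist (al * xi) ((1 - al) * xi) (be * xi) ((1 - be) * xi) dy.
have e : 1 - al - (1 - be) = be - al by ring.
rewrite -!mulrBl e !normrM (distrC be) -mulr2n in t.
have w := weight_ge_norm xi (leqnSn 2).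
apply: (@le_trans _ _ (`|xi| * ((`|al - be| * `|xi|) *+ 2 * rnorm y))); first by rewrite ler_wpM2l.
have -> : `|xi| * ((`|al - be| * `|xi|) *+ 2 * rnorm y) = 2%:R * rnorm y * `|al - be| * `|xi| ^+ 2 by ring.
by rewrite ler_wpM2l// !mulr_ge0// rnorm_ge0.
Qed.

Lemma deriv2E y : deriv2 T mu y = bochner lebesgue_measure `[0, 1]%classic (dint ^~ y).
Proof.
rewrite /deriv2; congr (bochner _ _ _); apply/funext => al.
by congr (bochner _ _ _); apply/funext => xi; rewrite /dker scalerA.
Qed.

Definition dsum N y : T := \sum_(k < N.+1) (N.+1%:R^-1)%:C *: dint (k%:R / N.+1%:R) y.

Lemma deriv2_dsum N y : dom y ->
  rnorm (dsum N y - deriv2 T mu y) <= (2%:R * rnorm y * moment mu) / N.+1%:R.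
Proof. by move=> dy; rewrite rnormB deriv2E; apply: riemann_sum; exact: dint_lip. Qed.

Lemma harmonic_to0 (c : R) : to0 (fun n => c / n.+1%:R).
Proof.
move=> d d0; have c0 : 0 < `|c| + 1 by rewrite ltr_wpDl.
exists (Num.truncn (d / (`|c| + 1))^-1) => n /(inv_succ_le (divr_gt0 d0 c0)).
rewrite ler_pdivlMr// => h; apply: le_trans h; rewrite mulrC ler_wpM2l ?invr_ge0//.
by apply: (le_trans (ler_norm _)); rewrite lerDl.
Qed.

Lemma deriv2_cvg y : dom y -> forall e, 0 < e ->
  exists N, forall n, (N <= n)%N -> rnorm (dsum n y - deriv2 T mu y) <= e.
Proof.
move=> dy e /(harmonic_to0 (2%:R * rnorm y * moment mu))[N hN]; exists N => n /hN.
exact: le_trans (deriv2_dsum n dy).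
Qed.

Lemma good_deriv2 : good dom (deriv2 T mu) (moment mu) 1.
Proof.
apply: (good_limit (F := dsum)) deriv2_cvg => N.
(* The N + 1 weights 1/(N+1) sum to 1, so averaging does not change the constant. *)
have -> : moment mu = \sum_(k < N.+1) cabs ((N.+1%:R^-1 : R)%:C) * moment mu.
  rewrite -mulr_suml sumr_const card_ord cabsR ger0_norm ?invr_ge0//.
  by rewrite -[_^-1 *+ _]mulr_natl divff ?mul1r.
apply: good_sum => // k; apply: good_scale; apply: good_dint.
by rewrite divr_ge0//= ler_pdivrMr// mul1r ler_nat ltnW.
Qed.

End DividedDifference.

(** * Naturality of the divided difference and Taylor remainders *)

Section DividedDifferenceNatural.
Context (R : realType) (A : vonNeumannAlgebra R) (mu : complexMeasure R) (h3 : in_F 3 mu).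

(** Both integrals commute with bounded linear maps. Applied to the canonical map from A_s (x) A_s
    to A_u (x) A_u, this identifies the derivatives computed at times s and u. *)
Lemma deriv2_map (S S' : linSubspace A) (T : ptensor2 S) (T' : ptensor2 S') (M : R) (L : T -> T') y :
  0 <= M -> bounded_linear M L -> (forall u v, S u -> S v -> L (tens2 T u v) = tens2 T' u v) ->
  dom S y -> dom S' y -> L (deriv2 T mu y) = deriv2 T' mu y.
Proof.
move=> M0 bL hL dy dy'.
have hD := bounded_linearD bL; have hZ := bounded_linearZ bL.
have hM := bounded_linear_rnorm bL.
have e al : L (dint T mu al y) = dint T' mu al y.
  rewrite /dint -(fint_map h3 M0 bL (dker_fkernel _ _ dy)); congr fint; apply/funext => xi /=.
  by rewrite /dker hZ hL//; apply: dom_S.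
have [_ h] := bochner_map (m := @lebesgue_measure R) (measurable_itv `[0, 1]) (lebesgue01 R) hD (fun r u => hZ r%:C u) M0 hM
   (lipschitz_bintegrable (dint_lip T h3 dy)).
rewrite !deriv2E -h; congr (bochner _ _ _); apply/funext => al /=; exact: e.
Qed.

Variables (S : linSubspace A) (T : ptensor2 S).

Lemma sharp2P (a : A) : (forall u v, S u -> S v -> sharp2 (tens2 T u v) a = u ** a ** v) /\
  bounded_linear (rnorm a) (fun x : T => sharp2 x a).
Proof.
have [|x y hx hy|h1 h2] := @extend2P _ _ _ T A (fun u v => u ** a ** v) _ (rnorm_ge0 a).
- by move=> c x y z _ _ _; rewrite !vmulDl !vmulZl !vmulDr !vmulZr.
- by apply: le_trans (rnormM _ _) _; rewrite mulrA ler_wpM2r ?rnorm_ge0// mulrC rnormM.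
by split.
Qed.

Definition taylor y z : A := fop mu z - fop mu y - sharp2 (deriv2 T mu y) (z - y).

(** The N-th Riemann sum of the derivative can be moved under the Fourier integral, where it
    produces exactly [taylor_step]; the bounds on exponentials then integrate. *)
Lemma taylor_fint N y z : dom S y -> selfadjoint z ->
  fkernel (fun xi => taylor_step N xi y z) /\
  fint mu (fun xi => taylor_step N xi y z) = fop mu z - fop mu y - sharp2 (dsum T mu N y) (z - y).
Proof.
move=> dy sz; have sy := dom_selfadjoint dy.
have [s1 s2] := sharp2P (z - y); have sD := bounded_linearD s2; have sZ := bounded_linearZ s2.
have i0 : 0 <= rnorm (z - y) := rnorm_ge0 _.
pose G k xi : A := ((N.+1%:R^-1 : R)%:C *: sharp2 (dker T (k%:R / N.+1%:R) xi y) (z - y)).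
have eG xi : taylor_step N xi y z = E xi z - E xi y - \sum_(k < N.+1) G k xi.
  congr (_ - _); apply: eq_bigr => k _; rewrite /G /dker sZ s1; try exact: dom_S.
  rewrite scalerA; congr (_ *: (E _ _ ** _ ** E _ _)).
  - by rewrite RCM RCV mulrA mulrC mulrA.
  - by rewrite mulrA mulrAC.
  - have n0 : N.+1%:R != 0 :> R by rewrite pnatr_eq0.
    by rewrite natrB 1?ltnW//; move: n0; set n := N.+1%:R => n0; field.
have kS k : fkernel (fun xi => sharp2 (dker T (k%:R / N.+1%:R) xi y) (z - y)).
  by apply: (fkernel_map sD i0 (bounded_linear_rnorm s2)); exact: dker_fkernel.
have bZ : bounded_linear (cabs ((N.+1%:R^-1 : R)%:C)) ( *:%R (N.+1%:R^-1 : R)%:C : A -> A).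
  apply: rnorm_bounded_linear => [c u v|u]; last by rewrite rnormZ.
  by rewrite scalerDr !scalerA mulrC.
have kG k : fkernel (G k).
  by apply: (fkernel_map (bounded_linearD bZ) (cabs_ge0 _) (bounded_linear_rnorm bZ) (kS k)).
rewrite (funext eG); split.
  by apply: fkernelB; [apply: fkernelB; exact: E_fkernel|exact: fkernel_sum].
rewrite fintB//; [|by apply: fkernelB; exact: E_fkernel|exact: fkernel_sum].
rewrite fintB; try exact: E_fkernel; last exact: h3.
congr (_ - _ - _); rewrite fint_sum// /dsum (big_morph (fun x => sharp2 x (z - y)) sD (additive0 sD)).
apply: eq_bigr => k _; rewrite sZ /dint -(fint_map h3 i0 s2); last exact: dker_fkernel.
exact: (fint_map h3 (cabs_ge0 _) bZ (kS k)).
Qed.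

Lemma taylor_cvg N y z : dom S y ->
  rnorm (fop mu z - fop mu y - sharp2 (dsum T mu N y) (z - y) - taylor y z) <=
    rnorm (z - y) * (2%:R * rnorm y * moment mu) / N.+1%:R.
Proof.
move=> dy; have [_ s2] := sharp2P (z - y).
have -> : fop mu z - fop mu y - sharp2 (dsum T mu N y) (z - y) - taylor y z =
   - (sharp2 (dsum T mu N y) (z - y) - sharp2 (deriv2 T mu y) (z - y)).
  rewrite /taylor; set p := fop mu z; set q := fop mu y; set s1 := sharp2 (dsum _ _ _ _) _.
  set s := sharp2 _ _; zmod.
rewrite rnormN -(additiveB (bounded_linearD s2)) -mulrA; apply: le_trans (bounded_linear_rnorm s2 _) _.
by rewrite ler_wpM2l ?rnorm_ge0// deriv2_dsum.
Qed.

Lemma taylor_norm y z : dom S y -> selfadjoint z ->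
  rnorm (taylor y z) <= moment mu * rnorm (z - y) ^+ 2.
Proof.
move=> dy sz; have sy := dom_selfadjoint dy.
apply: (@ler_harmonic _ _ _ (rnorm (z - y) * (2%:R * rnorm y * moment mu) + moment mu * taylor_const y z) 0) => N _.
have [k1 e1] := taylor_fint N dy sz; have := taylor_cvg N z dy; rewrite -e1.
set F := fint _ _ => h; have hF : rnorm F <= (rnorm (z - y) ^+ 2 + taylor_const y z / N.+1%:R) * moment mu.
  have tc0 : 0 <= taylor_const y z by rewrite /taylor_const !addr_ge0 ?mulr_ge0 ?exprn_ge0 ?rnorm_ge0.
  apply: fint_norm => //; first by rewrite addr_ge0 ?exprn_ge0 ?divr_ge0 ?rnorm_ge0.
  move=> xi; apply: le_trans (taylor_step_norm N xi sy sz) _.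
  rewrite -mulrA -mulrDr mulrC ler_wpM2l ?addr_ge0 ?exprn_ge0 ?divr_ge0 ?rnorm_ge0//.
  by rewrite -real_normK ?num_real//; exact: weight_ge_norm.
have -> : taylor y z = F - (F - taylor y z) by zmod.
apply: le_trans (rnormDB _ _) _; apply: le_trans (lerD hF h) _.
by rewrite le_eqVlt; apply/orP; left; apply/eqP; ring.
Qed.

Lemma taylor_dist y z y' z' : dom S y -> selfadjoint z -> dom S y' -> selfadjoint z' ->
  rnorm (taylor y z - taylor y' z') <= moment mu *
   (rnorm (y - y') * rnorm (z - y) ^+ 2 + rnorm (z' - y') *
      (rnorm (z - z') * rnorm (z - y) + rnorm (z' - y') * rnorm (y - y'))
   + rnorm ((z - y) - (z' - y')) * (rnorm (z - y) + rnorm (z' - y'))).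
Proof.
move=> dy sz dy' sz'; have sy := dom_selfadjoint dy; have sy' := dom_selfadjoint dy'.
pose b1 := rnorm (y - y') * rnorm (z - y) ^+ 2 + rnorm (z' - y') *
      (rnorm (z - z') * rnorm (z - y) + rnorm (z' - y') * rnorm (y - y')).
pose b2 := rnorm ((z - y) - (z' - y')) * (rnorm (z - y) + rnorm (z' - y')).
pose tc := taylor_const y z + taylor_const y' z'.
have b10 : 0 <= b1 by rewrite /b1 !(addr_ge0, mulr_ge0, exprn_ge0, rnorm_ge0).
have b20 : 0 <= b2 by rewrite /b2 !(addr_ge0, mulr_ge0, exprn_ge0, rnorm_ge0).
have tc0 : 0 <= tc by rewrite /tc /taylor_const !(addr_ge0, mulr_ge0, exprn_ge0, rnorm_ge0).
apply: (@ler_harmonic _ _ _ (rnorm (z - y) * (2%:R * rnorm y * moment mu) +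
   rnorm (z' - y') * (2%:R * rnorm y' * moment mu) + moment mu * tc) 0) => N _.
have [k1 e1] := taylor_fint N dy sz; have := taylor_cvg N z dy; rewrite -e1.
have [k2 e2] := taylor_fint N dy' sz'; have := taylor_cvg N z' dy'; rewrite -e2.
set F := fint _ _ => h; set F' := fint _ _ => h'.
have hF : rnorm (F' - F) <= (b1 + b2 + tc / N.+1%:R) * moment mu.
  rewrite -fintB//; apply: fint_norm => //; first exact: fkernelB.
    by apply: addr_ge0; [exact: addr_ge0|exact: divr_ge0].
  move=> xi; apply: le_trans (taylor_step_diff N xi sy sz sy' sz') _.
  have w2 : xi ^+ 2 <= weight xi by rewrite -real_normK ?num_real//; exact: weight_ge_norm.
  have w3 : `|xi| ^+ 3 <= weight xi by exact: weight_ge_norm.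
  rewrite (mulrDl (b1 + b2)) (mulrDl b1) -/b1 -/b2 -/tc; apply: lerD; first apply: lerD.
  - by rewrite (mulrC b1); apply: ler_wpM2r.
  - by rewrite (mulrC b2); apply: ler_wpM2r.
  - by rewrite -mulrA mulrC; apply: ler_wpM2l => //; apply: divr_ge0.
have -> : taylor y z - taylor y' z' = (F' - F) - (F' - taylor y z) + (F - taylor y' z') by zmod.
apply: le_trans (rnormD _ _) _; apply: le_trans (lerD (rnormDB _ _) (lexx _)) _.
apply: le_trans (lerD (lerD hF h') h) _.
by rewrite -/b1 -/b2 le_eqVlt; apply/orP; left; apply/eqP; ring.
Qed.

End DividedDifferenceNatural.

(** * Reflection of measures *)

Section Reflection.
Context (R : realType).
Local Notation opp := (-%R : R -> R).

Lemma measurable_reflect (B : set R) : measurable B -> measurable (opp @^-1` B).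
Proof. by move=> mB; rewrite -[X in measurable X]setTI; exact: oppr_measurable. Qed.

Definition lrefl (V : normedModType R[i]) (s : seq (set R * V)) := [seq (opp @^-1` p.1, p.2) | p <- s].

Lemma lval_refl (V : normedModType R[i]) (s : seq (set R * V)) x : lval (lrefl s) x = lval s (- x).
Proof. by rewrite /lval /lrefl big_map. Qed.

Lemma mlist_refl (V : normedModType R[i]) (s : seq (set R * V)) : mlist s -> mlist (lrefl s).
Proof. by move=> ms _ /mapP[p hp ->] /=; apply: measurable_reflect; exact: ms. Qed.

Lemma smeas_refl (V : normedModType R[i]) (H : R -> V) : smeas H -> smeas (H \o opp).
Proof.
move=> [s [ms hs]]; exists (fun n => lrefl (s n)); split; first by move=> n; exact: mlist_refl.
by move=> x e e0; have [N hN] := hs (- x) e e0; exists N => n /hN; rewrite lval_refl.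
Qed.

Context (m : {finite_measure set R -> \bar R}).

Lemma reflected_integral (h : R -> \bar R) : measurable_fun setT h -> (forall x, 0 <= h x)%E ->
  (\int[reflected m]_(x in setT) (h \o opp) x = \int[m]_(x in setT) h x)%E.
Proof.
move=> mh h0.
rewrite (@ge0_integral_pushforward _ _ _ _ R opp (@oppr_measurable _ _) m setT (h \o opp)) //.
- by apply: eq_integral => x _; rewrite /= opprK.
- by apply: measurableT_comp => //; exact: oppr_measurable.
- by move=> x _; exact: h0.
Qed.

Lemma bochner_reflected (V : completeNormedModType R[i]) (H : R -> V) : bintegrable m setT H ->
  bochner (reflected m) setT (H \o opp) = bochner m setT H.
Proof.
move=> bH; have sH := bH.1.
have [s [hs ms cs is_]] := bochnerP measurableT (finite_setT m) bH.
apply: bochnerE; [exact: measurableT|exact: finite_setT|exact: smeas_refl|].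
have msn n : mlist (s n) by move=> p /hs[].
exists (fun n => lrefl (s n)); split.
- move=> n p hp; split; first by apply: (mlist_refl (msn n)).
  by rewrite setTI -ge0_fin_numE ?measure_ge0// fin_num_measure//; exact: (mlist_refl (msn n)).
- move=> n; under eq_fun do rewrite [simple_value _ _]lval_refl.
  by apply: (measurableT_comp (ms n)); exact: oppr_measurable.
- rewrite (_ : (fun _ => _) = (fun n => (\int[m]_(x in setT) (rnorm (H x - simple_value (s n) x))%:E)%E))//.
  apply/funext => n; rewrite -reflected_integral.
  + by apply: eq_integral => x _; rewrite [simple_value _ _]lval_refl.
  + by apply/measurable_EFinP; exact: ms.
  + by move=> x; rewrite lee_fin rnorm_ge0.
- rewrite (_ : (fun _ => _) = (fun n => simple_integral m setT (s n)))//.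
  apply/funext => n; rewrite /simple_integral /lrefl big_map; apply: eq_bigr => p _ /=.
  rewrite !setTI /reflected /pushforward; congr ((fine (m _))%:C *: _).
  by apply/seteqP; split => x /=; rewrite opprK.
Qed.

End Reflection.

Section StarMeasure.
Context (R : realType) (mu : complexMeasure R).

Lemma in_F_star k : in_F k mu -> in_F k (cm_star mu).
Proof.
move=> h j /h; rewrite -(reflected_integral (cm_abs mu) (h := fun xi => (`|xi| ^+ j)%:E)).
- by rewrite (_ : (fun xi => _) \o _ = fun xi => (`|xi| ^+ j)%:E)//; apply/funext => x /=; rewrite normrN.
- apply/measurable_EFinP; apply: measurable_funX; exact: (measurableT_comp (@normr_measurable _ _)).
- by move=> x; rewrite lee_fin exprn_ge0.
Qed.

(** Hence the bounds on g are those on f, and the final polynomial does not depend on the choice of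
    g. *)
Lemma moment_star : moment (cm_star mu) = moment mu.
Proof.
rewrite /moment -(reflected_integral (cm_abs mu) (h := fun xi => (weight xi)%:E)).
- by congr fine; apply: eq_integral => x _; rewrite /= /weight normrN.
- by apply/measurable_EFinP; exact: measurable_weight.
- by move=> x; rewrite lee_fin (le_trans _ (weight_ge1 _)).
Qed.

Hypothesis h3 : in_F 3 mu.

Lemma fint_star (V W : completeNormedModType R[i]) (L : V -> W) (M : R) (G : R -> V) :
  (forall u v, L (u + v) = L u + L v) -> (forall c u, L (c *: u) = conjc c *: L u) -> 0 <= M ->
  (forall u, rnorm (L u) <= M * rnorm u) -> fkernel G ->
  L (fint mu G) = fint (cm_star mu) (fun xi => L (G (- xi))).
Proof.
move=> hD hZ M0 hM kG.
have hR (r : R) u : L (r%:C *: u) = r%:C *: L u by rewrite hZ CJR.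
have [b1 b2] := bochner_map measurableT (finite_setT _) hD hR M0 hM (fkernel_bintegrable h3 kG).
rewrite /fint -b2 -(bochner_reflected b1); congr (bochner _ _ _); apply/funext => xi /=.
by rewrite hZ.
Qed.

End StarMeasure.

Section StarCalculus.
Context (R : realType) (A : vonNeumannAlgebra R) (mu : complexMeasure R) (h3 : in_F 3 mu).
Implicit Types y : A.

Lemma fop_star y : selfadjoint y -> vn_star (fop mu y) = fop (cm_star mu) y.
Proof.
move=> sy.
have hM (u : A) : rnorm (vn_star u) <= 1 * rnorm u by rewrite mul1r rnorm_star.
rewrite /fop (fint_star h3 (@starD R A) (@starZ R A) ler01 hM (E_fkernel sy)).
by congr fint; apply/funext => xi; rewrite (E_star sy) opprK.
Qed.

Variables (S : linSubspace A) (T : ptensor2 S).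
Hypothesis S_star : forall u, S u -> S (vn_star u).

(** The involution is antilinear; it is obtained from the universal property with values in the
    conjugate module. *)
Lemma star2P : [/\ forall u v, S u -> S v -> star2 (tens2 T u v) = tens2 T (vn_star v) (vn_star u),
  forall x y : T, star2 (x + y) = star2 x + star2 y,
  forall (c : R[i]) (x : T), star2 (c *: x) = conjc c *: star2 x &
  forall x : T, rnorm (star2 x) <= rnorm x].
Proof.
pose b (u v : A) : conj_car T := tens2 T (vn_star v) (vn_star u).
have bT := tens2_bilinear T.
have [|x y hx hy|h1 h2] := @extend2P _ _ _ T (conj_car T) b 1 ler01.
- move=> c x y z hx hy hz; rewrite /b !conj_scaleE !starD !starZ.
  have [cx sy sz] := And3 (S_star hx) (S_star hy) (S_star hz).
  by have [-> _] := bT (conjc c) _ _ _ cx sy sz; have [_ ->] := bT (conjc c) _ _ _ cx sy sz.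
- rewrite mul1r mulrC -(rnorm_star x) -(rnorm_star y).
  exact: (tens2_rnorm T (S_star hy) (S_star hx)).
have e : @star2 R A S T = (@extend2 R A (conj_car T) S T b : T -> T).
  apply: (@extend2_eq _ _ _ T T _ _ 1).
  - by move=> x y; exact: (bounded_linearD h1).
  - by move=> x; exact: (bounded_linear_rnorm h1).
  - by move=> u v hu hv; exact: h2.
rewrite e; split.
- by move=> u v hu hv; exact: h2.
- by move=> x y; exact: (bounded_linearD h1).
- by move=> c x; exact: (bounded_linearZ h1).
- by move=> x; have := bounded_linear_rnorm h1 x; rewrite mul1r.
Qed.

(** The involution exchanges the two exponentials and thus al with 1 - al. The symmetry of the
    integral is read on Riemann sums, where it moves every node by 1/(N+1), an error controlled by
    the Lipschitz bound in al. *)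
Lemma deriv2_star y : dom S y -> star2 (deriv2 T mu y) = deriv2 T (cm_star mu) y.
Proof.
move=> dy; have sy := dom_selfadjoint dy; have [s1 s2 s3 s4] := star2P.
have h3' := in_F_star h3.
have e al : star2 (dint T mu al y) = dint T (cm_star mu) (1 - al) y.
  have hM (x : T) : rnorm (star2 x) <= 1 * rnorm x by rewrite mul1r.
  rewrite /dint (fint_star h3 s2 s3 ler01 hM (dker_fkernel T al dy)).
  congr fint; apply/funext => xi; rewrite /dker s3 s1; try exact: dom_S.
  have e1 : conjc ('i * (- xi)%:C) = 'i * xi%:C :> R[i] by rewrite RCN CJM CJI CJN CJR mulrNN.
  have e2 : - ((1 - al) * - xi) = (1 - al) * xi by ring.
  have e3 : - (al * - xi) = (1 - (1 - al)) * xi by ring.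
  by rewrite (E_star sy ((1 - al) * - xi)) (E_star sy (al * - xi)) e1 e2 e3.
apply/eqP; rewrite -subr_eq0; apply/eqP/rnorm_eq0P.
pose c1 := 2%:R * rnorm y * moment mu; pose c2 := 2%:R * rnorm y * moment (cm_star mu).
apply: (@ler_harmonic _ _ _ (c1 + c2 + c2) 0) => N _; rewrite add0r.
have r1 := deriv2_dsum T h3 N dy; have r2 := deriv2_dsum T h3' N dy.
have n0 : N.+1%:R != 0 :> R by rewrite pnatr_eq0.
(* Reversing the order sends left endpoints k/(N+1) to right endpoints (k+1)/(N+1). *)
have es : star2 (dsum T mu N y) = \sum_(k < N.+1) (N.+1%:R^-1)%:C *: dint T (cm_star mu) (k.+1%:R / N.+1%:R) y.
  have er (k : 'I_N.+1) : 1 - (N.+1 - k.+1)%:R / N.+1%:R = k.+1%:R / N.+1%:R :> R.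
    by rewrite natrB// mulrBl divff// subKr.
  rewrite /dsum (big_morph _ s2 (additive0 s2)) (reindex_inj rev_ord_inj) /=.
  by apply: eq_bigr => k _; rewrite s3 e (CJR (N.+1%:R^-1)) er.
have d3 : rnorm (star2 (dsum T mu N y) - dsum T (cm_star mu) N y) <= c2 / N.+1%:R.
  rewrite es /dsum -sumrB; apply: le_trans (rnorm_sum _ _ _) _.
  apply: (@le_trans _ _ (\sum_(k < N.+1) N.+1%:R^-1 * (c2 / N.+1%:R))).
    apply: ler_sum => k _; rewrite -cscalerBr rnormZR ger0_norm ?invr_ge0// ler_wpM2l ?invr_ge0//.
    apply: le_trans (dint_lip T h3' dy _ _) _; rewrite /c2 -mulrBl -natrB// subSnn mul1r.
    by rewrite ger0_norm ?invr_ge0.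
  by rewrite -mulr_suml sumr_const card_ord -[_^-1 *+ _]mulr_natl divff// mul1r.
have -> : star2 (deriv2 T mu y) - deriv2 T (cm_star mu) y =
   - (star2 (dsum T mu N y) - star2 (deriv2 T mu y)) + (star2 (dsum T mu N y) - dsum T (cm_star mu) N y) +
    (dsum T (cm_star mu) N y - deriv2 T (cm_star mu) y) by zmod.
apply: le_trans (rnormD _ _) _; apply: le_trans (lerD (rnormD _ _) (lexx _)) _.
rewrite rnormN -(additiveB s2) 2!mulrDl; apply: lerD => //; apply: lerD => //.
by apply: le_trans (s4 _) _.
Qed.

End StarCalculus.

(** * Nonlinear sewing *)

Section DiscreteSewing.
Context (R : realType) (X : Type) (run : R -> X -> seq R -> X).
Variables (e : R -> X -> seq R -> R) (G : R -> X -> seq R -> Prop) (B c th : R).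

(* [2 * rho < 1] is the factor gained by splitting an interval at its middle;
   [eta] is the largest step perturbation the induction below can absorb. *)
Definition rho : R := 2%:R^-1 `^ th.
Definition eta : R := (1 - 2%:R * rho) / 2%:R.

Hypothesis th1 : 1 < th.

Lemma rho_gt0 : 0 < rho.
Proof. by rewrite powR_gt0// invr_gt0. Qed.

Lemma eta_gt0 : 0 < eta.
Proof.
have : rho < 2%:R^-1.
  have i0 : 0 < 2%:R^-1 :> R by rewrite invr_gt0.
  have t0 := lt_trans ltr01 th1.
  rewrite /rho -mulr_powRB1 ?(ltW i0)//.
  have : 2%:R^-1 `^ (th - 1) < 1 `^ (th - 1) :> R.
    by apply: gt0_ltr_powR; rewrite ?subr_gt0 ?nnegrE ?(ltW i0)//; lra.
  by rewrite powR1 => h; rewrite -[ltRHS]mulr1 ltr_pM2l.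
by rewrite /eta => h; rewrite divr_gt0// subr_gt0; lra.
Qed.

Lemma rho_eta : 2%:R * rho = 1 - 2%:R * eta.
Proof. by rewrite /eta; field. Qed.

Lemma powR_half (w v : R) : 0 <= v -> v <= w / 2%:R -> v `^ th <= rho * w `^ th.
Proof.
move=> v0 vw; have w0 : 0 <= w by lra.
have t0 : 0 <= th := ltW (lt_trans ltr01 th1).
by rewrite /rho -powRM ?invr_ge0// mulrC; apply: ge0_ler_powR; rewrite ?nnegrE ?divr_ge0.
Qed.

Hypothesis B0 : 0 <= B.
Hypothesis c0 : 0 <= c.
Hypothesis c_eta : c <= eta.
Hypothesis G_path : forall s x p, G s x p -> path <=%R s p.
Hypothesis G_cat : forall s x p q, G s x (p ++ q) -> G s x p /\ G (last s p) (run s x p) q.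
Hypothesis e_nil : forall s x, G s x [::] -> e s x [::] <= 0.
Hypothesis e_one : forall s x u, G s x [:: u] -> e s x [:: u] <= 0.
Hypothesis e_cat : forall s x p q, G s x (p ++ q) ->
  e s x (p ++ q) <= e (last s p) (run s x p) q + (1 + c) * e s x p + B * (last s (p ++ q) - s) `^ th.

Lemma path_le_last (s : R) p : path <=%R s p -> s <= last s p.
Proof.
elim: p s => //= u p ih s /andP[su /ih]; exact: le_trans.
Qed.

Lemma split_path (s m : R) p : path <=%R s p -> s <= m -> m <= last s p -> (0 < size p)%N ->
  exists p1 u p2, [/\ p = p1 ++ u :: p2, last s p1 <= m & m <= u].
Proof.
elim: p s => // u p ih s /= /andP[su pp] sm ml _.
have [um|mu] := ltP u m; last by exists [::], u, p.
case: p ih pp ml => [|v p] ih pp ml; first by exists [::], u, [::]; split => //=; apply: le_trans ml _.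
have [p1 [v' [p2 [-> h1 h2]]]] := ih u pp (ltW um) ml isT.
by exists (u :: p1), v', p2.
Qed.

(** Isolate the step that straddles the midpoint. The parts before and after it span at most half
    the length, so each costs at most [rho] times the bound; the step itself costs nothing and the
    two recombinations cost 2 B. The error [e] is abstract, as it measures the distance to one step
    in one use and a difference of two such distances in another. *)
Lemma discrete_sewing s x p : G s x p -> e s x p <= (2%:R * B / eta) * (last s p - s) `^ th.
Proof.
have eg := eta_gt0; have c_eta' := c_eta; have c0' := c0; have B0' := B0.
have K0 : 0 <= 2%:R * B / eta by apply: divr_ge0; [exact: mulr_ge0|exact: ltW].
have [n] := ubnP (size p); elim: n s x p => // n ih s x p; rewrite ltnS => pn Gp.
have pp := G_path Gp; have sl := path_le_last pp.
case: (posnP (size p)) => [/size0nil pnil|p0].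
  by rewrite pnil in Gp *; apply: le_trans (e_nil Gp) _; rewrite mulr_ge0// powR_ge0.
set w := last s p - s.
have [||p1 [u [p2 [ep h1 h2]]]] := @split_path s (s + w / 2%:R) p pp _ _ p0; try by rewrite /w; lra.
rewrite ep in Gp; have [G1 G2] := G_cat Gp.
have G2' : G (last s p1) (run s x p1) ([:: u] ++ p2) by [].
have [G3 G4] := G_cat G2'.
have q1 := e_cat Gp; have q2 := e_cat G2'; have q3 := e_one G3.
have sp1 : (size p1 < n)%N by move: pn; rewrite ep size_cat /= addnS => /(leq_trans _); apply; rewrite ltnS leq_addr.
have sp2 : (size p2 < n)%N by move: pn; rewrite ep size_cat /= addnS => /(leq_trans _); apply; rewrite ltnS leq_addl.
have i1 := ih _ _ _ sp1 G1; have i2 := ih _ _ _ sp2 G4.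
have s1 := path_le_last (G_path G1); have s2 := path_le_last (G_path G2); have s3 := path_le_last (G_path G4).
have el : last s p = last u p2 by rewrite ep last_cat.
have w0 : 0 <= w by rewrite /w subr_ge0.
rewrite /= in q2 q3 i2 s2 s3.
have r1 : (last s p1 - s) `^ th <= rho * w `^ th by apply: powR_half; [rewrite subr_ge0|lra].
have r2 : (last u p2 - u) `^ th <= rho * w `^ th by apply: powR_half; [rewrite subr_ge0|rewrite /w el in h2 *; lra].
have r3 : (last u p2 - last s p1) `^ th <= w `^ th.
  have t0 := ltW (lt_trans ltr01 th1).
  by apply: ge0_ler_powR; rewrite ?nnegrE ?subr_ge0// /w el lerB.
rewrite -ep -/w in q1; rewrite ep -ep -/w.
set W := w `^ th in r1 r2 r3 q1 *; have W0 : 0 <= W by exact: powR_ge0.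
have e1 : e s x p1 <= (2%:R * B / eta) * (rho * W) by apply: le_trans i1 _; rewrite ler_wpM2l.
have e2 : e u (run (last s p1) (run s x p1) [:: u]) p2 <= (2%:R * B / eta) * (rho * W) by apply: le_trans i2 _; rewrite ler_wpM2l.
have e3 : B * (last u p2 - last s p1) `^ th <= B * W by rewrite ler_wpM2l.
have e4 : (1 + c) * e s x p1 <= (1 + eta) * ((2%:R * B / eta) * (rho * W)).
  have k0 : 0 <= (2%:R * B / eta) * (rho * W).
    by apply: mulr_ge0 => //; apply: mulr_ge0 => //; exact: ltW rho_gt0.
  apply: (@le_trans _ _ ((1 + c) * ((2%:R * B / eta) * (rho * W)))); first by rewrite ler_wpM2l// addr_ge0.
  by rewrite ler_wpM2r// lerD2l.
have e5 : (1 + c) * e (last s p1) (run s x p1) [:: u] <= 0.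
  by apply: mulr_ge0_le0 => //; exact: addr_ge0.
(* From 2 rho = 1 - 2 eta and rho <= 1; the part eta of the bound that is left over pays for the
   recombinations. *)
have key : (2%:R + eta) * rho <= 1 - eta.
  have := rho_eta; have := rho_gt0; move: eg; move: rho eta => r t t0 r0 tr.
  have : t * r <= t * 1 by apply: ler_wpM2l; lra.
  lra.
have kw : (2%:R * B / eta) * ((2%:R + eta) * rho * W) <= (2%:R * B / eta) * ((1 - eta) * W).
  by apply: ler_wpM2l => //; apply: ler_wpM2r.
have ke : (2%:R * B / eta) * (eta * W) = 2%:R * (B * W).
  by move: eg; move: eta => t t0; field; rewrite gt_eqF.
move: q1 q2 q3 e1 e2 e3 e4 e5 kw ke.
set K := 2%:R * B / eta; set BW := B * W.
set E0 := e _ _ _; set E1 := e _ _ _; set E2 := e _ _ _.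
lra.
Qed.

End DiscreteSewing.

(** * Partitions and their common refinements *)

Section Partitions.
Context (R : realType) (th : R).
Hypothesis th1 : 1 < th.
Implicit Types (s t u : R) (p q : seq R).

Fixpoint cost s p : R := if p is u :: p' then (u - s) `^ th + cost u p' else 0.

Lemma cost_cat s p q : cost s (p ++ q) = cost s p + cost (last s p) q.
Proof. by elim: p s => [|u p ih] s /=; rewrite ?add0r// ih addrA. Qed.

Definition uniform s t n : seq R := [seq s + k.+1%:R * ((t - s) / n.+1%:R) | k <- iota 0 n.+1].

Let uniform_from (a d : R) i n : 0 <= d ->
  let p := [seq a + k.+1%:R * d | k <- iota i n] in
  [/\ path <=%R (a + i%:R * d) p, last (a + i%:R * d) p = a + (i + n)%:R * d &
      cost (a + i%:R * d) p = n%:R * d `^ th].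
Proof.
move=> d0; elim: n i => [|n ih] i /=; first by rewrite addn0 mul0r.
have [h1 h2 h3] := ih i.+1; rewrite /= in h1 h2 h3.
have st : a + i.+1%:R * d - (a + i%:R * d) = d by rewrite -addn1 natrD; ring.
split; first by rewrite h1 andbT -subr_ge0 st.
  by rewrite h2 addSnnS.
by rewrite h3 st -addn1 natrD mulrDl mul1r addrC.
Qed.

Lemma uniformP s t n : s <= t -> [/\ path <=%R s (uniform s t n), last s (uniform s t n) = t &
  cost s (uniform s t n) <= (t - s) `^ th * n.+1%:R `^ (1 - th)].
Proof.
move=> st; have d0 : 0 <= (t - s) / n.+1%:R by rewrite divr_ge0// subr_ge0.
have [] := uniform_from s 0 n.+1 d0; rewrite mul0r addr0 -/(uniform s t n) => h1 h2 h3; split => //.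
  by rewrite h2 add0n mulrC divfK ?pnatr_eq0// addrC subrK.
rewrite h3 powRM ?subr_ge0 ?invr_ge0// -powR_inv1// -powRrM mulrCA; apply: eq_ler; congr (_ * _).
rewrite powRD; last by rewrite pnatr_eq0/= implybT.
by rewrite powRr1// mulN1r.
Qed.

Lemma powR_neg_to0 : to0 (fun n => n.+1%:R `^ (1 - th) : R).
Proof.
move=> d d0; have r0 : 0 < th - 1 by rewrite subr_gt0.
pose x := d `^ (th - 1)^-1; have x0 : 0 < x by exact: powR_gt0.
exists (Num.truncn x^-1) => n /(inv_succ_le x0) h.
have n0 : 0 <= n.+1%:R^-1 :> R by rewrite invr_ge0.
have -> : n.+1%:R `^ (1 - th) = (n.+1%:R^-1) `^ (th - 1) :> R.
  by rewrite -powR_inv1// -powRrM mulN1r opprB.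
apply: (@le_trans _ _ (x `^ (th - 1))).
  by apply: ge0_ler_powR; rewrite ?nnegrE// ltW.
by rewrite /x -powRrM mulVf ?gt_eqF// powRr1// ltW.
Qed.

(** Each interval of the coarse partition is followed by a block of the fine one. Blocks may be
    empty, so repeated points are harmless. *)
Inductive refines : R -> seq R -> seq R -> Prop :=
| RefinesNil s : refines s [::] [::]
| RefinesCons s u p b q : path <=%R s b -> last s b = u -> refines u p q ->
    refines s (u :: p) (b ++ q).

Lemma refines_last s p q : refines s p q -> last s q = last s p.
Proof. by elim=> //= {}s u {}p b {}q _ lb _ ih; rewrite last_cat lb. Qed.

Lemma refines_path s p q : refines s p q -> path <=%R s q.
Proof. by elim=> //= {}s u {}p b {}q pb lb _ ih; rewrite cat_path pb lb. Qed.

Lemma refines_pathl s p q : refines s p q -> path <=%R s p.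
Proof.
by elim=> //= {}s u {}p b {}q pb lb _ ih; rewrite ih andbT -lb; exact: path_le_last.
Qed.

Lemma refines_const s p : path <=%R s p -> last s p = s -> refines s p [::].
Proof.
elim: p s => [|u p ih] s /=; first by move=> _ _; exact: RefinesNil.
move=> /andP[su pp] lp; have us : u = s.
  by apply/le_anti; rewrite su andbT -lp; exact: path_le_last.
rewrite us in pp lp *; apply: (@RefinesCons s s p [::] [::]) => //; exact: ih.
Qed.

Lemma refines_cons s u p q : s <= u -> refines u p q -> refines s (u :: p) (u :: q).
Proof. by move=> su; apply: (@RefinesCons s u p [:: u]); rewrite //= su. Qed.

Lemma refines_widen s u v p q : s <= u -> refines u (v :: p) q -> refines s (v :: p) (u :: q).
Proof.
move=> su h; inversion h as [|s' u' p' b q' pb lb hq]; subst.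
by apply: (@RefinesCons s _ p (u :: b)); rewrite //= su.
Qed.

(** The two sorted lists are merged; when one is exhausted the other consists of points equal to
    s. *)
Lemma common_refinement s p1 p2 : path <=%R s p1 -> path <=%R s p2 -> last s p1 = last s p2 ->
  exists q, refines s p1 q /\ refines s p2 q.
Proof.
have [n] := ubnP (size p1 + size p2); elim: n s p1 p2 => // n ih s [|u1 p1] [|u2 p2] hn.
- by move=> _ _ _; exists [::]; split; exact: RefinesNil.
- by move=> _ pp /= lp; exists [::]; split; [exact: RefinesNil|exact: refines_const].
- by move=> pp _ /= lp; exists [::]; split; [exact: refines_const|exact: RefinesNil].
move=> /= /andP[s1 pp1] /andP[s2 pp2] lp.
have [u12|/ltW u21] := leP u1 u2.
  have hn' : (size p1 + size (u2 :: p2) < n)%N by move: hn; rewrite /= addSn.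
  have [q [h1 h2]] := ih u1 p1 (u2 :: p2) hn' pp1 (introT andP (conj u12 pp2)) lp.
  by exists (u1 :: q); split; [exact: refines_cons|exact: refines_widen].
have hn' : (size (u1 :: p1) + size p2 < n)%N by move: hn; rewrite /= !addSn addnS.
have [q [h1 h2]] := ih u2 (u1 :: p1) p2 hn' (introT andP (conj u21 pp1)) pp2 lp.
by exists (u2 :: q); split; [exact: refines_widen|exact: refines_cons].
Qed.

End Partitions.

(** * Almost flows and the paths they generate *)

Section Flow.
Context (R : realType) (V : completeNormedModType R[i]).
Variables (S : R -> V -> Prop) (mu : R -> R -> V -> V) (T C gam th : R).

(* [af_four] propagates the Lipschitz bound of order [th] from the defects of two
   steps to compositions of any length. *)
Record almost_flow : Prop := AlmostFlow {
  af_C : 0 <= C;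
  af_gam : 0 < gam;
  af_th : 1 < th;
  af_mono : forall s t y, 0 <= s -> s <= t -> t <= T -> S s y -> S t y;
  af_closed : forall t, 0 <= t -> t <= T -> closed [set y | S t y];
  af_dom : forall s t y, 0 <= s -> s <= t -> t <= T -> S s y -> S t (mu s t y);
  af_id : forall s y, mu s s y = y;
  af_lip : forall s t y z, 0 <= s -> s <= t -> t <= T -> S s y -> S s z ->
    rnorm (mu s t y - mu s t z - (y - z)) <= C * (t - s) `^ gam * rnorm (y - z);
  af_four : forall s t a b c d, 0 <= s -> s <= t -> t <= T -> S s a -> S s b -> S s c -> S s d ->
    rnorm (mu s t a - mu s t b - (mu s t c - mu s t d) - (a - b - (c - d))) <=
    C * (t - s) `^ gam * (rnorm (a - b - (c - d)) + quad a b c d);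
  af_norm : forall s u t y, 0 <= s -> s <= u -> u <= t -> t <= T -> S s y ->
    rnorm (mu u t (mu s u y) - mu s t y) <= C * (t - s) `^ th;
  af_defect : forall s u t y z, 0 <= s -> s <= u -> u <= t -> t <= T -> S s y -> S s z ->
    rnorm (mu u t (mu s u y) - mu s t y - (mu u t (mu s u z) - mu s t z)) <=
    C * (t - s) `^ th * rnorm (y - z) }.

Hypothesis AF : almost_flow.
Implicit Types (s t u : R) (y z : V) (p q : seq R).

Fixpoint run s y p : V := if p is u :: p' then run u (mu s u y) p' else y.

Lemma run_cat s y p q : run s y (p ++ q) = run (last s p) (run s y p) q.
Proof. by elim: p s y => //= u p ih s y; rewrite ih. Qed.

Definition ok s p : Prop := [/\ 0 <= s, path <=%R s p & last s p <= T].

Lemma ok_cat s p q : ok s (p ++ q) -> ok s p /\ ok (last s p) q.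
Proof.
move=> [s0]; rewrite cat_path last_cat => /andP[h1 h2] h3.
have h4 := path_le_last h1; have h5 := path_le_last h2; split; split => //.
  exact: le_trans h3.
exact: le_trans h4.
Qed.

Lemma ok_cons s u p : ok s (u :: p) -> [/\ 0 <= s, s <= u, u <= T & ok u p].
Proof.
move=> [s0 /= /andP[su pp] h]; split => //; first by apply: le_trans h; exact: path_le_last.
by split => //; exact: le_trans su.
Qed.

Lemma run_dom s y p : ok s p -> S s y -> S (last s p) (run s y p).
Proof.
elim: p s y => //= u p ih s y /ok_cons[s0 su uT okp] Sy.
by apply: ih => //; exact: (af_dom AF).
Qed.

Lemma mu_lipschitz s t y z : 0 <= s -> s <= t -> t <= T -> S s y -> S s z ->
  rnorm (mu s t y - mu s t z) <= (1 + C * (t - s) `^ gam) * rnorm (y - z).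
Proof.
move=> s0 st tT Sy Sz; have h := af_lip AF s0 st tT Sy Sz.
have -> : mu s t y - mu s t z = (y - z) + (mu s t y - mu s t z - (y - z)) by zmod.
by rewrite mulrDl mul1r; apply: le_trans (rnormD _ _) _; rewrite lerD2l.
Qed.

Variable h : R.
Hypothesis h0 : 0 < h.
Hypothesis hC : C * h `^ gam <= eta th.
Let K : R := 2%:R * C / eta th.
Hypothesis hK : 26%:R * C / eta th * h `^ th <= 2%:R^-1.

Lemma etag : 0 < eta th.
Proof. exact: eta_gt0 (af_th AF). Qed.

Lemma K_ge0 : 0 <= K.
Proof. by apply: divr_ge0; [apply: mulr_ge0 => //; exact: af_C AF|exact: ltW etag]. Qed.

Lemma eta_le1 : eta th <= 1.
Proof. by have := rho_gt0 th; rewrite /eta; lra. Qed.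

Let Cw s t : s <= t -> t - s <= h -> C * (t - s) `^ gam <= eta th.
Proof.
move=> st w; apply: le_trans hC; apply: ler_wpM2l; first exact: af_C AF.
by apply: ge0_ler_powR; rewrite ?nnegrE ?subr_ge0 ?(ltW h0) ?(ltW (af_gam AF)).
Qed.

Lemma run_norm s y p : ok s p -> last s p - s <= h -> S s y ->
  rnorm (run s y p - mu s (last s p) y) <= K * (last s p - s) `^ th.
Proof.
move=> okp w Sy; have C0 := af_C AF.
apply: (@discrete_sewing R V run (fun s y p => rnorm (run s y p - mu s (last s p) y))
  (fun s y p => [/\ ok s p, last s p - s <= h & S s y]) C (eta th) th (af_th AF) C0 (ltW etag) (lexx _)) => //.
- by move=> s1 y1 p1 [[]].
- move=> {w okp Sy}s {}y {}p q [okpq w Sy]; have [ok1 ok2] := ok_cat okpq.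
  have l1 := path_le_last (let: And3 _ h _ := ok1 in h); have l2 := path_le_last (let: And3 _ h _ := ok2 in h).
  rewrite last_cat in w; split; split => //; try lra; exact: run_dom.
- by move=> s1 y1 _ /=; rewrite (af_id AF) subrr rnorm0.
- by move=> s1 y1 u _ /=; rewrite subrr rnorm0.
move=> {w okp Sy}s {}y {}p q [okpq w Sy]; have [ok1 ok2] := ok_cat okpq.
have l1 := path_le_last (let: And3 _ h _ := ok1 in h); have l2 := path_le_last (let: And3 _ h _ := ok2 in h).
rewrite run_cat last_cat; rewrite last_cat in w; have Sr := run_dom ok1 Sy.
set u := last s p in l1 l2 w Sr ok2 *; set t := last u q in l2 w *; set x := run s y p in Sr *.
have s0 : 0 <= s by case: ok1.
have uT : u <= T by case: ok1.
have tT : t <= T by case: ok2.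
have u0 := le_trans s0 l1.
have Sm := af_dom AF s0 l1 uT Sy.
have -> : run u x q - mu s t y = (run u x q - mu u t x) + (mu u t x - mu u t (mu s u y)) +
   (mu u t (mu s u y) - mu s t y) by zmod.
apply: le_trans (rnormD _ _) _; have R1 := af_norm AF s0 l1 l2 tT Sy.
apply: lerD; last exact: R1.
apply: le_trans (rnormD _ _) _; rewrite lerD2l; apply: le_trans (mu_lipschitz u0 l2 tT Sr Sm) _.
rewrite ler_wpM2r ?rnorm_ge0// lerD2l; apply: Cw => //; lra.
Qed.

(** Discrete sewing on pairs of points. [af_four] is applied to the quadrilateral formed by the
    composed steps and the single steps: two of its sides are of order [th] by [run_norm], the
    others at most D and 2 D, which gives 12 C D; [af_defect] adds C D. The gap D is assumed on
    proper prefixes only, as these are what the induction of [run_lipschitz] provides. *)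
Let run_diff (D : R) s y z p : ok s p -> last s p - s <= h -> S s y -> S s z -> 0 <= D ->
  (forall p1 p2, p = p1 ++ p2 -> p2 != [::] -> rnorm (run s y p1 - run s z p1) <= D) ->
  rnorm (run s y p - mu s (last s p) y - (run s z p - mu s (last s p) z)) <=
   (2%:R * (13%:R * C * D) / eta th) * (last s p - s) `^ th.
Proof.
move=> okp w Sy Sz D0 hD; have C0 := af_C AF; have eg := etag.
pose ee s (x : V * V) p := rnorm (run s x.1 p - mu s (last s p) x.1 - (run s x.2 p - mu s (last s p) x.2)).
pose G s (x : V * V) p := [/\ ok s p, last s p - s <= h, S s x.1, S s x.2 &
   forall p1 p2, p = p1 ++ p2 -> p2 != [::] -> rnorm (run s x.1 p1 - run s x.2 p1) <= D].
have B0 : 0 <= 13%:R * C * D by rewrite !mulr_ge0.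
apply: (@discrete_sewing R (V * V)%type (fun s x p => (run s x.1 p, run s x.2 p)) ee G
  _ (eta th) th (af_th AF) B0 (ltW etag) (lexx _) _ _ _ _ _ s (y, z) p) => //.
- by move=> {okp w Sy Sz hD}s x {}p [[]].
- move=> {okp w Sy Sz hD y z}s [y z] {}p q [/= okpq w Sy Sz hD]; have [ok1 ok2] := ok_cat okpq.
  have l1 := path_le_last (let: And3 _ h _ := ok1 in h); have l2 := path_le_last (let: And3 _ h _ := ok2 in h).
  rewrite last_cat in w; split; split => //=; try lra; try exact: run_dom.
    move=> p1 p2 e n2; apply: (hD p1 (p2 ++ q)); first by rewrite e catA.
    by case: (p2) n2.
  by move=> p1 p2 e n2; rewrite -!run_cat; apply: (hD (p ++ p1) p2) => //; rewrite e catA.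
- by move=> {okp w Sy Sz hD y z}s x _; rewrite /ee /= !(af_id AF) !subrr rnorm0.
- by move=> {okp w Sy Sz hD y z}s x u _; rewrite /ee /= !subrr rnorm0.
move=> {okp w Sy Sz hD y z}s [y z] {}p q [/= okpq w Sy Sz hD]; have [ok1 ok2] := ok_cat okpq.
have l1 := path_le_last (let: And3 _ h _ := ok1 in h); have l2 := path_le_last (let: And3 _ h _ := ok2 in h).
(* For empty q the prefix p is not proper and D says nothing about it, but there is nothing to
   recombine. *)
have [q0|qn] := eqVneq q [::].
  rewrite q0 cats0 /ee /= !(af_id AF) !subrr rnorm0 add0r.
  apply: (@le_trans _ _ (1 * rnorm (run s y p - mu s (last s p) y - (run s z p - mu s (last s p) z)) + 0)).
    by rewrite mul1r addr0.
  apply: lerD; last by rewrite mulr_ge0// powR_ge0.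
  by rewrite ler_wpM2r ?rnorm_ge0// lerDl ltW.
have Dp := hD p q erefl qn.
have Dy : rnorm (y - z) <= D by apply: (hD [::] (p ++ q)) => //; case: (p) qn.
rewrite /ee /= !run_cat last_cat; rewrite last_cat in w.
have Sry := run_dom ok1 Sy; have Srz := run_dom ok1 Sz.
have wp : last s p - s <= h by lra.
have Jy := run_norm ok1 wp Sy; have Jz := run_norm ok1 wp Sz.
set u := last s p in l1 l2 w wp Sry Srz ok2 Jy Jz *; set t := last u q in l2 w *.
set y' := run s y p in Sry Dp Jy *; set z' := run s z p in Srz Dp Jz *.
have s0 : 0 <= s by case: ok1.
have uT : u <= T by case: ok1.
have tT : t <= T by case: ok2.
have u0 := le_trans s0 l1; have st := le_trans l1 l2.
have Smy := af_dom AF s0 l1 uT Sy; have Smz := af_dom AF s0 l1 uT Sz.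
have -> : run u y' q - mu s t y - (run u z' q - mu s t z) =
  (run u y' q - mu u t y' - (run u z' q - mu u t z')) +
  ((mu u t y' - mu u t (mu s u y) - (mu u t z' - mu u t (mu s u z)) - (y' - mu s u y - (z' - mu s u z)))
    + (y' - mu s u y - (z' - mu s u z))) +
  (mu u t (mu s u y) - mu s t y - (mu u t (mu s u z) - mu s t z)) by zmod.
have t1 := af_defect AF s0 l1 l2 tT Sy Sz.
have t2 := af_four AF u0 l2 tT Sry Smy Srz Smz.
have Cut : C * (t - u) `^ gam <= eta th by apply: Cw => //; lra.
have Csu : C * (u - s) `^ gam <= eta th by apply: Cw.
have t3 : rnorm (mu s u y - mu s u z) <= 2%:R * D.
  apply: le_trans (mu_lipschitz s0 l1 uT Sy Sz) _; apply: ler_pM; rewrite ?rnorm_ge0//.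
    by rewrite addr_ge0// mulr_ge0// powR_ge0.
  by have := eta_le1; lra.
have w0 : 0 <= u - s by rewrite subr_ge0.
have pm : (u - s) `^ th <= (t - s) `^ th.
  apply: ge0_ler_powR; rewrite ?nnegrE ?subr_ge0//; last by rewrite lerD2r.
  by apply: ltW; apply: lt_trans (af_th AF).
set W := (t - s) `^ th in t1 pm *; have W0 : 0 <= W by exact: powR_ge0.
set E := rnorm (y' - mu s u y - (z' - mu s u z)) in t2 *.
have E0 : 0 <= E by exact: rnorm_ge0.
have q1 : quad y' (mu s u y) z' (mu s u z) <= (K * W + K * W) * (D + 2%:R * D).
  have K0 := K_ge0; have kw : K * (u - s) `^ th <= K * W by apply: ler_wpM2l.
  rewrite /quad; apply: ler_pM; rewrite ?addr_ge0 ?rnorm_ge0//; last exact: lerD.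
  by apply: lerD; [apply: le_trans Jy _|apply: le_trans Jz _].
have t4 : C * (t - u) `^ gam * (E + quad y' (mu s u y) z' (mu s u z)) <= eta th * E + 12%:R * C * D * W.
  apply: (@le_trans _ _ (eta th * (E + quad y' (mu s u y) z' (mu s u z)))).
    by apply: ler_wpM2r => //; rewrite addr_ge0// quad_ge0.
  rewrite mulrDr lerD2l; apply: (@le_trans _ _ (eta th * ((K * W + K * W) * (D + 2%:R * D)))).
    by apply: ler_wpM2l => //; exact: ltW.
  have ek : eta th * K = 2%:R * C by rewrite /K; move: eg; move: (eta th) => e0 eg; field; rewrite gt_eqF.
  have -> : eta th * ((K * W + K * W) * (D + 2%:R * D)) = (eta th * K) * (6%:R * D * W) by ring.
  by rewrite ek le_eqVlt; apply/orP; left; apply/eqP; ring.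
have t5 : C * W * rnorm (y - z) <= C * D * W.
  by rewrite -mulrA (mulrC W) mulrA; apply: ler_wpM2r => //; apply: ler_wpM2l.
apply: le_trans (rnormD _ _) _; apply: le_trans (lerD (rnormD _ _) (lexx _)) _.
apply: le_trans (lerD (lerD (lexx _) (rnormD _ _)) (lexx _)) _.
rewrite -/E; move: t1 t2 t4 t5.
set e1 := rnorm (run u y' q - _ - _); set e2 := rnorm (mu u t y' - _ - _ - _); set e3 := rnorm (mu u t (mu s u y) - _ - _).
move: (eta th) (C * (t - u) `^ gam * _) (C * W * _) => et c1 c2 t1 t2 t4 t5.
have -> : 13%:R * C * D * W = 12%:R * C * D * W + C * D * W by ring.
rewrite mulrDl mul1r; lra.
Qed.

(** Strong induction with D = 3 times the initial gap. By [hK] the deviation from a single step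
    contributes at most 3/2 and the single step at most 1 + [eta th] <= 3/2, so the constant 3
    reproduces itself whatever the number of steps. *)
Lemma run_lipschitz s y z p : ok s p -> last s p - s <= h -> S s y -> S s z ->
  rnorm (run s y p - run s z p) <= 3%:R * rnorm (y - z).
Proof.
have [n] := ubnP (size p); elim: n p => // n ih p; rewrite ltnS => pn okp w Sy Sz.
have n0 := rnorm_ge0 (y - z); have C0 := af_C AF.
have D0 : 0 <= 3%:R * rnorm (y - z) by rewrite mulr_ge0.
have sl : s <= last s p by case: okp => _ /path_le_last.
have pre q1 q2 : p = q1 ++ q2 -> q2 != [::] -> rnorm (run s y q1 - run s z q1) <= 3%:R * rnorm (y - z).
  move=> e q20; have [ok1 ok2] : ok s q1 /\ ok (last s q1) q2 by apply: ok_cat; rewrite -e.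
  have l2 : last s q1 <= last s p by case: ok2 => _ /path_le_last l2 _; rewrite e last_cat.
  apply: ih => //; last by lra.
  apply: leq_trans pn; rewrite e size_cat -[X in (X < _)%N]addn0 ltn_add2l.
  by case: q2 q20 {e ok2 l2}.
have hd := run_diff okp w Sy Sz D0 pre.
have -> : run s y p - run s z p = (run s y p - mu s (last s p) y - (run s z p - mu s (last s p) z)) +
  (mu s (last s p) y - mu s (last s p) z) by zmod.
apply: le_trans (rnormD _ _) _.
have [s0 lT] : 0 <= s /\ last s p <= T by case: okp.
have hm := mu_lipschitz s0 sl lT Sy Sz.
have c1 := Cw sl w; have e1 : eta th <= 2%:R^-1 by have := rho_gt0 th; rewrite /eta; lra.
have pm : (last s p - s) `^ th <= h `^ th.
  by apply: ge0_ler_powR; rewrite ?nnegrE ?subr_ge0 ?(ltW h0)// ltW// (lt_trans ltr01 (af_th AF)).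
have k0 : 0 <= 26%:R * C / eta th by apply: divr_ge0; [exact: mulr_ge0|exact: ltW etag].
have h1 : 26%:R * C / eta th * (last s p - s) `^ th <= 2%:R^-1.
  by apply: le_trans hK; apply: ler_wpM2l.
have t1 : (2%:R * (13%:R * C * (3%:R * rnorm (y - z))) / eta th) * (last s p - s) `^ th <=
    2%:R^-1 * (3%:R * rnorm (y - z)).
  apply: le_trans (ler_wpM2r D0 h1); apply: eq_ler; move: etag; move: (eta th) => et et0.
  by field; rewrite gt_eqF.
have t2 : (1 + C * (last s p - s) `^ gam) * rnorm (y - z) <= (1 + 2%:R^-1) * rnorm (y - z).
  by apply: ler_wpM2r => //; rewrite lerD2l (le_trans c1).
move: hd hm t1 t2; move: (rnorm (y - z)) ((_ / eta th) * _) ((1 + C * _) * _) => *; lra.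
Qed.

(** The steps of the coarse partition are replaced by blocks one at a time: each replacement costs K
    times a power of the step, and the remaining steps amplify it by at most 3. *)
Lemma run_refines s y p q : refines s p q -> ok s q -> last s q - s <= h -> S s y ->
  rnorm (run s y p - run s y q) <= 3%:R * K * cost th s p.
Proof.
move=> r; elim: r y => [s1|s1 u p1 b q1 pb lb r ih] y okq w Sy.
  by rewrite /= subrr rnorm0 mulr0.
have [ok1 ok2] := ok_cat okq; rewrite lb in ok2.
have su : s1 <= u by rewrite -lb; exact: path_le_last.
have ul : u <= last u q1 by case: ok2 => _ /path_le_last.
rewrite last_cat lb in w; rewrite run_cat lb /=.
have wb : last s1 b - s1 <= h by rewrite lb; lra.
have wq : last u q1 - u <= h by lra.
have Sb : S u (run s1 y b) by rewrite -lb; exact: run_dom.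
have [s0 uT] : 0 <= s1 /\ u <= T by case: ok1; rewrite lb.
have Sm := af_dom AF s0 su uT Sy.
have okp : ok u p1.
  have lp := refines_last r; case: ok2 => u0 _ lT; split=> //; last by rewrite -lp.
  exact: refines_pathl r.
have -> : run u (mu s1 u y) p1 - run u (run s1 y b) q1 =
   (run u (mu s1 u y) p1 - run u (run s1 y b) p1) + (run u (run s1 y b) p1 - run u (run s1 y b) q1) by zmod.
apply: le_trans (rnormD _ _) _; rewrite mulrDr; apply: lerD; last exact: ih.
have wp : last u p1 - u <= h by rewrite -(refines_last r).
apply: le_trans (run_lipschitz okp wp Sm Sb) _; rewrite -mulrA ler_wpM2l// rnormB.
by have := run_norm ok1 wb Sy; rewrite lb.
Qed.

Lemma run_compare s y p1 p2 : ok s p1 -> ok s p2 -> last s p1 = last s p2 -> last s p1 - s <= h ->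
  S s y -> rnorm (run s y p1 - run s y p2) <= 3%:R * K * (cost th s p1 + cost th s p2).
Proof.
move=> ok1 ok2 ll w Sy.
have [s0 pp1 lT] := ok1; have [_ pp2 _] := ok2.
have [q [r1 r2]] := common_refinement pp1 pp2 ll.
have okq : ok s q by split => //; [exact: refines_path r1|rewrite (refines_last r1)].
have wq : last s q - s <= h by rewrite (refines_last r1).
have -> : run s y p1 - run s y p2 = (run s y p1 - run s y q) - (run s y p2 - run s y q) by zmod.
apply: le_trans (rnormDB _ _) _; rewrite mulrDr.
by apply: lerD; exact: run_refines.
Qed.

Definition davie (a b M : R) (Y : R -> V) : Prop :=
  (forall t, a <= t -> t <= b -> S t (Y t)) /\
  forall s t, a <= s -> s <= t -> t <= b -> rnorm (Y t - mu s t (Y s)) <= M * (t - s) `^ th.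

Lemma uniform_ok s t n : 0 <= s -> s <= t -> t <= T ->
  ok s (uniform s t n) /\ last s (uniform s t n) = t.
Proof. by move=> s0 st tT; have [h1 h2 h3] := uniformP th n st; rewrite /ok h2. Qed.

Let mesh (n : nat) : R := n.+1%:R `^ (1 - th).

Let mesh_ge0 n : 0 <= mesh n. Proof. exact: powR_ge0. Qed.

Let uniform_cost s t n : s <= t -> t - s <= h -> cost th s (uniform s t n) <= h `^ th * mesh n.
Proof.
move=> st w; have [_ _ h3] := uniformP th n st; apply: le_trans h3 _.
apply: ler_wpM2r; first exact: powR_ge0.
by apply: ge0_ler_powR; rewrite ?nnegrE ?subr_ge0 ?(ltW h0)// ltW// (lt_trans ltr01 (af_th AF)).
Qed.

Let mesh_small (c e : R) : 0 <= c -> 0 < e -> exists n, c * mesh n <= e.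
Proof.
move=> c0 e0; have c1 : 0 < c + 1 by rewrite ltr_wpDl.
have [N /(_ N (leqnn N)) hN] := powR_neg_to0 (af_th AF) (divr_gt0 e0 c1).
exists N; rewrite ler_pdivlMr// in hN; apply: le_trans hN; rewrite mulrC; apply: ler_wpM2l; first exact: mesh_ge0.
by rewrite lerDl.
Qed.

Let mesh_mono n k : (n <= k)%N -> mesh k <= mesh n.
Proof.
move=> nk; rewrite /mesh -(opprB th) !powRN; rewrite lef_pV2 ?posrE ?powR_gt0//.
apply: ge0_ler_powR; rewrite ?nnegrE ?ler_nat//.
by rewrite subr_ge0 ltW// (af_th AF).
Qed.

Lemma run_same s y p : path <=%R s p -> last s p = s -> run s y p = y.
Proof.
elim: p y => //= u p ih y /andP[su pp] lp.
have us : u = s by apply/le_anti; rewrite su andbT -lp; exact: path_le_last.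
by rewrite us (af_id AF) in pp lp *; exact: ih.
Qed.

(** Each t has its own uniform partitions of [s0, t]. They are not nested, yet the runs along them
    converge since [run_compare] goes through common refinements. *)
Lemma local_solution s0 y0 : 0 <= s0 -> s0 <= T -> S s0 y0 -> exists Y, Y s0 = y0 /\
  davie s0 (Num.min (s0 + h) T) K Y.
Proof.
move=> s00 s0T Sy0; have K0 := K_ge0.
pose U n t := run s0 y0 (uniform s0 t n).
pose c := 6%:R * K * h `^ th; have c0 : 0 <= c by apply: mulr_ge0; [exact: mulr_ge0|exact: powR_ge0].
have lim t : s0 <= t -> t - s0 <= h -> t <= T -> exists l, forall n, rnorm (U n t - l) <= c * mesh n.
  move=> st w tT; apply: cauchy_limit => [d d0|n k nk].
    have [n hn] := mesh_small c0 d0; exists n => k /mesh_mono hk; apply: le_trans hn; exact: ler_wpM2l.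
  have [ok1 l1] := uniform_ok k s00 st tT; have [ok2 l2] := uniform_ok n s00 st tT.
  have := run_compare ok1 ok2 (etrans l1 (esym l2)) (eq_ind_r (fun v => v - s0 <= h) w l1) Sy0.
  move/le_trans; apply; have -> : c * mesh n = 3%:R * K * (h `^ th * mesh n + h `^ th * mesh n) by rewrite /c; ring.
  apply: ler_wpM2l; first exact: mulr_ge0.
  apply: lerD; last exact: uniform_cost.
  apply: le_trans (uniform_cost k st w) _; apply: ler_wpM2l; [exact: powR_ge0|exact: mesh_mono].
pose Y t := xget y0 [set l | forall n, rnorm (U n t - l) <= c * mesh n].
have YP t : s0 <= t -> t - s0 <= h -> t <= T -> forall n, rnorm (U n t - Y t) <= c * mesh n.
  by move=> st w tT; have [l hl] := lim t st w tT; rewrite /Y; case: xgetP => [x _ //|/(_ l)]; exact.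
have bnd t : t <= Num.min (s0 + h) T -> t - s0 <= h /\ t <= T.
  by rewrite le_min lerBlDl => /andP[].
have SU n t : s0 <= t -> t <= T -> S t (U n t).
  move=> st tT; have [ok1 l1] := uniform_ok n s00 st tT.
  by have := run_dom ok1 Sy0; rewrite l1.
exists Y; split; last split.
- apply/eqP; rewrite -subr_eq0; apply/eqP/rnorm_eps => e e0.
  have [n hn] := mesh_small c0 e0; have := YP s0 (lexx _) _ s0T n; rewrite subrr => /(_ (ltW h0)) hh.
  have [h1 h2 _] := uniformP th n (lexx s0).
  have <- : U n s0 = y0 by exact: run_same.
  by rewrite rnormB; exact: le_trans hn.
- move=> t st /bnd[w tT]; apply: (closed_approx (af_closed AF (le_trans s00 st) tT)) => e e0.
  have [n hn] := mesh_small c0 e0; exists (U n t); first exact: SU.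
  by rewrite rnormB; apply: le_trans hn; exact: YP.
move=> s t ss st /bnd[wt tT]; have ws : s - s0 <= h by lra.
have sT := le_trans st tT; have s_0 := le_trans s00 ss.
apply: ler_eps => e e0.
pose c' := 3%:R * c + 9%:R * K * h `^ th; have c'0 : 0 <= c'.
  apply: addr_ge0; first exact: mulr_ge0.
  by apply: mulr_ge0; [exact: mulr_ge0|exact: powR_ge0].
have [n hn] := mesh_small c'0 e0.
have [ok1 l1] := uniform_ok n s00 (le_trans ss st) tT; have [ok2 l2] := uniform_ok n s00 ss sT.
have [ok3 l3] := uniform_ok n s_0 st tT.
(* To relate the limits at s and t, the partition of [s0, t] is compared with one that passes
   through s. *)
have ok4 : ok s0 (uniform s0 s n ++ uniform s t n).
  case: ok2 => _ p2 _; case: ok3 => _ p3 _.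
  by split=> //; rewrite ?cat_path ?last_cat l2 ?p2 ?l3.
have l4 : last s0 (uniform s0 s n ++ uniform s t n) = t by rewrite last_cat l2.
have w1 : last s0 (uniform s0 t n) - s0 <= h by rewrite l1.
have cmp := run_compare ok1 ok4 (etrans l1 (esym l4)) w1 Sy0.
rewrite cost_cat l2 run_cat l2 in cmp.
have k1 := uniform_cost n (le_trans ss st) wt; have k2 := uniform_cost n ss ws.
have wst : t - s <= h by lra.
have k3 := uniform_cost n st wst.
have w3 : last s (uniform s t n) - s <= h by rewrite l3.
have J := run_norm ok3 w3 (SU n s ss sT); rewrite l3 in J.
have Ys : S s (Y s).
  apply: (closed_approx (af_closed AF s_0 sT)) => d d0.
  have [k hk] := mesh_small c0 d0; exists (U k s); first exact: SU.
  by rewrite rnormB; apply: le_trans hk; exact: YP.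
have L := mu_lipschitz s_0 st tT (SU n s ss sT) Ys.
have Y1 := YP t (le_trans ss st) wt tT n; have Y2 := YP s ss ws sT n.
have L' : rnorm (mu s t (U n s) - mu s t (Y s)) <= 2%:R * (c * mesh n).
  apply: le_trans L _; apply: ler_pM; rewrite ?rnorm_ge0//.
    by rewrite addr_ge0// mulr_ge0 ?powR_ge0 ?(af_C AF).
  by have := Cw st wst; have := eta_le1; lra.
have -> : Y t - mu s t (Y s) = - (U n t - Y t) + (U n t - run s (U n s) (uniform s t n)) +
  (run s (U n s) (uniform s t n) - mu s t (U n s)) + (mu s t (U n s) - mu s t (Y s)) by zmod.
have cmp' : rnorm (U n t - run s (U n s) (uniform s t n)) <= 9%:R * K * h `^ th * mesh n.
  apply: le_trans cmp _; have -> : 9%:R * K * h `^ th * mesh n = 3%:R * K * (3%:R * (h `^ th * mesh n)) by ring.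
  by apply: ler_wpM2l; [exact: mulr_ge0|lra].
have tr := le_trans (rnormD _ _) (lerD (le_trans (rnormD _ _) (lerD (rnormD (- (U n t - Y t)) (U n t - run s (U n s) (uniform s t n)))
   (lexx (rnorm (run s (U n s) (uniform s t n) - mu s t (U n s)))))) (lexx (rnorm (mu s t (U n s) - mu s t (Y s))))).
apply: le_trans tr _; rewrite rnormN.
move: hn; rewrite /c' mulrDl -mulrA; move: cmp' L' J Y1.
set m1 := 9%:R * K * _ * _; set m2 := c * mesh n; lra.
Qed.

Lemma davie_run a b M Y s p : davie a b M Y -> 0 <= M -> a <= s -> ok s p -> last s p <= b ->
  last s p - s <= h -> rnorm (run s (Y s) p - Y (last s p)) <= 3%:R * M * cost th s p.
Proof.
move=> [SY dY] M0; elim: p s => [|u p ih] s as_ okp lb w.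
  by rewrite /= subrr rnorm0 mulr0.
have [s0 su uT oku] := ok_cons okp; rewrite /= in lb w *.
have ul : u <= last u p by case: oku => _ /path_le_last.
have au := le_trans as_ su; have ub := le_trans ul lb; have sb := le_trans su ub.
have Sy := SY s as_ sb; have Su := SY u au ub.
have wu : last u p - u <= h by lra.
have -> : run u (mu s u (Y s)) p - Y (last u p) = (run u (mu s u (Y s)) p - run u (Y u) p) +
  (run u (Y u) p - Y (last u p)) by zmod.
apply: le_trans (rnormD _ _) _; rewrite mulrDr; apply: lerD; last exact: ih.
apply: le_trans (run_lipschitz oku wu (af_dom AF s0 su uT Sy) Su) _.
by rewrite -mulrA ler_wpM2l// rnormB dY.
Qed.

Lemma davie_limit a b M Y s t : davie a b M Y -> 0 <= M -> 0 <= a -> a <= s -> s <= t -> t <= b -> b <= T ->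
  t - s <= h -> forall e, 0 < e -> exists n,
    rnorm (run s (Y s) (uniform s t n) - Y t) <= e.
Proof.
move=> dY M0 a0 as_ st tb bT w e e0; have c0 : 0 <= 3%:R * M * h `^ th by rewrite !mulr_ge0// powR_ge0.
have [n hn] := mesh_small c0 e0; exists n; apply: le_trans hn.
have [ok1 l1] := uniform_ok n (le_trans a0 as_) st (le_trans tb bT).
have := davie_run dY M0 as_ ok1; rewrite l1 => /(_ tb w)/le_trans; apply.
by rewrite -!mulrA ler_wpM2l// ler_wpM2l// uniform_cost.
Qed.

(** On short intervals the arbitrary constant M is improved to K, because the path is a limit of
    runs. The size of M, which carries no polynomial bound, then drops out of the estimates. *)
Lemma davie_local M Y s t : davie 0 T M Y -> 0 <= M -> 0 <= s -> s <= t -> t <= T -> t - s <= h ->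
  rnorm (Y t - mu s t (Y s)) <= K * (t - s) `^ th.
Proof.
move=> dY M0 s0 st tT w; apply: ler_eps => e e0.
have [n hn] := davie_limit dY M0 (lexx _) s0 st tT (lexx _) w e0.
have [ok1 l1] := uniform_ok n s0 st tT.
have := run_norm ok1 _ (dY.1 s s0 (le_trans st tT)); rewrite l1 => /(_ w) J.
have -> : Y t - mu s t (Y s) = (run s (Y s) (uniform s t n) - mu s t (Y s)) -
   (run s (Y s) (uniform s t n) - Y t) by zmod.
by apply: le_trans (rnormDB _ _) _; exact: lerD.
Qed.

Lemma davie_unique M M' Y Z : davie 0 T M Y -> davie 0 T M' Z -> 0 <= M -> 0 <= M' -> Y 0 = Z 0 ->
  forall t, 0 <= t -> t <= T -> Y t = Z t.
Proof.
move=> dY dZ M0 M0' YZ0.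
suff H n t : 0 <= t -> t <= T -> t <= n%:R * h -> Y t = Z t.
  move=> t t0 tT; apply: (H (Num.truncn (t / h)).+1) => //.
  rewrite -ler_pdivrMr// ltW// truncnS_gt// divr_ge0// ltW//.
elim: n t => [|n ih] t t0 tT tn.
  by have -> : t = 0 by apply/le_anti; rewrite t0 andbT -(mul0r h).
have [tn'|tn'] := leP t (n%:R * h); first exact: ih.
pose s := n%:R * h; have s0 : 0 <= s by rewrite mulr_ge0// ltW.
have st : s <= t by rewrite ltW.
have eYZ : Y s = Z s by apply: ih => //; apply: le_trans tT.
have w : t - s <= h by rewrite lerBlDl -[X in _ <= _ + X]mul1r -mulrDl natr1.
apply/eqP; rewrite -subr_eq0; apply/eqP/rnorm_eps => e e0.
have e2 : 0 < e / 2%:R by rewrite divr_gt0.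
pose c := 3%:R * (M + M') * h `^ th.
have c0 : 0 <= c by rewrite /c !mulr_ge0 ?addr_ge0 ?powR_ge0.
have [k hk] := mesh_small c0 e0.
have [ok1 l1] := uniform_ok k s0 st tT.
have h1 := davie_run dY M0 s0 ok1; rewrite l1 in h1; have {}h1 := h1 tT w.
have h2 := davie_run dZ M0' s0 ok1; rewrite l1 in h2; have {}h2 := h2 tT w.
have -> : Y t - Z t = (run s (Z s) (uniform s t k) - Z t) - (run s (Y s) (uniform s t k) - Y t).
  by rewrite eYZ; zmod.
apply: le_trans (rnormDB _ _) _; apply: le_trans hk; apply: le_trans (lerD h2 h1) _.
have := uniform_cost k st w; move: (cost _ _ _) => x hx.
have -> : c * mesh k = 3%:R * M' * (h `^ th * mesh k) + 3%:R * M * (h `^ th * mesh k) by rewrite /c; ring.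
by apply: lerD; apply: ler_wpM2l => //; exact: mulr_ge0.
Qed.

Lemma global_solution y0 : 0 <= T -> S 0 y0 ->
  exists M Y, [/\ 0 <= M, Y 0 = y0 & davie 0 T M Y].
Proof.
move=> T0 Sy0; have C0 := af_C AF.
suff H n : exists M Y, [/\ 0 <= M, Y 0 = y0 & davie 0 (Num.min (n%:R * h) T) M Y].
  have [M [Y [M0 Y0 dY]]] := H (Num.truncn (T / h)).+1; exists M, Y; split => //.
  move: dY; rewrite min_r// -ler_pdivrMr// ltW// truncnS_gt// divr_ge0// ltW//.
elim: n => [|n [M [Y [M0 Y0 dY]]]].
  exists 0, (fun=> y0); rewrite mul0r min_l//; split => //; split=> [t t0 t1|s t s0 st t0].
    by have -> : t = 0 by apply/le_anti; rewrite t0 t1.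
  have -> : t = 0 by apply/le_anti; rewrite t0 (le_trans s0).
  have -> : s = 0 by apply/le_anti; rewrite s0 (le_trans st).
  by rewrite (af_id AF) subrr rnorm0 mul0r.
pose u := n%:R * h; have u0 : 0 <= u by rewrite mulr_ge0// ltW.
have uh : n.+1%:R * h = u + h by rewrite -natr1 mulrDl mul1r.
have [Tu|uT] := leP T u.
  exists M, Y; split => //; rewrite uh min_r; last by rewrite (le_trans Tu)// lerDl ltW.
  by rewrite min_r in dY.
rewrite (min_l (ltW uT)) in dY; have [SY dY'] := dY; have uT' := ltW uT.
have [Z [Zu [SZ dZ]]] := local_solution u0 uT' (SY u u0 (lexx _)).
pose Y' t := if t <= u then Y t else Z t.
have Yl t : t <= u -> Y' t = Y t by rewrite /Y' => ->.
have Yr t : u <= t -> Y' t = Z t.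
  by rewrite /Y'; case: ifP => // tu ut; have -> : t = u by apply/le_anti; rewrite tu ut.
(* The constant is multiplied by 1 + C T^gam at each gluing, hence grows geometrically;
   [davie_local] makes this harmless. *)
have cT0 : 0 <= 1 + C * T `^ gam by rewrite addr_ge0// mulr_ge0// powR_ge0.
pose M' := K + (1 + C * T `^ gam) * M + C.
have K0 := K_ge0; have cM : 0 <= (1 + C * T `^ gam) * M by exact: mulr_ge0.
exists M', Y'; split; first by rewrite /M'; lra.
  by rewrite Yl.
rewrite uh; split=> [t t0 tb|s t s0 st tb].
  have [tu|/ltW ut] := leP t u; first by rewrite Yl//; exact: SY.
  by rewrite Yr//; exact: SZ.
have p0 : 0 <= (t - s) `^ th by exact: powR_ge0.
have [tu|/ltW ut] := leP t u.
  rewrite !Yl//; last exact: le_trans tu.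
  apply: le_trans (dY' _ _ s0 st tu) _; apply: ler_wpM2r => //; rewrite /M'.
  have : 1 * M <= (1 + C * T `^ gam) * M by apply: ler_wpM2r => //; rewrite lerDl mulr_ge0// powR_ge0.
  lra.
have [us|/ltW su] := leP u s.
  rewrite !Yr//; apply: le_trans (dZ _ _ us st tb) _; apply: ler_wpM2r => //; rewrite /M'; lra.
rewrite (Yr t)// (Yl s)//; have tT : t <= T by move: tb; rewrite le_min => /andP[].
have j1 := dZ _ _ (lexx _) ut tb; have j2 := dY' _ _ s0 su (lexx _); rewrite Zu in j1.
have Sys := SY s s0 su; have j3 := af_norm AF s0 su ut tT Sys.
have j4 := mu_lipschitz u0 ut tT (SY u u0 (lexx _)) (af_dom AF s0 su uT' Sys).
have -> : Z t - mu s t (Y s) = (Z t - mu u t (Y u)) + (mu u t (Y u) - mu u t (mu s u (Y s))) +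
   (mu u t (mu s u (Y s)) - mu s t (Y s)) by zmod.
have th0 : 0 <= th by apply: ltW; apply: lt_trans (af_th AF).
have q1 : (t - u) `^ th <= (t - s) `^ th.
  by apply: ge0_ler_powR; rewrite ?nnegrE ?subr_ge0// lerB.
have q2 : (u - s) `^ th <= (t - s) `^ th.
  by apply: ge0_ler_powR; rewrite ?nnegrE ?subr_ge0// lerB.
have q3 : (t - u) `^ gam <= T `^ gam.
  by apply: ge0_ler_powR; rewrite ?nnegrE ?subr_ge0 ?(ltW (af_gam AF))//; lra.
apply: le_trans (rnormD _ _) _; apply: le_trans (lerD (rnormD _ _) (lexx _)) _.
rewrite /M' 2!mulrDl; apply: lerD => //; apply: lerD.
  by apply: le_trans j1 _; apply: ler_wpM2l.
apply: le_trans j4 _; rewrite -mulrA; apply: ler_pM; rewrite ?rnorm_ge0//.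
- by rewrite addr_ge0// mulr_ge0// powR_ge0.
- by rewrite lerD2l ler_wpM2l.
- by apply: le_trans j2 _; apply: ler_wpM2l.
Qed.

End Flow.

Section FlowStep.
Context (R : realType) (V : completeNormedModType R[i]).
Variables (S : R -> V -> Prop) (mu : R -> R -> V -> V) (T C gam th : R).
Hypothesis AF : almost_flow S mu T C gam th.
Hypothesis C1 : 1 <= C.
Hypothesis gam_th : gam <= th.

(** The solution of C h^gam = eta/52, for which 26 C h^gam / eta is exactly 1/2. As h <= 1 and gam
    <= th, both smallness conditions of the flow follow. *)
Definition flow_step : R := (eta th / (52%:R * C)) `^ gam^-1.

Lemma flow_stepP : [/\ 0 < flow_step, C * flow_step `^ gam <= eta th &
  26%:R * C / eta th * flow_step `^ th <= 2%:R^-1].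
Proof.
have eg := etag AF; have e1 := eta_le1 th; have C1' := C1.
have g0 := af_gam AF; have C0 : 0 < 52%:R * C by rewrite mulr_gt0// (lt_le_trans ltr01).
have x0 : 0 < eta th / (52%:R * C) by rewrite divr_gt0.
have x1 : eta th / (52%:R * C) <= 1 by rewrite ler_pdivrMr// mul1r; lra.
have hp : 0 < flow_step by exact: powR_gt0.
have h1 : flow_step <= 1.
  have -> : 1 = 1 `^ gam^-1 :> R by rewrite powR1.
  by apply: ge0_ler_powR; rewrite ?nnegrE ?invr_ge0 ?(ltW x0) ?(ltW g0).
have hg : flow_step `^ gam = eta th / (52%:R * C) by rewrite -powRrM mulVf ?gt_eqF// powRr1// ltW.
split => //.
  rewrite hg; have -> : C * (eta th / (52%:R * C)) = eta th / 52%:R by field; lra.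
  lra.
apply: (@le_trans _ _ (26%:R * C / eta th * flow_step `^ gam)).
  apply: ler_wpM2l; first by apply: divr_ge0; [lra|exact: ltW].
  by apply: ger_powR => //; rewrite hp.
rewrite hg; apply: eq_ler; move: eg; move: (eta th) => x xp; field; lra.
Qed.

End FlowStep.

(** * Operations on projective tensor products *)

Section TensorOperationTheory.
Context (R : realType) (A : vonNeumannAlgebra R).
Implicit Types (S : linSubspace A) (a b c u v : A).

Lemma ext2 S (T : ptensor2 S) (F : completeNormedModType R[i]) (L1 L2 : T -> F) (M1 M2 : R) :
  (forall x y, L1 (x + y) = L1 x + L1 y) -> (forall x, rnorm (L1 x) <= M1 * rnorm x) ->
  (forall x y, L2 (x + y) = L2 x + L2 y) -> (forall x, rnorm (L2 x) <= M2 * rnorm x) ->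
  (forall u v, S u -> S v -> L1 (tens2 T u v) = L2 (tens2 T u v)) -> forall x, L1 x = L2 x.
Proof.
move=> a1 b1 a2 b2 h x; suff -> : L1 = L2 by [].
by apply: (@uniq2 _ _ _ T) => //; [exact: bounded_additive_continuous b1|exact: bounded_additive_continuous b2].
Qed.

Section OneSpace.
Variables (S : linSubspace A) (T : ptensor2 S).
Hypothesis S_mul : forall u v, S u -> S v -> S (u ** v).

Let inner u1 u2 : T -> T := extend2 (fun v1 v2 => tens2 T (u1 ** v1) (v2 ** u2)).

Let innerP u1 u2 : S u1 -> S u2 -> bounded_linear (rnorm u1 * rnorm u2) (inner u1 u2) /\
  forall v1 v2, S v1 -> S v2 -> inner u1 u2 (tens2 T v1 v2) = tens2 T (u1 ** v1) (v2 ** u2).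
Proof.
move=> s1 s2; have bT := tens2_bilinear T; apply: extend2P.
- by rewrite mulr_ge0 ?rnorm_ge0.
- move=> c x y z sx sy sz; rewrite !vmulDl !vmulDr !vmulZl !vmulZr; split.
    by have [-> _] := bT c _ _ _ (S_mul s1 sx) (S_mul s1 sy) (S_mul sz s2).
  by have [_ ->] := bT c _ _ _ (S_mul sx s2) (S_mul sy s2) (S_mul s1 sz).
- move=> x y sx sy; apply: le_trans (tens2_rnorm T (S_mul s1 sx) (S_mul sy s2)) _.
  apply: (@le_trans _ _ ((rnorm u1 * rnorm x) * (rnorm y * rnorm u2))).
    by apply: ler_pM; rewrite ?rnorm_ge0 ?rnormM.
  by apply: eq_ler; ring.
Qed.

(** [mul2] is a nested extension; the outer one exists only if the inner one is bilinear in (u1,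
    u2), which is checked for elementary y and extended by density. *)
Let inner_bilinear y : bilinear_on S (fun u1 u2 => inner u1 u2 y).
Proof.
move=> c u v w su sv sw; have bT := tens2_bilinear T.
have s1 : S (c *: u + v) by exact: subspace_lin.
have [l1 t1] := innerP s1 sw; have [l2 t2] := innerP su sw; have [l3 t3] := innerP sv sw.
have [l1' t1'] := innerP sw s1; have [l2' t2'] := innerP sw su; have [l3' t3'] := innerP sw sv.
have comb (L1 L2 : T -> T) M1 M2 : bounded_linear M1 L1 -> bounded_linear M2 L2 ->
   bounded_linear (cabs c * M1 + M2) (fun y => c *: L1 y + L2 y).
  move=> b1 b2; apply: rnorm_bounded_linear => [d p q|p].
    rewrite (bounded_linearD b1) (bounded_linearD b2) (bounded_linearZ b1) (bounded_linearZ b2).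
    by rewrite !cscalerDr !scalerA (mulrC c); zmod.
  apply: le_trans (rnormD _ _) _; rewrite rnormZ mulrDl -mulrA; apply: lerD.
    by apply: ler_wpM2l; [exact: cabs_ge0|exact: bounded_linear_rnorm].
  exact: bounded_linear_rnorm.
split.
  have b4 := comb _ _ _ _ l2 l3.
  apply: (ext2 (bounded_linearD l1) (bounded_linear_rnorm l1) (bounded_linearD b4) (bounded_linear_rnorm b4)).
  move=> p q sp sq; rewrite t1// t2// t3// vmulDl vmulZl.
  by have [-> _] := bT c _ _ _ (S_mul su sp) (S_mul sv sp) (S_mul sq sw).
have b4 := comb _ _ _ _ l2' l3'.
apply: (ext2 (bounded_linearD l1') (bounded_linear_rnorm l1') (bounded_linearD b4) (bounded_linear_rnorm b4)).
move=> p q sp sq; rewrite t1'// t2'// t3'// vmulDr vmulZr.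
by have [_ ->] := bT c _ _ _ (S_mul sq su) (S_mul sq sv) (S_mul sw sp).
Qed.

Let mul2_ext y : bounded_linear (rnorm y) (fun x : T => mul2 x y) /\
  forall u v, S u -> S v -> mul2 (tens2 T u v) y = inner u v y.
Proof.
apply: extend2P; [exact: rnorm_ge0|exact: inner_bilinear|].
move=> u v su sv; have [l _] := innerP su sv; rewrite mulrC; exact: bounded_linear_rnorm.
Qed.

Lemma mul2_bounded y : bounded_linear (rnorm y) (fun x : T => mul2 x y).
Proof. by have [] := mul2_ext y. Qed.

Lemma mul2_tens u v u' v' : S u -> S v -> S u' -> S v' ->
  mul2 (tens2 T u v) (tens2 T u' v') = tens2 T (u ** u') (v' ** v).
Proof.
move=> su sv su' sv'; have [_ ->//] := mul2_ext (tens2 T u' v').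
by have [_ ->] := innerP su sv.
Qed.

Lemma mul2Dr (x y z : T) : mul2 x (y + z) = mul2 x y + mul2 x z.
Proof.
have [l1 t1] := mul2_ext (y + z); have [l2 t2] := mul2_ext y; have [l3 t3] := mul2_ext z.
have D2 := bounded_linearD l2; have D3 := bounded_linearD l3.
apply: (@ext2 _ T _ (fun x => mul2 x (y + z)) (fun x => mul2 x y + mul2 x z) _ (rnorm y + rnorm z)
  (bounded_linearD l1) (bounded_linear_rnorm l1)).
- by move=> p q; rewrite D2 D3; zmod.
- move=> p; rewrite mulrDl; apply: le_trans (rnormD _ _) _; apply: lerD.
    exact: (bounded_linear_rnorm l2).
  exact: (bounded_linear_rnorm l3).
- move=> u v su sv; rewrite t1// t2// t3//; have [l _] := innerP su sv.
  exact: bounded_linearD l _ _.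
Qed.

Lemma mul2Bl (x y z : T) : mul2 (x - y) z = mul2 x z - mul2 y z.
Proof. exact: (additiveB (bounded_linearD (mul2_bounded z))). Qed.

Lemma mul2Br (x y z : T) : mul2 z (x - y) = mul2 z x - mul2 z y.
Proof. by apply: (@additiveB _ _ (mul2 z)) => p q; exact: mul2Dr. Qed.

Lemma mul2_norm (x y : T) : rnorm (mul2 x y) <= 1 * (rnorm x * rnorm y).
Proof. by rewrite mul1r mulrC; exact: bounded_linear_rnorm (mul2_bounded y) x. Qed.

Lemma sharp2_tens u v a : S u -> S v -> sharp2 (tens2 T u v) a = u ** a ** v.
Proof. by move=> su sv; have [h _] := sharp2P T a; exact: h. Qed.

Lemma sharp2_bounded a : bounded_linear (rnorm a) (fun x : T => sharp2 x a).
Proof. by have [] := sharp2P T a. Qed.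

Lemma sharp2Dl (x y : T) a : sharp2 (x + y) a = sharp2 x a + sharp2 y a.
Proof. exact: bounded_linearD (sharp2_bounded a) x y. Qed.

Lemma sharp2Bl (x y : T) a : sharp2 (x - y) a = sharp2 x a - sharp2 y a.
Proof. exact: (additiveB (bounded_linearD (sharp2_bounded a))). Qed.

Lemma sharp2_norm (x : T) a : rnorm (sharp2 x a) <= 1 * (rnorm x * rnorm a).
Proof. by rewrite mul1r mulrC; exact: bounded_linear_rnorm (sharp2_bounded a) x. Qed.

Lemma sharp2Dr (x : T) a b : sharp2 x (a + b) = sharp2 x a + sharp2 x b.
Proof.
apply: (@ext2 _ T _ (fun x => sharp2 x (a + b)) (fun x => sharp2 x a + sharp2 x b) (rnorm (a + b)) (rnorm a + rnorm b)).
- by move=> p q; exact: sharp2Dl.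
- exact: bounded_linear_rnorm (sharp2_bounded _).
- by move=> p q; rewrite !sharp2Dl; zmod.
- move=> p; rewrite mulrDl; apply: le_trans (rnormD _ _) _.
  by apply: lerD; exact: bounded_linear_rnorm (sharp2_bounded _) p.
- by move=> u v su sv; rewrite !sharp2_tens// vmulDr vmulDl.
Qed.

Lemma sharp2Br (x : T) a b : sharp2 x (a - b) = sharp2 x a - sharp2 x b.
Proof. by apply: (@additiveB _ _ (sharp2 x)) => p q; exact: sharp2Dr. Qed.

Lemma sharp2_0 (x : T) : sharp2 x 0 = 0.
Proof. by apply: (@additive0 _ _ (sharp2 x)) => p q; exact: sharp2Dr. Qed.

(** The reversed order of the second factors in [mul2] is what makes the product act as a
    composition. *)
Lemma sharp2_mul (x y : T) a : sharp2 (mul2 x y) a = sharp2 x (sharp2 y a).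
Proof.
have lx z := bounded_linearD (mul2_bounded z).
apply: (@ext2 _ T _ (fun x => sharp2 (mul2 x y) a) (fun x => sharp2 x (sharp2 y a)) (rnorm y * rnorm a) (rnorm (sharp2 y a))).
- by move=> p q; rewrite lx sharp2Dl.
- move=> p; apply: le_trans (sharp2_norm _ _) _; rewrite mul1r.
  have m1 := mul2_norm p y; rewrite mul1r in m1.
  by apply: le_trans (ler_wpM2r (rnorm_ge0 a) m1) _; apply: eq_ler; ring.
- by move=> p q; exact: sharp2Dl.
- exact: bounded_linear_rnorm (sharp2_bounded _).
move=> u v su sv.
apply: (@ext2 _ T _ (fun y => sharp2 (mul2 (tens2 T u v) y) a) (fun y => sharp2 (tens2 T u v) (sharp2 y a))
  (rnorm (tens2 T u v) * rnorm a) (rnorm (tens2 T u v) * rnorm a)).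
- by move=> p q; rewrite mul2Dr sharp2Dl.
- move=> p; apply: le_trans (sharp2_norm _ _) _; rewrite mul1r mulrAC ler_wpM2r ?rnorm_ge0//.
  by have := mul2_norm (tens2 T u v) p; rewrite mul1r.
- by move=> p q; rewrite sharp2Dl sharp2Dr.
- move=> p; apply: le_trans (sharp2_norm _ _) _; rewrite mul1r -mulrA ler_wpM2l ?rnorm_ge0//.
  by have := sharp2_norm p a; rewrite mul1r mulrC.
- move=> p q sp sq; rewrite mul2_tens// !sharp2_tens//; try exact: S_mul.
  by rewrite !vmulA.
Qed.

Section Star.
Hypothesis S_star : forall u, S u -> S (vn_star u).

Let star2_tens u v : S u -> S v -> star2 (tens2 T u v) = tens2 T (vn_star v) (vn_star u).
Proof. by have [h _ _ _] := star2P T S_star; exact: h. Qed.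

Lemma star2D (x y : T) : star2 (x + y) = star2 x + star2 y.
Proof. by have [_ h _ _] := star2P T S_star. Qed.

Lemma star2_norm (x : T) : rnorm (star2 x) <= rnorm x.
Proof. by have [_ _ _ h] := star2P T S_star. Qed.

Lemma star2_mul (x y : T) : star2 (mul2 x y) = mul2 (star2 x) (star2 y).
Proof.
have lx z := bounded_linearD (mul2_bounded z).
have n1 p q : rnorm (star2 (mul2 p q) : T) <= rnorm p * rnorm q.
  by apply: le_trans (star2_norm _) _; have := mul2_norm p q; rewrite mul1r.
have n2 (p q : T) : rnorm (mul2 (star2 p) (star2 q)) <= rnorm p * rnorm q.
  apply: le_trans (mul2_norm _ _) _; rewrite mul1r.
  by apply: ler_pM; rewrite ?rnorm_ge0 ?star2_norm.
apply: (@ext2 _ T _ (fun x => star2 (mul2 x y)) (fun x => mul2 (star2 x) (star2 y)) (rnorm y) (rnorm y)).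
- by move=> p q; rewrite lx star2D.
- by move=> p; rewrite mulrC.
- by move=> p q; rewrite star2D lx.
- by move=> p; rewrite mulrC.
move=> u v su sv.
apply: (@ext2 _ T _ (fun y => star2 (mul2 (tens2 T u v) y)) (fun y => mul2 (star2 (tens2 T u v)) (star2 y))
  (rnorm (tens2 T u v)) (rnorm (tens2 T u v))) => //.
- by move=> p q; rewrite mul2Dr star2D.
- by move=> p q; rewrite star2D mul2Dr.
move=> p q sp sq; rewrite mul2_tens// !star2_tens ?mul2_tens//; try exact: S_mul; try exact: S_star.
by rewrite !starM.
Qed.

Lemma star2K (x : T) : star2 (star2 x) = x.
Proof.
apply: (@ext2 _ T _ (fun x => star2 (star2 x)) id 1 1) => //.
- by move=> p q; rewrite !star2D.
- by move=> p; rewrite mul1r; exact: le_trans (star2_norm _) (star2_norm _).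
- by move=> p; rewrite mul1r.
- by move=> u v su sv; rewrite !star2_tens//; try exact: S_star; rewrite !starK.
Qed.

Lemma star_sharp2 (x : T) a : vn_star (sharp2 x a) = sharp2 (star2 x) (vn_star a).
Proof.
apply: (@ext2 _ T _ (fun x => vn_star (sharp2 x a)) (fun x => sharp2 (star2 x) (vn_star a)) (rnorm a) (rnorm a)).
- by move=> p q; rewrite sharp2Dl starD.
- by move=> p; rewrite rnorm_star; exact: bounded_linear_rnorm (sharp2_bounded a) p.
- by move=> p q; rewrite star2D sharp2Dl.
- move=> p; apply: le_trans (sharp2_norm _ _) _; rewrite rnorm_star mul1r mulrC.
  by rewrite ler_wpM2l ?rnorm_ge0// star2_norm.
- move=> u v su sv; rewrite star2_tens// !sharp2_tens//; try exact: S_star.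
  by rewrite !starM vmulA.
Qed.

End Star.

Section Third.
Variable (G : ptensor3 S).

Lemma op_times_id_tens21 (L : T -> A) (M : R) (x : T) a : 0 <= M -> bounded_linear M L -> S a ->
  op_times_id L (tens21 G x a) = L x ** a.
Proof.
move=> M0 bL sa; have bT := tens2_bilinear T; have tG := tens3_trilinear G.
have [||l1 t1] := @extend3P _ _ _ G A (fun u v w => L (tens2 T u v) ** w) M M0.
- move=> c x1 y z w sx sy sz sw.
  have [e1 e2] := bT c _ _ _ sx sy sz.
  by rewrite e1 e2 !(bounded_linearD bL) !(bounded_linearZ bL) !vmulDl !vmulDr !vmulZl !vmulZr.
- move=> u v w su sv sw; apply: le_trans (rnormM _ _) _; rewrite mulrA ler_wpM2r ?rnorm_ge0//.
  apply: le_trans (bounded_linear_rnorm bL _) _; rewrite ler_wpM2l//; exact: tens2_rnorm.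
have [|u v su sv|l2 t2] := @extend2P _ _ _ T G (fun u v => tens3 G u v a) (rnorm a) (rnorm_ge0 a).
- move=> c x1 y z sx sy sz; have [e1 _ _] := tG c _ _ _ _ sx sy sz sa.
  by have [_ e2 _] := tG c _ _ _ _ sx sy sz sa.
- have := tens3_norm G su sv sa; rewrite !rnormE -!RCM lecR => h; by rewrite mulrC.
apply: (@ext2 _ T _ (fun x => op_times_id L (tens21 G x a)) (fun x => L x ** a) (M * rnorm a) (M * rnorm a)).
- by move=> p q; rewrite /op_times_id /tens21 (bounded_linearD l2) (bounded_linearD l1).
- move=> p; rewrite -mulrA; apply: le_trans (bounded_linear_rnorm l1 _) _; rewrite ler_wpM2l//.
  exact: (bounded_linear_rnorm l2 p).
- by move=> p q; rewrite (bounded_linearD bL) vmulDl.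
- move=> p; apply: le_trans (rnormM _ _) _; rewrite mulrAC ler_wpM2r ?rnorm_ge0//.
  exact: bounded_linear_rnorm.
- by move=> u v su sv; rewrite /tens21 t2// /op_times_id t1.
Qed.

Lemma id_times_op_tens12 (L : T -> A) (M : R) (x : T) a : 0 <= M -> bounded_linear M L -> S a ->
  id_times_op L (tens12 G a x) = a ** L x.
Proof.
move=> M0 bL sa; have bT := tens2_bilinear T; have tG := tens3_trilinear G.
have [||l1 t1] := @extend3P _ _ _ G A (fun u v w => u ** L (tens2 T v w)) M M0.
- move=> c x1 y z w sx sy sz sw.
  have [e1 _] := bT c _ _ _ sx sy sw; have [_ e2] := bT c _ _ _ sx sy sw.
  by rewrite e1 e2 !(bounded_linearD bL) !(bounded_linearZ bL) !vmulDl !vmulDr !vmulZl !vmulZr.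
- move=> u v w su sv sw; apply: le_trans (rnormM _ _) _; rewrite -mulrA mulrCA ler_wpM2l ?rnorm_ge0//.
  apply: le_trans (bounded_linear_rnorm bL _) _; rewrite ler_wpM2l//; exact: tens2_rnorm.
have [|u v su sv|l2 t2] := @extend2P _ _ _ T G (fun u v => tens3 G a u v) (rnorm a) (rnorm_ge0 a).
- move=> c x1 y z sx sy sz; have [_ e1 _] := tG c _ _ _ _ sx sy sa sz.
  by have [_ _ e2] := tG c _ _ _ _ sx sy sa sz.
- have := tens3_norm G sa su sv; rewrite !rnormE -!RCM lecR => h; by rewrite mulrA.
apply: (@ext2 _ T _ (fun x => id_times_op L (tens12 G a x)) (fun x => a ** L x) (M * rnorm a) (M * rnorm a)).
- by move=> p q; rewrite /id_times_op /tens12 (bounded_linearD l2) (bounded_linearD l1).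
- move=> p; rewrite -mulrA; apply: le_trans (bounded_linear_rnorm l1 _) _; rewrite ler_wpM2l//.
  exact: (bounded_linear_rnorm l2 p).
- by move=> p q; rewrite (bounded_linearD bL) vmulDr.
- move=> p; apply: le_trans (rnormM _ _) _; rewrite -mulrA mulrCA ler_wpM2l ?rnorm_ge0//.
  exact: bounded_linear_rnorm.
- by move=> u v su sv; rewrite /tens12 t2// /id_times_op t1.
Qed.

End Third.

End OneSpace.

Section Inclusion.
Variables (S S' : linSubspace A) (T : ptensor2 S) (T' : ptensor2 S').
Hypothesis SS' : forall u, S u -> S' u.

Lemma incl2P : bounded_linear 1 (incl2 T' : T -> T') /\
  forall u v, S u -> S v -> incl2 T' (tens2 T u v) = tens2 T' u v.
Proof.
apply: extend2P => // [c x y z sx sy sz|x y sx sy].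
  exact: (tens2_bilinear T') c _ _ _ (SS' sx) (SS' sy) (SS' sz).
by rewrite mul1r; apply: tens2_rnorm; exact: SS'.
Qed.

Lemma incl2_tens u v : S u -> S v -> incl2 T' (tens2 T u v) = tens2 T' u v.
Proof. by have [_ h] := incl2P; exact: h. Qed.

Lemma incl2D (x y : T) : incl2 T' (x + y) = incl2 T' x + incl2 T' y.
Proof. by have [h _] := incl2P; exact: bounded_linearD h x y. Qed.

Lemma incl2_norm (x : T) : rnorm (incl2 T' x) <= rnorm x.
Proof. by have [h _] := incl2P; have := bounded_linear_rnorm h x; rewrite mul1r. Qed.

Lemma sharp2_incl (x : T) a : sharp2 (incl2 T' x) a = sharp2 x a.
Proof.
apply: (@ext2 _ T _ (fun x => sharp2 (incl2 T' x) a) (fun x => sharp2 x a) (rnorm a) (rnorm a)).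
- by move=> p q; rewrite incl2D sharp2Dl.
- move=> p; apply: le_trans (bounded_linear_rnorm (sharp2_bounded T' a) _) _.
  by rewrite ler_wpM2l ?rnorm_ge0// incl2_norm.
- by move=> p q; exact: sharp2Dl.
- exact: bounded_linear_rnorm (sharp2_bounded T a).
- by move=> u v su sv; rewrite incl2_tens// !sharp2_tens//; exact: SS'.
Qed.

Lemma incl2_mul (x y : T) : (forall u v, S u -> S v -> S (u ** v)) -> (forall u v, S' u -> S' v -> S' (u ** v)) ->
  incl2 T' (mul2 x y) = mul2 (incl2 T' x) (incl2 T' y).
Proof.
move=> m m'; have lx z := bounded_linearD (mul2_bounded m (z : T)).
have lx' z := bounded_linearD (mul2_bounded m' (z : T')).
have n1 p q : rnorm (incl2 T' (mul2 p q)) <= rnorm (p : T) * rnorm (q : T).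
  by apply: le_trans (incl2_norm _) _; have := mul2_norm m p q; rewrite mul1r.
have n2 (p q : T) : rnorm (mul2 (incl2 T' p) (incl2 T' q)) <= rnorm p * rnorm q.
  apply: le_trans (mul2_norm m' _ _) _; rewrite mul1r.
  by apply: ler_pM; rewrite ?rnorm_ge0 ?incl2_norm.
apply: (@ext2 _ T _ (fun x => incl2 T' (mul2 x y)) (fun x => mul2 (incl2 T' x) (incl2 T' y)) (rnorm y) (rnorm y)).
- by move=> p q; rewrite lx incl2D.
- by move=> p; rewrite mulrC.
- by move=> p q; rewrite incl2D lx'.
- by move=> p; rewrite mulrC.
move=> u v su sv.
apply: (@ext2 _ T _ (fun y => incl2 T' (mul2 (tens2 T u v) y)) (fun y => mul2 (incl2 T' (tens2 T u v)) (incl2 T' y))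
  (rnorm (tens2 T u v)) (rnorm (tens2 T u v))) => //.
- by move=> p q; rewrite mul2Dr// incl2D.
- by move=> p q; rewrite incl2D mul2Dr.
move=> p q sp sq; rewrite mul2_tens// !incl2_tens ?mul2_tens//; try exact: m; by apply: SS'.
Qed.

Lemma star2_incl (x : T) : (forall u, S u -> S (vn_star u)) -> (forall u, S' u -> S' (vn_star u)) ->
  star2 (incl2 T' x) = incl2 T' (star2 x).
Proof.
move=> st st'; have [t1 d1 _ n1] := star2P T st; have [t2 d2 _ n2] := star2P T' st'.
apply: (@ext2 _ T _ (fun x => star2 (incl2 T' x)) (fun x => incl2 T' (star2 x)) 1 1).
- by move=> p q; rewrite incl2D d2.
- by move=> p; rewrite mul1r; exact: le_trans (n2 _) (incl2_norm _).
- by move=> p q; rewrite d1 incl2D.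
- by move=> p; rewrite mul1r; exact: le_trans (incl2_norm _) (n1 _).
- move=> u v su sv; rewrite t1// !incl2_tens//; try exact: st.
  by rewrite t2//; exact: SS'.
Qed.

End Inclusion.

End TensorOperationTheory.

(** * Filtration *)

Section ClosedMembership.
Context (R : realType).

(** A closed subspace is a Banach space: the kernel is integrated there and the inclusion commutes
    with the integral. *)
Lemma fint_in (V : completeNormedModType R[i]) (S : linSubspace V) (mu : complexMeasure R) (G : R -> V) :
  in_F 3 mu -> closed [set x | S x] -> (forall xi, S (G xi)) -> fkernel G -> S (fint mu G).
Proof.
move=> h3 cS SG [kG1 kG2].
pose G' xi : csub cS := sub_mk (SG xi).
have nE (x : csub cS) : rnorm x = rnorm (sub_val x) by exact: sub_norm.
have kG' : fkernel G'.
  split=> [xi e /kG1 h|]; first by have [dl dl0 hd] := h xi; exists dl => // eta /hd; rewrite nE.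
  by have [c hc] := kG2; exists c => xi; exact: (hc xi).
have bv : bounded_linear 1 (@sub_val R V S : csub cS -> V).
  by apply: rnorm_bounded_linear => // x; rewrite mul1r nE.
have <- : fint mu (@sub_val R V S \o G') = fint mu G by [].
by rewrite (fint_map h3 ler01 bv kG'); exact: sub_valP.
Qed.

Context (A : vonNeumannAlgebra R) (S : linSubspace A).
Hypothesis hS : closed_unital_subalgebra [set x | S x].

Lemma csa_mul u v : S u -> S v -> S (u ** v).
Proof. by case: hS => _ _ _; exact. Qed.

Lemma csa_one : S (vn_one A).
Proof. by case: hS. Qed.

Lemma csa_pow y n : S y -> S (vn_pow y n).
Proof.
move=> Sy; elim: n => [|n ih]; first exact: csa_one.
by rewrite vn_powS; exact: csa_mul.
Qed.

Lemma csa_E xi y : S y -> S (E xi y).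
Proof.
move=> Sy; have [cS _ _ _] := hS; apply: (closed_approx cS) => e e0.
have [N /(_ N (leqnn _)) hN] := exp_tail_to0 (`|xi| * rnorm y) e0.
exists (vn_horner (taylor_exp N xi) y).
  by apply: subspace_sum => k _; apply: subspaceZ; exact: csa_pow.
by rewrite rnormB; apply: le_trans (E_approx _ _ _) hN.
Qed.

Lemma csa_dom y : selfadjoint y -> S y -> dom S y.
Proof. by move=> sy Sy; split => // xi; exact: csa_E. Qed.

Lemma csa_fop (mu : complexMeasure R) y : in_F 3 mu -> dom S y -> S (fop mu y).
Proof.
move=> h3 [sy Sy]; have [cS _ _ _] := hS; apply: fint_in => //; exact: E_fkernel.
Qed.

End ClosedMembership.

Section FiltrationTheory.
Context (R : realType) (A : vonNeumannAlgebra R) (X : R -> A).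

Lemma alg_csa t : closed_unital_subalgebra [set x | alg X t x].
Proof.
split.
- rewrite (_ : [set x | _] = alg_set X t)//; apply: closed_bigI => B [[cB _ _ _] _]; exact: cB.
- by move=> B [[_ h _ _] _].
- by move=> c a b; exact: subspace_lin.
- move=> a b ha hb; change (alg_set X t (a ** b)) => B hB; case: (hB) => -[_ _ _ h] _.
  by apply: h; [exact: ha|exact: hb].
Qed.

Lemma alg_closed t : closed [set x | alg X t x].
Proof. by case: (alg_csa t). Qed.

Lemma alg_mul t u v : alg X t u -> alg X t v -> alg X t (u ** v).
Proof. exact: csa_mul (alg_csa t) u v. Qed.

Lemma alg_X s t : 0 <= s -> s <= t -> alg X t (X s).
Proof.
move=> s0 st; change (alg_set X t (X s)) => B [_ h]; apply: h; exists s => //=.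
by rewrite in_itv /= s0.
Qed.

Lemma alg_min t (B : set A) : closed_unital_subalgebra B -> (forall s, 0 <= s -> s <= t -> B (X s)) ->
  forall x, alg X t x -> B x.
Proof.
move=> cB hB x h; apply: h; split => // y [s]; rewrite /= in_itv /= => /andP[s0 st] <-.
exact: hB.
Qed.

Lemma alg_mono s t x : s <= t -> alg X s x -> alg X t x.
Proof.
move=> st; apply: (@alg_min s [set x | alg X t x] (alg_csa t)) => r r0 rs.
by apply: alg_X => //; exact: le_trans st.
Qed.

(** The elements whose adjoint lies in the algebra form a closed unital subalgebra containing the
    self-adjoint generators. *)
Lemma alg_star T t x : (forall s, 0 <= s -> s <= T -> selfadjoint (X s)) -> t <= T ->
  alg X t x -> alg X t (vn_star x).
Proof.
move=> hX tT; apply: (@alg_min t [set x | alg X t (vn_star x)]) => [|s s0 st]; last first.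
  by rewrite /= (hX s s0 (le_trans st tT)); exact: alg_X.
split.
- rewrite (_ : [set x | _] = @vn_star R A @^-1` [set x | alg X t x])//.
  apply: closed_comp; last exact: alg_closed.
  move=> z _; have c : continuous (@vn_star R A).
    by apply: (@lipschitz_continuous _ _ _ _ 1) => u v; rewrite mul1r -starB rnorm_star.
  exact: c.
- by rewrite /= star1; case: (alg_csa t).
- move=> c a b ha hb; change (alg X t (vn_star (c *: a + b))); rewrite starD starZ.
  exact: (subspace_lin _ ha hb).
- move=> a b ha hb; change (alg X t (vn_star (a ** b))); rewrite starM.
  exact: (alg_mul hb ha).
Qed.

End FiltrationTheory.

(** * Lipschitz estimates *)

Section LipschitzCalculus.
Context (R : realType).
Implicit Types (V W : completeNormedModType R[i]) (k l : R).

(** The part of [good] without second differences. Composition with a perturbation Z of the identity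
    leads from [good] to [lipb], since only first differences of Z are controlled. *)
Record lipb V W (D : V -> Prop) (F : V -> W) k l : Prop := Lipb {
  lipb_k : 0 <= k;
  lipb_l : 0 <= l;
  lipb_norm : forall y, D y -> rnorm (F y) <= k;
  lipb_lip : forall y z, D y -> D z -> rnorm (F y - F z) <= k * (l * rnorm (y - z)) }.

Lemma good_lipb V W (D : V -> Prop) (F : V -> W) k l : good D F k l -> lipb D F k l.
Proof. by case. Qed.

Section Operations.
Context (V : completeNormedModType R[i]) (D : V -> Prop).

Lemma lipb_mono W (F : V -> W) k l k' l' : lipb D F k l -> k <= k' -> l <= l' -> lipb D F k' l'.
Proof.
move=> [k0 l0 h1 h2] kk ll; split.
- exact: le_trans kk.
- exact: le_trans ll.
- by move=> y /h1 /le_trans; apply.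
- move=> y z hy hz; apply: le_trans (h2 _ _ hy hz) _.
  by apply: ler_pM => //; rewrite ?mulr_ge0 ?rnorm_ge0 ?ler_wpM2r ?rnorm_ge0.
Qed.

Lemma lipb_ext W (F G : V -> W) k l : lipb D F k l -> (forall y, D y -> G y = F y) -> lipb D G k l.
Proof.
move=> [k0 l0 h1 h2] e; split=> // [y hy|y z hy hz]; first by rewrite (e _ hy); exact: h1.
by rewrite (e _ hy) (e _ hz); exact: h2.
Qed.

Lemma lipb_add W (F G : V -> W) k k' l : lipb D F k l -> lipb D G k' l ->
  lipb D (fun y => F y + G y) (k + k') l.
Proof.
move=> [k0 l0 h1 h2] [k0' _ h1' h2']; split; rewrite ?addr_ge0//.
- by move=> y hy; apply: le_trans (rnormD _ _) _; apply: lerD; [exact: h1|exact: h1'].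
- move=> y z hy hz; have -> : F y + G y - (F z + G z) = (F y - F z) + (G y - G z) by zmod.
  by rewrite mulrDl; apply: le_trans (rnormD _ _) _; apply: lerD; [exact: h2|exact: h2'].
Qed.

Lemma lipb_cst W (c : W) : lipb D (fun=> c) (rnorm c) 0.
Proof. exact: good_lipb (good_cst D c). Qed.

Lemma lipb_sum W n (F : 'I_n -> V -> W) k l : 0 <= k -> 0 <= l ->
  (forall i, lipb D (F i) k l) -> lipb D (fun y => \sum_i F i y) (n%:R * k) l.
Proof.
move=> k0 l0 h.
have {}h (r : seq 'I_n) : lipb D (fun y => \sum_(i <- r) F i y) ((size r)%:R * k) l.
  elim: r => [|i r ih].
    rewrite mul0r (_ : (fun y => _) = (fun=> 0)); last by apply/funext => y; rewrite big_nil.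
    by apply: lipb_mono (lipb_cst 0) _ _; rewrite ?rnorm0.
  rewrite (_ : (fun y => _) = (fun y => F i y + \sum_(j <- r) F j y)).
    by rewrite /= -natr1 mulrDl mul1r addrC; exact: lipb_add.
  by apply/funext => y; rewrite big_cons.
have e : size (index_enum 'I_n) = n.
  by rewrite /index_enum; case: index_enum_key => /=; rewrite -enumT size_enum_ord.
by have := h (index_enum 'I_n); rewrite e.
Qed.

Lemma lipb_map W W' (L : W -> W') (M : R) (F : V -> W) k l :
  (forall u v, L (u + v) = L u + L v) -> 0 <= M -> (forall u, rnorm (L u) <= M * rnorm u) ->
  lipb D F k l -> lipb D (fun y => L (F y)) (M * k) l.
Proof.
move=> hD M0 hM [k0 l0 h1 h2]; split => //=; first by rewrite mulr_ge0.
- by move=> y hy; apply: le_trans (hM _) _; rewrite ler_wpM2l ?h1.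
- by move=> y z hy hz; rewrite -additiveB//; apply: le_trans (hM _) _; rewrite -mulrA ler_wpM2l ?h2.
Qed.

Lemma lipb_bilinear W1 W2 W (b : W1 -> W2 -> W) (F : V -> W1) (G : V -> W2) k l k' l' :
  (forall x y z, b (x - y) z = b x z - b y z) ->
  (forall x y z, b z (x - y) = b z x - b z y) ->
  (forall x y, rnorm (b x y) <= 1 * (rnorm x * rnorm y)) ->
  lipb D F k l -> lipb D G k' l' -> lipb D (fun y => b (F y) (G y)) (k * k') (l + l').
Proof.
move=> bl br bM [k0 l0 h1 h2] [k0' l0' h1' h2'].
have bP x y (u v : R) : rnorm x <= u -> rnorm y <= v -> rnorm (b x y) <= u * v.
  move=> hu hv; apply: le_trans (bM _ _) _; rewrite mul1r.
  by apply: ler_pM; rewrite ?rnorm_ge0.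
split; rewrite ?addr_ge0 ?mulr_ge0//.
- by move=> y hy; apply: bP; [exact: h1|exact: h1'].
- move=> y z hy hz.
  have -> : b (F y) (G y) - b (F z) (G z) = b (F y - F z) (G y) + b (F z) (G y - G z).
    by rewrite bl br; zmod.
  apply: le_trans (rnormD _ _) _; apply: le_trans (lerD
     (bP _ _ _ _ (h2 _ _ hy hz) (h1' _ hy)) (bP _ _ _ _ (h1 _ hz) (h2' _ _ hy hz))) _.
  by apply: eq_ler; ring.
Qed.

Context (D' : V -> Prop) (Z : V -> V) (del l0 : R).
Hypothesis ZD : forall y, D y -> D' (Z y).
Hypothesis DD : forall y, D y -> D' y.
Hypothesis hZ : lipb D (fun y => Z y - y) del l0.

Definition lipZ : R := 1 + del * l0.

Lemma lipZ_ge1 : 1 <= lipZ.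
Proof. by rewrite lerDl mulr_ge0 ?(lipb_k hZ) ?(lipb_l hZ). Qed.

Lemma Z_lip y z : D y -> D z -> rnorm (Z y - Z z) <= lipZ * rnorm (y - z).
Proof.
move=> hy hz; have -> : Z y - Z z = (y - z) + ((Z y - y) - (Z z - z)) by zmod.
rewrite mulrDl mul1r; apply: le_trans (rnormD _ _) _; rewrite lerD2l -mulrA.
exact: lipb_lip hZ _ _ hy hz.
Qed.

Lemma lipb_comp W (F : V -> W) k l : lipb D' F k l -> lipb D (fun y => F (Z y)) k (l * lipZ).
Proof.
move=> [k0 l00 h1 h2]; split => //; first by rewrite mulr_ge0// (le_trans ler01 lipZ_ge1).
  by move=> y /ZD; exact: h1.
move=> y z hy hz; apply: le_trans (h2 _ _ (ZD hy) (ZD hz)) _.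
by rewrite -mulrA !ler_wpM2l// Z_lip.
Qed.

(** One order of smoothness is traded for smallness: the Lipschitz bound on F(Z y) - F(y) is a
    second difference of F over (Z y, y, Z z, z), and its constant carries the size [del] of Z y -
    y. *)
Lemma lipb_diff W (F : V -> W) k l : good D' F k l ->
  lipb D (fun y => F (Z y) - F y) (k * l * del) (l0 + 2%:R * l * (lipZ + 1)).
Proof.
move=> [k0 l00 h1 h2 h4]; have d0 := lipb_k hZ; have l0' := lipb_l hZ; have z1 := lipZ_ge1.
split; first by rewrite !mulr_ge0.
- by rewrite addr_ge0// !mulr_ge0// addr_ge0// (le_trans ler01).
- move=> y hy; apply: le_trans (h2 _ _ (ZD hy) (DD hy)) _; rewrite -mulrA !ler_wpM2l//.
  exact: lipb_norm hZ _ hy.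
- move=> y z hy hz; apply: le_trans (h4 _ _ _ _ (ZD hy) (DD hy) (ZD hz) (DD hz)) _.
  apply: (@le_trans _ _ (k * (l * (del * (l0 * rnorm (y - z))) +
      l ^+ 2 * ((del + del) * (lipZ * rnorm (y - z) + rnorm (y - z)))))); last by apply: eq_ler; ring.
  apply: ler_wpM2l => //; apply: lerD; apply: ler_wpM2l => //; [exact: lipb_lip hZ _ _ hy hz|exact: exprn_ge0|].
  rewrite /quad; apply: ler_pM; rewrite ?addr_ge0 ?rnorm_ge0//.
    by apply: lerD; exact: lipb_norm hZ _ _.
  by rewrite lerD2r; exact: Z_lip.
Qed.

End Operations.

Lemma lipb_taylor (A : vonNeumannAlgebra R) (mu : complexMeasure R) (h3 : in_F 3 mu)
   (S : linSubspace A) (T : ptensor2 S) (D : A -> Prop) (Z : A -> A) (del l0 : R) :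
  (forall y, D y -> dom S y) -> (forall y, D y -> selfadjoint (Z y)) ->
  lipb D (fun y => Z y - y) del l0 ->
  lipb D (fun y => taylor mu T y (Z y)) (moment mu * del ^+ 2) (2%:R + lipZ del l0 + 2%:R * l0).
Proof.
move=> Dd Dz hZ; have d0 := lipb_k hZ; have l00 := lipb_l hZ; have m0 := moment_ge0 mu.
have z1 := lipZ_ge1 hZ; have z0 := le_trans ler01 z1.
split.
- by rewrite mulr_ge0// exprn_ge0.
- by rewrite !addr_ge0// mulr_ge0.
- move=> y hy; apply: le_trans (taylor_norm h3 T (Dd _ hy) (Dz _ hy)) _.
  rewrite ler_wpM2l// lerXn2r ?nnegrE ?rnorm_ge0//; exact: lipb_norm hZ _ hy.
- move=> y z hy hz; apply: le_trans (taylor_dist h3 T (Dd _ hy) (Dz _ hy) (Dd _ hz) (Dz _ hz)) _.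
  rewrite -mulrA ler_wpM2l//.
  have n1 := lipb_norm hZ hy; have n2 := lipb_norm hZ hz; have l1 := lipb_lip hZ hy hz.
  have l2 := Z_lip hZ hy hz.
  have r0 := rnorm_ge0 (y - z); set r := rnorm (y - z) in l1 l2 r0 *.
  have p1 := rnorm_ge0 (Z y - y); have p2 := rnorm_ge0 (Z z - z); have p3 := rnorm_ge0 (Z y - Z z).
  have p4 := rnorm_ge0 (Z y - y - (Z z - z)).
  rewrite [leRHS](_ : _ = r * del ^+ 2 + del * ((lipZ del l0 * r) * del + del * r) + (del * (l0 * r)) * (del + del)).
    apply: lerD; last by apply: ler_pM; rewrite ?addr_ge0// lerD.
    apply: lerD; first by rewrite ler_wpM2l// lerXn2r ?nnegrE.
    apply: ler_pM => //; first by rewrite addr_ge0 ?mulr_ge0.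
    by apply: lerD; [apply: ler_pM|rewrite ler_wpM2r].
  ring.
Qed.

End LipschitzCalculus.

(** * One step of the scheme *)

Section OneStep.
Context (R : realType) (A : vonNeumannAlgebra R).
Context (T2 : forall S : linSubspace A, ptensor2 S).
Context (gam T : R) (X : R -> A) (L : forall s : R, R -> AA T2 X s -> A).
Context (m : nat) (f g : 'I_m -> complexMeasure R) (B : R).

(* All the data are bounded by powers of the single constant [B], which will be
   affine in the norms of [X] and of the area. *)
Record setting : Prop := Setting {
  st_B : 52%:R <= B;
  st_eta : (eta (3%:R * gam))^-1 <= B;
  st_gam : 3^-1 < gam;
  st_T : 0 < T;
  st_TB : T <= B;
  st_TgB : T `^ gam <= B;
  st_m : m%:R <= B;
  st_f : forall i, in_F 3 (f i) /\ moment (f i) <= B;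
  st_fg : exists sg : 'I_m -> 'I_m, involutive sg /\ forall i, g i = cm_star (f (sg i));
  st_X : forall t, 0 <= t -> t <= T -> selfadjoint (X t);
  st_Xh : forall s t, 0 <= s -> s <= t -> t <= T -> rnorm (delta1 X s t) <= B * (t - s) `^ gam;
  st_lin : forall s t, 0 <= s -> s < t -> t <= T ->
    forall (c : R[i]) U V, L t (c *: U + V) = c *: L t U + L (s := s) t V;
  st_adapt : forall s t, 0 <= s -> s < t -> t <= T -> forall U : AA T2 X s, alg X t (L t U);
  st_Lnorm : forall s t, 0 <= s -> s < t -> t <= T -> forall U : AA T2 X s,
    rnorm (L t U) <= B * (t - s) `^ (2%:R * gam) * rnorm U;
  st_delta : forall s u t, 0 <= s -> s < u -> u < t -> t <= T ->
    forall V : AA T2 X s, L t V - L u V - L t (incl2 (AA T2 X u) V) =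
      sharp2 V (delta1 X s u) ** delta1 X u t }.

Hypothesis ST : setting.
Implicit Types (s t u : R) (y z : A) (mu : complexMeasure R).
Local Notation AA := (AA T2 X).

Let B1 : 1 <= B.
Proof. by apply: le_trans (st_B ST); rewrite ler1n. Qed.

Let B0 : 0 <= B. Proof. exact: le_trans ler01 B1. Qed.

Let BX k n : (k <= n)%N -> B ^+ k <= B ^+ n.
Proof. by move=> kn; exact: ler_weXn2l. Qed.

Let BX0 k : 0 <= B ^+ k. Proof. exact: exprn_ge0. Qed.

Let BX1 k : 1 <= B ^+ k. Proof. by rewrite -[leLHS](expr0 B); exact: BX. Qed.

Let gam0 : 0 < gam.
Proof. by apply: lt_trans (st_gam ST); rewrite invr_gt0. Qed.

Definition omega s t : R := (t - s) `^ gam.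

Lemma omega_ge0 s t : 0 <= omega s t. Proof. exact: powR_ge0. Qed.

Lemma omega_le s t s' t' : s' <= s -> s <= t -> t <= t' -> omega s t <= omega s' t'.
Proof.
move=> ss st tt; apply: ge0_ler_powR; rewrite ?nnegrE ?subr_ge0 ?(ltW gam0)//.
  by rewrite (le_trans ss)// (le_trans st).
exact: lerB.
Qed.

Lemma omega_leB s t : 0 <= s -> s <= t -> t <= T -> omega s t <= B.
Proof.
by move=> s0 st tT; apply: le_trans (omega_le s0 st tT) _; rewrite /omega subr0; exact: st_TgB ST.
Qed.

Lemma omegaX s t n : s <= t -> (t - s) `^ (n%:R * gam) = omega s t ^+ n.
Proof. by move=> st; rewrite mulrC powRrM powR_mulrn// powR_ge0. Qed.

Lemma alg_starT t (x : A) : t <= T -> alg X t x -> alg X t (vn_star x).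
Proof. exact: alg_star (st_X ST). Qed.

Lemma st_g i : in_F 3 (g i) /\ moment (g i) <= B.
Proof.
have [sg [_ ->]] := st_fg ST; have [h1 h2] := st_f ST (sg i).
by split; [exact: in_F_star|rewrite moment_star].
Qed.

Definition inF mu := in_F 3 mu /\ moment mu <= B.

Definition DS s y : Prop := selfadjoint y /\ alg X s y.

Lemma DS_dom s y : DS s y -> dom (alg X s) y.
Proof. by move=> [sy ay]; apply: csa_dom => //; exact: alg_csa. Qed.

Lemma DS_mono s t y : s <= t -> DS s y -> DS t y.
Proof. by move=> st [sy ay]; split => //; exact: alg_mono ay. Qed.

Lemma DS_fop mu s y : inF mu -> DS s y -> alg X s (fop mu y).
Proof. by move=> [h3 _] /DS_dom d; apply: csa_fop => //; exact: alg_csa. Qed.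

(* [Wf] and [Pf] are the derivative Y^X and the products d f(Y) . Y^X of a
   solution, as functions of the value y of Y, and [germM] is the germ of the
   i-th integral. *)
Definition Wf s y : AA s := \sum_i tens2 (AA s) (fop (f i) y) (fop (g i) y).

Definition Pf s mu y : AA s := mul2 (deriv2 (AA s) mu y) (Wf s y).

Definition germM i s t y : A := fop (f i) y ** delta1 X s t ** fop (g i) y +
  L t (Pf s (f i) y) ** fop (g i) y + fop (f i) y ** op_star (L (s := s) t) (Pf s (g i) y).

Lemma good_fopB mu s : inF mu -> good (DS s) (fop mu) B 1.
Proof.
move=> [h3 hB]; apply: (good_mono (good_sub (good_fop A h3) _) hB (lexx _)) => y [sy _].
exact: sy.
Qed.

Let big_le n (k : R) : n%:R <= B -> 0 <= k -> n%:R * k <= B * k.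
Proof. by move=> h k0; apply: ler_wpM2r. Qed.

(** Stated for an arbitrary tensor square so as to serve both A_s (x) A_s and the full A (x) A. *)
Lemma good_tens (S : linSubspace A) (E : ptensor2 S) (D : A -> Prop) :
  (forall y, D y -> selfadjoint y) -> (forall i y, D y -> S (fop (f i) y) /\ S (fop (g i) y)) ->
  good D (fun y => \sum_i tens2 E (fop (f i) y) (fop (g i) y)) (B ^+ 3) 2%:R.
Proof.
move=> Dsa DSfg.
have gf mu : inF mu -> good D (fop mu) B 1.
  by move=> [h3 hB]; exact: good_mono (good_sub (good_fop A h3) Dsa) hB (lexx _).
have h i : good D (fun y => tens2 E (fop (f i) y) (fop (g i) y)) (B ^+ 2) 2%:R.
  have bT := tens2_bilinear E.
  have := good_bilinear_on (S1 := S) (S2 := S) (b := tens2 E) (M := 1)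
    (fun x y z hx hy hz => bilinearBl bT hx hy hz) (fun x y z hz hx hy => bilinearBr bT hx hy hz) ler01
    (fun x y hx hy => le_trans (tens2_rnorm E hx hy) (eq_ler (esym (mul1r _))))
    (fun y Dy => (DSfg i y Dy).1) (fun y Dy => (DSfg i y Dy).2)
    (gf _ (st_f ST i)) (gf _ (st_g i)).
  by rewrite mul1r -expr2 (_ : 1 + 1 = 2%:R) //; ring.
apply: good_mono (good_sum (index_enum 'I_m) (ler0n R 2) h) _ (lexx _).
by rewrite sumr_const card_ord -[_ *+ m]mulr_natl (exprS B 2); apply: big_le (st_m ST) (BX0 _).
Qed.

Lemma good_Wf s : good (DS s) (Wf s) (B ^+ 3) 2%:R.
Proof.
apply: good_tens => [y []//|i y dy].
by split; [exact: DS_fop (st_f ST i) dy|exact: DS_fop (st_g i) dy].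
Qed.

Lemma good_Pf s mu : inF mu -> good (DS s) (Pf s mu) (B ^+ 4) 3%:R.
Proof.
move=> [h3 hB]; have gd := good_sub (good_deriv2 (AA s) h3) (@DS_dom s).
have am := @alg_mul _ _ X s.
have := good_bilinear (@mul2Bl _ _ _ (AA s) am) (@mul2Br _ _ _ (AA s) am) ler01 (@mul2_norm _ _ _ (AA s) am)
   (good_mono gd hB (lexx _)) (good_Wf s).
by rewrite mul1r -exprS (_ : 1 + 2%:R = 3%:R) //; ring.
Qed.

Lemma area_bounded_linear s t : 0 <= s -> s < t -> t <= T ->
  bounded_linear (B * omega s t ^+ 2) (L (s := s) t).
Proof.
move=> s0 st tT; have h := st_lin ST s0 st tT; apply: rnorm_bounded_linear; first exact: h.
by move=> U; rewrite -(omegaX 2 (ltW st)); exact: (st_Lnorm ST s0 st tT U).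
Qed.

Lemma area_const_ge0 s t : 0 <= B * omega s t ^+ 2.
Proof. by rewrite mulr_ge0// exprn_ge0// omega_ge0. Qed.

Lemma op_star_bounded_linear s t : 0 <= s -> s < t -> t <= T ->
  bounded_linear (B * omega s t ^+ 2) (op_star (L (s := s) t)).
Proof.
move=> s0 st tT; have bL := area_bounded_linear s0 st tT.
have sT : s <= T by rewrite ltW// (lt_le_trans st).
have [_ d1 d2 d3] := star2P (AA s) (fun x => @alg_starT s x sT).
apply: rnorm_bounded_linear => [c x y|x]; rewrite /op_star.
  by rewrite d1 d2 (bounded_linearD bL) (bounded_linearZ bL) starD starZ conjcK.
rewrite rnorm_star; apply: le_trans (bounded_linear_rnorm bL _) _.
by apply: ler_wpM2l; [exact: area_const_ge0|exact: d3].
Qed.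

Lemma delta1_star s t : 0 <= s -> s <= t -> t <= T -> vn_star (delta1 X s t) = delta1 X s t.
Proof.
move=> s0 st tT; rewrite /delta1 starB (st_X ST (le_trans s0 st) tT).
by rewrite (st_X ST s0 (le_trans st tT)).
Qed.

(** The adjoint of the algebraic relation satisfied by the area: the factors appear in the opposite
    order. *)
Lemma op_star_delta s u t (V : AA s) : 0 <= s -> s < u -> u < t -> t <= T ->
  op_star (L (s := s) t) V - op_star (L (s := s) u) V - op_star (L (s := u) t) (incl2 (AA u) V) =
  delta1 X u t ** sharp2 V (delta1 X s u).
Proof.
move=> s0 su ut tT; have uT := ltW (lt_le_trans ut tT); have sT := le_trans (ltW su) uT.
have as_ := fun x => @alg_starT s x sT; have au := fun x => @alg_starT u x uT.
have inc := fun x => @alg_mono _ _ X s u x (ltW su).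
rewrite /op_star (star2_incl (AA u) inc V as_ au) -!starB (st_delta ST s0 su ut tT).
rewrite starM star_sharp2// star2K// !delta1_star//; first exact: ltW.
by rewrite (le_trans s0)// ltW.
by rewrite ltW.
Qed.

Lemma Wf_incl s u y : s <= u -> DS s y -> incl2 (AA u) (Wf s y) = Wf u y.
Proof.
move=> su dy; have inc := fun x => @alg_mono _ _ X s u x su.
have iD := incl2D (AA u) inc (T := AA s).
rewrite /Wf (big_morph _ iD (additive0 iD)); apply: eq_bigr => i _.
by rewrite incl2_tens//; apply: DS_fop => //; [exact: st_f ST i|exact: st_g].
Qed.

Lemma Pf_incl mu s u y : inF mu -> s <= u -> DS s y -> incl2 (AA u) (Pf s mu y) = Pf u mu y.
Proof.
move=> [h3 _] su dy; have inc := fun x => @alg_mono _ _ X s u x su.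
rewrite /Pf (incl2_mul (AA u) inc _ _ (@alg_mul _ _ X s) (@alg_mul _ _ X u)) Wf_incl//.
have [bl tl] := incl2P (AA s) (AA u) inc; congr (mul2 _ _).
by apply: (deriv2_map h3 ler01 bl tl); apply: DS_dom => //; exact: DS_mono dy.
Qed.

Lemma good_germM i s t : 0 <= s -> s < t -> t <= T -> good (DS s) (germM i s t) (B ^+ 8 * omega s t) 4%:R.
Proof.
move=> s0 st tT; have w0 := omega_ge0 s t; have wB := omega_leB s0 (ltW st) tT.
have gp := good_fopB s (st_f ST i); have gq := good_fopB s (st_g i).
have gP := good_Pf s (st_f ST i); have gQ := good_Pf s (st_g i).
have bL := area_bounded_linear s0 st tT; have bS := op_star_bounded_linear s0 st tT.
have c0 := area_const_ge0 s t.
have gLP := good_map (bounded_linearD bL) c0 (bounded_linear_rnorm bL) gP.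
have gLQ := good_map (bounded_linearD bS) c0 (bounded_linear_rnorm bS) gQ.
have mb (x y : A) : rnorm (x ** y) <= 1 * (rnorm x * rnorm y) by rewrite mul1r; exact: rnormM.
have mul := fun F G k l k' l' => @good_bilinear R A (DS s) A A A (@vn_mul R A) F G 1 k l k' l'
  (@vmulBl R A) (fun x y z => @vmulBr R A z x y) ler01 mb.
have t1 := mul _ _ _ _ _ _ (mul _ _ _ _ _ _ gp (good_cst (DS s) (delta1 X s t))) gq.
have t2 := mul _ _ _ _ _ _ gLP gq; have t3 := mul _ _ _ _ _ _ gp gLQ.
have w2 : B * omega s t ^+ 2 * B ^+ 4 * B <= B ^+ 7 * omega s t.
  have -> : B * omega s t ^+ 2 * B ^+ 4 * B = B ^+ 6 * omega s t * omega s t by ring.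
  have := ler_wpM2l (mulr_ge0 (BX0 6) w0) wB; move/le_trans; apply; apply: eq_ler; ring.
have t1' : good (DS s) (fun y => fop (f i) y ** delta1 X s t ** fop (g i) y) (B ^+ 7 * omega s t) 4%:R.
  apply: good_mono t1 _ _; last by lra.
  rewrite !mul1r; apply: (@le_trans _ _ (B * (B * omega s t) * B)).
    have hx := st_Xh ST s0 (ltW st) tT.
    by rewrite ler_wpM2r// ler_wpM2l.
  have -> : B * (B * omega s t) * B = B ^+ 3 * omega s t by ring.
  by rewrite ler_wpM2r// BX.
have t2' : good (DS s) (fun y => L t (Pf s (f i) y) ** fop (g i) y) (B ^+ 7 * omega s t) 4%:R.
  by apply: good_mono t2 _ _; [rewrite mul1r|lra].
have t3' : good (DS s) (fun y => fop (f i) y ** op_star (L (s := s) t) (Pf s (g i) y)) (B ^+ 7 * omega s t) 4%:R.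
  by apply: good_mono t3 _ _; [rewrite mul1r mulrC|lra].
apply: good_mono (good_add (good_add t1' t2') t3') _ (lexx _).
have -> : B ^+ 8 * omega s t = B * (B ^+ 7 * omega s t) by rewrite mulrA -exprS.
have : 0 <= B ^+ 7 * omega s t by rewrite mulr_ge0.
have := st_B ST; move: (B ^+ 7 * _) => x hB x0; nra.
Qed.

(** The cancellation behind the exponent 3 gam. The hypotheses are the relations for the area and
    its adjoint; they remove the first order parts px and qx, and each remaining term has total
    order three in the increments. *)
Lemma delta_germ_identity (p q p' q' x1 x2 px qx lsu lut lut' lst rsu rut rut' rst : A) :
  lst - lsu - lut = px ** x2 -> rst - rsu - rut = x2 ** qx ->
  (p ** x1 ** q + lsu ** q + p ** rsu) + (p' ** x2 ** q' + lut' ** q' + p' ** rut') -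
  (p ** (x1 + x2) ** q + lst ** q + p ** rst) =
  ((p' - p - px) ** x2 ** q + p ** x2 ** (q' - q - qx) + (p' - p) ** x2 ** (q' - q)) +
  ((lut' - lut) ** q' + lut ** (q' - q) + (p' ** (rut' - rut) + (p' - p) ** rut)).
Proof.
move=> hl hr.
have -> : lst = lsu + lut + px ** x2 by rewrite -hl; zmod.
have -> : rst = rsu + rut + x2 ** qx by rewrite -hr; zmod.
rewrite !(vmulDl, vmulDr, vmulNl, vmulNr, vmulA); zmod.
Qed.

Section Increment.
Variables (s u t : R) (D : A -> Prop) (Z : A -> A).
Hypotheses (s0 : 0 <= s) (su : s < u) (ut : u < t) (tT : t <= T).
Hypothesis DDS : forall y, D y -> DS s y.
Hypothesis ZDS : forall y, D y -> DS u (Z y).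
Hypothesis hZ : lipb D (fun y => Z y - y) (B ^+ 9 * omega s u) B.
Hypothesis hZ2 : lipb D (fun y => Z y - y - sharp2 (Wf s y) (delta1 X s u)) (B ^+ 9 * omega s u ^+ 2) B.

Let a := omega s u.
Let b := omega u t.
Let a0 : 0 <= a. Proof. exact: omega_ge0. Qed.
Let b0 : 0 <= b. Proof. exact: omega_ge0. Qed.
Let uT : u <= T. Proof. exact: ltW (lt_le_trans ut tT). Qed.
Let sT : s <= T. Proof. exact: le_trans (ltW su) uT. Qed.
Let u0 : 0 <= u. Proof. exact: le_trans s0 (ltW su). Qed.
Let aB : a <= B. Proof. exact: omega_leB s0 (ltW su) uT. Qed.
Let bB : b <= B. Proof. exact: omega_leB u0 (ltW ut) tT. Qed.

Let x1 := delta1 X s u.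
Let x2 := delta1 X u t.

Let x2_norm : rnorm x2 <= B * b.
Proof. exact: (st_Xh ST u0 (ltW ut) tT). Qed.

Let DDu y : D y -> DS u y.
Proof. by move=> /DDS; apply: DS_mono; exact: ltW. Qed.

Let lz := lipZ (B ^+ 9 * a) B.

Let lz_le : lz <= B ^+ 12.
Proof.
rewrite /lz /lipZ; apply: (@le_trans _ _ (1 + B ^+ 11)).
  rewrite lerD2l; have -> : B ^+ 11 = B ^+ 9 * B * B by rewrite -!exprSr.
  by rewrite ler_wpM2r// ler_wpM2l.
have := BX1 11; rewrite (exprS B 11); have := st_B ST; move: (B ^+ 11) => p hp p1; nra.
Qed.

Let lz_ge1 : 1 <= lz. Proof. exact: lipZ_ge1 hZ. Qed.

Let mulb (F G : A -> A) k l k' l' : lipb D F k l -> lipb D G k' l' ->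
  lipb D (fun y => F y ** G y) (k * k') (l + l').
Proof.
have mb (x y : A) : rnorm (x ** y) <= 1 * (rnorm x * rnorm y) by rewrite mul1r; exact: rnormM.
exact: (@lipb_bilinear R A D A A A (@vn_mul R A) F G k l k' l' (@vmulBl R A) (fun x y z => @vmulBr R A z x y) mb).
Qed.

Let lip_fop mu : inF mu -> lipb D (fop mu) B 1.
Proof. by move=> h; apply: good_lipb; apply: (good_sub (good_fopB s h)) => y; exact: DDS. Qed.

Let lip_fopZ mu : inF mu -> lipb D (fun y => fop mu (Z y)) B (B ^+ 12).
Proof.
move=> h; have := lipb_comp (D' := DS u) ZDS hZ (good_lipb (good_fopB u h)).
by move=> h'; apply: lipb_mono h' _ _; rewrite ?mul1r.
Qed.

Let diff_l (l : R) : l <= 3%:R -> 0 <= l -> B + 2%:R * l * (lz + 1) <= B ^+ 13.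
Proof.
move=> l3 l0; apply: (@le_trans _ _ (B ^+ 12 + 2%:R * 3%:R * (B ^+ 12 + B ^+ 12))).
  apply: lerD; first by rewrite -{1}[B]expr1 BX.
  apply: ler_pM.
  - exact: mulr_ge0.
  - by apply: addr_ge0 => //; exact: le_trans ler01 lz_ge1.
  - exact: ler_wpM2l.
  - by apply: lerD; [exact: lz_le|exact: BX1].
have := BX0 12; rewrite (exprS B 12); have := st_B ST; move: (B ^+ 12) => x hB x1'; nra.
Qed.

Let lip_diff mu : inF mu -> lipb D (fun y => fop mu (Z y) - fop mu y) (B ^+ 10 * a) (B ^+ 13).
Proof.
move=> h; have h' := lipb_diff (D' := DS u) ZDS DDu hZ (good_fopB u h).
apply: lipb_mono h' _ _; first by rewrite mulr1 mulrA -exprS.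
by apply: diff_l; rewrite ?ler1n.
Qed.

Let lip_diffP mu : inF mu -> lipb D (fun y => Pf u mu (Z y) - Pf u mu y) (B ^+ 14 * a) (B ^+ 13).
Proof.
move=> h; have h' := lipb_diff (D' := DS u) ZDS DDu hZ (good_Pf u h).
apply: lipb_mono h' _ _; last exact: diff_l.
have -> : B ^+ 4 * 3%:R * (B ^+ 9 * a) = 3%:R * (B ^+ 13 * a) by ring.
have -> : B ^+ 14 * a = B * (B ^+ 13 * a) by ring.
by apply: ler_wpM2r; [rewrite mulr_ge0|apply: le_trans (st_B ST); rewrite ler_nat].
Qed.

Let lip_rem mu : inF mu -> lipb D (fun y => fop mu (Z y) - fop mu y - sharp2 (Pf s mu y) x1)
  (B ^+ 20 * a ^+ 2) (B ^+ 13).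
Proof.
move=> hmu; have [h3 hB] := hmu.
have Dd y : D y -> dom (alg X s) y by move=> /DDS; exact: DS_dom.
have Dz y : D y -> selfadjoint (Z y) by move=> /ZDS[].
have t1 := lipb_taylor h3 (AA s) Dd Dz hZ.
have gd := good_lipb (good_sub (good_deriv2 (AA s) h3) Dd).
have sb (x : AA s) y z : sharp2 x (y - z) = sharp2 x y - sharp2 x z by exact: sharp2Br.
have t2 := lipb_bilinear (@sharp2Bl _ _ _ (AA s)) (fun y z x => sb x y z) (@sharp2_norm _ _ _ (AA s)) gd hZ2.
have t1' : lipb D (fun y => taylor mu (AA s) y (Z y)) (B ^+ 19 * a ^+ 2) (B ^+ 13).
  apply: lipb_mono t1 _ _.
    rewrite exprMn mulrA ler_wpM2r ?exprn_ge0//.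
    by rewrite -exprM (exprS B 18) ler_wpM2r.
  rewrite -/lz; apply: (@le_trans _ _ (B ^+ 12 + B ^+ 12 + 2%:R * B ^+ 12)).
    apply: lerD; first apply: lerD => //.
      by apply: le_trans (BX (isT : (1 <= 12)%N)); rewrite expr1; apply: le_trans (st_B ST); rewrite ler_nat.
    by rewrite ler_wpM2l// -{1}[B]expr1 BX.
  have := BX0 12; rewrite (exprS B 12); have := st_B ST; move: (B ^+ 12) => x hB' x1'; nra.
have t2' : lipb D (fun y => sharp2 (deriv2 (AA s) mu y) (Z y - y - sharp2 (Wf s y) x1)) (B ^+ 19 * a ^+ 2) (B ^+ 13).
  apply: lipb_mono t2 _ _.
    rewrite mulrA ler_wpM2r ?exprn_ge0//; apply: (@le_trans _ _ (B * B ^+ 9)); first by rewrite ler_wpM2r.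
    by rewrite -exprS BX.
  apply: (@le_trans _ _ (B + B)); first by rewrite lerD2r.
  have := BX (isT : (2 <= 13)%N); rewrite expr2; have := st_B ST; have := B1; nra.
(* The increment of f splits into a Taylor remainder, quadratic in Z y - y, and the derivative
   applied to the part of Z y - y not explained by the increment of X. *)
have -> : (fun y => fop mu (Z y) - fop mu y - sharp2 (Pf s mu y) x1) =
    (fun y => taylor mu (AA s) y (Z y) + sharp2 (deriv2 (AA s) mu y) (Z y - y - sharp2 (Wf s y) x1)).
  apply/funext => y; rewrite /taylor (sb _ (Z y - y) (sharp2 (Wf s y) x1)) /Pf (sharp2_mul (@alg_mul _ _ X s)).
  set p := fop mu (Z y); set q := fop mu y; set s1 := sharp2 _ (Z y - y); set s2 := sharp2 _ (sharp2 _ _).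
  zmod.
apply: lipb_mono (lipb_add t1' t2') _ (lexx _).
rewrite -mulrDl ler_wpM2r ?exprn_ge0// (exprS B 19).
have := BX0 19; have := st_B ST; move: (B ^+ 19) => p; nra.
Qed.

Let lip_x2 : lipb D (fun=> x2) (B * b) 0.
Proof. exact: lipb_mono (lipb_cst D x2) x2_norm (lexx _). Qed.

Let area_lip (F : A -> AA u) k l : lipb D F k l ->
  lipb D (fun y => L t (F y)) (B * b ^+ 2 * k) l /\
  lipb D (fun y => op_star (L (s := u) t) (F y)) (B * b ^+ 2 * k) l.
Proof.
move=> hF; have bL := area_bounded_linear u0 ut tT; have bS := op_star_bounded_linear u0 ut tT.
have c0 := area_const_ge0 u t; split.
  exact: lipb_map (bounded_linearD bL) c0 (bounded_linear_rnorm bL) hF.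
exact: lipb_map (bounded_linearD bS) c0 (bounded_linear_rnorm bS) hF.
Qed.

Let k1 := B ^+ 22 * (a ^+ 2 * b).
Let k2 := B ^+ 22 * (a * b ^+ 2).

Let ab2 n : (n <= 22)%N -> B ^+ n * (a * b ^+ 2) <= k2.
Proof. by move=> h; apply: ler_wpM2r; [rewrite mulr_ge0// exprn_ge0|exact: BX]. Qed.

Let a2b n : (n <= 22)%N -> B ^+ n * (a ^+ 2 * b) <= k1.
Proof. by move=> h; apply: ler_wpM2r; [rewrite mulr_ge0// exprn_ge0|exact: BX]. Qed.

Let l_le n (l : R) : (n <= 14)%N -> l <= 4%:R * B ^+ n -> l <= B ^+ 16.
Proof.
move=> h /le_trans; apply; apply: (@le_trans _ _ (B * B ^+ n)).
  by apply: ler_wpM2r => //; apply: le_trans (st_B ST); rewrite ler_nat.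
by rewrite -exprS; apply: BX; apply: leq_trans (leq_ltn_trans h (ltnSn _)) _.
Qed.

Let B13 := BX1 13.

(** D and Z are kept general for two uses: Z = the flow from s to u on all of [DS], which makes mu
    an almost flow, and Z constant on a single point, which controls the germs along a given
    path. *)
Lemma lip_germ_increment i : lipb D (fun y => germM i s u y + germM i u t (Z y) - germM i s t y)
  (B ^+ 24 * (a ^+ 2 * b + a * b ^+ 2)) (B ^+ 16).
Proof.
have hf : inF (f i) := st_f ST i; have hg : inF (g i) := st_g i.
have su' := ltW su.
pose d1 y := (fop (f i) (Z y) - fop (f i) y - sharp2 (Pf s (f i) y) x1) ** x2 ** fop (g i) y.
pose d2 y := fop (f i) y ** x2 ** (fop (g i) (Z y) - fop (g i) y - sharp2 (Pf s (g i) y) x1).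
pose d3 y := (fop (f i) (Z y) - fop (f i) y) ** x2 ** (fop (g i) (Z y) - fop (g i) y).
pose d4 y := L t (Pf u (f i) (Z y) - Pf u (f i) y) ** fop (g i) (Z y).
pose d5 y := L t (Pf u (f i) y) ** (fop (g i) (Z y) - fop (g i) y).
pose d6 y := fop (f i) (Z y) ** op_star (L (s := u) t) (Pf u (g i) (Z y) - Pf u (g i) y).
pose d7 y := (fop (f i) (Z y) - fop (f i) y) ** op_star (L (s := u) t) (Pf u (g i) y).
have e y : D y -> germM i s u y + germM i u t (Z y) - germM i s t y =
    (d1 y + d2 y + d3 y) + ((d4 y + d5 y) + (d6 y + d7 y)).
  move=> Dy; rewrite /germM.
  have -> : delta1 X s t = x1 + x2 by rewrite /x1 /x2 /delta1; zmod.
  have bL := area_bounded_linear u0 ut tT; have bS := op_star_bounded_linear u0 ut tT.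
  have iP mu : inF mu -> incl2 (AA u) (Pf s mu y) = Pf u mu y by move=> h; apply: Pf_incl => //; exact: DDS.
  have hl := st_delta ST s0 su ut tT (Pf s (f i) y); rewrite iP// in hl.
  have hr := op_star_delta (Pf s (g i) y) s0 su ut tT; rewrite iP// in hr.
  rewrite (delta_germ_identity _ _ _ _ _ _ _ hl hr) /d4 /d6.
  by rewrite (additiveB (bounded_linearD bL)) (additiveB (bounded_linearD bS)) addrA.
have gP mu : inF mu -> lipb D (Pf u mu) (B ^+ 4) 3%:R.
  by move=> h; apply: good_lipb; apply: good_sub (good_Pf u h) _ => y; exact: DDu.
have r1 : lipb D d1 k1 (B ^+ 16).
  apply: lipb_mono (mulb (mulb (lip_rem hf) lip_x2) (lip_fop hg)) _ _.
    by apply: le_trans (a2b (leqnn _)); apply: eq_ler; ring.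
  by apply: (@l_le 13) => //; move: B13; set x := B ^+ 13; lra.
have r2 : lipb D d2 k1 (B ^+ 16).
  apply: lipb_mono (mulb (mulb (lip_fop hf) lip_x2) (lip_rem hg)) _ _.
    by apply: le_trans (a2b (leqnn _)); apply: eq_ler; ring.
  by apply: (@l_le 13) => //; move: B13; set x := B ^+ 13; lra.
have r3 : lipb D d3 k1 (B ^+ 16).
  apply: lipb_mono (mulb (mulb (lip_diff hf) lip_x2) (lip_diff hg)) _ _.
    by apply: le_trans (a2b (isT : (21 <= 22)%N)); apply: eq_ler; ring.
  by apply: (@l_le 13) => //; move: B13; set x := B ^+ 13; lra.
have r4 : lipb D d4 k2 (B ^+ 16).
  have [h _] := area_lip (lip_diffP hf).
  apply: lipb_mono (mulb h (lip_fopZ hg)) _ _.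
    by apply: le_trans (ab2 (isT : (16 <= 22)%N)); apply: eq_ler; ring.
  apply: (@l_le 13) => //; have := BX (isT : (12 <= 13)%N); move: B13; set x := B ^+ 13; lra.
have r5 : lipb D d5 k2 (B ^+ 16).
  have [h _] := area_lip (gP _ hf).
  apply: lipb_mono (mulb h (lip_diff hg)) _ _.
    by apply: le_trans (ab2 (isT : (15 <= 22)%N)); apply: eq_ler; ring.
  by apply: (@l_le 13) => //; move: B13; set x := B ^+ 13; lra.
have r6 : lipb D d6 k2 (B ^+ 16).
  have [_ h] := area_lip (lip_diffP hg).
  apply: lipb_mono (mulb (lip_fopZ hf) h) _ _.
    by apply: le_trans (ab2 (isT : (16 <= 22)%N)); apply: eq_ler; ring.
  apply: (@l_le 13) => //; have := BX (isT : (12 <= 13)%N); move: B13; set x := B ^+ 13; lra.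
have r7 : lipb D d7 k2 (B ^+ 16).
  have [_ h] := area_lip (gP _ hg).
  apply: lipb_mono (mulb (lip_diff hf) h) _ _.
    by apply: le_trans (ab2 (isT : (15 <= 22)%N)); apply: eq_ler; ring.
  by apply: (@l_le 13) => //; move: B13; set x := B ^+ 13; lra.
have r := lipb_add (lipb_add (lipb_add r1 r2) r3) (lipb_add (lipb_add r4 r5) (lipb_add r6 r7)).
have k10 : 0 <= k1 by rewrite /k1 mulr_ge0// mulr_ge0// exprn_ge0.
have k20 : 0 <= k2 by rewrite /k2 mulr_ge0// mulr_ge0// exprn_ge0.
have r' := lipb_mono (k' := B ^+ 24 * (a ^+ 2 * b + a * b ^+ 2)) r _ (lexx _).
have kk : k1 + k1 + k1 + (k2 + k2 + (k2 + k2)) <= B ^+ 24 * (a ^+ 2 * b + a * b ^+ 2).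
  have -> : B ^+ 24 * (a ^+ 2 * b + a * b ^+ 2) = B ^+ 2 * (k1 + k2) by rewrite /k1 /k2; ring.
  have : 4%:R <= B ^+ 2 by apply: le_trans (BX (isT : (1 <= 2)%N)); rewrite expr1; apply: le_trans (st_B ST); rewrite ler_nat.
  move: k10 k20; move: k1 k2 (B ^+ 2) => x y z x0 y0 z4.
  have : 4%:R * (x + y) <= z * (x + y) by apply: ler_wpM2r => //; exact: addr_ge0.
  lra.
exact: lipb_ext (r' kk) e.
Qed.

End Increment.

End OneStep.

(** * Hoelder spaces *)

Section HoelderSpaces.
Context (R : realType) (V : completeNormedModType R[i]) (T gam : R).
Hypothesis gam0 : 0 < gam.
Implicit Types (K : R) (s t u : R).

Lemma powR_small K e : 0 <= K -> 0 < e -> exists2 d, 0 < d & forall x, 0 <= x -> x <= d -> K * x `^ gam <= e.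
Proof.
move=> K0 e0; have K1 : 0 < K + 1 by rewrite ltr_wpDl.
have e1 : 0 < e / (K + 1) by rewrite divr_gt0.
exists ((e / (K + 1)) `^ gam^-1); first exact: powR_gt0.
move=> x x0 xd; have : x `^ gam <= e / (K + 1).
  have -> : e / (K + 1) = ((e / (K + 1)) `^ gam^-1) `^ gam.
    by rewrite -powRrM mulVf ?gt_eqF// powRr1// ltW.
  by apply: ge0_ler_powR; rewrite ?nnegrE ?(ltW gam0) ?powR_ge0.
rewrite ler_pdivlMr// => h; apply: le_trans h; rewrite mulrC ler_wpM2l ?powR_ge0//.
by rewrite lerDl.
Qed.

Lemma within_continuous_rnorm (U : normedModType R) (D : set U) (F : U -> V) :
  (forall x, D x -> forall e, 0 < e -> exists2 d, 0 < d &
    forall y, D y -> `|x - y| <= d -> rnorm (F x - F y) <= e) ->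
  {within D, continuous F}.
Proof.
move=> h; apply/subspace_continuousP => x Dx; apply/cvgrPdist_le => e' /lecR_gt0[e e0 ->].
have [d d0 hd] := h x Dx e e0; rewrite /within /=; apply/nbhs_ballP; exists d => //= y.
rewrite -ball_normE /= => /ltW xy Dy; rewrite rnorm_lecP; exact: hd.
Qed.

Lemma holder_C1 (g : R -> V) K : 0 <= K ->
  (forall s t, 0 <= s -> s <= t -> t <= T -> rnorm (g t - g s) <= K * (t - s) `^ gam) ->
  C1 T gam g /\ (N1 T gam g <= K%:E)%E.
Proof.
move=> K0 h; have b : (N1 T gam g <= K%:E)%E.
  apply: ge_ereal_sup => _ [s [t [s0 st tT ->]]]; rewrite lee_fin ler_pdivrMr ?powR_gt0 ?subr_gt0//.
  by apply: h => //; exact: ltW.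
split=> //; split; last by apply: le_lt_trans b _; rewrite ltry.
apply: (@within_continuous_rnorm R^o) => x; rewrite /= in_itv /= => /andP[x0 xT] e e0.
have [d d0 hd] := powR_small K0 e0; exists d => // y; rewrite in_itv /= => /andP[y0 yT] xy.
have [yx|/ltW yx] := leP y x.
  by apply: le_trans (h _ _ y0 yx xT) _; apply: hd; rewrite ?subr_ge0// (le_trans (ler_norm _)).
by rewrite rnormB; apply: le_trans (h _ _ x0 yx yT) _; apply: hd; rewrite ?subr_ge0// (le_trans (ler_norm _))// distrC.
Qed.

Lemma N1_0_le (g : R -> V) K : (forall s, 0 <= s -> s <= T -> rnorm (g s) <= K) -> (N1_0 T g <= K%:E)%E.
Proof. by move=> h; apply: ge_ereal_sup => _ [s [s0 sT ->]]; rewrite lee_fin; exact: h. Qed.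

Lemma N2_le al (h : R -> R -> V) K :
  (forall s t, 0 <= s -> s < t -> t <= T -> rnorm (h s t) <= K * (t - s) `^ al) -> (N2 T al h <= K%:E)%E.
Proof.
move=> hh; apply: ge_ereal_sup => _ [s [t [s0 st tT ->]]].
by rewrite lee_fin ler_pdivrMr ?powR_gt0 ?subr_gt0//; exact: hh.
Qed.

Lemma N1_bound (g : R -> V) s t : (N1 T gam g < +oo)%E -> 0 <= s -> s <= t -> t <= T ->
  rnorm (g t - g s) <= fine (N1 T gam g) * (t - s) `^ gam.
Proof.
move=> fin s0; rewrite le_eqVlt => /orP[/eqP -> _|st tT].
  by rewrite subrr rnorm0 subrr powR0 ?gt_eqF// mulr0.
have h : ((rnorm (g t - g s) / (t - s) `^ gam)%:E <= N1 T gam g)%E.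
  by apply: ereal_sup_ubound; exists s, t.
have N0 : (0 <= N1 T gam g)%E by apply: le_trans h; rewrite lee_fin divr_ge0 ?rnorm_ge0 ?powR_ge0.
rewrite -ler_pdivrMr ?powR_gt0 ?subr_gt0// -lee_fin fineK//.
by rewrite ge0_fin_numE.
Qed.

Lemma N2_bound al (h : R -> R -> V) s t : (N2 T al h < +oo)%E -> 0 <= s -> s < t -> t <= T ->
  rnorm (h s t) <= fine (N2 T al h) * (t - s) `^ al.
Proof.
move=> fin s0 st tT.
have hh : ((rnorm (h s t) / (t - s) `^ al)%:E <= N2 T al h)%E.
  by apply: ereal_sup_ubound; exists s, t.
have N0 : (0 <= N2 T al h)%E by apply: le_trans hh; rewrite lee_fin divr_ge0 ?rnorm_ge0 ?powR_ge0.
rewrite -ler_pdivrMr ?powR_gt0 ?subr_gt0// -lee_fin fineK//.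
by rewrite ge0_fin_numE.
Qed.

(* Joint continuity on the simplex comes for free from bounds on the increments
   delta2, whatever the regularity of [h] in each variable. *)
Lemma C2_continuous (h : R -> R -> V) K : 0 <= K ->
  (forall s, 0 <= s -> s <= T -> h s s = 0) ->
  (forall s t, 0 <= s -> s < t -> t <= T -> rnorm (h s t) <= K * (t - s) `^ gam) ->
  (forall s u t, 0 <= s -> s < u -> u < t -> t <= T -> rnorm (delta2 h s u t) <= K * (u - s) `^ gam) ->
  (forall s u t, 0 <= s -> s < u -> u < t -> t <= T -> rnorm (delta2 h s u t) <= K * (t - u) `^ gam) ->
  {within simplex2 T, continuous (fun p : R * R => h p.1 p.2)}.
Proof.
move=> K0 hd hn h1 h2.
have right s t t' : 0 <= s -> s <= t -> t <= t' -> t' <= T -> rnorm (h s t' - h s t) <= 2%:R * K * (t' - t) `^ gam.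
  move=> s0; rewrite le_eqVlt => /orP[/eqP <-|st]; rewrite le_eqVlt => /orP[/eqP <-|tt] tT.
  - by rewrite subrr rnorm0 mulr_ge0 ?powR_ge0// mulr_ge0.
  - rewrite (hd s)//; last by rewrite (le_trans (ltW tt)).
    rewrite subr0; apply: le_trans (hn _ _ s0 tt tT) _; apply: ler_wpM2r; first exact: powR_ge0.
    by rewrite mulr_natl mulr2n lerDl.
  - by rewrite subrr rnorm0 mulr_ge0 ?powR_ge0// mulr_ge0.
  have -> : h s t' - h s t = h t t' + delta2 h s t t' by rewrite /delta2; zmod.
  apply: le_trans (rnormD _ _) _; have := h2 _ _ _ s0 st tt tT.
  have := hn _ _ (le_trans s0 (ltW st)) tt tT; move: (_ `^ gam) => x; nra.
have left s s' t : 0 <= s -> s <= s' -> s' <= t -> t <= T -> rnorm (h s t - h s' t) <= 2%:R * K * (s' - s) `^ gam.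
  move=> s0; rewrite le_eqVlt => /orP[/eqP <-|st]; rewrite le_eqVlt => /orP[/eqP <-|tt] tT.
  - by rewrite subrr rnorm0 mulr_ge0 ?powR_ge0// mulr_ge0.
  - by rewrite subrr rnorm0 mulr_ge0 ?powR_ge0// mulr_ge0.
  - rewrite (hd s')//; last by rewrite (le_trans s0)// ltW.
    rewrite subr0; apply: le_trans (hn _ _ s0 st tT) _; apply: ler_wpM2r; first exact: powR_ge0.
    by rewrite mulr_natl mulr2n lerDl.
  have -> : h s t - h s' t = h s s' + delta2 h s s' t by rewrite /delta2; zmod.
  apply: le_trans (rnormD _ _) _; have := h1 _ _ _ s0 st tt tT.
  have := hn _ _ s0 st (le_trans (ltW tt) tT); move: (_ `^ gam) => x; nra.
apply: within_continuous_rnorm => -[s0 t0] [/= s00 st0 tT0] e e0.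
have e4 : 0 < e / 4%:R by rewrite divr_gt0.
have K2 : 0 <= 2%:R * K by rewrite mulr_ge0.
have [d d0 hd'] := powR_small K2 e4.
exists d => // -[s t] [/= s_0 st tT]; rewrite prod_normE /= ge_max => /andP[ds dt].
have small x y : x <= y -> `|x - y| <= d -> 2%:R * K * (y - x) `^ gam <= e / 4%:R.
  by move=> xy; rewrite distrC ger0_norm ?subr_ge0// => q; apply: hd'; rewrite ?subr_ge0.
have small' x y : x <= y -> `|y - x| <= d -> 2%:R * K * (y - x) `^ gam <= e / 4%:R.
  by move=> xy; rewrite distrC; exact: small.
have same : 2%:R * K * 0 `^ gam <= e / 4%:R by apply: hd'; rewrite ?lexx// ltW.
pose s1 := Num.min s s0; pose t1 := Num.max t t0.
have s1s : s1 <= s by rewrite ge_min lexx.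
have s1s0 : s1 <= s0 by rewrite ge_min lexx orbT.
have tt1 : t <= t1 by rewrite le_max lexx.
have t0t1 : t0 <= t1 by rewrite le_max lexx orbT.
have s10 : 0 <= s1 by rewrite le_min s_0.
have t1T : t1 <= T by rewrite ge_max tT.
have b1 : 2%:R * K * (s - s1) `^ gam <= e / 4%:R.
  by rewrite /s1; case: (leP s s0) => ss; rewrite ?subrr//; apply: small; [exact: ltW|].
have b2 : 2%:R * K * (s0 - s1) `^ gam <= e / 4%:R.
  by rewrite /s1; case: (leP s s0) => ss; rewrite ?subrr//; exact: small'.
have b3 : 2%:R * K * (t1 - t) `^ gam <= e / 4%:R.
  by rewrite /t1; case: (leP t t0) => ss; rewrite ?subrr//; exact: small'.
have b4 : 2%:R * K * (t1 - t0) `^ gam <= e / 4%:R.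
  by rewrite /t1; case: (leP t t0) => ss; rewrite ?subrr//; apply: small; [exact: ltW|].
have q1 := le_trans (left _ _ _ s10 s1s st tT) b1.
have q2 := le_trans (left _ _ _ s10 s1s0 st0 tT0) b2.
have q3 := le_trans (right _ _ _ s10 (le_trans s1s st) tt1 t1T) b3.
have q4 := le_trans (right _ _ _ s10 (le_trans s1s0 st0) t0t1 t1T) b4.
have -> : h s0 t0 - h s t = - (h s1 t0 - h s0 t0) - (h s1 t1 - h s1 t0) + (h s1 t1 - h s1 t) + (h s1 t - h s t) by zmod.
apply: le_trans (rnormD _ _) _; apply: le_trans (lerD (rnormD _ _) (lexx _)) _.
apply: le_trans (lerD (lerD (rnormDB _ _) (lexx _)) (lexx _)) _; rewrite rnormN; lra.
Qed.

Section LinearFlow.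
Variables (h : R -> R -> V) (C th : R).
Hypotheses (C0 : 0 <= C) (th1 : 1 < th).
Hypothesis h_same : forall s, h s s = 0.
Hypothesis h_delta : forall s u t, 0 <= s -> s < u -> u < t -> t <= T ->
  rnorm (delta2 h s u t) <= C * (t - s) `^ th.

(** Additive sewing as a special case: translations have vanishing second differences, so the cubic
    bound on delta2 is the only requirement. *)
Lemma linear_flow : almost_flow (fun _ _ => True) (fun s t y => y + h s t) T C gam th.
Proof.
have Cp x : 0 <= C * x `^ th by rewrite mulr_ge0 ?powR_ge0.
split => //.
- by move=> s y; rewrite h_same addr0.
- move=> s t y z _ _ _ _ _; rewrite (_ : _ - _ - _ = 0); last by zmod.
  by rewrite rnorm0 !mulr_ge0 ?powR_ge0 ?rnorm_ge0.
- move=> s t a b c d _ _ _ _ _ _ _; rewrite (_ : _ - _ - _ = 0); last by zmod.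
  by rewrite rnorm0 !mulr_ge0 ?powR_ge0// addr_ge0 ?rnorm_ge0 ?quad_ge0.
- move=> s u t y s0; rewrite le_eqVlt => /orP[/eqP <-|su]; rewrite le_eqVlt => /orP[/eqP <-|ut] tT _.
  + by rewrite h_same !addr0 subrr rnorm0.
  + by rewrite h_same addr0 subrr rnorm0.
  + by rewrite h_same addr0 subrr rnorm0.
  have -> : y + h s u + h u t - (y + h s t) = - delta2 h s u t by rewrite /delta2; zmod.
  by rewrite rnormN; exact: h_delta.
- move=> s u t y z _ _ _ _ _ _; rewrite (_ : _ - _ - _ = 0); last by zmod.
  by rewrite rnorm0 mulr_ge0 ?rnorm_ge0.
Qed.

End LinearFlow.

End HoelderSpaces.

(** * The almost flow *)

Lemma selfadjoint_closed (R : realType) (A : vonNeumannAlgebra R) : closed [set y : A | selfadjoint y].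
Proof.
rewrite (_ : [set y : A | selfadjoint y] = (fun y : A => vn_star y - y) @^-1` [set 0]); last first.
  by apply/seteqP; split => y /= /eqP; [rewrite -subr_eq0 => /eqP|rewrite subr_eq0 => /eqP].
apply: closed_comp; last by apply: accessible_closed_set1; apply: hausdorff_accessible; exact: norm_hausdorff.
move=> z _; have c : continuous (fun y : A => vn_star y - y); last exact: c.
apply: (@lipschitz_continuous _ _ _ _ 2%:R) => u v.
have -> : vn_star u - u - (vn_star v - v) = vn_star (u - v) - (u - v) by rewrite starB; zmod.
by apply: le_trans (rnormDB _ _) _; rewrite rnorm_star mulr_natl mulr2n.
Qed.

Section RoughFlow.
Context (R : realType) (A : vonNeumannAlgebra R).
Context (T2 : forall S : linSubspace A, ptensor2 S).
Context (gam T : R) (X : R -> A) (L : forall s : R, R -> AA T2 X s -> A).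
Context (m : nat) (f g : 'I_m -> complexMeasure R) (B : R).
Hypothesis ST : setting gam T L f g B.
Implicit Types (s t u : R) (y z : A).
Local Notation AA := (AA T2 X).
Local Notation D_ := (DS X).
Local Notation W_ := (Wf T2 X f g).
Local Notation w_ := (omega gam).

Let B1 : 1 <= B.
Proof. by apply: le_trans (st_B ST); rewrite ler1n. Qed.

Let B0 : 0 <= B. Proof. exact: le_trans ler01 B1. Qed.

Let BX k n : (k <= n)%N -> B ^+ k <= B ^+ n.
Proof. by move=> kn; exact: ler_weXn2l. Qed.

Let BX0 k : 0 <= B ^+ k. Proof. exact: exprn_ge0. Qed.

Let BX1 k : 1 <= B ^+ k. Proof. by rewrite -[leLHS](expr0 B); exact: BX. Qed.

Let gam0 : 0 < gam.
Proof. by apply: lt_trans (st_gam ST); rewrite invr_gt0. Qed.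

Let as_ s : s <= T -> forall x, alg X s x -> alg X s (vn_star x).
Proof. by move=> sT x; apply: (alg_starT ST). Qed.

Let dual mu mu' s y : inF B mu -> s <= T -> D_ s y -> mu' = cm_star mu ->
  [/\ vn_star (fop mu y) = fop mu' y, vn_star (fop mu' y) = fop mu y,
      star2 (deriv2 (AA s) mu y) = deriv2 (AA s) mu' y &
      star2 (deriv2 (AA s) mu' y) = deriv2 (AA s) mu y].
Proof.
move=> [h3 _] sT dy ->; have sy : selfadjoint y by case: dy.
have e := fop_star h3 sy; have e2 := deriv2_star h3 (AA s) (as_ sT) (DS_dom dy).
split; [exact: e | by rewrite -e starK | exact: e2 | rewrite -e2; apply: star2K; exact: as_].
Qed.

(** The involution maps the term of index i to the term of index [sg i]; only the sum is
    invariant. *)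
Lemma Wf_star s y : s <= T -> D_ s y -> star2 (W_ s y) = W_ s y.
Proof.
move=> sT dy; have [sg [sgK gE]] := st_fg ST.
have [st2 sD _ _] := star2P (AA s) (as_ sT).
rewrite /Wf (big_morph _ sD (additive0 sD)) [RHS](reindex_inj (inv_inj sgK)); apply: eq_bigr => i _.
rewrite (st2 _ _ (DS_fop (st_f ST i) dy) (DS_fop (st_g ST i) dy)).
have [e1 e2 _ _] := dual (st_f ST (sg i)) sT dy (gE i).
have [] := dual (st_f ST i) sT dy (_ : g (sg i) = _); first by rewrite gE sgK.
by move=> e3 e4 _ _; rewrite e2 e3.
Qed.

Let star_germ (p x q l ls p' q' l' ls' : A) : vn_star p = q' -> vn_star q = p' -> vn_star x = x ->
  vn_star l = ls' -> vn_star ls = l' ->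
  vn_star (p ** x ** q + l ** q + p ** ls) = p' ** x ** q' + l' ** q' + p' ** ls'.
Proof.
by move=> <- <- e <- <-; rewrite !starD !starM e vmulA -addrA [X in _ + X]addrC addrA.
Qed.

(** A single integral need not be self-adjoint when g lists the adjoints in reverse order; the
    involution permutes the germs by [sg], so that their sum is self-adjoint. *)
Lemma germM_star : exists2 sg : 'I_m -> 'I_m, injective sg & forall i s t y, 0 <= s -> s < t -> t <= T -> D_ s y ->
  vn_star (germM L f g i s t y) = germM L f g (sg i) s t y.
Proof.
have [sg [sgK gE]] := st_fg ST; exists sg; first exact: inv_inj.
move=> i s t y s0 st tT dy; have sT := ltW (lt_le_trans st tT).
have [e1 e2 e3 e4] := dual (st_f ST (sg i)) sT dy (gE i).
have [] := dual (st_f ST i) sT dy (_ : g (sg i) = _); first by rewrite gE sgK.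
move=> f1 f2 f3 f4; have am := @alg_mul _ _ X s; have sW := Wf_star sT dy.
have P1 : star2 (Pf T2 X f g s (g i) y) = Pf T2 X f g s (f (sg i)) y.
  exact: etrans (star2_mul am (as_ sT) _ _) (congr2 (@mul2 _ _ _ (AA s)) e4 sW).
have P2 : star2 (Pf T2 X f g s (g (sg i)) y) = Pf T2 X f g s (f i) y.
  exact: etrans (star2_mul am (as_ sT) _ _) (congr2 (@mul2 _ _ _ (AA s)) f4 sW).
have P3 : L t (Pf T2 X f g s (f i) y) = L t (star2 (Pf T2 X f g s (g (sg i)) y)) by rewrite P2.
apply: star_germ f1 e2 (delta1_star ST s0 (ltW st) tT) _ _; first exact: (congr1 (fun x : A => vn_star x) P3).
exact: etrans (starK _) (congr1 (L (s := s) t) P1).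
Qed.

Lemma germM_alg i s t y : 0 <= s -> s < t -> t <= T -> D_ s y -> alg X t (germM L f g i s t y).
Proof.
move=> s0 st tT dy; have st' := ltW st.
have inc x : alg X s x -> alg X t x by exact: alg_mono.
have ap := inc _ (DS_fop (st_f ST i) dy); have aq := inc _ (DS_fop (st_g ST i) dy).
have aD x z : alg X t x -> alg X t z -> alg X t (x + z).
  by move=> hx hz; rewrite -[x]scale1r; exact: subspace_lin.
have ax : alg X t (delta1 X s t).
  rewrite /delta1 addrC -scaleN1r; apply: subspace_lin; first exact: alg_X.
  by apply: alg_X => //; exact: le_trans st'.
have aL : alg X t (L t (Pf T2 X f g s (f i) y)) by exact: (st_adapt ST).
have aLs : alg X t (op_star (L (s := s) t) (Pf T2 X f g s (g i) y)).
  by apply: (alg_starT ST) => //; exact: (st_adapt ST).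
have mm := @alg_mul _ _ X t.
rewrite /germM; apply: (aD); last exact: mm ap aLs.
by apply: (aD); [exact: mm (mm _ _ ap ax) aq|exact: mm aL aq].
Qed.

Definition step s t y : A := \sum_i germM L f g i s t y.

(** The area is constrained only for s < t, so the value at s = t is imposed. *)
Definition flow s t y : A := if s < t then y + step s t y else y.

Lemma flow_lt s t y : s < t -> flow s t y = y + step s t y.
Proof. by rewrite /flow => ->. Qed.

Lemma flow_same s y : flow s s y = y.
Proof. by rewrite /flow ltxx. Qed.

Lemma step_dom s t y : 0 <= s -> s < t -> t <= T -> D_ s y -> D_ t (y + step s t y).
Proof.
move=> s0 st tT dy; have [sy ay] := dy; have st' := ltW st.
have [sg sgi h] := germM_star; split.
  rewrite /selfadjoint starD sy /step; congr (_ + _).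
  rewrite (big_morph _ (@starD _ A) (additive0 (@starD _ A))) [RHS](reindex_inj sgi).
  by apply: eq_bigr => i _; exact: h.
rewrite -[X in X + _](scale1r y); apply: subspace_lin; first exact: alg_mono ay.
apply: (big_ind (fun x => alg X t x)) => [|x z hx hz|i _]; first exact: subspace0.
  by rewrite -[x]scale1r; exact: subspace_lin.
exact: germM_alg.
Qed.

Lemma flow_dom s t y : 0 <= s -> s <= t -> t <= T -> D_ s y -> D_ t (flow s t y).
Proof.
move=> s0; rewrite le_eqVlt => /orP[/eqP <- _|st tT]; first by rewrite flow_same.
by rewrite flow_lt//; exact: step_dom.
Qed.

Lemma good_step s t : 0 <= s -> s < t -> t <= T -> good (D_ s) (step s t) (B ^+ 9 * w_ s t) 4%:R.
Proof.
move=> s0 st tT; have h i := good_germM ST i s0 st tT.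
apply: good_mono (good_sum (index_enum 'I_m) (ler0n R 4) h) _ (lexx _).
rewrite sumr_const card_ord -[_ *+ m]mulr_natl (exprS B 8) -mulrA.
by apply: ler_wpM2r (st_m ST); rewrite mulr_ge0// omega_ge0.
Qed.

Lemma step_remainder s t y : D_ s y -> step s t y - sharp2 (W_ s y) (delta1 X s t) =
  \sum_i (L t (Pf T2 X f g s (f i) y) ** fop (g i) y +
          fop (f i) y ** op_star (L (s := s) t) (Pf T2 X f g s (g i) y)).
Proof.
move=> dy; have sD (x z : AA s) : sharp2 (x + z) (delta1 X s t) = _ := sharp2Dl x z (delta1 X s t).
rewrite /step /Wf (big_morph (fun x : AA s => sharp2 x (delta1 X s t)) sD (additive0 sD)) -sumrB.
apply: eq_bigr => i _; rewrite (sharp2_tens _ _ (DS_fop (st_f ST i) dy) (DS_fop (st_g ST i) dy)) /germM.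
by set c := fop (f i) y ** _ ** _; set d := _ ** fop (g i) y; set e := fop (f i) y ** _; zmod.
Qed.

Lemma lip_step_remainder s t : 0 <= s -> s < t -> t <= T ->
  lipb (D_ s) (fun y => step s t y - sharp2 (W_ s y) (delta1 X s t)) (B ^+ 9 * w_ s t ^+ 2) B.
Proof.
move=> s0 st tT; have w0 := omega_ge0 gam s t.
have c0 : 0 <= B * w_ s t ^+ 2 by rewrite mulr_ge0// exprn_ge0.
have lf mu : inF B mu -> lipb (D_ s) (fop mu) B 1 by move=> h; exact: good_lipb (good_fopB X s h).
have lP mu : inF B mu -> lipb (D_ s) (Pf T2 X f g s mu) (B ^+ 4) 3%:R by move=> h; exact: good_lipb (good_Pf ST s h).
have bL := area_bounded_linear ST s0 st tT; have bS := op_star_bounded_linear ST s0 st tT.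
have lL mu : inF B mu -> lipb (D_ s) (fun y => L t (Pf T2 X f g s mu y)) (B * w_ s t ^+ 2 * B ^+ 4) 3%:R.
  by move=> h; exact: lipb_map (bounded_linearD bL) c0 (bounded_linear_rnorm bL) (lP _ h).
have lS mu : inF B mu -> lipb (D_ s) (fun y => op_star (L (s := s) t) (Pf T2 X f g s mu y)) (B * w_ s t ^+ 2 * B ^+ 4) 3%:R.
  by move=> h; exact: lipb_map (bounded_linearD bS) c0 (bounded_linear_rnorm bS) (lP _ h).
have mb (x y : A) : rnorm (x ** y) <= 1 * (rnorm x * rnorm y) by rewrite mul1r; exact: rnormM.
have mul F G k l k' l' := @lipb_bilinear R A (D_ s) A A A (@vn_mul R A) F G k l k' l' (@vmulBl R A) (fun x y z => @vmulBr R A z x y) mb.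
pose F i y := L t (Pf T2 X f g s (f i) y) ** fop (g i) y + fop (f i) y ** op_star (L (s := s) t) (Pf T2 X f g s (g i) y).
have hF i : lipb (D_ s) (F i) (B ^+ 8 * w_ s t ^+ 2) B.
  have := lipb_add (lipb_mono (mul _ _ _ _ _ _ (lL _ (st_f ST i)) (lf _ (st_g ST i))) (lexx _) (lexx _))
    (lipb_mono (mul _ _ _ _ _ _ (lf _ (st_f ST i)) (lS _ (st_g ST i))) (lexx _) (eq_ler (addrC _ _))).
  move=> h; apply: lipb_mono h _ _; last by apply: le_trans (st_B ST); rewrite (_ : 3 + 1 = 4%:R) ?ler_nat//; ring.
  have -> : B * w_ s t ^+ 2 * B ^+ 4 * B + B * (B * w_ s t ^+ 2 * B ^+ 4) = 2%:R * (B ^+ 6 * w_ s t ^+ 2) by ring.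
  have -> : B ^+ 8 * w_ s t ^+ 2 = (B * B) * (B ^+ 6 * w_ s t ^+ 2) by ring.
  apply: ler_wpM2r; first by rewrite mulr_ge0// exprn_ge0.
  by have := st_B ST; nra.
have h8 : 0 <= B ^+ 8 * w_ s t ^+ 2 by rewrite mulr_ge0// exprn_ge0.
apply: lipb_ext (lipb_mono (lipb_sum h8 B0 hF) _ (lexx _)) _.
  by rewrite (exprS B 8) -mulrA; apply: ler_wpM2r (st_m ST).
by move=> y dy; exact: step_remainder.
Qed.

Lemma lip_step s t : 0 <= s -> s < t -> t <= T -> lipb (D_ s) (step s t) (B ^+ 9 * w_ s t) B.
Proof.
move=> s0 st tT; apply: lipb_mono (good_lipb (good_step s0 st tT)) (lexx _) _.
by apply: le_trans (st_B ST); rewrite ler_nat.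
Qed.

Lemma lip_flow_defect s u t : 0 <= s -> s < u -> u < t -> t <= T ->
  lipb (D_ s) (fun y => flow u t (flow s u y) - flow s t y)
    (B ^+ 25 * (w_ s u ^+ 2 * w_ u t + w_ s u * w_ u t ^+ 2)) (B ^+ 16).
Proof.
move=> s0 su ut tT; have uT := ltW (lt_le_trans ut tT).
have Zd y : D_ s y -> D_ u (flow s u y) by apply: flow_dom => //; exact: ltW.
have k0 : 0 <= B ^+ 24 * (w_ s u ^+ 2 * w_ u t + w_ s u * w_ u t ^+ 2).
  by rewrite mulr_ge0// addr_ge0// mulr_ge0// ?exprn_ge0// omega_ge0.
have h1 : lipb (D_ s) (fun y => flow s u y - y) (B ^+ 9 * w_ s u) B.
  by apply: lipb_ext (lip_step s0 su uT) _ => y _; rewrite flow_lt// addrC addKr.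
have h2 : lipb (D_ s) (fun y => flow s u y - y - sharp2 (W_ s y) (delta1 X s u)) (B ^+ 9 * w_ s u ^+ 2) B.
  by apply: lipb_ext (lip_step_remainder s0 su uT) _ => y _; rewrite flow_lt// [y + _]addrC addrK.
have h := lipb_sum k0 (BX0 16) (lip_germ_increment ST s0 su ut tT (fun y dy => dy) Zd h1 h2).
apply: lipb_ext (lipb_mono h _ (lexx _)) _.
  by rewrite (exprS B 24) -mulrA; apply: ler_wpM2r (st_m ST).
move=> y dy; rewrite sumrB big_split /= -!/(step _ _ _) (flow_lt _ (lt_trans su ut)) (flow_lt _ ut).
rewrite {1}(flow_lt _ su); zmod.
Qed.

Let cubic_le a b c : 0 <= a -> 0 <= b -> a <= c -> b <= c -> B ^+ 25 * (a ^+ 2 * b + a * b ^+ 2) <= B ^+ 26 * c ^+ 3.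
Proof.
move=> a0 b0 ac bc; have c0 := le_trans a0 ac.
have h : a ^+ 2 * b + a * b ^+ 2 <= 2%:R * c ^+ 3.
  have -> : 2%:R * c ^+ 3 = c ^+ 2 * c + c * c ^+ 2 by ring.
  by apply: lerD; apply: ler_pM; rewrite ?exprn_ge0//; rewrite ler_pXn2r.
apply: le_trans (ler_wpM2l (BX0 25) h) _; rewrite mulrA [B ^+ 26]exprSr.
apply: ler_wpM2r; first exact: exprn_ge0.
by apply: ler_wpM2l => //; apply: le_trans (st_B ST); rewrite ler_nat.
Qed.

Let defect_le s u t : 0 <= s -> s < u -> u < t -> t <= T ->
  B ^+ 25 * (w_ s u ^+ 2 * w_ u t + w_ s u * w_ u t ^+ 2) <= B ^+ 26 * (t - s) `^ (3%:R * gam).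
Proof.
move=> s0 su ut tT; rewrite (omegaX _ _ (ltW (lt_trans su ut))).
by apply: cubic_le; rewrite ?omega_ge0//; apply: (omega_le ST); rewrite ?(ltW su) ?(ltW ut).
Qed.

Lemma flow_almost : almost_flow D_ flow T (B ^+ 42) gam (3%:R * gam).
Proof.
have th1 : 1 < 3%:R * gam.
  by rewrite mulrC -ltr_pdivrMr// mul1r; exact: st_gam ST.
have step_le s t (k : R) n : (n <= 42)%N -> 0 <= k -> B ^+ n * (t - s) `^ gam * k <= B ^+ 42 * (t - s) `^ gam * k.
  by move=> n42 k0; apply: ler_wpM2r => //; apply: ler_wpM2r; [exact: powR_ge0|exact: BX].
have qge0 (a b c d : A) : 0 <= rnorm (a - b - (c - d)) + quad a b c d by rewrite addr_ge0 ?rnorm_ge0 ?quad_ge0.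
have p0 (x y : R) : 0 <= B ^+ 42 * x `^ y by rewrite mulr_ge0 ?powR_ge0.
split => //.
- by move=> s t y _ st _; exact: DS_mono.
- move=> t t0 tT; apply: closedI; last exact: alg_closed.
  exact: selfadjoint_closed.
- by move=> s t y; exact: flow_dom.
- exact: flow_same.
- move=> s t y z s0; rewrite le_eqVlt => /orP[/eqP <-|st] tT dy dz.
    by rewrite !flow_same subrr rnorm0 mulr_ge0 ?rnorm_ge0.
  rewrite !flow_lt// (_ : _ - _ - _ = step s t y - step s t z); last by zmod.
  apply: le_trans (lipb_lip (lip_step s0 st tT) dy dz) _.
  apply: le_trans (step_le s t _ 10 isT (rnorm_ge0 _)); rewrite (exprSr B 9) /omega; apply: eq_ler; ring.
- move=> s t a b c d s0; rewrite le_eqVlt => /orP[/eqP <-|st] tT da db dc dd.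
    by rewrite !flow_same subrr rnorm0 mulr_ge0.
  rewrite !flow_lt// (_ : _ - _ - _ = step s t a - step s t b - (step s t c - step s t d)); last by zmod.
  apply: le_trans (good_four (good_step s0 st tT) da db dc dd) _.
  apply: le_trans (step_le s t _ 10 isT (qge0 a b c d)); rewrite (exprSr B 9) /omega.
  have q0 := quad_ge0 a b c d; have r0 := rnorm_ge0 (a - b - (c - d)).
  move: (quad a b c d) (rnorm _) q0 r0 => q r q0 r0.
  have k0 : 0 <= B ^+ 9 * (t - s) `^ gam by rewrite mulr_ge0 ?powR_ge0.
  rewrite [B ^+ 9 * B * _]mulrAC -[leRHS]mulrA; apply: ler_wpM2l => //.
  have := st_B ST; nra.
- move=> s u t y s0; rewrite le_eqVlt => /orP[/eqP <-|su]; rewrite le_eqVlt => /orP[/eqP <-|ut] tT dy.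
  + by rewrite !flow_same subrr rnorm0.
  + by rewrite !flow_same subrr rnorm0.
  + by rewrite !flow_same subrr rnorm0.
  apply: le_trans (lipb_norm (lip_flow_defect s0 su ut tT) dy) _.
  by apply: le_trans (defect_le s0 su ut tT) _; apply: ler_wpM2r; [exact: powR_ge0|exact: BX].
- move=> s u t y z s0; rewrite le_eqVlt => /orP[/eqP <-|su]; rewrite le_eqVlt => /orP[/eqP <-|ut] tT dy dz.
  + by rewrite !flow_same !subrr rnorm0 mulr_ge0 ?rnorm_ge0.
  + by rewrite !flow_same !subrr rnorm0 mulr_ge0 ?rnorm_ge0.
  + by rewrite !flow_same !subrr rnorm0 mulr_ge0 ?rnorm_ge0.
  apply: le_trans (lipb_lip (lip_flow_defect s0 su ut tT) dy dz) _.
  rewrite mulrA; apply: ler_wpM2r; first exact: rnorm_ge0.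
  apply: le_trans (ler_wpM2r (BX0 16) (defect_le s0 su ut tT)) _.
  by apply: eq_ler; rewrite (exprD B 26 16); ring.
Qed.

End RoughFlow.

(** * Solutions *)

(** Lets the constant of a path replace B, so that one constant bounds the data and the path. *)
Lemma setting_mono (R : realType) (A : vonNeumannAlgebra R)
  (T2 : forall S : linSubspace A, ptensor2 S)
  (gam T : R) (X : R -> A) (L : forall s : R, R -> AA T2 X s -> A)
  (m : nat) (f g : 'I_m -> complexMeasure R) (B B' : R) :
  setting gam T L f g B -> B <= B' -> setting gam T L f g B'.
Proof.
move=> ST BB; have tr x : x <= B -> x <= B' by move=> /le_trans; apply.
have tr2 (x w : R) : 0 <= w -> x <= B * w -> x <= B' * w.
  by move=> w0 /le_trans; apply; exact: ler_wpM2r.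
split; do ?[exact: tr (st_B ST) | exact: tr (st_eta ST) | exact: tr (st_TB ST) | exact: tr (st_TgB ST)
  | exact: tr (st_m ST) | exact: st_gam ST | exact: st_T ST | exact: st_fg ST | exact: st_X ST
  | exact: st_lin ST | exact: st_adapt ST | exact: st_delta ST].
- by move=> i; have [h1 h2] := st_f ST i; split => //; exact: tr.
- by move=> s t s0 st tT; apply: tr2; [exact: powR_ge0|exact: (st_Xh ST s0 st tT)].
- move=> s t s0 st tT U; rewrite -mulrA; apply: tr2; first by rewrite mulr_ge0 ?powR_ge0 ?rnorm_ge0.
  by rewrite mulrA; exact: (st_Lnorm ST s0 st tT U).
Qed.

Section Solution.
Context (R : realType) (A : vonNeumannAlgebra R).
Context (T2 : forall S : linSubspace A, ptensor2 S).
Context (gam T : R) (X : R -> A) (L : forall s : R, R -> AA T2 X s -> A).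
Context (m : nat) (f g : 'I_m -> complexMeasure R) (B : R).
Hypothesis ST : setting gam T L f g B.
Implicit Types (s t u : R) (y z : A).
Local Notation AA := (AA T2 X).
Local Notation D_ := (DS X).
Local Notation W_ := (Wf T2 X f g).
Local Notation w_ := (omega gam).
Local Notation flow := (flow L f g).
Local Notation step := (step L f g).

Let B1 : 1 <= B.
Proof. by apply: le_trans (st_B ST); rewrite ler1n. Qed.

Let B0 : 0 <= B. Proof. exact: le_trans ler01 B1. Qed.

Let BX k n : (k <= n)%N -> B ^+ k <= B ^+ n.
Proof. by move=> kn; exact: ler_weXn2l. Qed.

Let BX0 k : 0 <= B ^+ k. Proof. exact: exprn_ge0. Qed.

Let BX1 k : 1 <= B ^+ k. Proof. by rewrite -[leLHS](expr0 B); exact: BX. Qed.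

Let gam0 : 0 < gam.
Proof. by apply: lt_trans (st_gam ST); rewrite invr_gt0. Qed.

(** Membership in Q_*(X) with derivative W(Y), with one constant for all bounds. *)
Record controlled (K : R) (Y : R -> A) : Prop := Controlled {
  ctl_K : 0 <= K;
  ctl_dom : forall t, 0 <= t -> t <= T -> D_ t (Y t);
  ctl_holder : forall s t, 0 <= s -> s < t -> t <= T -> rnorm (Y t - Y s) <= K * w_ s t;
  ctl_rem : forall s t, 0 <= s -> s < t -> t <= T ->
    rnorm (Y t - Y s - sharp2 (W_ s (Y s)) (delta1 X s t)) <= K * w_ s t ^+ 2 }.

Lemma chain_holder (Y : R -> A) (h K : R) : 0 < h -> 0 <= K ->
  (forall s t, 0 <= s -> s < t -> t <= T -> t - s <= h -> rnorm (Y t - Y s) <= K * w_ s t) ->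
  forall n s t, 0 <= s -> s < t -> t <= T -> t - s <= n.+1%:R * h -> rnorm (Y t - Y s) <= n.+1%:R * K * w_ s t.
Proof.
move=> h0 K0 loc; elim=> [|n ih] s t s0 st tT; first by rewrite !mul1r; exact: loc.
move=> ts; have w0 := omega_ge0 gam s t; have Kw := mulr_ge0 K0 w0.
have [tsh|tsh] := leP (t - s) h.
  apply: le_trans (loc _ _ s0 st tT tsh) _; rewrite -mulrA ler_peMl// ler1n//.
have su : s < s + h by rewrite ltrDl.
have ut : s + h < t by rewrite addrC -ltrBrDr.
have -> : Y t - Y s = (Y t - Y (s + h)) + (Y (s + h) - Y s) by zmod.
apply: le_trans (rnormD _ _) _; rewrite -[n.+2]addn1 natrD 2!mulrDl mul1r; apply: lerD.
  apply: le_trans (ih _ _ _ ut tT _) _.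
  - by rewrite addr_ge0// ltW.
  - by rewrite opprD addrA lerBlDr; apply: le_trans ts _; rewrite -natr1 mulrDl mul1r.
  apply: ler_wpM2l; first by rewrite mulr_ge0.
  exact: (omega_le ST (ltW su) (ltW ut) (lexx t)).
apply: le_trans (loc _ _ s0 su _ _) _; first by rewrite (le_trans (ltW ut)).
  by rewrite addrC addKr.
by apply: ler_wpM2l => //; exact: (omega_le ST (lexx s) (ltW su) (ltW ut)).
Qed.

(* A power of [B], as [3^-1 < gam] turns the exponent [gam^-1] into at most 3. *)
Local Notation h_ := (flow_step (B ^+ 42) gam (3%:R * gam)).

Let eta0 : 0 < eta (3%:R * gam).
Proof. by apply: eta_gt0; rewrite mulrC -ltr_pdivrMr// mul1r; exact: st_gam ST. Qed.

Let flow_step_inv : h_^-1 <= B ^+ 132 /\ (h_ `^ gam)^-1 <= B ^+ 44.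
Proof.
have C0 : 0 < B ^+ 42 by exact: lt_le_trans (BX1 42).
have q0 : 0 < eta (3%:R * gam) / (52%:R * B ^+ 42) by rewrite divr_gt0// mulr_gt0.
have qB : (eta (3%:R * gam) / (52%:R * B ^+ 42))^-1 <= B ^+ 44.
  rewrite invf_div (exprD B 42 2) expr2 mulrAC mulrC; apply: ler_wpM2l; first exact: ltW.
  by apply: ler_pM; rewrite ?invr_ge0 ?(ltW eta0)//; [exact: st_B ST|exact: st_eta ST].
rewrite /flow_step; move: (eta _ / _) q0 qB => q q0 qB.
have h0 : 0 < q `^ gam^-1 by exact: powR_gt0.
split; last by rewrite -powRrM mulVf ?gt_eqF// powRr1// ltW.
have -> : (q `^ gam^-1)^-1 = q^-1 `^ gam^-1.
  apply: (mulfI (lt0r_neq0 h0)); rewrite mulfV ?gt_eqF// -powRM ?invr_ge0 ?(ltW q0)//.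
  by rewrite mulfV ?gt_eqF// powR1.
apply: (@le_trans _ _ ((B ^+ 44) `^ gam^-1)).
  by apply: ge0_ler_powR; rewrite ?nnegrE ?invr_ge0 ?(ltW gam0) ?(ltW q0).
apply: (@le_trans _ _ ((B ^+ 44) `^ 3%:R)).
  apply: ler_powR => //; rewrite -[leRHS]invrK lef_pV2 ?posrE ?invr_gt0//; exact: ltW (st_gam ST).
by rewrite powR_mulrn// -exprM.
Qed.

(** M does not enter the conclusion: [davie_local] gives a bound on intervals of length at most the
    flow step, whose inverse is at most [B ^+ 132], so fewer than [B ^+ 134] intervals cover [0, T]
    and chaining keeps the bound polynomial. *)
Lemma davie_controlled (M : R) (Y : R -> A) : davie D_ flow (3%:R * gam) 0 T M Y -> 0 <= M ->
  controlled (B ^+ 230) Y.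
Proof.
move=> dY M0; have AF := flow_almost ST.
have gth : gam <= 3%:R * gam by rewrite ler_peMl ?ltW// ltr1n.
have [h0 hC hK] := flow_stepP AF (BX1 42) gth.
have [i1 i2] := flow_step_inv.
have loc0 s t : 0 <= s -> s < t -> t <= T -> t - s <= h_ ->
    rnorm (Y t - Y s - step s t (Y s)) <= B ^+ 44 * w_ s t ^+ 3.
  move=> s0 st tT ts; have := davie_local AF h0 hC hK dY M0 s0 (ltW st) tT ts.
  rewrite (flow_lt _ _ _ _ st) (_ : Y t - (Y s + _) = Y t - Y s - step s t (Y s)); last by zmod.
  rewrite (omegaX _ _ (ltW st)) => /le_trans; apply; apply: ler_wpM2r; first by rewrite exprn_ge0// omega_ge0.
  have e := st_eta ST; rewrite (exprD B 42 2) expr2 mulrAC mulrC.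
  apply: ler_wpM2l; first exact: BX0.
  apply: ler_pM; rewrite ?invr_ge0 ?(ltW eta0)//.
  by apply: le_trans (st_B ST); rewrite ler_nat.
have wB s t : 0 <= s -> s < t -> t <= T -> w_ s t <= B by move=> s0 /ltW; exact: (omega_leB ST).
have w0 s t := omega_ge0 gam s t.
have loc s t : 0 <= s -> s < t -> t <= T -> t - s <= h_ -> rnorm (Y t - Y s) <= B ^+ 47 * w_ s t.
  move=> s0 st tT ts; have h1 := loc0 _ _ s0 st tT ts; have dYs := dY.1 s s0 (ltW (lt_le_trans st tT)).
  have h2 := lipb_norm (lip_step ST s0 st tT) dYs.
  have -> : Y t - Y s = (Y t - Y s - step s t (Y s)) + step s t (Y s) by zmod.
  apply: le_trans (rnormD _ _) _; apply: le_trans (lerD h1 h2) _.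
  have h3 : w_ s t ^+ 3 <= B ^+ 2 * w_ s t.
    by rewrite exprSr ler_wpM2r// ler_pXn2r ?nnegrE//; exact: wB.
  apply: le_trans (lerD (ler_wpM2l (BX0 44) h3) (lexx _)) _; rewrite mulrA -exprD -mulrDl ler_wpM2r//.
  have := BX (isT : (9 <= 46)%N); rewrite (exprSr B 46); have := BX0 46; have := st_B ST; nra.
have locr s t : 0 <= s -> s < t -> t <= T -> t - s <= h_ ->
    rnorm (Y t - Y s - sharp2 (W_ s (Y s)) (delta1 X s t)) <= B ^+ 47 * w_ s t ^+ 2.
  move=> s0 st tT ts; have h1 := loc0 _ _ s0 st tT ts; have dYs := dY.1 s s0 (ltW (lt_le_trans st tT)).
  have h2 := lipb_norm (lip_step_remainder ST s0 st tT) dYs.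
  rewrite (_ : _ - _ = (Y t - Y s - step s t (Y s)) +
    (step s t (Y s) - sharp2 (W_ s (Y s)) (delta1 X s t))); last by set c := sharp2 _ _; zmod.
  apply: le_trans (rnormD _ _) _; apply: le_trans (lerD h1 h2) _.
  have h3 : w_ s t ^+ 3 <= B * w_ s t ^+ 2.
    by rewrite exprS ler_wpM2r ?exprn_ge0//; exact: wB.
  apply: le_trans (lerD (ler_wpM2l (BX0 44) h3) (lexx _)) _; rewrite mulrA -exprSr -mulrDl ler_wpM2r ?exprn_ge0//.
  have := BX (isT : (9 <= 46)%N); have := BX (isT : (45 <= 46)%N); rewrite (exprSr B 46); have := BX0 46; have := st_B ST; nra.
pose n := Num.truncn (T / h_).
have Th0 : 0 <= T / h_ by rewrite divr_ge0 ?ltW//; exact: st_T ST.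
have nT : n.+1%:R <= B ^+ 134.
  have : n%:R <= T / h_ by rewrite truncn_le.
  move=> h; rewrite -[n.+1%:R]natr1; apply: (@le_trans _ _ (B * B ^+ 132 + 1)).
    by rewrite lerD2r; apply: le_trans h _; apply: ler_pM => //; rewrite ?invr_ge0 ?(ltW h0) ?(ltW (st_T ST))//; exact: st_TB ST.
  rewrite -exprS (exprS B 133); have := BX1 133; have := st_B ST; nra.
have glob s t : 0 <= s -> s < t -> t <= T -> rnorm (Y t - Y s) <= B ^+ 181 * w_ s t.
  move=> s0 st tT; apply: le_trans (chain_holder h0 (BX0 47) loc (n := n) s0 st tT _) _.
    rewrite -ler_pdivrMr//; apply: ltW; apply: le_lt_trans (truncnS_gt _).
    apply: ler_wpM2r; first by rewrite invr_ge0 ltW.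
    by rewrite lerBlDr (le_trans tT)// lerDl.
  by rewrite ler_wpM2r// (exprD B 134 47) ler_wpM2r.
split; [exact: BX0|exact: dY.1| |].
  by move=> s t s0 st tT; apply: le_trans (glob _ _ s0 st tT) _; rewrite ler_wpM2r// BX.
move=> s t s0 st tT; have [ts|ts] := leP (t - s) h_.
  by apply: le_trans (locr _ _ s0 st tT ts) _; rewrite ler_wpM2r ?exprn_ge0// BX.
have hw : h_ `^ gam <= w_ s t by apply: ge0_ler_powR; rewrite ?nnegrE ?subr_ge0 ?ltW.
have hp : 0 < h_ `^ gam by exact: powR_gt0.
(* The remainder is not chained: over long intervals its terms are of order one, and the lower bound
   on t - s turns one power of the length into two. *)
have ww : w_ s t <= B ^+ 44 * w_ s t ^+ 2.
  rewrite expr2 mulrA ler_peMl//; apply: (@le_trans _ _ ((h_ `^ gam)^-1 * w_ s t)); last exact: ler_wpM2r.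
  by rewrite mulrC ler_pdivlMr// mul1r.
have dYs := dY.1 s s0 (ltW (lt_le_trans st tT)).
apply: le_trans (rnormDB _ _) _.
have h1 := glob _ _ s0 st tT.
have h2 : rnorm (sharp2 (W_ s (Y s)) (delta1 X s t)) <= B ^+ 3 * (B * w_ s t).
  apply: le_trans (sharp2_norm _ _) _; rewrite mul1r; apply: ler_pM; rewrite ?rnorm_ge0//.
    by have h := good_norm (good_Wf ST s) dYs.
  exact: (st_Xh ST s0 (ltW st) tT).
apply: le_trans (lerD h1 h2) _; rewrite mulrA -mulrDl.
apply: (@le_trans _ _ (B ^+ 182 * w_ s t)).
  rewrite ler_wpM2r// -exprSr.
  have := BX (isT : (4 <= 181)%N); rewrite (exprSr B 181); have := BX0 181; have := st_B ST; nra.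
apply: le_trans (ler_wpM2l (BX0 _) ww) _; rewrite mulrA -exprD ler_wpM2r ?exprn_ge0//.
exact: BX.
Qed.

End Solution.

(** * From controlled paths to elements of Q_*(X) *)

Section ControlledPath.
Context (R : realType) (A : vonNeumannAlgebra R).
Context (T2 : forall S : linSubspace A, ptensor2 S) (T3 : forall S : linSubspace A, ptensor3 S).
Context (gam T : R) (X : R -> A) (L : forall s : R, R -> AA T2 X s -> A).
Context (m : nat) (f g : 'I_m -> complexMeasure R) (B : R).
Hypothesis ST : setting gam T L f g B.
Implicit Types (s t u : R) (y z : A).
Local Notation AA := (AA T2 X).
Local Notation D_ := (DS X).
Local Notation W_ := (Wf T2 X f g).
Local Notation w_ := (omega gam).

Let B1 : 1 <= B.
Proof. by apply: le_trans (st_B ST); rewrite ler1n. Qed.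

Let B0 : 0 <= B. Proof. exact: le_trans ler01 B1. Qed.

Let BX k n : (k <= n)%N -> B ^+ k <= B ^+ n.
Proof. by move=> kn; exact: ler_weXn2l. Qed.

Let BX0 k : 0 <= B ^+ k. Proof. exact: exprn_ge0. Qed.

Let gam0 : 0 < gam.
Proof. by apply: lt_trans (st_gam ST); rewrite invr_gt0. Qed.

Lemma Wf_fcalc s y : D_ s y ->
  W_ s y = \sum_(i < m) tens2 (AA s) (fcalc (fourier (f i)) y) (fcalc (fourier (g i)) y).
Proof.
move=> [sy _]; apply: eq_bigr => i _.
by rewrite (fcalc_fourier (st_f ST i).1 sy) (fcalc_fourier (st_g ST i).1 sy).
Qed.

Definition germ_fg (i : 'I_m) (Y : R -> A) (YX : forall t, AA t) : R -> R -> A :=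
  germ (T3 := T3) L
    (fun t => tens2 (AA t) (fcalc (fourier (f i)) (Y t)) (fcalc (fourier (g i)) (Y t)))
    (fun t => tens21 (AAA T3 X t) (mul2 (deriv2 (AA t) (f i) (Y t)) (YX t)) (fcalc (fourier (g i)) (Y t)))
    (fun t => tens12 (AAA T3 X t) (fcalc (fourier (f i)) (Y t)) (mul2 (deriv2 (AA t) (g i) (Y t)) (YX t))).

(** Identifies the germ of the definition, written with chosen extensions and functional calculus,
    with [germM], on which the estimates were made. *)
Lemma germ_fgE i Y YX s t : 0 <= s -> s < t -> t <= T -> D_ s (Y s) -> YX s = W_ s (Y s) ->
  germ_fg i Y YX s t = germM L f g i s t (Y s).
Proof.
move=> s0 st tT dY eY; have [sY _] := dY.
have ap := DS_fop (st_f ST i) dY; have aq := DS_fop (st_g ST i) dY.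
rewrite /germ_fg /germ (fcalc_fourier (st_f ST i).1 sY) (fcalc_fourier (st_g ST i).1 sY) eY.
rewrite (sharp2_tens _ _ ap aq).
have bL := area_bounded_linear ST s0 st tT; have bS := op_star_bounded_linear ST s0 st tT.
have c0 : 0 <= B * w_ s t ^+ 2 by rewrite mulr_ge0// exprn_ge0// omega_ge0.
by rewrite (op_times_id_tens21 _ _ c0 bL aq) (id_times_op_tens12 _ _ c0 bS ap).
Qed.

Section Path.
Variables (K : R) (Y : R -> A).
Hypothesis hY : controlled T2 gam T X f g K Y.

Let K0 : 0 <= K. Proof. exact: ctl_K hY. Qed.

Let YX t : AA t := W_ t (Y t).

Let full := AAfull T2.

(** W(y) seen in A (x) A: it no longer depends on the time, so derivatives at different times can be
    subtracted. *)
Let WF y : full := \sum_i tens2 full (fop (f i) y) (fop (g i) y).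

Let good_WF : good [set y | selfadjoint y] WF (B ^+ 3) 2%:R.
Proof. exact: (good_tens ST). Qed.

Let incl_W s y : D_ s y -> incl2 full (W_ s y) = WF y.
Proof.
move=> dy; have inc x : alg X s x -> full_linSubspace A x by [].
have iD := incl2D full inc (T := AA s).
rewrite /Wf (big_morph _ iD (additive0 iD)); apply: eq_bigr => i _.
by apply: (incl2_tens _ _ inc); [exact: DS_fop (st_f ST i) dy|exact: DS_fop (st_g ST i) dy].
Qed.

Let sharp_W s y x : D_ s y -> sharp2 (W_ s y) x = sharp2 (WF y) x.
Proof.
move=> dy; have inc y' : alg X s y' -> full_linSubspace A y' by [].
by rewrite -(incl_W dy) (sharp2_incl full inc).
Qed.

Let sa t : 0 <= t -> t <= T -> selfadjoint (Y t).
Proof. by move=> t0 tT; case: (ctl_dom hY t0 tT). Qed.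

Let WF_dist s t : 0 <= s -> s < t -> t <= T -> rnorm (WF (Y t) - WF (Y s)) <= 2%:R * B ^+ 3 * K * w_ s t.
Proof.
move=> s0 st tT; have h := good_lip good_WF (sa (le_trans s0 (ltW st)) tT) (sa s0 (ltW (lt_le_trans st tT))).
apply: le_trans h _; rewrite mulrA -[leRHS]mulrA [2%:R * _]mulrC; apply: ler_wpM2l; first by rewrite mulr_ge0.
exact: ctl_holder hY _ _ s0 st tT.
Qed.

Let wB s t : 0 <= s -> s < t -> t <= T -> w_ s t <= B.
Proof. by move=> s0 /ltW; exact: (omega_leB ST). Qed.

Let holder (V : completeNormedModType R[i]) (F : R -> V) (k : R) : 0 <= k ->
  (forall s t, 0 <= s -> s < t -> t <= T -> rnorm (F t - F s) <= k * w_ s t) ->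
  C1 T gam F /\ (N1 T gam F <= k%:E)%E.
Proof.
move=> k0 h; apply: (holder_C1 gam0 k0) => s t s0; rewrite le_eqVlt => /orP[/eqP <- _|st tT].
  by rewrite subrr rnorm0 mulr_ge0// powR_ge0.
exact: h.
Qed.

Let remainder_delta (y1 y2 y3 p q r z : A) : y1 = y2 + y3 -> p = q + r ->
  y1 - p - (y2 - q) - (y3 - z) = z - r.
Proof. by move=> -> ->; zmod. Qed.

Lemma controlled_in_Q : in_Qstar gam T Y YX /\
  (N_Q gam T Y YX <= (K + B ^+ 3 + 2%:R * B ^+ 3 * K + K)%:E)%E.
Proof.
have [cY nY] := holder K0 (ctl_holder hY).
have K3 : 0 <= 2%:R * B ^+ 3 * K by rewrite !mulr_ge0.
have eW t : 0 <= t -> t <= T -> in_full YX t = WF (Y t).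
  by move=> t0 tT; rewrite /in_full incl_W//; exact: ctl_dom hY _ t0 tT.
have [cW nW] : C1 T gam (in_full YX) /\ (N1 T gam (in_full YX) <= (2%:R * B ^+ 3 * K)%:E)%E.
  apply: holder => // s t s0 st tT; rewrite !eW//; first exact: WF_dist.
    exact: ltW (lt_le_trans st tT).
  exact: le_trans s0 (ltW st).
have n0 : (N1_0 T (in_full YX) <= (B ^+ 3)%:E)%E.
  by apply: N1_0_le => s s0 sT; rewrite eW//; have h := good_norm good_WF (sa s0 sT).
have rn s t : 0 <= s -> s < t -> t <= T -> rnorm (remainder Y YX s t) <= K * (t - s) `^ (2%:R * gam).
  by move=> s0 st tT; rewrite (omegaX _ _ (ltW st)); exact: ctl_rem hY _ _ s0 st tT.
have nR := N2_le rn.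
have rd s u t : 0 <= s -> s < u -> u < t -> t <= T ->
    rnorm (delta2 (remainder Y YX) s u t) <= (2%:R * B ^+ 4 * K) * (w_ s u * w_ u t).
  move=> s0 su ut tT; have uT := ltW (lt_le_trans ut tT); have u0 := le_trans s0 (ltW su).
  have dYs := ctl_dom hY s0 (le_trans (ltW su) uT); have dYu := ctl_dom hY u0 uT.
  (* The increments of Y cancel and only the variation of the derivative between s and u remains,
     which gives the bounds needed for joint continuity. *)
  have -> : delta2 (remainder Y YX) s u t = sharp2 (WF (Y u) - WF (Y s)) (delta1 X u t).
    rewrite /delta2 /remainder /YX !sharp_W// sharp2Bl.
    by apply: remainder_delta; [rewrite /delta1; zmod|rewrite -sharp2Dr; congr (sharp2 _ _); rewrite /delta1; zmod].
  apply: le_trans (sharp2_norm _ _) _; rewrite mul1r.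
  have -> : 2%:R * B ^+ 4 * K * (w_ s u * w_ u t) = (2%:R * B ^+ 3 * K * w_ s u) * (B * w_ u t) by ring.
  apply: ler_pM; rewrite ?rnorm_ge0//; first exact: WF_dist.
  exact: (st_Xh ST u0 (ltW ut) tT).
have Kb : 0 <= 2%:R * B ^+ 4 * K by rewrite !mulr_ge0.
pose K' := B * K + B * (2%:R * B ^+ 4 * K).
have K'0 : 0 <= K' by rewrite addr_ge0// mulr_ge0.
have w0 s t := omega_ge0 gam s t.
have cR : C2 T (2 * gam) (remainder Y YX).
  split; last by apply: le_lt_trans nR _; rewrite ltry.
  - apply: (C2_continuous gam0 K'0).
    + by move=> s _ _; rewrite /remainder /delta1 !subrr (sharp2_0 (S := alg X s)) subrr.
    + move=> s t s0 st tT; apply: le_trans (rn _ _ s0 st tT) _; rewrite (omegaX _ _ (ltW st)) expr2 mulrA.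
      rewrite -/(w_ s t); apply: ler_wpM2r => //; rewrite /K'; apply: ler_wpDr; first by rewrite mulr_ge0.
      by rewrite mulrC ler_wpM2r//; exact: wB.
    + move=> s u t s0 su ut tT; apply: le_trans (rd _ _ _ s0 su ut tT) _; rewrite [w_ s u * _]mulrC mulrA.
      apply: ler_wpM2r => //; rewrite /K'; apply: ler_wpDl; first by rewrite mulr_ge0.
      by rewrite mulrC ler_wpM2r//; apply: wB => //; exact: le_trans (ltW su).
    + move=> s u t s0 su ut tT; apply: le_trans (rd _ _ _ s0 su ut tT) _; rewrite mulrA.
      apply: ler_wpM2r => //; rewrite /K'; apply: ler_wpDl; first by rewrite mulr_ge0.
      by rewrite mulrC ler_wpM2r//; apply: wB => //; exact: ltW (lt_le_trans ut tT).
  - by move=> s _ _; rewrite /remainder /delta1 !subrr (sharp2_0 (S := alg X s)) subrr.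
split; last by rewrite /N_Q !EFinD; do !apply: leeD.
split; first by split => // t t0 tT; case: (ctl_dom hY t0 tT).
move=> s s0 sT; have d := ctl_dom hY s0 sT; split; first exact: sa.
exact: (Wf_star ST).
Qed.

End Path.

End ControlledPath.

(** On a single point a Lipschitz bound is a norm bound; this lets Lipschitz lemmas be applied along
    a path. *)
Lemma lipb_point (R : realType) (V W : completeNormedModType R[i]) (a : V) (F : V -> W) (k l : R) :
  0 <= k -> 0 <= l -> rnorm (F a) <= k -> lipb (fun y => y = a) F k l.
Proof.
move=> k0 l0 h; split => // [y -> //|y z -> ->].
by rewrite subrr rnorm0 !mulr_ge0 ?rnorm_ge0.
Qed.

(** * Davie paths and solutions of the equation *)

Section Existence.
Context (R : realType) (A : vonNeumannAlgebra R).
Context (T2 : forall S : linSubspace A, ptensor2 S) (T3 : forall S : linSubspace A, ptensor3 S).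
Context (gam T : R) (X : R -> A) (L : forall s : R, R -> AA T2 X s -> A).
Context (m : nat) (f g : 'I_m -> complexMeasure R) (B : R).
Hypothesis ST : setting gam T L f g B.
Implicit Types (s t u : R) (y z : A).
Local Notation AA := (AA T2 X).
Local Notation D_ := (DS X).
Local Notation W_ := (Wf T2 X f g).
Local Notation w_ := (omega gam).
Local Notation flow := (flow L f g).
Local Notation step := (step L f g).

Let B1 : 1 <= B.
Proof. by apply: le_trans (st_B ST); rewrite ler1n. Qed.

Let B0 : 0 <= B. Proof. exact: le_trans ler01 B1. Qed.

Let gam0 : 0 < gam.
Proof. by apply: lt_trans (st_gam ST); rewrite invr_gt0. Qed.

Let th1 : 1 < 3%:R * gam.
Proof. by rewrite mulrC -ltr_pdivrMr// mul1r; exact: st_gam ST. Qed.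

Let gth : gam <= 3%:R * gam.
Proof. by rewrite ler_peMl ?ltW// ltr1n. Qed.

Let w0 s t : 0 <= w_ s t. Proof. exact: omega_ge0. Qed.

Definition path_germ (Y : R -> A) (i : 'I_m) s t : A := if s < t then germM L f g i s t (Y s) else 0.

Lemma path_germ_same Y i s : path_germ Y i s s = 0.
Proof. by rewrite /path_germ ltxx. Qed.

(** The increment estimate is applied with D = {Y s} and Z constantly Y u: the path need not follow
    the flow exactly, being controlled is enough. *)
Lemma path_germ_delta (K : R) (Y : R -> A) i s u t : controlled T2 gam T X f g K Y -> B <= K ->
  0 <= s -> s < u -> u < t -> t <= T ->
  rnorm (delta2 (path_germ Y i) s u t) <= K ^+ 24 * (w_ s u ^+ 2 * w_ u t + w_ s u * w_ u t ^+ 2).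
Proof.
move=> hY BK s0 su ut tT; have uT := ltW (lt_le_trans ut tT); have sT := le_trans (ltW su) uT.
have u0 := le_trans s0 (ltW su); have K1 := le_trans B1 BK; have K0 := le_trans ler01 K1.
have K9 : K <= K ^+ 9 by rewrite -[leLHS]expr1; exact: ler_weXn2l.
have le9 (x w : R) : 0 <= w -> x <= K * w -> x <= K ^+ 9 * w.
  by move=> w0' /le_trans; apply; exact: ler_wpM2r.
have q := lip_germ_increment (setting_mono ST BK) s0 su ut tT
  (D := fun y => y = Y s) (Z := fun _ => Y u) _ _ _ _ i.
rewrite /delta2 /path_germ su ut (lt_trans su ut).
have -> : germM L f g i s t (Y s) - germM L f g i s u (Y s) - germM L f g i u t (Y u) =
  - (germM L f g i s u (Y s) + germM L f g i u t (Y u) - germM L f g i s t (Y s)) by zmod.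
have k9 n : 0 <= K ^+ 9 * w_ s u ^+ n by rewrite mulr_ge0 ?exprn_ge0.
have d1 := ctl_holder hY s0 su uT; have d2 := ctl_rem hY s0 su uT.
rewrite rnormN; apply: (lipb_norm (q _ _ _ _)) => //.
- by move=> y ->; exact: ctl_dom hY _ s0 sT.
- by move=> y _; exact: ctl_dom hY _ u0 uT.
- by apply: (lipb_point (k9 1%N) K0); apply: le9 (w0 s u) d1.
- by apply: (lipb_point (k9 2%N) K0); apply: le9 (exprn_ge0 2 (w0 s u)) d2.
Qed.

Section Path.
Variables (M C : R) (Y : R -> A).
Hypotheses (dY : davie D_ flow (3%:R * gam) 0 T M Y) (M0 : 0 <= M) (c1 : 1 <= C).

Local Notation h := (path_germ Y).

Hypothesis h_delta : forall i s u t, 0 <= s -> s < u -> u < t -> t <= T ->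
  rnorm (delta2 (h i) s u t) <= C * (w_ s u ^+ 2 * w_ u t + w_ s u * w_ u t ^+ 2).

Let YX t : AA t := W_ t (Y t).

Let H s t : A := \sum_i h i s t.

Let C0 : 0 <= C. Proof. exact: le_trans ler01 c1. Qed.

Let h_cubic i s u t : 0 <= s -> s < u -> u < t -> t <= T ->
  rnorm (delta2 (h i) s u t) <= 2%:R * C * (t - s) `^ (3%:R * gam).
Proof.
move=> s0 su ut tT; apply: le_trans (h_delta i s0 su ut tT) _.
rewrite (omegaX _ _ (ltW (lt_trans su ut))).
have -> : 2%:R * C * w_ s t ^+ 3 = C * (2%:R * w_ s t ^+ 3) by ring.
apply: (ler_wpM2l C0).
have a := omega_le ST (lexx s) (ltW su) (ltW ut); have b := omega_le ST (ltW su) (ltW ut) (lexx t).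
have -> : 2%:R * w_ s t ^+ 3 = w_ s t ^+ 2 * w_ s t + w_ s t * w_ s t ^+ 2 by ring.
by apply: lerD; apply: ler_pM; rewrite ?exprn_ge0//; rewrite ler_pXn2r ?nnegrE.
Qed.

Let flow_h_bound : 1 <= 2%:R * C.
Proof. by rewrite -[leLHS]mulr1; apply: ler_pM; rewrite ?ler1n. Qed.

Local Notation germ_ i := (germ_fg T3 L f g i Y YX).

Let germ_h i s t : 0 <= s -> s < t -> t <= T -> germ_ i s t = h i s t.
Proof.
move=> s0 st tT; rewrite /path_germ st; apply: (germ_fgE T3 ST) => //.
exact: dY.1 s s0 (ltW (lt_le_trans st tT)).
Qed.

Let sew i := sewing T (3 * gam) (delta2 (germ_ i)).

Let wB s t : 0 <= s -> s < t -> t <= T -> w_ s t <= B.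
Proof. by move=> s0 /ltW; exact: (omega_leB ST). Qed.

(** [sewing] is defined by choice, so an admissible element has to be exhibited. The flow of
    translations by the germ generates a path I, and the germ minus the increments of I is of order
    3 gam with the same delta2. *)
Lemma sewing_germ i : C2 T (3 * gam) (sew i) /\ forall s u t, 0 <= s -> s < u -> u < t -> t <= T ->
  delta2 (sew i) s u t = delta2 (germ_ i) s u t.
Proof.
apply: (@xgetPex _ (fun _ _ => 0) [set k | C2 T (3 * gam) k /\ forall s u t, 0 <= s -> s < u -> u < t -> t <= T ->
  delta2 k s u t = delta2 (germ_ i) s u t]).
have cC : 0 <= 2%:R * C by rewrite mulr_ge0.
have AF := linear_flow gam0 cC th1 (path_germ_same Y i) (h_cubic i).
have [h0 hC hK] := flow_stepP AF flow_h_bound gth.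
have [N [I [N0 _ [_ hI]]]] := global_solution AF h0 hC hK (y0 := 0) (ltW (st_T ST)) Logic.I.
pose k s t := h i s t - (I t - I s); exists k.
have kn s t : 0 <= s -> s < t -> t <= T -> rnorm (k s t) <= N * (t - s) `^ (3%:R * gam).
  move=> s0 st tT; have := hI s t s0 (ltW st) tT; rewrite -rnormN; congr (rnorm _ <= _).
  by rewrite /k; zmod.
have kd s u t : delta2 k s u t = delta2 (h i) s u t by rewrite /delta2 /k; zmod.
pose N' := N * B ^+ 2 + 2%:R * C * B ^+ 2.
have N'0 : 0 <= N' by rewrite addr_ge0// mulr_ge0// exprn_ge0.
have le1 (x y : R) : 0 <= x -> x <= B -> 0 <= y -> y <= B -> x * y <= B ^+ 2.
  by move=> ? ? ? ?; rewrite expr2; exact: ler_pM.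
split; last first.
  move=> s u t s0 su ut tT; rewrite kd /delta2 (germ_h i s0 (lt_trans su ut) tT).
  by rewrite (germ_h i s0 su (ltW (lt_le_trans ut tT))) (germ_h i (le_trans s0 (ltW su)) ut tT).
split; last first.
- have nk := N2_le kn; apply: le_lt_trans nk _; exact: ltry.
- by move=> s _ _; rewrite /k path_germ_same subrr subr0.
apply: (C2_continuous gam0 N'0).
- by move=> s _ _; rewrite /k path_germ_same subrr subr0.
- move=> s t s0 st tT; apply: le_trans (kn _ _ s0 st tT) _; rewrite (omegaX _ _ (ltW st)) exprSr mulrA.
  apply: ler_wpM2r => //; rewrite /N'; apply: ler_wpDr; first by rewrite mulr_ge0// exprn_ge0.
  by apply: ler_wpM2l => //; rewrite expr2; apply: le1 => //; exact: wB.
- move=> s u t s0 su ut tT; rewrite kd; apply: le_trans (h_delta i s0 su ut tT) _.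
  have a0 := w0 s u; have b0 := w0 u t; have a := wB s0 su (ltW (lt_le_trans ut tT)).
  have b := wB (le_trans s0 (ltW su)) ut tT; rewrite -/(w_ s u); move: (w_ s u) (w_ u t) a0 b0 a b => a b a0 b0 aB bB.
  have -> : C * (a ^+ 2 * b + a * b ^+ 2) = C * (a * b + b * b) * a by ring.
  apply: ler_wpM2r => //; rewrite /N'; apply: ler_wpDl; first by rewrite mulr_ge0// exprn_ge0.
  have -> : 2%:R * C * B ^+ 2 = C * (B ^+ 2 + B ^+ 2) by ring.
  by apply: ler_wpM2l => //; apply: lerD; exact: le1.
- move=> s u t s0 su ut tT; rewrite kd; apply: le_trans (h_delta i s0 su ut tT) _.
  have a0 := w0 s u; have b0 := w0 u t; have a := wB s0 su (ltW (lt_le_trans ut tT)).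
  have b := wB (le_trans s0 (ltW su)) ut tT; rewrite -/(w_ u t); move: (w_ s u) (w_ u t) a0 b0 a b => a b a0 b0 aB bB.
  have -> : C * (a ^+ 2 * b + a * b ^+ 2) = C * (a * b + a * a) * b by ring.
  apply: ler_wpM2r => //; rewrite /N'; apply: ler_wpDl; first by rewrite mulr_ge0// exprn_ge0.
  have -> : 2%:R * C * B ^+ 2 = C * (B ^+ 2 + B ^+ 2) by ring.
  by apply: ler_wpM2l => //; apply: lerD; exact: le1.
Qed.

Let r i s t := germ_ i s t - sew i s t.

Let r_add i s u t : 0 <= s -> s < u -> u < t -> t <= T -> r i s t = r i s u + r i u t.
Proof.
move=> s0 su ut tT; have [_ q] := sewing_germ i; have := q _ _ _ s0 su ut tT.
rewrite /r /delta2; move: (sew i s t) (sew i s u) (sew i u t) => a b c.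
move: (germ_ i s t) (germ_ i s u) (germ_ i u t) => a' b' c' e.
have -> : a = a - b - c + b + c by zmod.
by rewrite e; zmod.
Qed.

(* Both [Y] and the sum of the integrals follow the germs up to the order
   [3 gam], hence coincide. *)
Lemma davie_equation s t : 0 <= s -> s < t -> t <= T ->
  delta1 Y s t = \sum_(i < m) rough_int_fg T3 gam T L (f i) (g i) Y YX s t.
Proof.
(* The primitive of the integrals started at Y 0; the value at time 0 is set apart because the germ
   is controlled only for s < t. *)
pose Z t' := Y 0 + \sum_i (if 0 < t' then r i 0 t' else 0).
have dZ s' t' : 0 <= s' -> s' < t' -> t' <= T -> Z t' - Z s' = \sum_i r i s' t'.
  rewrite le_eqVlt => /orP[/eqP <-|s0] st tT; rewrite /Z.
    by rewrite st ltxx [X in _ + _ - (_ + X)]big1// addr0 addrC addKr.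
  rewrite s0 (lt_trans s0 st) (_ : Y 0 + _ - _ = \sum_i r i 0 t' - \sum_i r i 0 s'); last by zmod.
  rewrite -sumrB; apply: eq_bigr => i _; rewrite (r_add i (lexx 0) s0 st tT).
  by rewrite addrC addKr.
have cC : 0 <= m%:R * (2%:R * C) + 1 by rewrite addr_ge0 ?mulr_ge0 ?ler0n.
have H_same s' : H s' s' = 0 by rewrite /H big1// => i _; exact: path_germ_same.
have H_delta s' u' t' : 0 <= s' -> s' < u' -> u' < t' -> t' <= T ->
    rnorm (delta2 H s' u' t') <= (m%:R * (2%:R * C) + 1) * (t' - s') `^ (3%:R * gam).
  move=> s0 su ut tT; have -> : delta2 H s' u' t' = \sum_i delta2 (h i) s' u' t'.
    by rewrite /delta2 /H -!sumrB.
  apply: le_trans (rnorm_sum _ _ _) _.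
  apply: (@le_trans _ _ (\sum_(i < m) (2%:R * C * (t' - s') `^ (3%:R * gam)))).
    by apply: ler_sum => i _; exact: h_cubic.
  set k := 2%:R * C * _; have -> : \sum_(i < m) k = m%:R * k by rewrite sumr_const card_ord mulr_natl.
  rewrite /k mulrA; apply: ler_wpM2r; first exact: powR_ge0.
  by rewrite lerDl.
have AF := linear_flow gam0 cC th1 H_same H_delta.
have m1 : 1 <= m%:R * (2%:R * C) + 1 by rewrite lerDr mulr_ge0 ?ler0n// mulr_ge0.
have [h0 hC hK] := flow_stepP AF m1 gth.
have HY : davie (fun _ _ => True) (fun s' t' y => y + H s' t') (3%:R * gam) 0 T M Y.
  split => // s' t' s0; rewrite le_eqVlt => /orP[/eqP <-|st] tT.
    by rewrite H_same addr0 subrr rnorm0 mulr_ge0 ?powR_ge0.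
  have := dY.2 s' t' s0 (ltW st) tT; rewrite (flow_lt _ _ _ _ st); congr (rnorm (_ - (_ + _)) <= _).
  by apply: eq_bigr => i _; rewrite /path_germ st.
pose N i := fine (N2 T (3 * gam) (sew i)).
have sn i s' t' : 0 <= s' -> s' < t' -> t' <= T -> rnorm (sew i s' t') <= N i * (t' - s') `^ (3%:R * gam).
  by move=> s0 st tT; apply: N2_bound => //; have [[_ _ q] _] := sewing_germ i.
pose N' := \sum_i `|N i|.
have N'0 : 0 <= N' by apply: sumr_ge0.
have HZ : davie (fun _ _ => True) (fun s' t' y => y + H s' t') (3%:R * gam) 0 T N' Z.
  split => // s' t' s0; rewrite le_eqVlt => /orP[/eqP <-|st] tT.
    by rewrite H_same addr0 subrr rnorm0 mulr_ge0 ?powR_ge0.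
  have -> : Z t' - (Z s' + H s' t') = - \sum_i sew i s' t'.
    rewrite opprD addrA dZ// /H -sumrB -sumrN; apply: eq_bigr => i _.
    by rewrite /r germ_h// addrAC subrr add0r.
  rewrite rnormN; apply: le_trans (rnorm_sum _ _ _) _; rewrite /N' mulr_suml.
  apply: ler_sum => i _; apply: le_trans (sn i _ _ s0 st tT) _.
  by apply: ler_wpM2r; [exact: powR_ge0|exact: ler_norm].
have e0 : Y 0 = Z 0 by rewrite /Z ltxx big1// addr0.
move=> s0 st tT; have YZ := davie_unique AF h0 hC hK HY HZ M0 N'0 e0.
rewrite /delta1 (YZ t (le_trans s0 (ltW st)) tT) (YZ s s0 (ltW (lt_le_trans st tT))) dZ//.
Qed.

End Path.

Lemma davie_solution M Y : davie D_ flow (3%:R * gam) 0 T M Y -> 0 <= M ->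
  is_solution T3 gam T L f g (Y 0) Y (fun t => W_ t (Y t)).
Proof.
move=> dY M0; have hY := davie_controlled ST dY M0.
have BK : B <= B ^+ 230 by rewrite -[leLHS]expr1; exact: ler_weXn2l.
have C1 : 1 <= (B ^+ 230) ^+ 24 by exact: exprn_ege1 (exprn_ege1 _ B1).
split => //; first by have [] := controlled_in_Q ST hY.
  by move=> s t; exact: (davie_equation dY M0 C1 (fun i s u t => @path_germ_delta _ Y i s u t hY BK)).
by move=> t t0 tT; rewrite (Wf_fcalc ST)//; exact: ctl_dom hY _ t0 tT.
Qed.

Lemma solution_davie (a : A) (Y : R -> A) (YX : forall t, AA t) : is_solution T3 gam T L f g a Y YX ->
  (forall t, 0 <= t -> t <= T -> YX t = W_ t (Y t)) /\
  exists2 M, 0 <= M & davie D_ flow (3%:R * gam) 0 T M Y.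
Proof.
move=> sol; have [[qY sY] Y0 eqY YXE] := sol.
have dY t : 0 <= t -> t <= T -> D_ t (Y t).
  by move=> t0 tT; split; [case: (sY t t0 tT)|exact: Q_adapted qY t t0 tT].
have eYX t : 0 <= t -> t <= T -> YX t = W_ t (Y t).
  by move=> t0 tT; rewrite YXE// (Wf_fcalc ST)//; exact: dY.
split => //.
pose sew i := sewing T (3 * gam) (delta2 (germ_fg T3 L f g i Y YX)).
pose N i := `|fine (N2 T (3 * gam) (sew i))|.
have hN i s t : 0 <= s -> s < t -> t <= T -> rnorm (sew i s t) <= N i * (t - s) `^ (3%:R * gam).
  (* No existence of the sewing is needed here: a chosen element has finite norm of order 3 gam, and
     the default value 0 satisfies the same bound. *)
  rewrite /N /sew /sewing; case: xgetP => [k _ [[_ _ kN] _]|_] s0 st tT.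
    apply: le_trans (N2_bound kN s0 st tT) _; apply: ler_wpM2r; [exact: powR_ge0|exact: ler_norm].
  by rewrite rnorm0 mulr_ge0 ?powR_ge0.
have N0 : 0 <= \sum_i N i by apply: sumr_ge0 => i _; exact: normr_ge0.
exists (\sum_i N i) => //; split => // s t s0; rewrite le_eqVlt => /orP[/eqP <-|st] tT.
  by rewrite flow_same subrr rnorm0 mulr_ge0 ?powR_ge0.
have sT := ltW (lt_le_trans st tT).
have -> : Y t - flow s t (Y s) = - \sum_i sew i s t.
  rewrite flow_lt// opprD addrA [Y t - Y s](eqY s t s0 st tT) -sumrB -sumrN; apply: eq_bigr => i _.
  rewrite -(germ_fgE T3 ST i s0 st tT (dY s s0 sT) (eYX s s0 sT)).
  by rewrite /rough_int_fg /rough_int -/(germ_fg T3 L f g i Y YX) -/(sew i) addrAC subrr add0r.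
rewrite rnormN; apply: le_trans (rnorm_sum _ _ _) _; rewrite mulr_suml.
by apply: ler_sum => i _; exact: hN.
Qed.

Lemma solution_unique (a : A) (Y Y' : R -> A) (YX YX' : forall t, AA t) :
  is_solution T3 gam T L f g a Y YX -> is_solution T3 gam T L f g a Y' YX' ->
  forall t, 0 <= t -> t <= T -> Y' t = Y t /\ YX' t = YX t.
Proof.
move=> sol sol'; have [e [M M0 dY]] := solution_davie sol; have [e' [M' M'0 dY']] := solution_davie sol'.
have AF := flow_almost ST.
have [h0 hC hK] := flow_stepP AF (exprn_ege1 42 B1) gth.
have e0 : Y' 0 = Y 0 by rewrite (sol_init sol) (sol_init sol').
move=> t t0 tT; have eY := davie_unique AF h0 hC hK dY' dY M'0 M0 e0 t0 tT.
split; first exact: eY.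
exact: etrans (e' t t0 tT) (etrans (congr1 (W_ t) eY) (esym (e t t0 tT))).
Qed.

Lemma solution_exists (a : A) : selfadjoint a -> alg X 0 a -> exists (Y : R -> A) (YX : forall t, AA t),
  is_solution T3 gam T L f g a Y YX /\ (N_Q gam T Y YX <= (B ^+ 240)%:E)%E.
Proof.
move=> sa aa; have AF := flow_almost ST.
have [h0 hC hK] := flow_stepP AF (exprn_ege1 42 B1) gth.
have [M [Y [M0 Y0 dY]]] := global_solution AF h0 hC hK (y0 := a) (ltW (st_T ST)) (conj sa aa).
exists Y, (fun t => W_ t (Y t)); split; first by rewrite -Y0; exact: davie_solution dY M0.
have [_ q] := controlled_in_Q ST (davie_controlled ST dY M0); apply: le_trans q _.
rewrite lee_fin; have b3 : B ^+ 3 <= B ^+ 233 by exact: ler_weXn2l.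
have b0 : B ^+ 230 <= B ^+ 233 by exact: ler_weXn2l.
have b5 : B ^+ 234 <= B ^+ 240 by exact: ler_weXn2l.
have p0 : 0 <= B ^+ 233 by exact: exprn_ge0.
rewrite -mulrA -exprD; apply: le_trans b5; rewrite (exprS B 233).
have := st_B ST; move: b3 b0 p0; set x := B ^+ 233; set x1 := B ^+ 3; set x2 := B ^+ 230 => *; nra.
Qed.

End Existence.

Lemma N_area_bound (R : realType) (A : vonNeumannAlgebra R) (T2 : forall S : linSubspace A, ptensor2 S)
    (gam T : R) (X : R -> A) (L : forall s : R, R -> AA T2 X s -> A) : productLevyArea gam T L ->
  0 <= fine (N_area gam T L) /\ forall s t, 0 <= s -> s < t -> t <= T -> forall U : AA T2 X s,
    rnorm (L s t U) <= fine (N_area gam T L) * (t - s) `^ (2%:R * gam) * rnorm U.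
Proof.
move=> hL; have fin := area_bounded hL.
have ub s t (U : AA T2 X s) : 0 <= s -> s < t -> t <= T -> U != 0 ->
    ((rnorm (L s t U) / ((t - s) `^ (2 * gam) * rnorm U))%:E <= N_area gam T L)%E.
  by move=> s0 st tT U0; apply: ereal_sup_ubound; exists s, t, U.
have pos s t (U : AA T2 X s) : 0 <= rnorm (L s t U) / ((t - s) `^ (2 * gam) * rnorm U).
  by rewrite divr_ge0 ?mulr_ge0 ?rnorm_ge0 ?powR_ge0.
split.
  (* If no nonzero biprocess value exists, the supremum is taken over the empty set and is -oo,
     whose real part [fine] is 0. *)
  have [[z [s [t [U [s0 st tT U0 _]]]]]|ne] := pselect (exists z : \bar R, exists s t (U : AA T2 X s), [/\ 0 <= s, s < t, t <= T, U != 0 &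
    z = (rnorm (L s t U) / ((t - s) `^ (2 * gam) * rnorm U))%:E]).
    by apply: fine_ge0; apply: le_trans (ub _ _ _ s0 st tT U0); rewrite lee_fin.
  rewrite /N_area (_ : [set z | _] = set0) ?ereal_sup0//.
  by apply/seteqP; split => // z hz; apply: ne; exists z.
move=> s t s0 st tT U; have [->|U0] := eqVneq U 0.

  have -> : L s t 0 = 0.
    have := area_linear hL s0 st tT 1 0 0; rewrite !scale1r addr0 => /eqP.
    by rewrite -[X in X == _]addr0 (inj_eq (addrI _)) eq_sym => /eqP.
  by rewrite !rnorm0 mulr0.
have h := ub _ _ _ s0 st tT U0.
have N0 : (0 <= N_area gam T L)%E by apply: le_trans h; rewrite lee_fin.
have r0 : 0 < rnorm U by rewrite lt_neqAle rnorm_ge0 andbT eq_sym; apply: contraNneq U0 => /rnorm_eq0 ->.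
rewrite -mulrA -ler_pdivrMr ?mulr_gt0 ?powR_gt0 ?subr_gt0// -lee_fin fineK//.
by rewrite ge0_fin_numE.
Qed.

Theorem theorem4p15 (R : realType) (A : vonNeumannAlgebra R) (phi : A -> R[i])
    (hphi : ncState phi) (gam T : R) (hgam : 3^-1 < gam) (hT : 0 < T)
    (m : nat) (f : 'I_m -> complexMeasure R) (hf : forall i, in_F 3 (f i))
    (a : A) (ha : selfadjoint a) :
  exists P : {poly {poly R}},
  forall (T2 : forall S : linSubspace A, ptensor2 S)
    (T3 : forall S : linSubspace A, ptensor3 S)
    (g : 'I_m -> complexMeasure R)
    (X : R -> A) (L : forall s : R, R -> AA T2 X s -> A),
    ((forall i, g i = cm_star (f i)) \/
     (forall i, g i = cm_star (f (rev_ord i)))) ->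
    (forall t, 0 <= t -> t <= T -> selfadjoint (X t)) ->
    C1 T gam X ->
    productLevyArea gam T L ->
    alg X 0 a ->
    exists (Y : R -> A) (YX : forall t, AA T2 X t),
      [/\ is_solution T3 gam T L f g a Y YX,
          (forall (Y' : R -> A) (YX' : forall t, AA T2 X t),
             is_solution T3 gam T L f g a Y' YX' ->
             forall t, 0 <= t -> t <= T -> Y' t = Y t /\ YX' t = YX t) &
          (N_Q gam T Y YX <=
             (P.[(fine (N1 T gam X))%:P].[fine (N_area gam T L)])%:E)%E].
Proof.
have gam0 : 0 < gam by apply: lt_trans hgam; rewrite invr_gt0.
have eta0 : 0 <= (eta (3%:R * gam))^-1.
  by rewrite invr_ge0 ltW//; apply: eta_gt0; rewrite mulrC -ltr_pdivrMr// mul1r.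
(* Gathers what depends only on f, T and gam; g enters through moments equal to those of f. *)
pose C0 : R := 52%:R + (eta (3%:R * gam))^-1 + T + T `^ gam + m%:R + \sum_i moment (f i).
(* The outer variable stands for the norm of X and the inner one for the norm of the area. *)
exists ((C0%:P%:P + 'X + 'X%:P) ^+ 240) => T2 T3 g X L hg hX hC hL aa.
set x := fine (N1 T gam X); set y := fine (N_area gam T L).
have -> : ((C0%:P%:P + 'X + 'X%:P) ^+ 240).[x%:P].[y] = (C0 + x + y) ^+ 240.
  by rewrite !(horner_exp, hornerD, hornerC, hornerX).
have [y0 hy] := N_area_bound hL; rewrite -/y in y0 hy.
have x0 : 0 <= x.
  have [_ fin] := hC; have h := N1_bound gam0 fin (lexx 0) (ltW hT) (lexx T).
  have p : 0 < (T - 0) `^ gam by apply: powR_gt0; rewrite subr0.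
  by rewrite -(pmulr_lge0 _ p); apply: le_trans h; exact: rnorm_ge0.
have S0 : 0 <= \sum_i moment (f i) by apply: sumr_ge0 => i _; exact: moment_ge0.
have p0 : 0 <= T `^ gam by exact: powR_ge0.
have m0 : 0 <= m%:R :> R by exact: ler0n.
have T0 := ltW hT.
have ST : setting gam T L f g (C0 + x + y).
  split => //; rewrite /C0; try lra.
  - move=> i; split => //; have : moment (f i) <= \sum_i moment (f i).
      by rewrite (bigD1 i)//= lerDl; apply: sumr_ge0 => j _; exact: moment_ge0.
    lra.
  - case: hg => hg; first by exists id.
    by exists (@rev_ord m); split => //; exact: rev_ordK.
  - move=> s t s0 st tT; have [_ fin] := hC; apply: le_trans (N1_bound gam0 fin s0 st tT) _.
    by apply: ler_wpM2r; [exact: powR_ge0|rewrite -/x; lra].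
  - exact: area_linear hL.
  - exact: area_adapted hL.
  - move=> s t s0 st tT U; apply: le_trans (hy _ _ s0 st tT U) _.
    apply: ler_wpM2r; first exact: rnorm_ge0.
    by apply: ler_wpM2r; [exact: powR_ge0|lra].
  - exact: area_delta hL.
have [Y [YX [sol hN]]] := solution_exists T3 ST ha aa.
exists Y, YX; by split => // Y' YX'; exact: (solution_unique ST sol).
Qed.
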